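(* Let $\alpha>0$, $\rho(\xi)=(1-\xi^2)_+^\alpha$ and $\phi(\xi)=(1-|\xi|)_+$. For $\psi\in\{\rho,\phi\}$ and $\sigma\ge1$ let $$\mathcal Q_\sigma^\psi f(x)=\sum_{k\in\mathbb Z}f(\sigma^{-1}k)\,\widehat\psi(\sigma x-k),\qquad \widehat\psi(x)=\frac1{2\pi}\int_{\mathbb R}\psi(\xi)e^{-i\xi x}\,d\xi.$$ Let $X=X(\mathbb R)$ be a Banach lattice satisfying Assumption A. Then for all $\sigma\ge1$, $f\in X_\sigma$ and $r\in\mathbb N$ $$\|f-\mathcal Q_\sigma^\rho f\|_X+\|f-\mathcal Q_\sigma^\rho f\|_{X_\sigma}\asymp\|(I-\dot A_{\gamma/\sigma})^2f\|_X+\|(I-A_{\gamma/\sigma})^rf\|_{X_\sigma}.$$ If, additionally, the Hilbert transform is bounded on $X$, then for all $\sigma\ge1$, $f\in X_\sigma$ and $r\in\mathbb N$ $$\|f-\mathcal Q_\sigma^\phi f\|_X+\|f-\mathcal Q_\sigma^\phi f\|_{X_\sigma}\asymp\|(I-\dot A_{\gamma/\sigma})f\|_X+\|(I-A_{\gamma/\sigma})^rf\|_{X_\sigma}.$$ Here $\asymp$ denotes a two-sided inequality with positive constants independent of $f$ and $\sigma$.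
   Context: $\mu$ is Lebesgue measure on $\mathbb R$. A Banach lattice $X=X(\mathbb R)$ is a Banach space of measurable functions on $\mathbb R$ such that: 1) if $f$ is measurable, $g\in X$ and $|f|\le|g|$, then $f\in X$ and $\|f\|_X\le\|g\|_X$; 2) if $f_n\in X$, $\sup_n\|f_n\|_X<\infty$ and $0\le f_n\uparrow f$, then $f\in X$ and $\|f_n\|_X\to\|f\|_X$; 3) for every measurable $E$ with $\mu(E)<\infty$, $\chi_E\in X$ and there is $c_E>0$ with $\int_E|f|\,d\mu\le c_E\|f\|_X$. Functions in $X$ are regarded as finite-valued and defined at every point, not as equivalence classes. Standing assumptions: $X$ has an order continuous norm ($f_n\downarrow0$ a.e. implies $\|f_n\|_X\to0$) and the Schwartz space $\mathcal S$ is dense in $X$. The series defining $\mathcal Q_\sigma^\psi f$ is understood as convergent in the norm of $X$. Steklov averages: $A_hf(x)=\frac1h\int_{x-h/2}^{x+h/2}f(t)\,dt$ and $\dot A_hf(x)=A_hf(x+\tfrac h2)$ for $h>0$; $I$ is the identity. Assumption A: $A_hf\in X$ for all $f\in X$, $h>0$, and $\sup_{h>0,\,\|f\|_X\le1}\|A_hf\|_X<\infty$. With $x_k=k/\sigma$, $\|f\|_{X_\sigma}=\big\|\sum_{k\in\mathbb Z}|f(x_k)|\chi_{[x_k,x_{k+1})}\big\|_X$; $f\in X_\sigma$ means $f\in X$ and $\|f\|_{X_\sigma}<\infty$. The constant $\gamma>0$ is fixed with $\frac\gamma\sigma\le x_{k+1}-x_k=\frac1\sigma$, i.e. $0<\gamma\le1$.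 The Hilbert transform on $\mathbb R$ is the operator with Fourier multiplier $-i\,\mathrm{sgn}(\xi)$. *)

(* Defs.v *)
From HB Require Import structures.
From mathcomp Require Import all_boot all_order all_algebra.
From mathcomp Require Import complex.
From mathcomp Require Import all_classical all_reals all_analysis.
Import Order.TTheory GRing.Theory Num.Theory.
Import numFieldNormedType.Exports.
Import Normc.
Set Implicit Arguments.
Unset Strict Implicit.
Unset Printing Implicit Defensive.
Local Open Scope classical_set_scope.
Local Open Scope ring_scope.
Local Open Scope complex_scope.

(* The real line with the sigma-algebra of all Lebesgue measurable sets (the
   default one on [R] in MathComp-Analysis is the Borel sigma-algebra). *)
Local Notation lebR R := (caratheodory_type (@wlength R idfun)^*%mu).

Local Notation mu := completed_lebesgue_measure.

Section ComplexFunctions.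
Context {R : realType}.
Implicit Types (f g : R -> R[i]) (h t : R).

Definition cmeasurable f :=
  measurable_fun [set: lebR R] (fun x : lebR R => complex.Re (f x)) /\
  measurable_fun [set: lebR R] (fun x : lebR R => complex.Im (f x)).

Definition of_real (u : R -> R) : R -> R[i] := fun x => (u x)%:C.

Definition cintegral (D : set R) f : R[i] :=
  (\int[@mu R]_(x in D) complex.Re (f x)) +i*
  (\int[@mu R]_(x in D) complex.Im (f x)).

Definition cis t : R[i] := cos t +i* sin t.

Definition fourier f : R -> R[i] := fun x =>
  ((2 * pi)^-1)%:C * cintegral setT (fun xi => f xi * cis (- (xi * x))).

(* The inverse of [fourier] carries no constant, so this is the operator whose
   action on Fourier transforms is multiplication by [m]. *)
Definition fourier_multiplier (m : R -> R[i]) f : R -> R[i] := fun x =>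
  cintegral setT (fun xi => m xi * fourier f xi * cis (xi * x)).

Definition hilbert : (R -> R[i]) -> R -> R[i] :=
  fourier_multiplier (fun xi => 0 -i* Num.sg xi).

Definition schwartz_real (u : R -> R) :=
  (forall (n : nat) (x : R), derivable (derive1n n u) x 1) /\
  (forall m n : nat, exists C : R, forall x : R,
    `|x ^+ m * derive1n n u x| <= C).

Definition schwartz f :=
  schwartz_real (fun x => complex.Re (f x)) /\
  schwartz_real (fun x => complex.Im (f x)).

Definition steklov h f : R -> R[i] := fun x =>
  (h^-1)%:C * cintegral `[x - h / 2, x + h / 2] f.

Definition steklov_dot h f : R -> R[i] := fun x => steklov h f (x + h / 2).

(* [(I - T)^r f] *)
Definition iter_diff (r : nat) (T : (R -> R[i]) -> R -> R[i]) f : R -> R[i] :=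
  iter r (fun g => g \- T g) f.

Definition node (sigma : R) (k : int) : R := k%:~R / sigma.

(* The sum over the integers has at most one nonzero term at each point. *)
Definition sample_step (sigma : R) f : R -> R := fun x =>
  \sum_(k \in [set: int])
    normc (f (node sigma k)) * \1_(`[node sigma k, node sigma (k + 1)[) x.

Definition rho (alpha : R) : R -> R := fun xi => Num.max (1 - xi ^+ 2) 0 `^ alpha.

Definition phi : R -> R := fun xi => Num.max (1 - `|xi|) 0.

Section SamplingSeries.
Variables (psi : R -> R) (sigma : R) (f : R -> R[i]).

Definition sampling_term (k : int) : R -> R[i] := fun x =>
  f (node sigma k) * fourier (of_real psi) (sigma * x - k%:~R).

(* The sum of the terms with [- m <= k < n]; [Negz k] is [- k.+1]. *)
Definition sampling_partial (m n : nat) : R -> R[i] := fun x =>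
  \sum_(0 <= k < n) sampling_term (Posz k) x +
  \sum_(0 <= k < m) sampling_term (Negz k) x.

(* The norm of a Banach lattice determines the sum only almost everywhere; this
   is the pointwise sum, which has a value at each node. *)
Definition sampling_op : R -> R[i] := fun x =>
  limn (fun n => complex.Re (sampling_partial n n x)) +i*
  limn (fun n => complex.Im (sampling_partial n n x)).

End SamplingSeries.

End ComplexFunctions.

(* A seminormed space of functions [R -> R[i]], defined at every point, which is
   a Banach space after identification of functions equal almost everywhere.  The
   value of [bl_norm] outside [bl_set] is meaningless. *)
Record banach_lattice (R : realType) := BanachLattice {
  bl_set :> (R -> R[i]) -> Prop;
  bl_norm : (R -> R[i]) -> R;
  bl_measurable : forall f, bl_set f -> cmeasurable f;
  bl_zero : bl_set (fun=> 0);
  bl_add : forall f g, bl_set f -> bl_set g -> bl_set (f \+ g);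
  bl_scale : forall (c : R[i]) f, bl_set f -> bl_set (fun x => c * f x);
  bl_norm_add : forall f g, bl_set f -> bl_set g ->
    bl_norm (f \+ g) <= bl_norm f + bl_norm g;
  bl_norm_scale : forall (c : R[i]) f, bl_set f ->
    bl_norm (fun x => c * f x) = normc c * bl_norm f;
  bl_norm_eq0 : forall f, bl_set f -> bl_norm f = 0 ->
    {ae @mu R, forall x, f x = 0};
  bl_complete : forall u : nat -> R -> R[i], (forall n, bl_set (u n)) ->
    (forall e : R, 0 < e -> exists N : nat, forall m n : nat,
      (N <= m)%N -> (N <= n)%N -> bl_norm (u m \- u n) <= e) ->
    exists2 f, bl_set f & bl_norm (u n \- f) @[n --> \oo] --> (0 : R);
  bl_ideal : forall f g, cmeasurable f -> bl_set g ->
    {ae @mu R, forall x, normc (f x) <= normc (g x)} ->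
    bl_set f /\ bl_norm f <= bl_norm g;
  bl_fatou : forall (u : nat -> R -> R) (f : R -> R),
    (forall n, bl_set (of_real (u n))) ->
    (exists C : R, forall n, bl_norm (of_real (u n)) <= C) ->
    {ae @mu R, forall x, (forall n, 0 <= u n x) /\
      nondecreasing_seq (fun n => u n x) /\ u n x @[n --> \oo] --> f x} ->
    bl_set (of_real f) /\
    bl_norm (of_real (u n)) @[n --> \oo] --> bl_norm (of_real f);
  bl_local : forall E : set (lebR R), measurable E -> (@mu R E < +oo)%E ->
    bl_set (of_real (\1_E : R -> R)) /\
    exists2 c : R, 0 < c & forall f, bl_set f ->
      (\int[@mu R]_(x in E) (normc (f x))%:E <= (c * bl_norm f)%:E)%E
}.

Section BanachLattices.
Context {R : realType} (X : banach_lattice R).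
Implicit Types f : R -> R[i].

Definition order_continuous := forall u : nat -> R -> R,
  (forall n, X (of_real (u n))) ->
  {ae @mu R, forall x, nonincreasing_seq (fun n => u n x) /\
    u n x @[n --> \oo] --> (0 : R)} ->
  bl_norm X (of_real (u n)) @[n --> \oo] --> (0 : R).

Definition schwartz_dense :=
  (forall f, schwartz f -> X f) /\
  (forall f, X f -> forall e : R, 0 < e ->
    exists2 g, schwartz g & bl_norm X (f \- g) < e).

Definition assumptionA :=
  (forall f h, X f -> 0 < h -> X (steklov h f)) /\
  (exists C : R, forall f h, X f -> 0 < h -> bl_norm X f <= 1 ->
    bl_norm X (steklov h f) <= C).

(* Boundedness of the extension by density from the Schwartz space. *)
Definition hilbert_bounded := exists C : R, forall f, schwartz f ->
  X (hilbert f) /\ bl_norm X (hilbert f) <= C * bl_norm X f.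

Definition xnorm f : \bar R := if `[< X f >] then (bl_norm X f)%:E else +oo%E.

Definition xsnorm (sigma : R) f : \bar R :=
  xnorm (of_real (sample_step sigma f)).

Definition Xsigma (sigma : R) : set (R -> R[i]) :=
  [set f | X f /\ (xsnorm sigma f < +oo)%E].

(* Convergence, in the norm of [X] and at every point, of the two-sided
   series, both ends of the summation range going to infinity independently. *)
Definition sampling_cvg (psi : R -> R) (sigma : R) f :=
  [/\ forall k, X (sampling_term psi sigma f k),
      X (sampling_op psi sigma f),
      forall e : R, 0 < e -> exists N : nat, forall m n : nat,
        (N <= m)%N -> (N <= n)%N ->
        bl_norm X (sampling_op psi sigma f \- sampling_partial psi sigma f m n)
          <= e &
      forall (x e : R), 0 < e -> exists N : nat, forall m n : nat,
        (N <= m)%N -> (N <= n)%N ->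
        normc (sampling_op psi sigma f x - sampling_partial psi sigma f m n x)
          <= e].

Definition sampling_error (psi : R -> R) (sigma : R) f : \bar R :=
  let g := f \- sampling_op psi sigma f in
  (xnorm g + xsnorm sigma g)%E.

Definition smoothness (gamma : R) (s r : nat) (sigma : R) f : \bar R :=
  let h := gamma / sigma in
  (xnorm (iter_diff s (steklov_dot h) f) +
   xsnorm sigma (iter_diff r (steklov h) f))%E.

End BanachLattices.

Definition two_sided (R : realType) (c1 c2 : R) (a b : \bar R) : Prop :=
  (c1%:E * b <= a /\ a <= c2%:E * b)%E.

(* Main.v *)
(**
Real and imaginary parts reduce everything to real functions [u].  Let [Q] be the sampling
operator and [e k = (u - Q u)(k / sigma)].

All kernels that occur decay like [(1 + |t|)^(-1 - a)] for some [a > 0]; convolving or sampling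
with such a kernel is dominated by a convergent series of Steklov averages at dyadic scales,
hence bounded by Assumption A.  Sampling the kernel of a symbol supported in [-1, 1] against
another such kernel gives the kernel of the product of the symbols; this follows from Fejer's
theorem.

Lower bound.  By the sampling identity the second derivative of [Q u] is [- sigma^2] times the
sampling operator of symbol [xi^2 rho / (1 - rho)] applied to [e] for [rho], and the first
derivative is [- sigma] times the Hilbert transform of [Q e] for [phi].  This is checked on finitely
supported samples and passes to the limit by density; the differences of [Q u] are averages of
these derivatives.

Upper bound.  [u] is replaced by a smooth [g] built from triangular averages, such that [u - g]
and the derivative of [g] of order two (for [rho]) or one (for [phi]) are controlled by the
differences of [u].  Then [g] is compared with its convolution with the kernel [V] of the
symbol [v = (1 - xi^2)_+^5].  The sampling error of that convolution has symbol [v (1 - psi)]: dividing by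
[xi^2] moves the factor onto the second derivative of [g] when [psi = rho], while for [psi = phi]
the factor [|xi|] is a Hilbert transform of the first derivative.

The Hilbert transform, given on Schwartz functions only, is carried to trigonometric integrals by
multiplying them with wide Gaussians and passing to the limit with Fatou's property.
*)
Require Import Defs.
From HB Require Import structures.
From mathcomp Require Import all_boot all_order all_algebra.
From mathcomp Require Import complex.
From mathcomp Require Import all_classical all_reals all_analysis.
From mathcomp Require Import measurable_realfun ring lra zify.
Import Order.TTheory GRing.Theory Num.Theory.
Import numFieldNormedType.Exports.
Import Normc.
Set Implicit Arguments.
Unset Strict Implicit.
Unset Printing Implicit Defensive.
Local Open Scope classical_set_scope.
Local Open Scope ring_scope.

(** Two norms are estimated at once, and the norm of [X] does not control values at nodes. The link
    is that a Steklov average over a window of length at most [1 / sigma] has node values bounded by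
    local averages; so the node values of [u - (I - A)^r u] are controlled by the norm of [u], for
    every [r]. The one-sided average matters in the other term: the centred [I - A] is already of
    second order, while the one-sided difference is of first order, so its powers can measure order
    one as well as order two. Frequencies stay in [-1, 1], well inside (-pi, pi), while samples sit
    at the integers after rescaling; there is no aliasing, and sampling multiplies symbols exactly.
    At 0 the function [1 - rho] behaves like [alpha * xi^2], which can be divided out, whereas
    [1 - phi] is [|xi|], that is [xi] times the sign in the Hilbert multiplier. At 1 the symbol
    [rho] is singular like [(1 - xi)^alpha], which limits the decay of its kernel. The power 5 in
    the cutoff gives its kernel decay of order 6, enough to integrate twice and keep decaying error
    kernels. *)

Local Notation lebR R := (caratheodory_type (@wlength R idfun)^*%mu).
Local Notation cmu := completed_lebesgue_measure.
Local Notation lmu := lebesgue_measure.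


(** * Borel measurability and the completed Lebesgue measure *)

Section Measurability.
Context {R : realType}.
Implicit Types (f : R -> R) (D : set R).

Lemma borel_lebesgue_set D : measurable D -> measurable (D : set (lebR R)).
Proof. by move=> mD; apply: sub_caratheodory. Qed.

Lemma borel_lebesgue f :
  measurable_fun setT f -> measurable_fun [set: lebR R] (f : lebR R -> R).
Proof.
move=> mf _ Y mY; rewrite setTI; apply: borel_lebesgue_set.
by rewrite -[X in measurable X]setTI; apply: mf.
Qed.

Let idc : lebR R -> measurableTypeR R := fun x => x.

Let midc : measurable_fun setT idc.
Proof. by move=> _ Y mY; rewrite setTI; apply: borel_lebesgue_set. Qed.

(** The identity [idc] is measurable from the completed sigma-algebra to the Borel one, and pushes
    the completed measure forward to Lebesgue measure on Borel sets. *)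
Lemma ge0_integral_completed D (f : R -> \bar R) : measurable D ->
  measurable_fun D f -> (forall x, 0 <= f x)%E ->
  (\int[@cmu R]_(x in D) f x = \int[@lmu R]_(x in D) f x)%E.
Proof.
move=> mD mf f0.
have := @ge0_integral_pushforward _ _ (lebR R) (measurableTypeR R) R idc midc (@cmu R) D f mD mf.
by move=> <-.
Qed.

Lemma integral_completed D (f : R -> \bar R) : measurable D ->
  measurable_fun D f ->
  (\int[@cmu R]_(x in D) f x = \int[@lmu R]_(x in D) f x)%E.
Proof.
move=> mD mf; rewrite integralE [in RHS]integralE.
rewrite !ge0_integral_completed//.
- exact: measurable_funeneg.
- exact: measurable_funepos.
Qed.

Lemma Rintegral_completed D f : measurable D -> measurable_fun D f ->
  \int[@cmu R]_(x in D) f x = \int[@lmu R]_(x in D) f x.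
Proof.
by move=> mD mf; rewrite /Rintegral integral_completed//; exact/measurable_EFinP.
Qed.

Lemma integrable_completed D f : measurable D -> 
  (@lmu R).-integrable D (EFin \o f) ->
  (@cmu R).-integrable (D : set (lebR R)) (EFin \o f).
Proof.
move=> mD /integrableP[mf foo]; apply/integrableP; split.
  move=> _ Y mY; apply: borel_lebesgue_set; exact: mf.
rewrite (integral_completed mD)//.
by apply: measurableT_comp.
Qed.

Lemma nondecreasing_lebesgue f : nondecreasing_fun f ->
  measurable_fun [set: lebR R] (f : lebR R -> R).
Proof. by move=> ndf; apply: borel_lebesgue; exact: nondecreasing_measurable. Qed.

Lemma continuous_lebesgue f : continuous f ->
  measurable_fun [set: lebR R] (f : lebR R -> R).
Proof. by move=> cf; apply: borel_lebesgue; exact: continuous_measurable_fun. Qed.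

(** Countably many values, each taken on a half-open cell, so a preimage is a countable union of
    cells. *)
Lemma step_lebesgue (sigma : R) (c : int -> R) : 0 < sigma ->
  measurable_fun [set: R] (fun x => c (Num.floor (sigma * x))).
Proof.
move=> s0.
have mfl (k : int) : measurable [set x : R | Num.floor (sigma * x) = k].
  rewrite (_ : [set _ | _] = `[k%:~R / sigma, (k + 1)%:~R / sigma[%classic)//.
  apply/seteqP; split => x /=; rewrite in_itv/= ler_pdivrMr// ltr_pdivlMr// (mulrC x).
    by move=> <-; exact: floor_itv.
  by move=> /floor_def ->.
move=> _ Y mY; rewrite setTI.
pose G k := if `[< Y (c k) >] then [set x : R | Num.floor (sigma * x) = k] else set0.
rewrite (_ : _ @^-1` Y = \bigcup_k G k).
  apply: countable_bigcupT_measurable => [|k]; first exact: countableP.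
  by rewrite /G; case: ifP.
apply/seteqP; split => x /=.
  move=> Yx; exists (Num.floor (sigma * x)) => //=.
  by rewrite /G; case: asboolP.
by move=> [k _]; rewrite /G; case: asboolP => //= Yk ->.
Qed.

End Measurability.

(** * One-variable calculus: mean value inequality and primitives *)

Section Calculus.
Context {R : realType}.
Implicit Types (f g F G : R -> R) (a b c x : R).

Definition has_deriv F x (l : R) := is_derive x (1 : R) F l.

Definition isd F f := forall x, has_deriv F x (f x).

Lemma isd_cont F f : isd F f -> continuous F.
Proof.
by move=> dF x; apply/differentiable_continuous/derivable1_diffP; case: (dF x).
Qed.

(** The mean value theorem for [G - s * F] with [s = 1] and [s = -1]. Only pointwise derivatives
    enter, so remainders of integrations by parts can be estimated without integrating them. *)
Lemma mvt_le F f G g a b : a <= b ->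
  (forall x, a <= x <= b -> has_deriv F x (f x)) ->
  (forall x, a <= x <= b -> has_deriv G x (g x)) ->
  (forall x, a <= x <= b -> `|f x| <= g x) ->
  `|F b - F a| <= G b - G a.
Proof.
move=> ab dF dG fg.
have key (s : R) : `|s| = 1 -> s * (F b - F a) <= G b - G a.
  move=> s1; pose H x := G x - s * F x; pose h x := g x - s * f x.
  have dH x : a <= x <= b -> is_derive x 1 H (h x).
    move=> xab; rewrite /H /h.
    have ? : is_derive x 1 F (f x) := dF _ xab.
    have ? : is_derive x 1 G (g x) := dG _ xab.
    exact: is_derive_eq.
  have cH : {within `[a, b], continuous H}.
    apply: derivable_within_continuous => x; rewrite in_itv/= => xab.
    by case: (dH _ xab).
  have [x xab e] : exists2 x, x \in `[a, b] & H b - H a = h x * (b - a).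
    by apply: MVT_segment => // x; rewrite in_itv/= => /andP[ax xb]; apply: dH; rewrite !ltW.
  have : 0 <= H b - H a.
    rewrite e mulr_ge0 ?subr_ge0//; move: xab; rewrite in_itv/= => /fg fgx.
    by rewrite (le_trans _ fgx)// (le_trans (ler_norm _))// normrM s1 mul1r.
  by rewrite /H; lra.
rewrite ler_norml; have := key 1 (normr1 _); have := key (-1).
by rewrite normrN normr1 => /(_ erefl); lra.
Qed.

(** Unsigned: the value is 0 when [b < a]. The completed measure is the one used by [cintegral]. *)
Definition itg a b f := \int[@cmu R]_(x in `[a, b]) f x.

Lemma itgE a b f : measurable_fun `[a, b] f -> itg a b f = \int[@lmu R]_(x in `[a, b]) f x.
Proof. by move=> mf; rewrite /itg Rintegral_completed. Qed.

Lemma cont_within f a b : continuous f -> {within `[a, b], continuous f}.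
Proof. by move=> cf; apply: continuous_subspaceT. Qed.

Lemma cont_meas f (D : set R) : continuous f -> measurable_fun D f.
Proof. by move=> cf; apply: (@measurable_funS _ _ _ _ setT) => //; exact: continuous_measurable_fun. Qed.

Lemma cont_itgable f a b : continuous f -> (@lmu R).-integrable `[a, b] (EFin \o f).
Proof.
move=> cf; apply: continuous_compact_integrable; first exact: segment_compact.
exact: cont_within.
Qed.

Lemma itg_FTC F f a b : a <= b -> isd F f -> continuous f ->
  itg a b f = F b - F a.
Proof.
move=> ab dF cf; rewrite itgE; last exact: cont_meas.
move: ab; rewrite le_eqVlt => /predU1P[->|ab].
  by rewrite set_itv1 Rintegral_set1 subrr.
rewrite /Rintegral (@continuous_FTC2 _ f F)//.
- exact: cont_within.
- split.
  + by move=> x _; case: (dF x).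
  + by apply: cvg_at_right_filter; apply: isd_cont dF _.
  + by apply: cvg_at_left_filter; apply: isd_cont dF _.
- by move=> x _; rewrite derive1E; case: (dF x).
Qed.

Lemma ex_prim f : continuous f -> exists F, isd F f.
Proof.
move=> cf; pose J a b := \int[@lmu R]_(x in `[a, b]) f x.
have JD a b c : a <= b -> b <= c -> J a c = J a b + J b c.
  move=> ab bc; rewrite /J.
  have := @Rintegral_itv_obnd_cbnd R b (BRight c) f.
  move=> e; have -> : \int[@lmu R]_(x in `[b, c]) f x = \int[@lmu R]_(x in `]b, c]) f x.
    rewrite e//; apply: integrableS (cont_itgable b c cf) => //.
    exact: subset_itv_oc_cc.
  have := @Rintegral_itvB R f (BLeft a) (BRight c) b (cont_itgable a c cf).
  by rewrite !bnd_simp => /(_ ab bc) <-; rewrite addrC subrK.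
have J0 a : J a a = 0 by rewrite /J set_itv1 Rintegral_set1.
have J1 a b : b < a -> J a b = 0.
  by move=> ba; rewrite /J set_itv_ge ?Rintegral_set0// bnd_simp -ltNge.
(* Integrals over reversed intervals are 0, so a signed primitive needs both terms. *)
pose F x := J 0 x - J x 0.
have FE a y : a <= y -> F y = F a + J a y.
  move=> ay; rewrite /F; have [y0|y0] := leP y 0.
    rewrite (@JD a y 0)//.
    move: y0; rewrite le_eqVlt => /predU1P[y0|y0].
      rewrite y0 J0; case: (ltP a 0) => a0; first by rewrite (J1 0 a)//; ring.
      by have -> : a = 0; [move: ay; rewrite y0; lra|rewrite !J0; ring].
    by rewrite (J1 0 y)// (J1 0 a) ?(le_lt_trans ay)//; ring.
  rewrite (J1 y 0)//; have [a0|a0] := ltP a 0.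
    by rewrite (J1 0 a)// (@JD a 0 y) ?(ltW a0) ?(ltW y0)//; ring.
  rewrite (@JD 0 a y)//; move: a0; rewrite le_eqVlt => /predU1P[<-|a0].
    by rewrite J0; ring.
  by rewrite (J1 a 0)//; ring.
exists F => x; rewrite /has_deriv.
have [d1 d2] := @continuous_FTC1_closed R f (x - 1) x (x + 1) (ltac:(lra)) (cont_itgable _ _ cf) (ltac:(lra)) (cf x).
have dJ : is_derive x 1 (fun y => F (x - 1) + J (x - 1) y) (f x).
  have ? : is_derive x 1 (J (x - 1)) (f x).
    exact: (DeriveDef d1 (etrans (esym (derive1E _ _)) d2)).
  by apply: is_derive_eq; rewrite add0r mul1r.
apply: near_eq_is_derive dJ.
near=> y; rewrite (FE (x - 1) y)//.
near: y; apply: (cvgr_ge x); [exact: cvg_id|lra].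
Unshelve. all: end_near. Qed.

End Calculus.

(** * Locally integrable functions and interval integrals *)

Section LocallyIntegrable.
Context {R : realType}.
Implicit Types (f g : R -> R) (a b c x : R).

Definition locint f := forall a b,
  (@cmu R).-integrable (`[a, b] : set (lebR R)) (EFin \o f).

Lemma mitv (i : interval R) : measurable ([set` i] : set (lebR R)).
Proof. exact: borel_lebesgue_set. Qed.

Lemma cont_locint f : continuous f -> locint f.
Proof. by move=> cf a b; apply: integrable_completed => //; exact: cont_itgable. Qed.

Lemma locintD f g : locint f -> locint g -> locint (fun x => f x + g x).
Proof.
move=> lf lg a b; rewrite (_ : _ \o _ = (EFin \o f) \+ (EFin \o g))%E//.
by apply: integrableD => //; exact: mitv.
Qed.

Lemma locintZ (k : R) f : locint f -> locint (fun x => k * f x).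
Proof.
move=> lf a b; rewrite (_ : _ \o _ = (fun x => k%:E * (EFin \o f) x)%E)//.
by apply: integrableZl => //; exact: mitv.
Qed.

Lemma locintB f g : locint f -> locint g -> locint (fun x => f x - g x).
Proof.
move=> lf lg; have := locintD lf (locintZ (-1) lg).
by under eq_fun do rewrite mulN1r.
Qed.

Lemma locint_abs f : locint f -> locint (fun x => `|f x|).
Proof. by move=> lf a b; apply: integrable_norm. Qed.

Lemma itg_le a b f g : locint f -> locint g ->
  (forall x, a <= x <= b -> f x <= g x) -> itg a b f <= itg a b g.
Proof.
by move=> lf lg fg; apply: le_Rintegral => //; exact: mitv.
Qed.

Lemma itg_ge0 a b f : (forall x, 0 <= f x) -> 0 <= itg a b f.
Proof. by move=> f0; apply: Rintegral_ge0 => x _; exact: f0. Qed.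

Lemma eq_itg a b f g : (forall x, a <= x <= b -> f x = g x) -> itg a b f = itg a b g.
Proof. by move=> fg; apply: eq_Rintegral => x; rewrite inE/= in_itv/=; exact: fg. Qed.

Lemma itgD a b f g : locint f -> locint g ->
  itg a b (fun x => f x + g x) = itg a b f + itg a b g.
Proof. by move=> lf lg; apply: RintegralD => //; exact: mitv. Qed.

Lemma itgB a b f g : locint f -> locint g ->
  itg a b (fun x => f x - g x) = itg a b f - itg a b g.
Proof. by move=> lf lg; apply: RintegralB => //; exact: mitv. Qed.

Lemma itgZ a b (k : R) f : locint f -> itg a b (fun x => k * f x) = k * itg a b f.
Proof. by move=> lf; apply: RintegralZl => //; exact: mitv. Qed.

Lemma itg_norm a b f : locint f -> `|itg a b f| <= itg a b (fun x => `|f x|).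
Proof. by move=> lf; apply: le_normr_Rintegral => //; exact: mitv. Qed.

Lemma itg_rev a b f : b < a -> itg a b f = 0.
Proof. by move=> ba; rewrite /itg set_itv_ge ?Rintegral_set0// bnd_simp -ltNge. Qed.

Lemma itg_sub a b c d f : locint f -> (forall x, 0 <= f x) ->
  c <= a -> b <= d -> itg a b f <= itg c d f.
Proof.
move=> lf f0 ca bd; rewrite /itg /Rintegral fine_le//.
- by apply: integrable_fin_num => //; exact: mitv.
- by apply: integrable_fin_num => //; exact: mitv.
- apply: ge0_subset_integral; [exact: mitv|exact: mitv| | |].
  + by have /integrableP[] := lf c d.
  + by move=> x _; rewrite lee_fin.
  + by apply: subset_itv; rewrite bnd_simp.
Qed.

Lemma itg_set1 f a : locint f -> \int[@cmu R]_(x in [set a]) f x = 0.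
Proof.
move=> lf; rewrite /Rintegral (@null_set_integral _ _ _ (@cmu R) _ (EFin \o f))//.
- by rewrite -set_itv1; exact: mitv.
- by rewrite -set_itv1; have /integrableP[] := lf a a.
- exact: lebesgue_measure_set1.
Qed.

Lemma itg_add a b c f : locint f -> a <= b -> b <= c ->
  itg a c f = itg a b f + itg b c f.
Proof.
move=> lf ab bc; rewrite /itg.
have e1 : `[a, c]%classic = `[a, b]%classic `|` `]b, c]%classic.
  by rewrite -itv_bndbnd_setU// bnd_simp.
have e2 : `[b, c]%classic = [set b] `|` `]b, c]%classic.
  by rewrite (@setU1itv _ _ _ _ false)// bnd_simp.
have d1 : [disjoint `[a, b]%classic & `]b, c]%classic].
  by apply/disj_setPS => y [/=]; rewrite !in_itv/= => /andP[_ yb] /andP[]; rewrite ltNge yb.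
have d2 : [disjoint [set b]%classic & `]b, c]%classic].
  by apply/disj_setPS => y [/= ->]; rewrite in_itv/= ltxx.
rewrite e1 Rintegral_setU//; [|exact: mitv|exact: mitv|by rewrite -e1; exact: lf].
rewrite e2 Rintegral_setU//; [|by rewrite -set_itv1; exact: mitv|exact: mitv|by rewrite -e2; exact: lf].
by rewrite itg_set1// add0r.
Qed.

Lemma itg_cst a b (k : R) : a <= b -> itg a b (fun=> k) = k * (b - a).
Proof.
move=> ab; have := @itg_FTC R (fun x => k * x) (fun=> k) a b ab.
rewrite -mulrBr; apply; [by move=> x; rewrite /has_deriv; apply: is_derive_eq; rewrite ?scaler0 ?add0r ?[LHS]mulr1|exact: cst_continuous].
Qed.

(** For a nonnegative integrand, [itg 0 x - itg x 0] is nondecreasing in [x], hence measurable. The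
    general case uses [|f| + f] and [|f| - f], twice the positive and negative parts. *)
Lemma itg_window_meas (h : R) f : locint f -> 0 <= h ->
  measurable_fun [set: lebR R] (fun x : lebR R => itg x (x + h) f).
Proof.
move=> lf h0.
pose P x := itg 0 x f - itg x 0 f.
have PE x y : x <= y -> itg x y f = P y - P x.
  move=> xy; have z0 : itg 0 0 f = 0.
    by have := @itg_add 0 0 0 f lf (lexx _) (lexx _); lra.
  rewrite /P; have [y0|y0] := leP y 0.
    rewrite (@itg_add x y 0)//.
    move: y0; rewrite le_eqVlt => /predU1P[y0|y0].
      move: xy; rewrite y0 => xy; case: (ltP x 0) => x0; first by rewrite (itg_rev _ x0) z0; ring.
      by have -> : x = 0; [lra|rewrite z0; ring].
    by rewrite (itg_rev _ y0) (itg_rev _ (le_lt_trans xy y0)); ring.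
  rewrite (itg_rev _ y0); have [x0|x0] := ltP x 0.
    by rewrite (itg_rev _ x0) (@itg_add x 0 y) ?(ltW x0) ?(ltW y0)//; ring.
  rewrite (@itg_add 0 x y)//; move: x0; rewrite le_eqVlt => /predU1P[<-|x0].
    by have := @itg_add 0 0 0 f lf (lexx _) (lexx _); lra.
  by rewrite (itg_rev _ x0); ring.
pose Pg (g : R -> R) (x : lebR R) : R := itg 0 x g - itg x 0 g.
pose Pw (g : R -> R) (x : lebR R) : R := itg 0 (x + h) g - itg (x + h) 0 g.
have mP g : locint g -> (forall x, 0 <= g x) -> measurable_fun setT (Pg g).
  move=> lg g0; apply: nondecreasing_lebesgue => x y xy.
  by apply: lerB; apply: itg_sub.
have mw g : locint g -> (forall x, 0 <= g x) -> measurable_fun setT (Pw g).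
  move=> lg g0; apply: nondecreasing_lebesgue => x y xy.
  by apply: lerB; apply: itg_sub => //; rewrite lerD2r.
pose fp x := `|f x| + f x; pose fn x := `|f x| - f x.
have lfp : locint fp by apply: locintD => //; exact: locint_abs.
have lfn : locint fn by apply: locintB => //; exact: locint_abs.
have fp0 x : 0 <= fp x by rewrite /fp -lerBlDr sub0r -normrN ler_norm.
have fn0 x : 0 <= fn x by rewrite /fn subr_ge0 ler_norm.
have fE a b : itg a b f = 2^-1 * (itg a b fp - itg a b fn).
  rewrite itgD ?itgB//; try exact: locint_abs; by field.
have PgE x : P x = 2^-1 * (Pg fp x - Pg fn x).
  rewrite /P /Pg !fE.
  by move: (itg _ _ fp) (itg _ _ fn) (itg _ _ fp) (itg _ _ fn) => *; ring.
have e : (fun x : lebR R => itg x (x + h) f) =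
         (fun x => 2^-1 * ((Pw fp x - Pw fn x) - (Pg fp x - Pg fn x))).
  by apply/funext => x; rewrite PE ?lerDl// !PgE -mulrBr.
rewrite e.
exact: (measurable_funM (measurable_cst _) (measurable_funB
  (measurable_funB (mw _ lfp fp0) (mw _ lfn fn0)) (measurable_funB (mP _ lfp fp0) (mP _ lfn fn0)))).
Qed.

End LocallyIntegrable.

Local Open Scope complex_scope.

(** * Closure properties of measurable functions *)

Section AbstractMeasurability.
Context d (T : measurableType d) (R : realType).
Implicit Types f g : T -> R.

Lemma measurable_normr f : measurable_fun setT f -> measurable_fun setT (fun x => `|f x|).
Proof. by move=> mf; apply: measurableT_comp. Qed.

Lemma measurable_infs_normr (u : nat -> T -> R) n :
  (forall k, measurable_fun setT (u k)) ->
  measurable_fun setT (fun x => infs (fun k => `|u k x|) n).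
Proof.
move=> mu; apply: measurable_fun_infs => [x _|k]; last exact: measurable_normr.
by exists 0 => _ [k _ <-].
Qed.

Lemma measurable_lim (u : nat -> T -> R) f : (forall k, measurable_fun setT (u k)) ->
  (forall x, u n x @[n --> \oo] --> f x) -> measurable_fun setT f.
Proof. by move=> mu uf; apply: (measurable_fun_cvg mu) => x _; exact: uf. Qed.

End AbstractMeasurability.

Section LebesgueMeasurable.
Context {R : realType}.
Implicit Types u v : R -> R.

Definition lmeas u := measurable_fun [set: lebR R] (u : lebR R -> R).

Lemma lmeas_abs u : lmeas u -> lmeas (fun x => `|u x|).
Proof. exact: measurable_normr. Qed.

Lemma lmeasD u v : lmeas u -> lmeas v -> lmeas (fun x => u x + v x).
Proof. exact: measurable_funD. Qed.

Lemma lmeasB u v : lmeas u -> lmeas v -> lmeas (fun x => u x - v x).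
Proof. exact: measurable_funB. Qed.

Lemma lmeasM u v : lmeas u -> lmeas v -> lmeas (fun x => u x * v x).
Proof. exact: measurable_funM. Qed.

Lemma lmeas_cst (k : R) : lmeas (fun=> k).
Proof. exact: measurable_cst. Qed.

Lemma lmeas_lim (w : nat -> R -> R) u : (forall k, lmeas (w k)) ->
  (forall x, w n x @[n --> \oo] --> u x) -> lmeas u.
Proof. exact: measurable_lim. Qed.

End LebesgueMeasurable.

(** * Real functions in a Banach lattice *)

Section RealLattice.
Context {R : realType} (X : banach_lattice R).
Implicit Types (u v f g : R -> R) (a b c x : R).

Definition rset u := X (of_real u).
Definition rnorm u := bl_norm X (of_real u).
Local Notation S := rset.
Local Notation p := rnorm.

Lemma normc_real x : normc (x%:C : R[i]) = `|x|.
Proof. by rewrite /= expr0n addr0 sqrtr_sqr. Qed.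

Lemma of_realD u v : of_real (fun x => u x + v x) = of_real u \+ of_real v.
Proof. by apply/funext => x; rewrite /of_real /= rmorphD. Qed.

Lemma of_realZ c u : of_real (fun x => c * u x) = (fun x => c%:C * of_real u x).
Proof. by apply/funext => x; rewrite /of_real /= rmorphM. Qed.

Lemma bl_norm0 : bl_norm X (fun=> 0) = 0.
Proof.
have := bl_norm_scale (0 : R[i]) (bl_zero X).
by rewrite normc0 !mul0r.
Qed.

Lemma bl_opp (f : R -> R[i]) : X f -> X (fun x => - f x).
Proof. by move=> /(bl_scale (-1)); under eq_fun do rewrite mulN1r. Qed.

Lemma bl_normN (f : R -> R[i]) : X f -> bl_norm X (fun x => - f x) = bl_norm X f.
Proof.
move=> Xf; have := bl_norm_scale (-1) Xf.
under eq_fun do rewrite mulN1r.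
by rewrite normcN normc1 mul1r.
Qed.

Lemma bl_norm_sub (f g : R -> R[i]) : X f -> X g ->
  bl_norm X (f \- g) <= bl_norm X f + bl_norm X g.
Proof.
by move=> Xf Xg; rewrite -(bl_normN Xg); exact: (bl_norm_add Xf (bl_opp Xg)).
Qed.

Lemma bl_norm_ge0 (f : R -> R[i]) : X f -> 0 <= bl_norm X f.
Proof.
move=> Xf; have := bl_norm_sub Xf Xf.
have -> : f \- f = (fun=> 0) by apply/funext => x /=; rewrite subrr.
by rewrite bl_norm0 -mulr2n pmulrn_lge0.
Qed.

Lemma rmeas u : S u -> lmeas u.
Proof. by move=> /bl_measurable[]. Qed.

Lemma cmeasurable_of_real u : lmeas u ->
  cmeasurable (of_real u).
Proof. by move=> mu; split => //=; exact: measurable_cst. Qed.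

Lemma rset_le u v : lmeas u -> S v ->
  (forall x, `|u x| <= `|v x|) -> S u /\ p u <= p v.
Proof.
move=> mu Sv uv; have mu' := cmeasurable_of_real mu.
by apply: (bl_ideal mu' Sv); apply: aeW => x; rewrite /of_real !normc_real.
Qed.

Lemma rset0 : S (fun=> 0).
Proof. exact: bl_zero. Qed.

Lemma rnorm0 : p (fun=> 0) = 0.
Proof. exact: bl_norm0. Qed.

Lemma rnorm_ge0 u : S u -> 0 <= p u.
Proof. exact: bl_norm_ge0. Qed.

Lemma rsetD u v : S u -> S v -> S (fun x => u x + v x).
Proof. by move=> Su Sv; rewrite /rset of_realD; exact: bl_add. Qed.

Lemma rnormD u v : S u -> S v -> p (fun x => u x + v x) <= p u + p v.
Proof. by move=> Su Sv; rewrite /rnorm of_realD; exact: bl_norm_add. Qed.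

Lemma rsetZ c u : S u -> S (fun x => c * u x).
Proof. by move=> Su; rewrite /rset of_realZ; exact: bl_scale. Qed.

Lemma rnormZ c u : S u -> p (fun x => c * u x) = `|c| * p u.
Proof. by move=> Su; rewrite /rnorm of_realZ bl_norm_scale// normc_real. Qed.

Lemma rsetB u v : S u -> S v -> S (fun x => u x - v x).
Proof.
by move=> Su /(rsetZ (-1)) Sv; have := rsetD Su Sv; under eq_fun do rewrite mulN1r.
Qed.

Lemma rnormB u v : S u -> S v -> p (fun x => u x - v x) <= p u + p v.
Proof.
move=> Su Sv; have := rnormD Su (rsetZ (-1) Sv); under eq_fun do rewrite mulN1r.
by rewrite rnormZ// normrN normr1 mul1r.
Qed.

Lemma rset_abs u : S u -> S (fun x => `|u x|).
Proof.
move=> Su; apply: (rset_le _ Su _).1 => [|x]; last by rewrite normr_id.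
by apply: lmeas_abs; exact: rmeas.
Qed.

Lemma rnorm_abs u : S u -> p (fun x => `|u x|) = p u.
Proof.
move=> Su; apply/eqP; rewrite eq_le; apply/andP; split.
- apply: (rset_le _ Su _).2 => [|x]; last by rewrite normr_id.
  by apply: lmeas_abs; exact: rmeas.
- by apply: (rset_le _ (rset_abs Su) _).2 => [|x]; [exact: rmeas|rewrite normr_id].
Qed.

Lemma rset_sum (I : Type) (r : seq I) (F : I -> R -> R) : (forall i, S (F i)) ->
  S (fun x => \sum_(i <- r) F i x) /\
  p (fun x => \sum_(i <- r) F i x) <= \sum_(i <- r) p (F i).
Proof.
move=> SF; elim: r => [|i r [IH1 IH2]].
  under eq_fun do rewrite big_nil.
  by rewrite big_nil rnorm0; split => //; exact: rset0.
under eq_fun do rewrite big_cons.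
split; first exact: rsetD.
by rewrite big_cons (le_trans (rnormD _ _))// lerD2l.
Qed.

Lemma rset_locint u : S u -> locint u.
Proof.
move=> Su a b.
have [fin [c c0 /(_ _ Su) h]] : X (of_real (\1_`[a, b] : R -> R)) /\
    exists2 c : R, 0 < c & forall f : R -> R[i], X f ->
      (\int[@cmu R]_(x in `[a, b]) (normc (f x))%:E <= (c * bl_norm X f)%:E)%E.
  apply: bl_local; first exact: mitv.
  have := @lebesgue_measure_itv R `[a, b]; rewrite /lebesgue_measure => e.
  by rewrite [X in (X < _)%E]e /=; case: ifP => _; rewrite ?ltry// -EFinB ltry.
apply/integrableP; split.
  by apply/measurable_EFinP; apply: measurable_funS (rmeas Su).
apply: le_lt_trans (ltry (c * bl_norm X (of_real u))); apply: le_trans h.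
by under [in leRHS]eq_integral do rewrite normc_real.
Qed.

Lemma rset_itv a b : S (\1_`[a, b]).
Proof.
apply: (@bl_local _ X (`[a, b] : set (lebR R)) _ _).1; first exact: mitv.
have := @lebesgue_measure_itv R `[a, b]; rewrite /lebesgue_measure => e.
by rewrite [X in (X < _)%E]e /=; case: ifP => _; rewrite ?ltry// -EFinB ltry.
Qed.

Lemma rset_bounded u a b (K : R) : lmeas u ->
  (forall x, `|u x| <= K) -> (forall x, ~~ (a <= x <= b) -> u x = 0) -> S u.
Proof.
move=> mu uK u0; apply: (rset_le mu (rsetZ K (rset_itv a b)) _).1 => x.
rewrite indicE; case: (boolP (a <= x <= b)) => xab.
  rewrite mem_set ?mulr1; last by rewrite /= in_itv.
  by rewrite (le_trans (uK x))// ler_norm.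
by rewrite (u0 _ xab) normr0.
Qed.

Lemma rset_fatou (u : nat -> R -> R) f C : (forall n, S (u n)) ->
  (forall n, p (u n) <= C) -> (forall n x, 0 <= u n x) ->
  (forall x, nondecreasing_seq (fun n => u n x)) ->
  (forall x, u n x @[n --> \oo] --> f x) -> S f /\ p f <= C.
Proof.
move=> Su puC u0 ndu uf.
have [Sf pf] : X (of_real f) /\
    bl_norm X (of_real (u n)) @[n --> \oo] --> bl_norm X (of_real f).
  by apply: bl_fatou => //; [exists C|apply: aeW].
by split => //; apply: cvgr_to_le pf _; exact: nearW.
Qed.

(** Fatou's lemma: the Fatou property is applied to the increasing sequence of infima of [|u k|]
    over [k >= n], which tends to [|f|]. *)
Lemma rset_liminf (u : nat -> R -> R) f C : (forall n, S (u n)) ->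
  (forall n, p (u n) <= C) -> (forall x, u n x @[n --> \oo] --> f x) ->
  S f /\ p f <= C.
Proof.
move=> Su puC uf.
pose w (n : nat) x : R := infs (fun k => `|u k x|) n.
have lb x : has_lbound (range (fun k => `|u k x|)) by exists 0 => _ [k _ <-].
have lbn x n : has_lbound (sdrop (fun k => `|u k x|) n) by exists 0 => _ [k _ <-].
have w0 n x : 0 <= w n x.
  by apply: lb_le_inf; [exists `|u n x|; exists n => /=|move=> _ [k _ <-]].
have wu n x : w n x <= `|u n x| by apply: ge_inf => //; exists n => /=.
have wf x : w n x @[n --> \oo] --> `|f x|.
  by apply: cvg_infs; apply: cvg_norm; exact: uf.
have mu n : lmeas (u n) by exact: rmeas.
have mw n : lmeas (w n).
  exact: measurable_infs_normr.
have Sw n : S (w n) /\ p (w n) <= p (u n).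
  by apply: rset_le => // x; rewrite ger0_norm.
have [Sf pf] : S (fun x => `|f x|) /\ p (fun x => `|f x|) <= C.
  apply: (@rset_fatou w) => // [n|n|x]; first exact: (Sw n).1.
    by rewrite (le_trans (Sw n).2).
  exact: nondecreasing_infs.
have mf : lmeas f.
  exact: lmeas_lim mu uf.
have [Sf' pf'] := rset_le mf Sf (fun x => ltac:(by rewrite normr_id)).
by split => //; exact: le_trans pf' pf.
Qed.

Definition roc := forall (u : nat -> R -> R) (e : R), (forall n, S (u n)) ->
  (forall x, nonincreasing_seq (fun n => u n x)) ->
  (forall x, u n x @[n --> \oo] --> (0 : R)) -> 0 < e ->
  exists N, forall n, (N <= n)%N -> p (u n) <= e.

Lemma order_continuous_real : order_continuous X -> roc.
Proof.
move=> hoc u e Su ndu u0 e0.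
have /cvgrPdist_le/(_ e e0)[N _ hN] : bl_norm X (of_real (u n)) @[n --> \oo] --> (0 : R).
  by apply: hoc => //; apply: aeW.
exists N => n /hN /=; rewrite sub0r normrN; exact: le_trans (ler_norm _).
Qed.

Definition stek (h : R) u x := h^-1 * itg (x - h / 2) (x + h / 2) u.

Lemma steklov_real h u : steklov h (of_real u) = of_real (stek h u).
Proof.
apply/funext => x; rewrite /steklov /of_real /stek /cintegral /=.
have -> : \int[cmu]_(x0 in `[(x - h / 2)%R, (x + h / 2)%R]) (0 : R) = 0.
  by rewrite /Rintegral integral0.
by rewrite rmorphM.
Qed.

Definition steklov_bound (C : R) := 0 <= C /\ forall u h, S u -> 0 < h ->
  S (stek h u) /\ p (stek h u) <= C * p u.

(** The assumption bounds averages on the unit ball; homogeneity extends the bound to all of [X]. *)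
Lemma assumptionA_real : assumptionA X -> exists C, steklov_bound C.
Proof.
move=> [hA [C hC]]; exists `|C|; split => // u h Su h0.
rewrite /rset /rnorm -steklov_real; split; first exact: hA.
have key (c : R) : 0 < c -> bl_norm X (of_real u) <= c^-1 -> c * bl_norm X (steklov h (of_real u)) <= `|C|.
  move=> c0 pc.
  have Su' : X (fun x => c%:C * of_real u x) by exact: bl_scale.
  have := hC _ h Su' h0.
  have h1 : c * bl_norm X (of_real u) <= 1 by rewrite mulrC -ler_pdivlMr// div1r.
  rewrite bl_norm_scale// normc_real (gtr0_norm c0) => /(_ h1).
  have -> : steklov h (fun x => c%:C * of_real u x) = (fun x => c%:C * steklov h (of_real u) x).
    rewrite -of_realZ !steklov_real -of_realZ; congr of_real; apply/funext => x.
    by rewrite /stek itgZ; [ring|exact: rset_locint].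
  rewrite bl_norm_scale ?normc_real ?(gtr0_norm c0)//; last exact: hA.
  by move=> /le_trans; apply; exact: (ler_norm C).
have p0 := bl_norm_ge0 Su; have q0 := bl_norm_ge0 (hA _ _ Su h0).
move: p0; rewrite le_eqVlt => /predU1P[p0|p0]; last first.
  rewrite -ler_pdivrMr// mulrC; apply: key; first by rewrite invr_gt0.
  by rewrite invrK.
(* The norm of [u] is 0, so [key] holds for every [c > 0]; a large [c] excludes a positive norm of
   the average. *)
rewrite -p0 mulr0 leNgt; apply/negP => q1.
have := key ((`|C| + 1) / bl_norm X (steklov h (of_real u))) _ _.
rewrite -p0 invr_ge0 divr_ge0 ?addr_ge0// => /(_ _ isT).
rewrite divr_gt0 ?ltr_wpDl// => /(_ isT); rewrite divfK ?gt_eqF//; lra.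
Qed.

Definition bdd_supp g := exists n : R, forall x, n < `|x| -> g x = 0.

Definition rdense := forall u (e : R), S u -> 0 < e ->
  exists g, [/\ continuous g, bdd_supp g & p (fun x => u x - g x) < e].

End RealLattice.

(** * Kernels read at dyadic scales *)

Section DyadicKernels.
Context {R : realType}.
Variable theta : R.
Hypothesis theta12 : 2^-1 <= theta < 1.
Implicit Types (K : R -> R) (C t x : R).

Lemma theta_gt0 : 0 < theta.
Proof. by have /andP[] := theta12; lra. Qed.

Lemma theta_lt1 : theta < 1.
Proof. by have /andP[] := theta12. Qed.

(** For [theta = 2^(-a)] this is [(2^j)^(-1 - a)]: the factor [2^(-j)] normalises an integral over a
    window of size [2^j], and [theta^j] is left to make series converge. *)
Definition dwt j : R := (theta / 2) ^+ j.

Lemma dwt_gt0 j : 0 < dwt j.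
Proof. by rewrite exprn_gt0// divr_gt0 ?theta_gt0. Qed.

Lemma dwt_ge0 j : 0 <= dwt j.
Proof. exact/ltW/dwt_gt0. Qed.

Lemma dwtS j : dwt j = 2 / theta * dwt j.+1.
Proof.
by rewrite /dwt exprS; have := theta_gt0; move: (_ ^+ j) => w t0; field; rewrite gt_eqF.
Qed.

(* With [theta = 2^(-a)] this is the decay [(1 + |t|)^(-1 - a)], read off at dyadic scales. *)
Definition kdec C K := (forall t, `|K t| <= C) /\
  forall j t, 2 ^+ j <= `|t| -> `|K t| <= C * dwt j.

Lemma kdec_ge0 C K : kdec C K -> 0 <= C.
Proof. by move=> [/(_ 0) + _]; apply: le_trans. Qed.

(** Take the first scale [j] with [|t| <= 2^j]. The decay known at scale [j - 1] differs from
    [dwt j] by the factor [2 / theta], and the single term of index [j] suffices. A kernel is thus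
    dominated by indicators of dyadic intervals, which integrate to Steklov averages. *)
Lemma kdec_dyadic C K J t : kdec C K -> `|t| <= 2 ^+ J ->
  `|K t| <= 2 / theta * C * \sum_(j < J.+1) dwt j * ((`|t| <= 2 ^+ j)%R)%:R.
Proof.
move=> kK; have C0 := kdec_ge0 kK; case: kK => [K1 K2].
have t21 : 1 <= 2 / theta by rewrite ler_pdivlMr ?theta_gt0//; have := theta_lt1; lra.
have term j : 0 <= dwt j * ((`|t| <= 2 ^+ j)%R)%:R by rewrite mulr_ge0// dwt_ge0.
have t20 : 0 <= 2 / theta * C by rewrite mulr_ge0// (le_trans ler01 t21).
elim: J => [|J IH] tJ.
  rewrite big_ord_recr big_ord0/= add0r tJ mulr1 /dwt expr0 mulr1.
  by rewrite (le_trans (K1 t))// ler_peMl.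
have [tJ'|tJ'] := leP `|t| (2 ^+ J).
  rewrite (le_trans (IH tJ'))// ler_wpM2l//.
  by rewrite [X in _ <= X]big_ord_recr/= lerDl.
rewrite (le_trans (K2 J t (ltW tJ')))// dwtS.
have -> : C * (2 / theta * dwt J.+1) = 2 / theta * C * (dwt J.+1 * ((`|t| <= 2 ^+ J.+1)%R)%:R) by rewrite tJ mulr1; ring.
rewrite ler_wpM2l//.
by rewrite [leRHS]big_ord_recr/= lerDr sumr_ge0.
Qed.

Lemma ex_dyadic t : exists J, t <= 2 ^+ J :> R.
Proof.
have [n hn] : exists n : nat, t <= n%:R.
  by exists (Num.bound `|t|); rewrite (le_trans (ler_norm _))// ltW// archi_boundP.
by exists n; rewrite (le_trans hn)// -natrX ler_nat ltnW// ltn_expl.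
Qed.

End DyadicKernels.

(** * Restrictions and finite sums under the integral *)

Section Restriction.
Context {R : realType}.

Lemma itg_restrict_le (a b c d : R) (f : R -> R) : locint f -> (forall x, 0 <= f x) ->
  itg a b (f \_ `[c, d]) <= itg c d f.
Proof.
move=> lf f0; rewrite /itg -Rintegral_mkcondr /Rintegral fine_le//.
- apply: integrable_fin_num; first by apply: measurableI; exact: mitv.
  by apply: integrableS (lf a b) => //; [exact: mitv|apply: measurableI; exact: mitv].
- by apply: integrable_fin_num; [exact: mitv|exact: lf].
- apply: ge0_subset_integral; [apply: measurableI; exact: mitv|exact: mitv| | |].
  + by have /integrableP[] := lf c d.
  + by move=> x _; rewrite lee_fin.
  + exact: subIsetr.
Qed.

Lemma locint_bounded (f : R -> R) (K : R) : lmeas f -> (forall x, `|f x| <= K) -> locint f.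
Proof.
move=> mf fK a b.
apply: (@le_integrable _ _ _ (@cmu R) _ _ _ (cst K%:E)); first exact: mitv.
- by apply/measurable_EFinP; apply: measurable_funS mf.
- by move=> x _ /=; rewrite lee_fin (le_trans (fK x))// ler_norm.
- exact: (cont_locint (@cst_continuous _ _ K)).
Qed.

Lemma locint_restrict (f : R -> R) c d : locint f -> locint (f \_ `[c, d]).
Proof.
move=> lf a b; rewrite -restrict_EFin; apply/integrable_restrict; [exact: mitv|exact: mitv|].
by apply: integrableS (lf a b) => //; [exact: mitv|apply: measurableI; exact: mitv].
Qed.

Lemma locint_sum (I : Type) (r : seq I) (F : I -> R -> R) :
  (forall i, locint (F i)) -> locint (fun x => \sum_(i <- r) F i x).
Proof.
move=> lF; elim: r => [|i r IH].
  under eq_fun do rewrite big_nil.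
  exact: (cont_locint (@cst_continuous _ _ 0)).
by under eq_fun do rewrite big_cons; exact: locintD.
Qed.

Lemma itg_sum (I : Type) (r : seq I) (F : I -> R -> R) a b :
  (forall i, locint (F i)) ->
  itg a b (fun x => \sum_(i <- r) F i x) = \sum_(i <- r) itg a b (F i).
Proof.
move=> lF; elim: r => [|i r IH].
  rewrite big_nil (_ : (fun x => _) = fun=> 0); last by apply/funext => x; rewrite big_nil.
  by rewrite /itg /Rintegral integral0.
rewrite big_cons -IH -itgD//; last exact: locint_sum.
by apply: eq_itg => x _; rewrite big_cons.
Qed.

End Restriction.

(** * The dyadic majorant built from Steklov averages *)

Section Majorant.
Context {R : realType} (X : banach_lattice R).
Local Notation S := (rset X).
Local Notation p := (rnorm X).
Variables (CA theta sigma : R).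
Hypothesis hCA : steklov_bound X CA.
Hypothesis theta12 : 2^-1 <= theta < 1.
Hypothesis sigma0 : 0 < sigma.
Implicit Types (s u g : R -> R) (x y : R).
Local Notation wt := (dwt theta).
Local Notation wt_gt0 := (dwt_gt0 theta12).
Local Notation wt_ge0 := (dwt_ge0 theta12).

Definition loc j s x := itg (x - 2 ^+ j / sigma) (x + 2 ^+ j / sigma) s.

Lemma CA_ge0 : 0 <= CA. Proof. by case: hCA. Qed.

Lemma exp2_gt0 j : 0 < (2 : R) ^+ j. Proof. exact: exprn_gt0. Qed.

Lemma exp2_ge1 j : 1 <= (2 : R) ^+ j. Proof. by rewrite exprn_ege1// ler1n. Qed.

Lemma locE j s x : sigma * loc j s x = 2 ^+ j.+1 * stek (2 ^+ j.+1 / sigma) s x.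
Proof.
rewrite /stek /loc (_ : 2 ^+ j.+1 / sigma / 2 = 2 ^+ j / sigma); last by rewrite exprS; field; rewrite gt_eqF.
rewrite invf_div mulrA mulrCA mulfV ?mulr1// gt_eqF// exp2_gt0.
Qed.

Lemma loc_rset j s : S s -> S (loc j s) /\ sigma * p (loc j s) <= 2 ^+ j.+1 * CA * p s.
Proof.
move=> Ss.
have [S1 p1] := hCA.2 _ _ Ss (divr_gt0 (exp2_gt0 j.+1) sigma0).
have e : loc j s = (fun x => sigma^-1 * 2 ^+ j.+1 * stek (2 ^+ j.+1 / sigma) s x).
  by apply/funext => x; rewrite -mulrA -locE mulrA mulVf ?mul1r// gt_eqF.
rewrite e; split; first exact: rsetZ.
rewrite rnormZ// gtr0_norm ?mulr_gt0 ?invr_gt0 ?exp2_gt0// !mulrA mulfV ?gt_eqF// mul1r -mulrA.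
by rewrite ler_wpM2l// ltW// exp2_gt0.
Qed.

Lemma loc_ge0 j s x : (forall y, 0 <= s y) -> 0 <= loc j s x.
Proof. exact: itg_ge0. Qed.

Lemma loc_sub j k s x y : S s -> (forall y, 0 <= s y) ->
  `|x - y| + 2 ^+ j / sigma <= 2 ^+ k / sigma -> loc j s y <= loc k s x.
Proof.
move=> Ss s0 h; have := ler_norm (x - y); have := ler_norm (y - x); rewrite distrC => h1 h2.
by apply: itg_sub => //; [exact: rset_locint Ss|lra|lra].
Qed.

Lemma rset_L1 a b : exists2 c : R, 0 < c & forall u, S u -> itg a b (fun x => `|u x|) <= c * p u.
Proof.
have [_ [c c0 h]] : X (of_real (\1_`[a, b] : R -> R)) /\
    exists2 c : R, 0 < c & forall f : R -> R[i], X f ->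
      (\int[@cmu R]_(x in `[a, b]) (normc (f x))%:E <= (c * bl_norm X f)%:E)%E.
  apply: bl_local; first exact: mitv.
  have := @lebesgue_measure_itv R `[a, b]; rewrite /lebesgue_measure => e.
  by rewrite [X in (X < _)%E]e /=; case: ifP => _; rewrite ?ltry// -EFinB ltry.
exists c => // u Su; have := h _ Su.
rewrite (_ : (fun x => _) = (fun x => `|u x|%:E)); last by apply/funext => x; rewrite normc_real.
rewrite /itg /Rintegral => h'; rewrite -lee_fin fineK//.
apply: integrable_fin_num; [exact: mitv|].
exact: (locint_abs (rset_locint Su)).
Qed.

Lemma rnorm_itv_gt0 a b : a < b -> 0 < p (\1_`[a, b]).
Proof.
move=> ab; have [c c0 /(_ _ (rset_itv X a b))] := rset_L1 a b.
rewrite (@eq_itg _ _ _ _ (fun=> 1)) ?itg_cst ?(ltW ab)//; last first.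
  by move=> x xab; rewrite indicE mem_set ?normr1//= in_itv.
by rewrite mul1r => h; have := @ltr_pM2l R c c0 0 (p (\1_`[a, b])); rewrite mulr0 => <-; lra.
Qed.

(** At a fixed point the local integrals grow at most linearly in the window. Half of [H] exceeds
    the radius [2^j / sigma] by 1, so the average of window [H] dominates [loc j s x / H] on all of
    [x - 1, x + 1]; its norm is bounded, and the indicator of that interval has positive norm. *)
Lemma loc_bound s x : S s -> (forall y, 0 <= s y) ->
  exists2 K : R, 0 <= K & forall j, loc j s x <= K * 2 ^+ j.
Proof.
move=> Ss s0; set q := p (\1_`[x - 1, x + 1]).
have q0 : 0 < q by apply: rnorm_itv_gt0; lra.
have sg0 : 0 < sigma^-1 by rewrite invr_gt0.
exists (2 * (1 + sigma^-1) * CA * p s / q).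
  have sg1 := ltW sg0.
  by rewrite divr_ge0 ?(ltW q0)// !mulr_ge0 ?CA_ge0 ?rnorm_ge0// addr_ge0.
move=> j; pose H := 2 * (1 + 2 ^+ j / sigma).
have e0 := exp2_gt0 j; have e1 : 1 <= (2 : R) ^+ j by rewrite exprn_ege1// ler1n.
have es0 : 0 < 2 ^+ j / sigma by rewrite divr_gt0.
have H0 : 0 < H by rewrite /H; lra.
have [S1 p1] := hCA.2 _ _ Ss H0.
have [_ p2] : S (fun y => H^-1 * loc j s x * (\1_`[x - 1, x + 1] : R -> R) y) /\
    p (fun y => H^-1 * loc j s x * (\1_`[x - 1, x + 1] : R -> R) y) <= p (stek H s).
  apply: rset_le => //; first exact: rmeas (rsetZ _ (rset_itv X _ _)).
  move=> y; rewrite indicE; case: (boolP (y \in _)); last first.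
    by rewrite mulr0 normr0.
  rewrite inE/= in_itv/= mulr1 => /andP[y1 y2].
  rewrite ger0_norm ?mulr_ge0 ?invr_ge0 ?(ltW H0) ?loc_ge0//.
  apply: le_trans (ler_norm _); rewrite /stek ler_wpM2l ?invr_ge0 ?(ltW H0)//.
  by apply: itg_sub => //; [exact: rset_locint Ss| |]; rewrite /H; lra.
rewrite rnormZ in p2; last exact: rset_itv.
rewrite ger0_norm -/q in p2; last by rewrite mulr_ge0 ?invr_ge0 ?(ltW H0) ?loc_ge0.
have h : loc j s x <= H * (CA * p s) / q.
  by rewrite ler_pdivlMr// -ler_pdivrMl// mulrA (le_trans p2).
apply: (le_trans h); rewrite ler_pdivrMr//.
rewrite (_ : _ / q * _ * q = 2 * (1 + sigma^-1) * 2 ^+ j * (CA * p s)); last by field; rewrite !gt_eqF.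
rewrite ler_wpM2r ?mulr_ge0 ?CA_ge0 ?rnorm_ge0// /H -mulrA ler_wpM2l//.
by rewrite mulrDl mul1r (mulrC sigma^-1) lerD2r.
Qed.

(** By [locE] the term of index [j] is [2 * theta^j] times a Steklov average, so the series
    converges geometrically in norm. *)
Definition majp n s x := \sum_(j < n) wt j * (sigma * loc j s x).
Definition maj s x := limn (fun n => majp n s x).

(** The sum over [j] of the bounds [2 * CA * theta^j]. *)
Definition Cmaj := 2 * CA / (1 - theta).

Lemma Cmaj_ge0 : 0 <= Cmaj.
Proof. by rewrite divr_ge0 ?mulr_ge0 ?CA_ge0//; have := theta_lt1 theta12; lra. Qed.

Lemma geo_le n (q : R) : 0 <= q < 1 -> \sum_(j < n) q ^+ j <= (1 - q)^-1.
Proof.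
move=> /andP[q0 q1]; have q10 : 0 < 1 - q by lra.
rewrite -(@ler_pM2l _ (1 - q))// mulfV ?gt_eqF//.
have -> : (1 - q) * \sum_(j < n) q ^+ j = 1 - q ^+ n by rewrite -[RHS]opprB subrX1; ring.
by rewrite lerBlDr lerDl exprn_ge0.
Qed.

Lemma majp_nd s x : (forall y, 0 <= s y) -> nondecreasing_seq (fun n => majp n s x).
Proof.
move=> s0; apply/nondecreasing_seqP => n; rewrite /majp big_ord_recr/= lerDl.
by rewrite !mulr_ge0 ?wt_ge0 ?(ltW sigma0) ?loc_ge0.
Qed.

Lemma majp_cvg s x : S s -> (forall y, 0 <= s y) -> cvgn (fun n => majp n s x).
Proof.
move=> Ss s0; have [K K0 hK] := loc_bound x Ss s0.
apply: nondecreasing_is_cvgn; first exact: majp_nd.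
exists (sigma * K * (1 - theta)^-1) => _ [n _ <-].
apply: le_trans (_ : \sum_(j < n) sigma * K * theta ^+ j <= _).
  rewrite /majp ler_sum// => j _.
  apply: (@le_trans _ _ (wt j * (sigma * (K * 2 ^+ j)))).
    by rewrite !ler_wpM2l ?wt_ge0 ?(ltW sigma0).
  rewrite le_eqVlt; apply/orP; left; apply/eqP.
  rewrite /dwt expr_div_n; field.
  by rewrite expf_neq0.
rewrite -mulr_sumr ler_wpM2l ?mulr_ge0 ?(ltW sigma0)//.
by apply: geo_le; rewrite (ltW (theta_gt0 theta12)) (theta_lt1 theta12).
Qed.

Lemma majp_le s x n : S s -> (forall y, 0 <= s y) -> majp n s x <= maj s x.
Proof.
move=> Ss s0; rewrite /maj; apply: (@nondecreasing_cvgn_le _ (fun n => majp n s x)).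
  exact: majp_nd.
exact: majp_cvg.
Qed.

Lemma maj_rset s : S s -> (forall y, 0 <= s y) ->
  S (maj s) /\ p (maj s) <= Cmaj * p s.
Proof.
move=> Ss s0.
have St j : S (fun x => wt j * (sigma * loc j s x)).
  by do 2 apply: rsetZ; exact: (loc_rset j Ss).1.
have pt j : p (fun x => wt j * (sigma * loc j s x)) <= 2 * CA * p s * theta ^+ j.
  rewrite rnormZ; last by apply: rsetZ; exact: (loc_rset j Ss).1.
  rewrite rnormZ; last exact: (loc_rset j Ss).1.
  rewrite gtr0_norm ?wt_gt0// gtr0_norm//.
  rewrite (le_trans (ler_wpM2l (wt_ge0 j) (loc_rset j Ss).2))//.
  rewrite le_eqVlt; apply/orP; left; apply/eqP.
  by rewrite /dwt expr_div_n exprS; field; rewrite expf_neq0.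
apply: (@rset_fatou _ _ (fun n => majp n s)).
- by move=> n; apply: (@rset_sum _ _ _ _ (fun (j : 'I_n) x => wt j * (sigma * loc j s x)) (fun j => St j)).1.
- move=> n; apply: le_trans (@rset_sum _ _ _ _ (fun (j : 'I_n) x => wt j * (sigma * loc j s x)) (fun j => St j)).2 _.
  apply: (@le_trans _ _ (\sum_(j < n) 2 * CA * p s * theta ^+ j)).
    by apply: ler_sum => j _.
  rewrite -mulr_sumr.
  have := @geo_le n theta; rewrite (ltW (theta_gt0 theta12)) (theta_lt1 theta12) => /(_ isT) h.
  have k0 : 0 <= 2 * CA * p s by rewrite !mulr_ge0 ?CA_ge0 ?rnorm_ge0.
  by rewrite (le_trans (ler_wpM2l k0 h))// /Cmaj le_eqVlt; apply/orP; left; apply/eqP; ring.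
- move=> n x; rewrite sumr_ge0// => j _.
  by rewrite !mulr_ge0 ?wt_ge0 ?(ltW sigma0) ?loc_ge0.
- by move=> x; exact: majp_nd.
- by move=> x; exact: majp_cvg.
Qed.

(** A shift by at most [1 / sigma] is absorbed by passing to the next dyadic window, which costs
    [2 / theta]. This is what lets one majorant control both the norm and the node values. *)
Lemma maj_shift s x y : S s -> (forall y, 0 <= s y) -> `|x - y| <= sigma^-1 ->
  maj s y <= 2 / theta * maj s x.
Proof.
move=> Ss s0 xy; apply: limr_le; first exact: majp_cvg.
apply: nearW => n; have t0 : 0 <= 2 / theta by rewrite divr_ge0// ltW// (theta_gt0 theta12).
apply: le_trans (ler_wpM2l t0 (majp_le x n.+1 Ss s0)).
rewrite /majp big_ord_recl mulrDr mulr_sumr.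
apply: (@le_trans _ _ (\sum_(i < n) 2 / theta * (wt (bump 0 i) * (sigma * loc (bump 0 i) s x)))); last first.
  by rewrite lerDr mulr_ge0// !mulr_ge0 ?wt_ge0 ?(ltW sigma0) ?loc_ge0.
apply: ler_sum => j _; rewrite (dwtS theta12) /bump/= add1n -[leLHS]mulrA.
apply: ler_wpM2l => //; apply: ler_wpM2l; first exact: wt_ge0.
apply: ler_wpM2l; first exact: ltW.
apply: loc_sub => //; rewrite exprS.
have h := exp2_ge1 j.
have : sigma^-1 <= 2 ^+ j / sigma by rewrite ler_peMl// invr_ge0 ltW.
by lra.
Qed.

(** The step function of a sequence on cells of length [1 / sigma]; the discrete norm is the norm of
    [X] on such functions. *)
Definition st (c : int -> R) x : R := c (Num.floor (sigma * x)).

Definition sabs (c : int -> R) := st (fun k => `|c k|).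

Lemma stE c x : st c x = c (Num.floor (sigma * x)). Proof. by []. Qed.

Lemma sabsE c x : sabs c x = `|c (Num.floor (sigma * x))|. Proof. by []. Qed.

Lemma sabs_ge0 c x : 0 <= sabs c x.
Proof. exact: normr_ge0. Qed.

Lemma lmeas_st c : lmeas (st c).
Proof. by apply: borel_lebesgue; exact: step_lebesgue. Qed.

Lemma st_cell c x k : k%:~R <= sigma * x < (k + 1)%:~R -> st c x = c k.
Proof. by move=> /floor_def; rewrite /st => ->. Qed.

Lemma itg_cell a b (k : int) : a <= k%:~R / sigma -> (k + 1)%:~R / sigma <= b ->
  sigma^-1 <= itg a b (st (fun l => (l == k)%:R)).
Proof.
move=> ak kb; have sg0 : 0 < sigma^-1 by rewrite invr_gt0.
have lf : locint (st (fun l => (l == k)%:R)).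
  by apply: (@locint_bounded _ _ 1) (lmeas_st _) _ => x; rewrite /st; case: eqP; rewrite ?normr1 ?normr0.
have f0 x : 0 <= st (fun l => (l == k)%:R) x by exact: ler0n.
(* The cell is half-open while [itg] uses closed intervals, so its right end is approached from
   inside. *)
apply/ler_addgt0Pr => e e0; rewrite -lerBlDr.
have [se|es] := leP sigma^-1 e.
  by apply: le_trans (itg_ge0 _ _ f0); lra.
have ek : (k + 1)%:~R / sigma = k%:~R / sigma + sigma^-1 by rewrite intrD mulrDl mul1r.
apply: (@le_trans _ _ (itg (k%:~R / sigma) ((k + 1)%:~R / sigma - e) (st (fun l => (l == k)%:R)))).
  rewrite (@eq_itg _ _ _ _ (fun=> 1)); last first.
    move=> x /andP[x1 x2]; rewrite (@st_cell _ _ k) ?eqxx//.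
    move: x1; rewrite ler_pdivrMr// mulrC => ->/=.
    have : x < (k + 1)%:~R / sigma by lra.
    by rewrite ltr_pdivlMr// mulrC.
  by rewrite itg_cst ek; lra.
by apply: itg_sub => //; lra.
Qed.

Lemma sum_le_itg (c : int -> R) (r : seq int) a b : uniq r -> locint (st c) ->
  (forall k, 0 <= c k) ->
  (forall k, k \in r -> a <= k%:~R / sigma /\ (k + 1)%:~R / sigma <= b) ->
  \sum_(k <- r) c k <= sigma * itg a b (st c).
Proof.
move=> ur lc c0 rab.
have lf (k : int) : locint (st (fun l => (l == k)%:R)).
  by apply: (@locint_bounded _ _ 1) (lmeas_st _) _ => x; rewrite /st; case: eqP; rewrite ?normr1 ?normr0.
have h : \sum_(k <- r) c k * itg a b (st (fun l => (l == k)%:R)) <= itg a b (st c).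
  rewrite (eq_bigr (fun k => itg a b (fun x => c k * st (fun l => (l == k)%:R) x))); last first.
    by move=> k _; rewrite itgZ.
  rewrite -itg_sum; last by move=> k; exact: locintZ.
  apply: itg_le => [|//|x _]; first by apply: locint_sum => k; exact: locintZ.
  rewrite /st; set l := Num.floor _; have [lr|lr] := boolP (l \in r).
    rewrite (big_rem l)//= eqxx mulr1 big_seq big1 ?addr0// => k.
    by rewrite mem_rem_uniq// inE => /andP[/negPf kl _]; rewrite eq_sym kl mulr0.
  rewrite big_seq big1// => k kr; case: eqP => [lk|]; last by rewrite mulr0.
  by rewrite lk kr in lr.
rewrite -ler_pdivrMl// mulr_sumr; apply: le_trans h.
rewrite big_seq [leRHS]big_seq; apply: ler_sum => k kr.
have [ak kb] := rab _ kr.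
by rewrite mulrC; apply: ler_wpM2l => //; exact: itg_cell.
Qed.

Lemma seq_dyadic (r : seq int) x : exists J, forall k, k \in r -> `|sigma * x - k%:~R| <= 2 ^+ J.
Proof.
elim: r => [|l r [J hJ]]; first by exists 0%N.
have [J' hJ'] := ex_dyadic `|sigma * x - l%:~R|.
exists (maxn J J') => k; rewrite inE => /predU1P[->|/hJ h].
  by apply: le_trans hJ' _; apply: ler_weXn2l; rewrite ?ler1n ?leq_maxr.
by apply: le_trans h _; apply: ler_weXn2l; rewrite ?ler1n ?leq_maxl.
Qed.

(** The bound of [kdec_dyadic] sorts the nodes by scale. The cells of the nodes within [2^j] of
    [sigma * x] reach one unit further, and [2^j + 1 <= 2^(j + 1)] places them in the window of
    [loc j.+1]; this shift of index is the second factor [2 / theta]. *)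
Lemma ksum_le C K c (r : seq int) x : kdec theta C K -> S (sabs c) -> uniq r ->
  \sum_(k <- r) `|c k| * `|K (sigma * x - k%:~R)| <= (2 / theta) ^+ 2 * C * maj (sabs c) x.
Proof.
move=> kK Sc ur; have C0 := kdec_ge0 kK.
have t0 : 0 <= 2 / theta by rewrite divr_ge0// ltW// (theta_gt0 theta12).
have [J hJ] := seq_dyadic r x.
pose I (k : int) (j : nat) : R := ((`|sigma * x - k%:~R| <= 2 ^+ j)%R)%:R.
apply: (@le_trans _ _ (\sum_(k <- r) `|c k| * (2 / theta * C * \sum_(j < J.+1) wt j * I k j))).
  rewrite big_seq [leRHS]big_seq; apply: ler_sum => k kr; apply: ler_wpM2l => //.
  by apply: kdec_dyadic => //; exact: hJ.
rewrite (eq_bigr (fun k => \sum_(j < J.+1) 2 / theta * C * (wt j * (`|c k| * I k j)))); last first.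
  by move=> k _; rewrite !mulr_sumr; apply: eq_bigr => j _; ring.
rewrite exchange_big/=.
have key j : \sum_(k <- r) `|c k| * I k j <= sigma * loc j.+1 (sabs c) x.
  rewrite (eq_bigr (fun k => if (`|sigma * x - k%:~R| <= 2 ^+ j) then `|c k| else 0)); last first.
    by move=> k _; rewrite /I; case: ifP; rewrite ?mulr1 ?mulr0.
  rewrite -big_mkcond -big_filter; apply: sum_le_itg => //.
  - exact: filter_uniq.
  - exact: rset_locint Sc.
  - move=> k; rewrite mem_filter => /andP[+ _]; rewrite ler_norml => /andP[h1 h2].
    have e1 := exp2_ge1 j; rewrite exprS intrD ler_pdivlMr// ler_pdivrMr//.
    rewrite (_ : (x - _) * sigma = sigma * x - 2 * 2 ^+ j); last by field; rewrite gt_eqF.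
    rewrite (_ : (x + _) * sigma = sigma * x + 2 * 2 ^+ j); last by field; rewrite gt_eqF.
    lra.
apply: (@le_trans _ _ (\sum_(j < J.+1) (2 / theta) ^+ 2 * C * (wt j.+1 * (sigma * loc j.+1 (sabs c) x)))).
  apply: ler_sum => j _; rewrite -!mulr_sumr (dwtS theta12).
  have := key j; set a := \sum_(k <- r) _; set b := sigma * _ => ab.
  rewrite (_ : (2 / theta) ^+ 2 * C * (wt j.+1 * b) = 2 / theta * C * (2 / theta * wt j.+1 * b)); last by ring.
  by apply: ler_wpM2l; [rewrite mulr_ge0|apply: ler_wpM2l => //; rewrite mulr_ge0 ?wt_ge0].
rewrite -mulr_sumr; apply: ler_wpM2l; first by rewrite mulr_ge0// exprn_ge0.
apply: le_trans (majp_le x J.+2 Sc (sabs_ge0 c)).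
rewrite /majp [leRHS]big_ord_recl lerDr !mulr_ge0 ?wt_ge0 ?(ltW sigma0) ?loc_ge0//.
exact: sabs_ge0.
Qed.

(** The continuous counterpart of [ksum_le]. Windows are exact here, without cells overhanging them,
    so a single factor [2 / theta] appears. *)
Lemma kconv_le C K g x a b : kdec theta C K -> lmeas K -> S (fun y => `|g y|) ->
  locint (fun y => `|K (sigma * (x - y))| * `|g y|) ->
  sigma * itg a b (fun y => `|K (sigma * (x - y))| * `|g y|) <=
  2 / theta * C * maj (fun y => `|g y|) x.
Proof.
move=> kK mK Sg lKg; have C0 := kdec_ge0 kK.
have t0 : 0 <= 2 / theta by rewrite divr_ge0// ltW// (theta_gt0 theta12).
have lg := rset_locint Sg; have g0 y : 0 <= `|g y| by exact: normr_ge0.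
have [J hJ] := ex_dyadic (sigma * (`|x - a| + `|x - b|)).
pose w j y : R := ((fun y => `|g y|) \_ `[x - 2 ^+ j / sigma, x + 2 ^+ j / sigma]) y.
have lw j : locint (w j) by exact: locint_restrict.
apply: (@le_trans _ _ (sigma * itg a b (fun y => \sum_(j < J.+1) (2 / theta * C * wt j) * w j y))).
  apply: ler_wpM2l; first exact: ltW.
  apply: itg_le => // [|y /andP[ay yb]].
    by apply: locint_sum => j; exact: locintZ.
  have xy : `|x - y| <= `|x - a| + `|x - b|.
    have := ler_norm (x - a); have := ler_norm (x - b); have := ler_norm (- (x - a)); have := ler_norm (- (x - b)).
    have := normr_ge0 (x - a); have := normr_ge0 (x - b).
    rewrite !normrN => *; rewrite ler_norml; apply/andP; split; lra.
  have /(kdec_dyadic theta12 kK) h : `|sigma * (x - y)| <= 2 ^+ J.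
    by rewrite normrM gtr0_norm// (le_trans _ hJ)// ler_pM2l.
  apply: le_trans (ler_wpM2r (g0 y) h) _.
  rewrite -[leLHS]mulrA mulr_suml mulr_sumr; apply: ler_sum => j _.
  rewrite /w patchE; have -> : y \in `[x - 2 ^+ j / sigma, x + 2 ^+ j / sigma]%classic = (`|sigma * (x - y)| <= 2 ^+ j).
    apply/idP/idP; rewrite inE/= in_itv/= normrM gtr0_norm// -ler_pdivlMl// (mulrC sigma^-1) ler_norml.
      by move=> /andP[h1 h2]; apply/andP; split; lra.
    by move=> /andP[h1 h2]; apply/andP; split; lra.
  case: (`|sigma * (x - y)| <= 2 ^+ j); last by rewrite /= !mulr0 !mul0r !mulr0.
  by rewrite le_eqVlt; apply/orP; left; apply/eqP; rewrite /=; ring.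
rewrite itg_sum; last by move=> j; exact: locintZ.
rewrite mulr_sumr.
apply: (@le_trans _ _ (\sum_(j < J.+1) 2 / theta * C * (wt j * (sigma * loc j (fun y => `|g y|) x)))).
  apply: ler_sum => j _; rewrite itgZ//.
  rewrite (_ : sigma * _ = 2 / theta * C * (wt j * (sigma * itg a b (w j)))); last by ring.
  apply: ler_wpM2l; first by rewrite mulr_ge0.
  apply: ler_wpM2l; first exact: wt_ge0.
  by apply: ler_wpM2l; [exact: ltW|exact: itg_restrict_le].
rewrite -mulr_sumr; apply: ler_wpM2l; first by rewrite mulr_ge0.
exact: (majp_le x J.+1 Sg g0).
Qed.

End Majorant.

(** * Rules for derivatives *)

Section DerivativeRules.
Context {R : realType}.
Implicit Types (f g : R -> R) (x a b : R).
Local Notation dv x f l := (has_deriv (f : R -> R) (x : R) (l : R)).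

Lemma dval x f a b : dv x f a -> a = b -> dv x f b.
Proof. by move=> h <-. Qed.

Lemma dcst k x : dv x (fun=> k) 0.
Proof. exact: is_derive_cst. Qed.

Lemma did x : dv x (fun y => y) 1.
Proof. exact: is_derive_id. Qed.

Lemma dadd x f g a b : dv x f a -> dv x g b -> dv x (fun y => f y + g y) (a + b).
Proof. by move=> hf hg; exact: is_deriveD. Qed.

Lemma dopp x f a : dv x f a -> dv x (fun y => - f y) (- a).
Proof. by move=> hf; exact: is_deriveN. Qed.

Lemma dsub x f g a b : dv x f a -> dv x g b -> dv x (fun y => f y - g y) (a - b).
Proof. by move=> hf hg; exact: is_deriveB. Qed.

Lemma dmul x f g a b : dv x f a -> dv x g b -> dv x (fun y => f y * g y) (a * g x + f x * b).
Proof.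
move=> hf hg; apply: dval (is_deriveM hf hg) _.
by rewrite -![_ *: _]/(_ * _) addrC (mulrC (g x)).
Qed.

Lemma dscale x k f a : dv x f a -> dv x (fun y => k * f y) (k * a).
Proof. by move=> hf; apply: dval (dmul (dcst k x) hf) _; rewrite mul0r add0r. Qed.

Lemma dexp x f a n : dv x f a -> dv x (fun y => f y ^+ n.+1) (n.+1%:R * f x ^+ n * a).
Proof.
move=> hf; elim: n => [|n IH].
  by apply: dval hf _; rewrite expr0 !mul1r.
have -> : (fun y => f y ^+ n.+2) = (fun y => f y * f y ^+ n.+1).
  by apply/funext => y; rewrite exprS.
apply: dval (dmul hf IH) _; rewrite -[in RHS]natr1 exprS; ring.
Qed.

Lemma dinv x f a : f x != 0 -> dv x f a -> dv x (fun y => (f y)^-1) (- a / f x ^+ 2).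
Proof.
move=> f0 hf; have h := is_deriveV f0 hf.
apply: dval h _; rewrite -![_ *: _]/(_ * _) /=; ring.
Qed.

Lemma dcomp x f g a b : dv (f x) g b -> dv x f a -> dv x (fun y => g (f y)) (a * b).
Proof.
move=> hg hf; by apply: dval (is_derive1_comp hg hf) _; rewrite mulrC.
Qed.

Lemma dsin x f a : dv x f a -> dv x (fun y => sin (f y)) (a * cos (f x)).
Proof. by move=> hf; exact: dcomp (is_derive_sin _) hf. Qed.

Lemma dcos x f a : dv x f a -> dv x (fun y => cos (f y)) (- a * sin (f x)).
Proof. by move=> hf; apply: dval (dcomp (is_derive_cos _) hf) _; rewrite mulrN mulNr. Qed.

Lemma dpow x f a (r : R) : 0 < f x -> dv x f a ->
  dv x (fun y => f y `^ r) (a * (r * f x `^ (r - 1))).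
Proof. by move=> f0 hf; exact: dcomp (is_derive1_powR _ f0) hf. Qed.

Lemma dcont x f a : dv x f a -> {for x, continuous f}.
Proof. by case=> df _; apply/differentiable_continuous/derivable1_diffP. Qed.

End DerivativeRules.

(** * Kernels as cosine integrals *)

Section Kernels.
Context {R : realType}.
Local Notation dv x f l := (has_deriv (f : R -> R) (x : R) (l : R)).
Implicit Types (m f g : R -> R) (a x t : R).

Lemma cos_cont (x : R) : continuous (fun xi => cos (x * xi)).
Proof.
move=> xi; apply: (@dcont _ _ _ (- x * sin (x * xi))).
by apply: dcos; apply: dval (dscale x (did xi)) _; rewrite mulr1.
Qed.

Lemma sin_cont (x : R) : continuous (fun xi => sin (x * xi)).
Proof.
move=> xi; apply: (@dcont _ _ _ (x * cos (x * xi))).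
by apply: dsin; apply: dval (dscale x (did xi)) _; rewrite mulr1.
Qed.

Lemma cos_le1 (t : R) : `|cos t| <= 1.
Proof. by rewrite ler_norml cos_geN1 cos_le1. Qed.

Lemma sin_le1 (t : R) : `|sin t| <= 1.
Proof. by rewrite ler_norml sin_geN1 sin_le1. Qed.

Lemma locint_mulb m g (B : R) : lmeas m -> lmeas g -> (forall x, `|m x| <= B) ->
  (forall x, `|g x| <= 1) -> locint (fun x => m x * g x).
Proof.
move=> mm mg mB g1; apply: (@locint_bounded _ _ B); first exact: lmeasM.
by move=> x; rewrite normrM -[leRHS]mulr1 ler_pM.
Qed.

Definition cosint m x := itg 0 1 (fun xi => m xi * cos (x * xi)).
(** In the normalisation of [fourier], the transform of the even function that equals [m] on [0, 1]
    and 0 outside [-1, 1]. *)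
Definition kern m x := pi^-1 * cosint m x.

Lemma cosint_locint m x (B : R) : lmeas m -> (forall x, `|m x| <= B) ->
  locint (fun xi => m xi * cos (x * xi)).
Proof.
move=> mm mB; apply: (@locint_mulb _ _ B) => //.
  by apply: continuous_lebesgue; exact: cos_cont.
by move=> xi; exact: cos_le1.
Qed.

Lemma cosint_le m x (B : R) : lmeas m -> (forall x, `|m x| <= B) -> `|cosint m x| <= B.
Proof.
move=> mm mB; have B0 : 0 <= B by exact: le_trans (mB 0).
apply: le_trans (itg_norm _ _ (cosint_locint x mm mB)) _.
apply: (@le_trans _ _ (itg 0 1 (fun=> B))); last by rewrite itg_cst// subr0 mulr1.
apply: itg_le => [||xi _].
- by apply: locint_abs; exact: (cosint_locint x mm mB).
- exact: (cont_locint (@cst_continuous _ _ B)).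
- by rewrite normrM -[leRHS]mulr1 ler_pM// cos_le1.
Qed.

Lemma cosintN m x : cosint m (- x) = cosint m x.
Proof. by apply: eq_itg => xi _; rewrite mulNr cosN. Qed.

Definition cutoff (lo hi : R) x := Num.max lo (Num.min hi x).

Lemma cutoff_id lo hi x : lo <= x <= hi -> cutoff lo hi x = x.
Proof. by move=> /andP[h1 h2]; rewrite /cutoff (min_idPr h2) (max_idPr h1). Qed.

Lemma cutoff_itv lo hi x : lo <= hi -> lo <= cutoff lo hi x <= hi.
Proof. by move=> h; rewrite /cutoff le_max lexx/= ge_max h ge_min lexx. Qed.

Lemma cutoff_cont lo hi : continuous (cutoff lo hi).
Proof.
by move=> x; apply: continuous_max; [exact: cst_continuous|apply: continuous_min; [exact: cst_continuous|exact: cvg_id]].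
Qed.

Lemma powR_le1 (y b : R) : 0 <= y <= 1 -> 0 <= b -> y `^ b <= 1.
Proof.
move=> /andP[y0 y1] b0; have := @ge0_ler_powR _ b b0 y 1.
by rewrite !nnegrE powR1; apply.
Qed.

Lemma abs_sin_le (t : R) : 0 <= t -> `|sin t| <= t.
Proof.
move=> t0; rewrite -[sin t]subr0 -sin0 -[t in leRHS]subr0.
apply: (@mvt_le _ sin cos (fun y => y) (fun=> 1)) => [//|x _|x _|x _].
- exact: is_derive_sin.
- exact: did.
- exact: cos_le1.
Qed.

(** * Decay of kernels whose symbol is singular at 1 *)

Section Criterion.
Variables (a C B : R) (m m1 m2 : R -> R).
Hypothesis a01 : 0 < a <= 2^-1.
Hypothesis mm : lmeas m.
Hypothesis mB : forall x, `|m x| <= B.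
Hypothesis m_der : forall x, 0 < x < 1 -> dv x m (m1 x).
Hypothesis m1_der : forall x, 0 < x < 1 -> dv x m1 (m2 x).
Hypothesis m_bd : forall x, 0 <= x <= 1 -> `|m x| <= C * (1 - x) `^ a.
Hypothesis m1_bd : forall x, 0 < x < 1 -> `|m1 x| <= C * (1 - x) `^ (a - 1).
Hypothesis m2_bd : forall x, 0 < x < 1 -> `|m2 x| <= C * (1 - x) `^ (a - 2).

Let C0 : 0 <= C.
Proof.
have := m_bd (x := 0); rewrite lexx ler01 subr0 powR1 mulr1 => /(_ isT).
exact: le_trans.
Qed.

(** The interval is cut at [d^2] and [1 - d]. The ends are estimated by their length, the right one
    also by the edge bound. In the middle two integrations by parts leave [d^2 * m2], and the
    integral of [d^2 * (1 - xi)^(a - 2)] up to [1 - d] is of order [d^(1 + a)]. *)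
Lemma cosint_decay d : 0 < d <= 2^-1 -> `|cosint m d^-1| <= 9 * C * (d * d `^ a).
Proof.
move=> /andP[d0 d12]; set x := d^-1; have /andP[a0 a12] := a01.
have x0 : 0 < x by rewrite invr_gt0.
have xd : x^-1 = d by rewrite /x invrK.
have lf := cosint_locint x mm mB; set f := fun xi => m xi * cos (x * xi).
(* With this cut [x * e = d], so the boundary term [m e * sin (x * e) * d] is of order [d^2]; the
   derivatives of [m] are controlled only in the open interval. *)
pose e := d ^+ 2.
have e0 : 0 < e by rewrite exprn_gt0.
have ed : e <= d / 2.
  by rewrite /e expr2 ler_wpM2l ?(ltW d0).
have dda : d <= d `^ a.
  by have := @ger1_powR R d a; rewrite d0; apply; lra.
have e1d : e <= 1 - d by lra.
have fC xi : 0 <= xi <= 1 -> `|f xi| <= C * (1 - xi) `^ a.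
  move=> h; rewrite /f normrM; apply: le_trans (m_bd h).
  by rewrite -[leRHS]mulr1 ler_wpM2l// cos_le1.
have lC k : locint (fun=> k : R) by exact: (cont_locint (@cst_continuous _ _ k)).
have I1 : `|itg 0 e f| <= C * e.
  apply: le_trans (itg_norm _ _ lf) _.
  rewrite -[e in leRHS]subr0 -itg_cst ?(ltW e0)//.
  apply: itg_le => [||xi /andP[h1 h2]]; [exact: locint_abs|exact: lC|].
  apply: le_trans (fC _ _) _; first by apply/andP; split; lra.
  rewrite -[leRHS]mulr1 ler_wpM2l//; apply: powR_le1; last exact: ltW.
  by apply/andP; split; lra.
have I3 : `|itg (1 - d) 1 f| <= C * d `^ a * d.
  apply: le_trans (itg_norm _ _ lf) _.
  have -> : C * d `^ a * d = C * d `^ a * (1 - (1 - d)) by ring.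
  rewrite -itg_cst; last by lra.
  apply: itg_le => [||xi /andP[h1 h2]]; [exact: locint_abs|exact: lC|].
  apply: le_trans (fC _ _) _; first by apply/andP; split; lra.
  by rewrite ler_wpM2l//; apply: ge0_ler_powR; rewrite ?nnegrE; lra.
(* Freezing the argument outside the middle interval makes the integrand continuous on the line, so
   a primitive exists. *)
pose mt xi := m (cutoff e (1 - d) xi).
have mtc : continuous mt.
  move=> xi; apply: continuous_comp; first exact: cutoff_cont.
  apply: (@dcont _ _ _ (m1 (cutoff e (1 - d) xi))); apply: m_der.
  by have /andP[h1 h2] := cutoff_itv xi e1d; apply/andP; split; lra.
have ftc : continuous (fun xi => mt xi * cos (x * xi)).
  by move=> xi; apply: continuousM; [exact: mtc|exact: cos_cont].
have [G dG] := ex_prim ftc.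
(* The boundary terms of the two integrations by parts; its derivative is the integrand plus the
   remainder with [m2]. *)
pose P xi := m xi * (sin (x * xi) * d) + m1 xi * (cos (x * xi) * d ^+ 2).
have dx xi : dv xi (fun y => x * y) x by apply: dval (dscale x (did xi)) _; rewrite mulr1.
have dP xi : 0 < xi < 1 -> dv xi P (m xi * cos (x * xi) + m2 xi * (cos (x * xi) * d ^+ 2)).
  move=> h; apply: dval (dadd (dmul (m_der h) (dmul (dsin (dx xi)) (dcst d xi)))
     (dmul (m1_der h) (dmul (dcos (dx xi)) (dcst (d ^+ 2) xi)))) _.
  by rewrite /x /=; field; rewrite gt_eqF.
pose Bd xi := C / (1 - a) * d ^+ 2 * (1 - xi) `^ (a - 1).
have dB xi : 0 < xi < 1 -> dv xi Bd (C * d ^+ 2 * (1 - xi) `^ (a - 2)).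
  move=> h; have h1 : 0 < 1 - xi by lra.
  have hd := @dpow R xi (fun y => 1 - y) _ (a - 1) h1 (dsub (dcst 1 xi) (did xi)).
  apply: dval (dscale _ hd) _.
  rewrite (_ : a - 1 - 1 = a - 2); last by ring.
  by field; apply/eqP; lra.
have I2 : `|itg e (1 - d) f - (P (1 - d) - P e)| <= Bd (1 - d) - Bd e.
  have -> : itg e (1 - d) f = G (1 - d) - G e.
    rewrite -(itg_FTC e1d dG ftc); apply: eq_itg => xi h.
    by rewrite /f /mt cutoff_id.
  rewrite -normrN (_ : - (G (1 - d) - G e - (P (1 - d) - P e)) = (P (1 - d) - G (1 - d)) - (P e - G e)); last by ring.
  have sub xi : e <= xi <= 1 - d -> 0 < xi < 1 by move=> /andP[? ?]; apply/andP; split; lra.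
  apply: (@mvt_le _ (fun xi => P xi - G xi) (fun xi => m2 xi * (cos (x * xi) * d ^+ 2)) Bd _ _ _ e1d).
  - move=> xi h; apply: dval (dsub (dP _ (sub _ h)) (dG xi)) _.
    by rewrite /mt cutoff_id//; ring.
  - by move=> xi h; exact: dB (sub _ h).
  - move=> xi /sub h; rewrite normrM normrM [`|d ^+ 2|]ger0_norm ?exprn_ge0 ?(ltW d0)//.
    apply: le_trans (_ : `|m2 xi| * d ^+ 2 <= _).
      by rewrite ler_wpM2l// ler_piMl ?exprn_ge0 ?(ltW d0)// cos_le1.
    by rewrite mulrAC ler_wpM2r ?exprn_ge0 ?(ltW d0)// m2_bd.
have da1 : d `^ (a - 1) * d = d `^ a.
  by rewrite -{2}(powRr1 (ltW d0)) -powRD ?subrK// (gt_eqF d0) implybT.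
have P1 : `|P (1 - d)| <= 2 * C * (d * d `^ a).
  apply: le_trans (ler_normD _ _) _; rewrite !normrM.
  have h1 : 0 < 1 - d < 1 by apply/andP; split; lra.
  have h1' : 0 <= 1 - d <= 1 by apply/andP; split; lra.
  have := m_bd h1'; have := m1_bd h1; have -> : 1 - (1 - d) = d by ring.
  move=> q1 q0; rewrite !(gtr0_norm d0).
  have s1 := sin_le1 (x * (1 - d)); have c1 := cos_le1 (x * (1 - d)).
  apply: le_trans (_ : C * d `^ a * (1 * d) + C * d `^ (a - 1) * (1 * (d * d)) <= _).
    have dd0 : 0 <= d * d by rewrite mulr_ge0// ltW.
    have d00 := ltW d0.
    by apply: lerD; apply: ler_pM => //; rewrite ?mulr_ge0// ler_wpM2r.
  by rewrite -da1 le_eqVlt; apply/orP; left; apply/eqP; ring.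
have d2 : d ^+ 2 <= d * d `^ a by rewrite expr2 ler_wpM2l// ltW.
have P2 : `|P e| <= 3 * C * (d * d `^ a).
  apply: le_trans (ler_normD _ _) _; rewrite !normrM.
  have h1 : 0 < e < 1 by apply/andP; split; lra.
  have h1' : 0 <= e <= 1 by apply/andP; split; lra.
  have s1 : `|sin (x * e)| <= d.
    have -> : x * e = d by rewrite /x /e; field; rewrite gt_eqF.
    exact/abs_sin_le/ltW.
  have c1 := cos_le1 (x * e).
  have q0 : `|m e| <= C.
    apply: le_trans (m_bd h1') _; rewrite -[leRHS]mulr1 ler_wpM2l//.
    by apply: powR_le1; [apply/andP; split; lra|exact: ltW].
  have q1 : `|m1 e| <= 2 * C.
    apply: le_trans (m1_bd h1) _; rewrite mulrC ler_wpM2r//.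
    have -> : a - 1 = - (1 - a) by ring.
    rewrite powRN -[leRHS]invrK lef_pV2 ?posrE ?invr_gt0 ?powR_gt0//; last by lra.
    apply: (@le_trans _ _ ((1 - e) `^ 1)); first by rewrite powRr1; lra.
    by apply: ger_powR; [apply/andP; split; lra|lra].
  rewrite !(gtr0_norm d0).
  apply: (@le_trans _ _ (C * (d * d) + 2 * C * (1 * (d * d)))).
    have dd0 : 0 <= d * d by rewrite mulr_ge0// ltW.
    have d00 := ltW d0.
    by apply: lerD; apply: ler_pM => //; rewrite ?mulr_ge0// ler_wpM2r.
  by have := ler_wpM2l C0 d2; rewrite expr2; lra.
have B1 : Bd (1 - d) - Bd e <= 2 * C * (d * d `^ a).
  have B0 : 0 <= Bd e.
    rewrite /Bd mulr_ge0 ?powR_ge0// mulr_ge0 ?exprn_ge0 ?(ltW d0)// divr_ge0//; lra.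
  apply: (@le_trans _ _ (Bd (1 - d))); first by lra.
  rewrite /Bd opprB addrCA subrr addr0 -da1.
  rewrite (_ : _ * d ^+ 2 * _ = (1 - a)^-1 * (C * (d * (d `^ (a - 1) * d)))); last by ring.
  rewrite -[leRHS]mulrA; apply: ler_wpM2r.
    by rewrite !mulr_ge0 ?powR_ge0 ?(ltW d0).
  by rewrite -[leRHS]invrK lef_pV2 ?posrE ?invr_gt0//; lra.
rewrite /cosint (@itg_add _ 0 e 1)//; [|exact: ltW|lra].
rewrite (@itg_add _ e (1 - d) 1)//; last by lra.
have : C * e <= C * (d * d `^ a) by rewrite ler_wpM2l.
have : C * d `^ a * d = C * (d * d `^ a) by ring.
move: (itg 0 e f) (itg e _ f) (itg _ 1 f) I1 I2 I3 P1 P2 B1 => i1 i2 i3.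
move: (P (1 - d)) (P e) (Bd (1 - d) - Bd e) => q1 q2 q3.
rewrite !ler_norml => /andP[? ?] /andP[? ?] /andP[? ?] /andP[? ?] /andP[? ?] ? ? ?.
by apply/andP; split; lra.
Qed.

(** For [|t| >= 2^j] the decay [|t|^(-1 - a)] is at most [dwt j]. Scale 0 uses the trivial bound,
    since [cosint_decay] starts at [|t| = 2]. *)
Lemma kern_kdec : exists K, kdec (2 `^ (- a)) K (kern m).
Proof.
have /andP[a0 a12] := a01.
have B0 : 0 <= B by exact: le_trans (mB 0).
exists (pi^-1 * (B + 9 * C)); split=> [t|j t jt].
  rewrite /kern normrM gtr0_norm ?invr_gt0 ?pi_gt0// ler_wpM2l ?invr_ge0 ?pi_ge0//.
  by rewrite (le_trans (cosint_le t mm mB))// lerDl mulr_ge0.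
rewrite /kern normrM gtr0_norm ?invr_gt0 ?pi_gt0// -mulrA ler_wpM2l ?invr_ge0 ?pi_ge0//.
have -> : `|cosint m t| = `|cosint m `|t| |.
  by have [t0|t0] := leP 0 t; [rewrite (ger0_norm t0)|rewrite (ltr0_norm t0) cosintN].
case: j jt => [|j] jt.
  by rewrite /dwt expr0 mulr1 (le_trans (cosint_le _ mm mB))// lerDl mulr_ge0.
have e2 : 2 <= `|t|.
  by apply: le_trans jt; rewrite exprS ler_peMr// exprn_ege1// ler1n.
have t0 : 0 < `|t| by lra.
rewrite -[`|t|]invrK; apply: le_trans (cosint_decay _) _.
  by rewrite invr_gt0 t0/= lef_pV2 ?posrE//; lra.
rewrite (_ : (B + _) * _ = B * dwt (2 `^ (- a)) j.+1 + 9 * C * dwt (2 `^ (- a)) j.+1); last by ring.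
have th0 : 0 < 2 `^ (- a) :> R by rewrite powR_gt0.
apply: (@le_trans _ _ (9 * C * dwt (2 `^ (- a)) j.+1)); last first.
  by rewrite lerDr mulr_ge0// /dwt exprn_ge0// divr_ge0// ltW.
rewrite ler_wpM2l ?mulr_ge0//.
have h : `|t|^-1 <= (2 ^+ j.+1)^-1 by rewrite lef_pV2 ?posrE// exprn_gt0.
rewrite /dwt expr_div_n mulrC; apply: ler_pM; rewrite ?powR_ge0 ?invr_ge0//.
have -> : (2 `^ (- a)) ^+ j.+1 = ((2 ^+ j.+1)^-1) `^ a :> R.
  rewrite -powR_mulrn ?powR_ge0// -powRrM -powR_mulrn// -powR_inv1 ?powR_ge0// -!powRrM.
  by congr (_ `^ _); ring.
by apply: ge0_ler_powR; rewrite ?nnegrE ?invr_ge0 ?(ltW a0)// exprn_ge0.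
Qed.

End Criterion.
End Kernels.

(** * A class of symbols closed under products and inverses *)

Section Tame.
Context {R : realType}.
Implicit Types (m b f g : R -> R) (x y C : R).
Variable a : R.
Hypothesis a01 : 0 < a <= 2^-1.

Let a0 : 0 < a. Proof. by case/andP: a01. Qed.
Let a12 : a <= 2^-1. Proof. by case/andP: a01. Qed.

(* Singularities of type [(1 - x)^a] at [1]; unlike the bounds in [kern_kdec], this class is
   closed under products and inverses. *)
Definition tame b := exists (C : R) (b1 b2 : R -> R), 0 <= C /\ forall x, 0 < x < 1 ->
  [/\ has_deriv b x (b1 x), has_deriv b1 x (b2 x), `|b x| <= C,
      `|b1 x| <= C * (1 - x) `^ (a - 1) & `|b2 x| <= C * (1 - x) `^ (a - 2)].

Lemma pow_neg_le (u y s t : R) : 0 < u -> u <= y -> y <= 1 -> t <= s -> t <= 0 ->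
  y `^ s <= u `^ t.
Proof.
move=> u0 uy y1 ts t0; have y0 : 0 < y by exact: lt_le_trans uy.
apply: (@le_trans _ _ (y `^ t)); first by apply: ger_powR => //; rewrite y0.
rewrite -[t]opprK !(powRN _ (- t)) lef_pV2 ?posrE ?powR_gt0//.
by apply: ge0_ler_powR; rewrite ?nnegrE ?oppr_ge0 ?(ltW u0) ?(ltW y0).
Qed.

Lemma w1_ge1 x : 0 < x < 1 -> 1 <= (1 - x) `^ (a - 1).
Proof.
move=> /andP[x0 x1]; have /andP[? ?] := a01.
by rewrite -[leLHS](powRr0 (1 : R)); apply: pow_neg_le => //; lra.
Qed.

Lemma w2_ge x : 0 < x < 1 -> (1 - x) `^ (a - 1) * (1 - x) `^ (a - 1) <= (1 - x) `^ (a - 2).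
Proof.
move=> /andP[x0 x1]; have h : 0 < 1 - x by lra.
rewrite -powRD ?(gt_eqF h) ?implybT//.
by have /andP[? ?] := a01; apply: pow_neg_le => //; lra.
Qed.

Lemma w12 x : 0 < x < 1 -> (1 - x) `^ (a - 1) <= (1 - x) `^ (a - 2).
Proof. by have /andP[? ?] := a01; move=> /andP[x0 x1]; apply: pow_neg_le => //; lra. Qed.

Lemma tame_smooth b (b1 b2 : R -> R) C : (forall x, 0 < x < 1 -> has_deriv b x (b1 x)) ->
  (forall x, 0 < x < 1 -> has_deriv b1 x (b2 x)) ->
  (forall x, 0 < x < 1 -> [/\ `|b x| <= C, `|b1 x| <= C & `|b2 x| <= C]) -> tame b.
Proof.
move=> d1 d2 h; have C0 : 0 <= C.
  have h01 : (0 < (2^-1 : R)) && ((2^-1 : R) < 1) by apply/andP; split; lra.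
  have [h0 _ _] := h _ h01.
  exact: le_trans h0.
exists C, b1, b2; split => // x x01; have [q0 q1 q2] := h _ x01.
have w1 := w1_ge1 x01; have w2 := w12 x01.
split; [exact: d1|exact: d2|by []| |].
- by apply: (le_trans q1); rewrite ler_peMr.
- by apply: (le_trans q2); rewrite ler_peMr// (le_trans w1).
Qed.

Lemma has_deriv_near f g x (l lo hi : R) : lo < x < hi ->
  (forall y, lo < y < hi -> f y = g y) -> has_deriv f x l -> has_deriv g x l.
Proof.
move=> /andP[lx xh] fg hf; apply: near_eq_is_derive hf.
near=> y; apply: fg; apply/andP; split.
  by near: y; exact: lt_nbhsr.
by near: y; exact: lt_nbhsl.
Unshelve. all: end_near. Qed.

Lemma tame_eq f g : (forall x, 0 < x < 1 -> f x = g x) -> tame f -> tame g.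
Proof.
move=> fg [C [b1 [b2 [C0 h]]]]; exists C, b1, b2; split => // x x01.
have [h1 h2 h3 h4 h5] := h _ x01; split => //; last by rewrite -fg.
exact: (has_deriv_near x01 fg h1).
Qed.

(** The critical term is the product [f1 * g1] of first derivatives, of size [(1 - x)^(2 a - 2)];
    [w2_ge] absorbs it because [2 a - 2 >= a - 2]. *)
Lemma tameM f g : tame f -> tame g -> tame (fun x => f x * g x).
Proof.
move=> [C [f1 [f2 [C0 hf]]]] [D [g1 [g2 [D0 hg]]]].
exists (4 * (C * D)), (fun x => f1 x * g x + f x * g1 x),
  (fun x => (f2 x * g x + f1 x * g1 x) + (f1 x * g1 x + f x * g2 x)).
split=> [|x x01]; first by rewrite !mulr_ge0.
have [p1 p2 p3 p4 p5] := hf _ x01; have [q1 q2 q3 q4 q5] := hg _ x01.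
have W1 := w1_ge1 x01; have W2 := w2_ge x01; have W3 := w12 x01.
set u := (1 - x) `^ (a - 1) in W1 W2 W3 p4 q4 *.
set v := (1 - x) `^ (a - 2) in W2 W3 p5 q5 *.
have CD0 : 0 <= C * D by exact: mulr_ge0.
have u0 : 0 <= u by lra.
have v0 : 0 <= v by lra.
have fg1 (A B A' B' : R) : `|A| <= A' -> `|B| <= B' -> `|A * B| <= A' * B'.
  by move=> hA hB; rewrite normrM ler_pM.
split.
- exact: dmul.
- by apply: dadd; exact: dmul.
- by apply: (le_trans (fg1 _ _ _ _ p3 q3)); lra.
- apply: le_trans (ler_normD _ _) _.
  have := fg1 _ _ _ _ p4 q3; have := fg1 _ _ _ _ p3 q4.
  have : 0 <= C * D * u by exact: mulr_ge0.
  by rewrite mulrAC (mulrA C D u); lra.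
- apply: le_trans (ler_normD _ _) _; apply: le_trans (lerD (ler_normD _ _) (ler_normD _ _)) _.
  have := fg1 _ _ _ _ p5 q3; have := fg1 _ _ _ _ p3 q5; have := fg1 _ _ _ _ p4 q4.
  rewrite (_ : C * v * D = C * D * v); last by ring.
  rewrite (_ : C * u * (D * u) = C * D * (u * u)); last by ring.
  rewrite (_ : C * (D * v) = C * D * v); last by ring.
  by have := ler_wpM2l CD0 W2; lra.
Qed.

Lemma tameV f (c : R) : 0 < c -> (forall x, 0 < x < 1 -> c <= f x) -> tame f ->
  tame (fun x => (f x)^-1).
Proof.
move=> c0 fc [C [f1 [f2 [C0 hf]]]].
(* The terms bound the inverse, the contributions linear in a derivative of [f], and the one with
   the square of [f1]. *)
pose D := c^-1 + c^-1 ^+ 2 * C + 2 * c^-1 ^+ 3 * C ^+ 2.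
have i0 : 0 < c^-1 by rewrite invr_gt0.
exists D, (fun x => - f1 x * ((f x)^-1) ^+ 2),
  (fun x => - f2 x * ((f x)^-1) ^+ 2 + - f1 x * (2%:R * ((f x)^-1) ^+ 1 * (- f1 x / f x ^+ 2))).
have e2 : 0 <= c^-1 ^+ 2 * C by rewrite mulr_ge0// exprn_ge0// ltW.
have e3 : 0 <= 2 * c^-1 ^+ 3 * C ^+ 2 by rewrite !mulr_ge0 ?exprn_ge0// ltW.
split=> [|x x01]; first by rewrite /D; lra.
have [p1 p2 p3 p4 p5] := hf _ x01; have fx := fc _ x01.
have f0 : 0 < f x by lra.
have fn : f x != 0 by rewrite gt_eqF.
have W1 := w1_ge1 x01; have W2 := w2_ge x01; have W3 := w12 x01.
set u := (1 - x) `^ (a - 1) in W1 W2 W3 p4 *.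
set v := (1 - x) `^ (a - 2) in W2 W3 p5 *.
have fi : `|(f x)^-1| <= c^-1 by rewrite gtr0_norm ?invr_gt0// lef_pV2 ?posrE.
have fg1 (A B A' B' : R) : `|A| <= A' -> `|B| <= B' -> `|A * B| <= A' * B'.
  by move=> hA hB; rewrite normrM ler_pM.
have fi2 : `|(f x)^-1 ^+ 2| <= c^-1 ^+ 2 by rewrite !expr2; exact: fg1.
have fi3 : `|(f x)^-1 ^+ 3| <= c^-1 ^+ 3 by rewrite (exprS _ 2) (exprS c^-1 2); exact: fg1.
have dinv1 : has_deriv (fun y => (f y)^-1) x (- f1 x * ((f x)^-1) ^+ 2).
  by apply: dval (dinv fn p1) _; rewrite exprVn.
split.
- exact: dinv1.
- apply: dmul; first exact: dopp.
  apply: dval (dexp 1 dinv1) _; congr (_ * _); by rewrite exprVn.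
- by rewrite /D; lra.
- have := fg1 _ _ _ _ p4 fi2; rewrite mulNr normrN => /le_trans; apply.
  rewrite (_ : C * u * _ = c^-1 ^+ 2 * C * u); last by ring.
  by rewrite ler_wpM2r// /D; lra.
- apply: le_trans (ler_normD _ _) _.
  have h1 := fg1 _ _ _ _ p5 fi2.
  have h2 := fg1 _ _ _ _ (fg1 _ _ _ _ p4 p4) fi3.
  rewrite mulNr normrN.
  have -> : - f1 x * (2%:R * (f x)^-1 ^+ 1 * (- f1 x / f x ^+ 2)) = 2 * (f1 x * f1 x * (f x)^-1 ^+ 3) by field.
  rewrite [`|2 * _|]normrM [`|2|]ger0_norm//.
  have h3 : C * u * (C * u) * c^-1 ^+ 3 <= c^-1 ^+ 3 * C ^+ 2 * v.
    rewrite (_ : C * u * (C * u) * c^-1 ^+ 3 = c^-1 ^+ 3 * C ^+ 2 * (u * u)); last by ring.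
    by rewrite ler_wpM2l// mulr_ge0 ?exprn_ge0// ltW.
  have v0 : 0 <= v by lra.
  rewrite /D !mulrDl.
  have h4 : 0 <= c^-1 * v by rewrite mulr_ge0// ltW.
  have h5 : C * v * c^-1 ^+ 2 = c^-1 ^+ 2 * C * v by ring.
  have h6 : 2 * c^-1 ^+ 3 * C ^+ 2 * v = 2 * (c^-1 ^+ 3 * C ^+ 2 * v) by ring.
  lra.
Qed.

(** Tame functions need not vanish at 1; the separate edge bound supplies the factor [(1 - x)^a]
    that [kern_kdec] asks for. *)
Lemma tame_kdec m (B C : R) : tame m -> lmeas m -> (forall x, `|m x| <= B) ->
  0 <= C -> (forall x, 0 <= x <= 1 -> `|m x| <= C * (1 - x) `^ a) ->
  exists K, kdec (2 `^ (- a)) K (kern m).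
Proof.
move=> [D [m1 [m2 [D0 h]]]] mm mB C0 mC.
apply: (@kern_kdec _ a (C + D) B m m1 m2) => //.
- by move=> x /h[].
- by move=> x /h[].
- by move=> x x01; apply: (le_trans (mC _ x01)); rewrite ler_wpM2r ?powR_ge0//; lra.
- by move=> x /h[_ _ _ q _]; apply: (le_trans q); rewrite ler_wpM2r ?powR_ge0//; lra.
- by move=> x /h[_ _ _ _ q]; apply: (le_trans q); rewrite ler_wpM2r ?powR_ge0//; lra.
Qed.

End Tame.

(** * The symbol rho and the quotient of 1 - rho by the square of the frequency *)

Section Symbols.
Context {R : realType}.
Variable alpha : R.
Hypothesis alpha0 : 0 < alpha.
Implicit Types x y t : R.

(** The cap [1/2] keeps [theta = 2^(-a)] in [1/2, 1) and [1 / (1 - a)] at most 2. For larger [alpha]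
    a weaker decay than the true one is recorded. *)
Definition aexp : R := Num.min alpha 2^-1.
Local Notation a := aexp.

Lemma aexp01 : 0 < a <= 2^-1.
Proof. by rewrite /aexp lt_min alpha0 invr_gt0 ltr0n/= ge_min lexx orbT. Qed.

Lemma aexp_le : a <= alpha.
Proof. by rewrite /aexp ge_min lexx. Qed.

Lemma ysq x : 0 < x < 1 -> [/\ 0 < 1 - x, 1 - x <= 1 - x ^+ 2, 0 < 1 - x ^+ 2 & 1 - x ^+ 2 <= 1].
Proof. by move=> /andP[x0 x1]; split; rewrite ?expr2; nra. Qed.

Lemma rhoE x : 0 <= x <= 1 -> rho alpha x = (1 - x ^+ 2) `^ alpha.
Proof.
move=> /andP[x0 x1]; rewrite /rho; congr (_ `^ _); apply/max_idPl.
by rewrite subr_ge0 exprn_ile1.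
Qed.

Lemma rho_out x : 1 <= `|x| -> rho alpha x = 0.
Proof.
move=> x1; rewrite /rho (max_idPr _) ?powR0 ?gt_eqF//.
by rewrite subr_le0 -real_normK ?num_real// exprn_ege1.
Qed.

Lemma rho_even x : rho alpha (- x) = rho alpha x.
Proof. by rewrite /rho sqrrN. Qed.

Lemma rho_itv x : 0 <= rho alpha x <= 1.
Proof.
rewrite /rho powR_ge0/=; apply: powR_le1; last exact: ltW.
by rewrite le_max lexx orbT/= ge_max ler01 andbT lerBlDr lerDl sqr_ge0.
Qed.

Lemma tame_rho : tame a (rho alpha).
Proof.
have /andP[a0 a12] := aexp01; have aa := aexp_le.
pose b x := (1 - x ^+ 2) `^ alpha.
pose b1 x := - (2 * x) * (alpha * (1 - x ^+ 2) `^ (alpha - 1)).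
pose b2 x := - 2 * (alpha * (1 - x ^+ 2) `^ (alpha - 1)) +
  - (2 * x) * (alpha * (- (2 * x) * ((alpha - 1) * (1 - x ^+ 2) `^ (alpha - 1 - 1)))).
apply: (@tame_eq _ _ b).
  by move=> x /andP[x0 x1]; rewrite rhoE// (ltW x0) (ltW x1).
pose C := 1 + 2 * alpha + 4 * alpha * `|alpha - 1|.
have n0 : 0 <= `|alpha - 1| by [].
exists C, b1, b2; split; first by rewrite /C; nra.
move=> x x01; have [y0 y1 y2 y3] := ysq x01; have /andP[x0 x1] := x01.
have dy : has_deriv (fun z => 1 - z ^+ 2) x (- (2 * x)).
  by apply: dval (dsub (dcst 1 x) (dexp 1 (did x))) _; rewrite expr1; ring.
have dx : has_deriv (fun z => - (2 * z)) x (- 2).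
  by apply: dval (dopp (dscale 2 (did x))) _; rewrite mulr1.
have P1 : `|(1 - x ^+ 2) `^ (alpha - 1)| <= (1 - x) `^ (a - 1).
  by rewrite ger0_norm ?powR_ge0//; apply: pow_neg_le; lra.
have P2 : `|(1 - x ^+ 2) `^ (alpha - 1 - 1)| <= (1 - x) `^ (a - 2).
  by rewrite ger0_norm ?powR_ge0//; apply: pow_neg_le; lra.
have W12 := w12 aexp01 x01; have W1 := w1_ge1 aexp01 x01.
set u := (1 - x) `^ (a - 1) in P1 W12 W1 *; set v := (1 - x) `^ (a - 2) in P2 W12 *.
have cx : `|- (2 * x)| <= 2 by rewrite normrN ger0_norm; lra.
have fg1 (A B A' B' : R) : `|A| <= A' -> `|B| <= B' -> `|A * B| <= A' * B'.
  by move=> hA hB; rewrite normrM ler_pM.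
have al : `|alpha| <= alpha by rewrite gtr0_norm.
split.
- exact: dpow.
- apply: dmul => //; apply: dscale; exact: dpow.
- rewrite ger0_norm ?powR_ge0//; apply: (@le_trans _ _ 1); last by rewrite /C; nra.
  by apply: powR_le1; [rewrite (ltW y2) y3|exact: ltW].
- have := fg1 _ _ _ _ cx (fg1 _ _ _ _ al P1) => /le_trans; apply.
  rewrite mulrA ler_wpM2r//; first lra.
  by rewrite /C; nra.
- apply: le_trans (ler_normD _ _) _.
  have n2 : `|- 2| <= 2 :> R by rewrite normrN ger0_norm.
  have h1 := fg1 _ _ _ _ n2 (fg1 _ _ _ _ al P1).
  have h2 := fg1 _ _ _ _ cx (fg1 _ _ _ _ al (fg1 _ _ _ _ cx (fg1 _ _ _ _ (lexx `|alpha - 1|) P2))).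
  apply: le_trans (lerD h1 h2) _; rewrite /C !mulrDl mul1r.
  have h3 : 2 * (alpha * u) <= 2 * alpha * v by rewrite -mulrA !ler_wpM2l// ltW.
  have h4 : 2 * (alpha * (2 * (`|alpha - 1| * v))) = 4 * alpha * `|alpha - 1| * v by ring.
  lra.
Qed.

(** [1 - rho] as a function of [t = xi^2]. *)
Definition Fpow t := 1 - (1 - t) `^ alpha.

(** From [(1 - t)^alpha <= exp (- alpha t) <= 1 / (1 + alpha t)] and [alpha t <= alpha]. *)
Lemma Fpow_lb t : 0 < t < 1 -> alpha / (1 + alpha) * t <= Fpow t.
Proof.
move=> /andP[t0 t1]; have e1 : 0 < 1 - t by lra.
have le1 : (1 - t) `^ alpha <= (1 + alpha * t)^-1.
  rewrite /powR gt_eqF// -[leRHS]opprK; rewrite opprK.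
  apply: (@le_trans _ _ (expR (- (alpha * t)))).
    rewrite ler_expR -mulrN ler_wpM2l ?(ltW alpha0)//.
    by apply: le_ln1Dx; lra.
  rewrite expRN lef_pV2 ?posrE ?expR_gt0 ?expR_ge1Dx//.
  by have : 0 < alpha * t by [rewrite mulr_gt0]; lra.
rewrite /Fpow; apply: (@le_trans _ _ (1 - (1 + alpha * t)^-1)); last by lra.
have p1 : 0 < 1 + alpha * t by have : 0 < alpha * t by [rewrite mulr_gt0]; lra.
have -> : 1 - (1 + alpha * t)^-1 = alpha * t / (1 + alpha * t) by field; rewrite gt_eqF.
rewrite mulrAC; apply: ler_wpM2l; first by rewrite mulr_ge0 ?(ltW alpha0) ?(ltW t0).
have p2 : 0 < 1 + alpha by rewrite addr_gt0.
have p3 : alpha * t <= alpha by rewrite ler_piMr ?(ltW alpha0) ?(ltW t1).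
by rewrite lef_pV2 ?posrE// lerD2l.
Qed.

Definition F1 t := alpha * (1 - t) `^ (alpha - 1).
Definition F2 t := - (alpha * (alpha - 1)) * (1 - t) `^ (alpha - 2).
Definition F3 t := alpha * (alpha - 1) * (alpha - 2) * (1 - t) `^ (alpha - 3).

Lemma dpow1m (r t : R) : t < 1 ->
  has_deriv (fun z => (1 - z) `^ r) t (- r * (1 - t) `^ (r - 1)).
Proof.
move=> t1; have h : 0 < 1 - t by lra.
apply: dval (@dpow R t (fun z => 1 - z) _ r h (dsub (dcst 1 t) (did t))) _.
by ring.
Qed.

Lemma dFpow t : t < 1 -> has_deriv Fpow t (F1 t).
Proof.
move=> t1; apply: dval (dsub (dcst 1 t) (dpow1m alpha t1)) _.
by rewrite /F1; ring.
Qed.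

Lemma dF1 t : t < 1 -> has_deriv F1 t (F2 t).
Proof.
move=> t1; apply: dval (dscale alpha (dpow1m (alpha - 1) t1)) _.
by rewrite /F2 (_ : alpha - 1 - 1 = alpha - 2); ring.
Qed.

Lemma dF2 t : t < 1 -> has_deriv F2 t (F3 t).
Proof.
move=> t1; apply: dval (dscale _ (dpow1m (alpha - 2) t1)) _.
by rewrite /F3 (_ : alpha - 2 - 1 = alpha - 3); ring.
Qed.

(** Numerators: the first two derivatives of [Fpow t / t] are [N1 t / t^2] and [N2 t / t^3]. *)
Definition N1 t := t * F1 t - Fpow t.
Definition N2 t := t ^+ 2 * F2 t - 2 * (t * F1 t) + 2 * Fpow t.

Lemma pow_bd (r : R) : exists2 K : R, 0 <= K &
  forall t, 0 <= t <= 2^-1 -> `|(1 - t) `^ r| <= K.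
Proof.
exists (1 + (2^-1) `^ r); first by rewrite addr_ge0// powR_ge0.
move=> t /andP[t0 t1]; rewrite ger0_norm ?powR_ge0//.
have p0 : 0 <= (2^-1 : R) `^ r by exact: powR_ge0.
have [r0|r0] := leP 0 r.
  have : (1 - t) `^ r <= 1 by apply: powR_le1 => //; apply/andP; split; lra.
  lra.
have : (1 - t) `^ r <= (2^-1) `^ r by apply: pow_neg_le; lra.
lra.
Qed.

(** Both functions vanish at 0, and their derivatives [t * F2 t] and [t^2 * F3 t] carry the powers
    of [t] that cancel the denominators. *)
Lemma N_small : exists2 K : R, 0 <= K & forall t, 0 < t <= 2^-1 ->
  `|N1 t| <= K * t ^+ 2 /\ `|N2 t| <= K * t ^+ 3.
Proof.
have [K2 K20 h2] := pow_bd (alpha - 2); have [K3 K30 h3] := pow_bd (alpha - 3).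
pose c2 := `|alpha * (alpha - 1)| * K2; pose c3 := `|alpha * (alpha - 1) * (alpha - 2)| * K3.
have c20 : 0 <= c2 by rewrite mulr_ge0.
have c30 : 0 <= c3 by rewrite mulr_ge0.
have b2 t : 0 <= t <= 2^-1 -> `|F2 t| <= c2.
  by move=> h; rewrite /F2 normrM normrN ler_wpM2l// h2.
have b3 t : 0 <= t <= 2^-1 -> `|F3 t| <= c3.
  by move=> h; rewrite /F3 normrM ler_wpM2l// h3.
have dN1 t : t < 1 -> has_deriv N1 t (t * F2 t).
  move=> t1; apply: dval (dsub (dmul (did t) (dF1 t1)) (dFpow t1)) _.
  by ring.
have dN2 t : t < 1 -> has_deriv N2 t (t ^+ 2 * F3 t).
  move=> t1; apply: dval (dadd (dsub (dmul (dexp 1 (did t)) (dF2 t1))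
    (dscale 2 (dmul (did t) (dF1 t1)))) (dscale 2 (dFpow t1))) _.
  by rewrite expr1; ring.
have F00 : Fpow 0 = 0 by rewrite /Fpow subr0 powR1 subrr.
exists (c2 + c3); first exact: addr_ge0.
move=> t /andP[t0 t12]; have t0' := ltW t0.
have sub y : 0 <= y <= t -> y < 1 /\ 0 <= y <= 2^-1.
  by move=> /andP[? ?]; split; [lra|apply/andP; split; lra].
split.
- apply: (@le_trans _ _ (c2 * t ^+ 2 - c2 * 0 ^+ 2)); last first.
    rewrite expr0n/= mulr0 subr0 ler_wpM2r ?exprn_ge0// lerDl//.
  have -> : N1 t = N1 t - N1 0 by rewrite [N1 0]/N1 F00 mul0r subr0 subr0.
  apply: (@mvt_le _ N1 (fun y => y * F2 y) (fun y => c2 * y ^+ 2) (fun y => c2 * (2%:R * y ^+ 1 * 1)) _ _ t0').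
  + by move=> y /sub[y1 _]; exact: dN1.
  + by move=> y _; apply: dscale; exact: dexp (did y).
  + move=> y /[dup] /andP[y0 _] /sub[_ y12]; rewrite normrM (ger0_norm y0) expr1 mulr1 mulrCA.
    rewrite mulrC mulrA; apply: (@le_trans _ _ (c2 * y)); first by rewrite ler_wpM2r// b2.
    by rewrite -mulrA [leRHS]mulrCA; have := mulr_ge0 c20 y0; lra.
- apply: (@le_trans _ _ (c3 * t ^+ 3 - c3 * 0 ^+ 3)); last first.
    by rewrite expr0n/= mulr0 subr0 ler_wpM2r ?exprn_ge0// lerDr.
  have -> : N2 t = N2 t - N2 0 by rewrite [N2 0]/N2 F00 expr0n/= !mul0r !mulr0 !subr0 addr0 subr0.
  apply: (@mvt_le _ N2 (fun y => y ^+ 2 * F3 y) (fun y => c3 * y ^+ 3) (fun y => c3 * (3%:R * y ^+ 2 * 1)) _ _ t0').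
  + by move=> y /sub[y1 _]; exact: dN2.
  + by move=> y _; apply: dscale; exact: dexp (did y).
  + move=> y /sub[_ y12]; rewrite normrM ger0_norm ?exprn_ge0//; last by case/andP: y12.
    have y2 : 0 <= y ^+ 2 by exact: sqr_ge0.
    rewrite mulrC mulr1; apply: (@le_trans _ _ (c3 * y ^+ 2)); first by rewrite ler_wpM2r// b3.
    by rewrite mulrCA; have := mulr_ge0 c30 y2; lra.
Qed.

Definition qsym x := (1 - rho alpha x) / x ^+ 2.

Lemma qsym_lb x : 0 < x < 1 -> alpha / (1 + alpha) <= qsym x.
Proof.
move=> /andP[x0 x1]; rewrite /qsym rhoE ?(ltW x0) ?(ltW x1)// ler_pdivlMr ?exprn_gt0//.
by apply: Fpow_lb; rewrite exprn_gt0//= exprn_ilt1// ltW.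
Qed.

(** Near 0 the apparent poles are removed by [N_small]; for [t = x^2 > 1/2] the denominators are
    harmless and only the singularity of [Fpow] at 1 counts. *)
Lemma tame_qsym : tame a qsym.
Proof.
have [K K0 hK] := N_small; have /andP[a0 a12] := aexp01; have aa := aexp_le.
apply: (@tame_eq _ _ (fun x => Fpow (x ^+ 2) / x ^+ 2)).
  by move=> x /andP[x0 x1]; rewrite /qsym rhoE// (ltW x0) (ltW x1).
pose D := alpha + alpha * `|alpha - 1| + 1.
have [K1 K10 hK1] := pow_bd (alpha - 1).
have aK1 : 0 <= alpha * K1 by rewrite mulr_ge0// ltW.
(* The terms with [K] and [K1] serve [t <= 1/2]; the multiple of [D] serves [t > 1/2], where the
   powers of [1 / t] are at most 8. *)
pose C := 2 * K * 4 + 400 * D + 4 * K + 400 + alpha * K1.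
have n0 : 0 <= `|alpha - 1| by [].
have n1 : 0 <= alpha * `|alpha - 1| by rewrite mulr_ge0// ltW.
have D1 : 1 <= D by rewrite /D; lra.
pose q1 t := N1 t / t ^+ 2; pose q2 t := N2 t / t ^+ 3.
exists C, (fun x => 2 * x * q1 (x ^+ 2)), (fun x => 2 * q1 (x ^+ 2) + 2 * x * (2 * x * q2 (x ^+ 2))).
split; first by rewrite /C; lra.
move=> x x01; have [y0 y1 y2 y3] := ysq x01; have /andP[x0 x1] := x01.
set t := x ^+ 2.
have t0 : 0 < t by exact: exprn_gt0.
have t1 : t < 1 by rewrite /t; lra.
have tn : t != 0 by rewrite gt_eqF.
have dt : has_deriv (fun z => z ^+ 2) x (2 * x).
  by apply: dval (dexp 1 (did x)) _; rewrite expr1; ring.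
have d1 : has_deriv (fun s => Fpow s / s) t (q1 t).
  apply: dval (dmul (dFpow t1) (@dinv R t (fun y => y) 1 tn (did t))) _.
  by rewrite /q1 /N1; field.
have d2 : has_deriv q1 t (q2 t).
  have dN1 : has_deriv N1 t (t * F2 t).
    by apply: dval (dsub (dmul (did t) (dF1 t1)) (dFpow t1)) _; ring.
  have t2n : t ^+ 2 != 0 by rewrite expf_neq0.
  apply: dval (dmul dN1 (@dinv R t (fun y => y ^+ 2) _ t2n (dexp 1 (did t)))) _.
  by rewrite /q2 /N1 /N2 expr1; field.
have W12 := w12 aexp01 x01; have W1 := w1_ge1 aexp01 x01.
have yt : 1 - x <= 1 - t by [].
have PF1 : `|F1 t| <= alpha * (1 - x) `^ (a - 1).
  rewrite /F1 normrM (gtr0_norm alpha0) ler_wpM2l ?(ltW alpha0)//.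
  by rewrite (ger0_norm (powR_ge0 _ _)); apply: pow_neg_le; clear -x1 yt t0 aa a12; lra.
have PF2 : `|F2 t| <= alpha * `|alpha - 1| * (1 - x) `^ (a - 2).
  rewrite /F2 normrM normrN normrM (gtr0_norm alpha0) ler_wpM2l ?mulr_ge0 ?(ltW alpha0)//.
  by rewrite (ger0_norm (powR_ge0 _ _)); apply: pow_neg_le; clear -x1 yt t0 aa a12; lra.
have PF : `|Fpow t| <= 1.
  rewrite /Fpow; have p0 := powR_ge0 (1 - t) alpha.
  have : (1 - t) `^ alpha <= 1 by apply: powR_le1; [apply/andP; split; clear -t0 t1; lra|exact: ltW].
  by clear -p0; rewrite ler_norml => ?; apply/andP; split; lra.
set u := (1 - x) `^ (a - 1) in PF1 W12 W1 *; set v := (1 - x) `^ (a - 2) in PF2 W12 *.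
have u0 : 0 <= u := le_trans ler01 W1.
have v0 : 0 <= v := le_trans u0 W12.
have V1 : 1 <= v := le_trans W1 W12.
have C0 : 0 <= C by rewrite /C; clear -K0 aK1 D1; lra.
have CK4 : K <= C / 4 by rewrite /C; clear -K0 aK1 D1; lra.
have CK8 : K <= C / 8 by rewrite /C; clear -K0 aK1 D1; lra.
have tt : `|t| <= 1 by rewrite (gtr0_norm t0) ltW.
have fg1 (A B A' B' : R) : `|A| <= A' -> `|B| <= B' -> `|A * B| <= A' * B'.
  by move=> hA hB; rewrite normrM ler_pM.
have t2 : `|t ^+ 2| <= 1 by rewrite expr2 -[leRHS]mulr1; exact: fg1.
have B1 : `|N1 t| <= D * u.
  apply: le_trans (ler_normB _ _) _.
  have := fg1 _ _ _ _ tt PF1; rewrite mul1r => h.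
  have := mulr_ge0 n1 u0.
  by rewrite /D !mulrDl mul1r; clear -h PF W1; lra.
have B2 : `|N2 t| <= 2 * D * v.
  apply: le_trans (ler_normD _ _) _; apply: le_trans (lerD (ler_normB _ _) (lexx _)) _.
  have h1 := fg1 _ _ _ _ t2 PF2; have h2 := fg1 _ _ _ _ tt PF1.
  rewrite [`|2 * (t * _)|]normrM [`|2 * Fpow _|]normrM [`|2|]ger0_norm//.
  have h3 : alpha * u <= alpha * v by rewrite ler_wpM2l// ltW.
  have := mulr_ge0 n1 v0.
  by rewrite /D -mulrA !mulrDl mul1r; clear -h1 h2 h3 PF V1; lra.
have bq : `|q1 t| <= C / 4 * u /\ `|q2 t| <= C / 8 * v.
  have i1 : `|t^-1 ^+ 2| = t^-1 ^+ 2 by rewrite ger0_norm// exprn_ge0// invr_ge0 ltW.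
  have i2 : `|t^-1 ^+ 3| = t^-1 ^+ 3 by rewrite ger0_norm// exprn_ge0// invr_ge0 ltW.
  have [th|th] := leP t 2^-1.
    have [h1 h2] : `|N1 t| <= K * t ^+ 2 /\ `|N2 t| <= K * t ^+ 3 by apply: hK; rewrite t0.
    have e1 : `|q1 t| <= K.
      by rewrite /q1 normrM -exprVn i1 exprVn ler_pdivrMr// exprn_gt0.
    have e2 : `|q2 t| <= K.
      by rewrite /q2 normrM -exprVn i2 exprVn ler_pdivrMr// exprn_gt0.
    split.
      by apply: (le_trans e1); rewrite -[leLHS]mulr1; exact: (ler_pM K0 ler01 CK4 W1).
    by apply: (le_trans e2); rewrite -[leLHS]mulr1; exact: (ler_pM K0 ler01 CK8 V1).
  have ti : `|t^-1| <= 2.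
    by rewrite gtr0_norm ?invr_gt0// -[leRHS]invrK lef_pV2 ?posrE ?invr_gt0// ltW.
  have ti2 : `|t^-1 ^+ 2| <= 2 * 2 by rewrite expr2; exact: fg1.
  have ti3 : `|t^-1 ^+ 3| <= 2 * (2 * 2) by rewrite exprS; exact: fg1.
  have h1 := fg1 _ _ _ _ B1 ti2; have h2 := fg1 _ _ _ _ B2 ti3.
  have D0 : 0 <= D by exact: le_trans ler01 D1.
  have Du : 0 <= D * u by exact: mulr_ge0.
  have Dv : 0 <= D * v by exact: mulr_ge0.
  have Ku : 0 <= K * u by exact: mulr_ge0.
  have Kv : 0 <= K * v by exact: mulr_ge0.
  split.
    by rewrite /q1 -exprVn; apply: (le_trans h1); rewrite /C; clear -Du Ku K0 D1 u0 aK1 W1; nra.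
  by rewrite /q2 -exprVn; apply: (le_trans h2); rewrite /C; clear -Dv Kv K0 D1 v0 aK1 W1 W12; nra.
case: bq => bq1 bq2.
have xx : `|2 * x| <= 2 by rewrite ger0_norm; clear -x0 x1; lra.
split.
- exact: (@dcomp R x (fun z => z ^+ 2) (fun s => Fpow s / s) _ _ d1 dt).
- apply: dval (dmul (dscale 2 (did x)) (@dcomp R x (fun z => z ^+ 2) q1 _ _ d2 dt)) _.
  by rewrite mulr1.
- have [th|th] := leP t 2^-1.
    have [h1 _] : `|N1 t| <= K * t ^+ 2 /\ `|N2 t| <= K * t ^+ 3 by apply: hK; rewrite t0.
    have -> : Fpow t / t = F1 t - N1 t / t by rewrite /N1; field.
    apply: le_trans (ler_normB _ _) _.
    have e1 : `|F1 t| <= alpha * K1.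
      rewrite /F1 normrM (gtr0_norm alpha0) ler_wpM2l ?(ltW alpha0)// hK1//.
      by rewrite (ltW t0).
    have e2 : `|N1 t / t| <= K.
      rewrite normrM normfV (gtr0_norm t0) ler_pdivrMr// (le_trans h1)// ler_wpM2l//.
      by rewrite expr2 ler_piMr// ltW.
    by clear -e1 e2 K0 aK1 D1; rewrite /C; lra.
  have ti : `|t^-1| <= 2.
    by rewrite gtr0_norm ?invr_gt0// -[leRHS]invrK lef_pV2 ?posrE ?invr_gt0// ltW.
  by have := fg1 _ _ _ _ PF ti => /le_trans; apply; clear -K0 aK1 D1; rewrite /C; lra.
- have := fg1 _ _ _ _ xx bq1 => /le_trans; apply.
  have Cu := mulr_ge0 C0 u0; clear -Cu; lra.
- apply: le_trans (ler_normD _ _) _; rewrite [`|2 * q1 _|]normrM [`|2|]ger0_norm//.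
  have h1 := fg1 _ _ _ _ xx (fg1 _ _ _ _ xx bq2).
  have h2 : C * u <= C * v := ler_wpM2l C0 W12.
  clear -h1 h2 bq1; lra.
Qed.

Lemma bmeas_rho : measurable_fun [set: R] (rho alpha).
Proof.
have mg : measurable_fun [set: R] (fun x : R => Num.max (1 - x ^+ 2) 0).
  apply: measurable_maxr; last exact: measurable_cst.
  apply: continuous_measurable_fun; apply: (@isd_cont R _ (fun y => - (2 * y))) => y.
  by apply: dval (dsub (dcst 1 y) (dexp 1 (did y))) _; rewrite expr1; ring.
exact: (measurableT_comp (@measurable_powR R alpha) mg).
Qed.

Lemma lmeas_rho : lmeas (rho alpha).
Proof. by apply: borel_lebesgue; exact: bmeas_rho. Qed.

Lemma rho_norm x : `|rho alpha x| <= 1.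
Proof. by have /andP[h0 h1] := rho_itv x; rewrite ger0_norm. Qed.

Lemma le_wa (c : R) x : 0 <= x <= 1 -> 0 <= c <= 2 * (1 - x) -> c `^ alpha <= 1 -> c <= 1 ->
  c `^ a <= 2 * (1 - x) `^ a.
Proof.
move=> /andP[x0 x1] /andP[c0 c2] ca c1; have /andP[a0 a12] := aexp01.
apply: (@le_trans _ _ ((2 * (1 - x)) `^ a)).
  by apply: ge0_ler_powR; rewrite ?nnegrE ?(ltW a0)//; lra.
rewrite powRM//; last by lra.
rewrite ler_wpM2r ?powR_ge0//; apply: (@le_trans _ _ (2 `^ 1)); last by rewrite powRr1.
by apply: ler_powR; lra.
Qed.

Lemma rho_edge x : 0 <= x <= 1 -> `|rho alpha x| <= 2 * (1 - x) `^ a.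
Proof.
move=> x01; have /andP[x0 x1] := x01; have /andP[a0 a12] := aexp01.
have y0 : 0 <= 1 - x ^+ 2 by rewrite subr_ge0 exprn_ile1.
have y1 : 1 - x ^+ 2 <= 1 by rewrite lerBlDr lerDl sqr_ge0.
rewrite ger0_norm; last by case/andP: (rho_itv x).
rewrite rhoE//; apply: (@le_trans _ _ ((1 - x ^+ 2) `^ a)).
  have [e|e] := eqVneq (1 - x ^+ 2) 0.
    by rewrite e powR0 ?gt_eqF// powR_ge0.
  by apply: ger_powR; rewrite ?aexp_le// y1 andbT lt_neqAle eq_sym e.
apply: le_wa => //; last by apply: powR_le1; [rewrite y0|exact: ltW].
by rewrite y0/= expr2; nra.
Qed.

Lemma kdec_rho : exists K, kdec (2 `^ (- a)) K (kern (rho alpha)).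
Proof.
apply: (tame_kdec aexp01 tame_rho lmeas_rho rho_norm (C := 2)) => //.
exact: rho_edge.
Qed.

End Symbols.

(** * The symbol phi and the smooth cutoff *)

Section OtherSymbols.
Context {R : realType}.
Implicit Types x y t : R.

(** With the power 5 all derivatives below the fifth vanish at 1, so six integrations by parts
    produce nothing below the sixth order. *)
Definition jac x := Num.max (1 - x ^+ 2) 0 ^+ 5.

Lemma cont_parabola : continuous (fun x : R => 1 - x ^+ 2).
Proof.
apply: (@isd_cont R _ (fun y => - (2 * y))) => y.
by apply: dval (dsub (dcst 1 y) (dexp 1 (did y))) _; rewrite expr1; ring.
Qed.

Lemma cont_jac : continuous jac.
Proof.
move=> x; apply: (@continuous_comp _ _ _ (fun x => Num.max (1 - x ^+ 2) 0) (fun y => y ^+ 5)); last exact: exprn_continuous.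
by apply: (@continuous_max R R (fun x => 1 - x ^+ 2) (fun=> 0) x); [exact: cont_parabola|exact: cst_continuous].
Qed.

Lemma jacE x : 0 <= x <= 1 -> jac x = (1 - x ^+ 2) ^+ 5.
Proof.
move=> /andP[x0 x1]; rewrite /jac; congr (_ ^+ _); apply/max_idPl.
by rewrite subr_ge0 exprn_ile1.
Qed.

Lemma jac_itv x : 0 <= jac x <= 1.
Proof.
rewrite /jac exprn_ge0 ?le_max ?lexx ?orbT//= exprn_ile1// ?le_max ?lexx ?orbT//.
by rewrite ge_max ler01 andbT lerBlDr lerDl sqr_ge0.
Qed.

Lemma jac_norm x : `|jac x| <= 1.
Proof. by have /andP[h0 h1] := jac_itv x; rewrite ger0_norm. Qed.

Lemma jac_even x : jac (- x) = jac x.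
Proof. by rewrite /jac sqrrN. Qed.

Lemma jac_out x : 1 <= `|x| -> jac x = 0.
Proof.
move=> x1; rewrite /jac (max_idPr _) ?expr0n//.
by rewrite subr_le0 -real_normK ?num_real// exprn_ege1.
Qed.

Lemma jac0 : jac 0 = 1.
Proof. by rewrite jacE ?lexx ?ler01// expr0n subr0 expr1n. Qed.

Lemma cont_phi : continuous (@phi R).
Proof.
move=> x; apply: (@continuous_max R R (fun x => 1 - `|x|) (fun=> 0) x); last exact: cst_continuous.
by apply: (@continuousB R R R (fun=> 1) (fun x => `|x|)); [exact: cst_continuous|exact: norm_continuous].
Qed.

Lemma phiE x : 0 <= x <= 1 -> phi x = 1 - x.
Proof.
by move=> /andP[x0 x1]; rewrite /phi ger0_norm//; apply/max_idPl; rewrite subr_ge0.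
Qed.

Lemma phi_itv x : 0 <= phi x <= 1.
Proof. by rewrite /phi le_max lexx orbT/= ge_max ler01 andbT lerBlDr lerDl. Qed.

Lemma phi_norm x : `|phi x| <= 1.
Proof. by have /andP[h0 h1] := phi_itv x; rewrite ger0_norm. Qed.

Lemma phi_even x : phi (- x) = phi x.
Proof. by rewrite /phi normrN. Qed.

Lemma phi_out x : 1 <= `|x| -> phi x = 0.
Proof. by move=> x1; rewrite /phi (max_idPr _)// subr_le0. Qed.

(** * Sixth-order decay of the kernel of the cutoff *)

Section JacksonKernel.

(** The expansion of [(1 - x^2)^5], followed by its first six derivatives. *)
Definition jp x : R := 1 - 5 * x ^+ 2 + 10 * x ^+ 4 - 10 * x ^+ 6 + 5 * x ^+ 8 - x ^+ 10.
Definition jp1 x : R := - 10 * x + 40 * x ^+ 3 - 60 * x ^+ 5 + 40 * x ^+ 7 - 10 * x ^+ 9.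
Definition jp2 x : R := - 10 + 120 * x ^+ 2 - 300 * x ^+ 4 + 280 * x ^+ 6 - 90 * x ^+ 8.
Definition jp3 x : R := 240 * (x - 5 * x ^+ 3 + 7 * x ^+ 5 - 3 * x ^+ 7).
Definition jp4 x : R := 240 * (1 - 15 * x ^+ 2 + 35 * x ^+ 4 - 21 * x ^+ 6).
Definition jp5 x : R := 240 * (- 30 * x + 140 * x ^+ 3 - 126 * x ^+ 5).
Definition jp6 x : R := 240 * (- 30 + 420 * x ^+ 2 - 630 * x ^+ 4).

Lemma djp x : has_deriv jp x (jp1 x).
Proof.
apply: dval (dsub (dadd (dsub (dadd (dsub (dcst 1 x) (dscale 5 (dexp 1 (did x))))
 (dscale 10 (dexp 3 (did x)))) (dscale 10 (dexp 5 (did x)))) (dscale 5 (dexp 7 (did x))))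
 (dexp 9 (did x))) _; rewrite /jp1; ring.
Qed.

Lemma djp1 x : has_deriv jp1 x (jp2 x).
Proof.
apply: dval (dsub (dadd (dsub (dadd (dscale (- 10) (did x)) (dscale 40 (dexp 2 (did x))))
 (dscale 60 (dexp 4 (did x)))) (dscale 40 (dexp 6 (did x)))) (dscale 10 (dexp 8 (did x)))) _.
rewrite /jp2; ring.
Qed.

Lemma djp2 x : has_deriv jp2 x (jp3 x).
Proof.
apply: dval (dsub (dadd (dsub (dadd (dcst (- 10) x) (dscale 120 (dexp 1 (did x))))
 (dscale 300 (dexp 3 (did x)))) (dscale 280 (dexp 5 (did x)))) (dscale 90 (dexp 7 (did x)))) _.
rewrite /jp3; ring.
Qed.

Lemma djp3 x : has_deriv jp3 x (jp4 x).
Proof.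
apply: dval (dscale 240 (dsub (dadd (dsub (did x) (dscale 5 (dexp 2 (did x))))
 (dscale 7 (dexp 4 (did x)))) (dscale 3 (dexp 6 (did x))))) _.
rewrite /jp4; ring.
Qed.

Lemma djp4 x : has_deriv jp4 x (jp5 x).
Proof.
apply: dval (dscale 240 (dsub (dadd (dsub (dcst 1 x) (dscale 15 (dexp 1 (did x))))
 (dscale 35 (dexp 3 (did x)))) (dscale 21 (dexp 5 (did x))))) _.
rewrite /jp5; ring.
Qed.

Lemma djp5 x : has_deriv jp5 x (jp6 x).
Proof.
apply: dval (dscale 240 (dsub (dadd (dscale (- 30) (did x)) (dscale 140 (dexp 2 (did x))))
 (dscale 126 (dexp 4 (did x))))) _.
rewrite /jp6; ring.
Qed.

Lemma jpE x : jp x = (1 - x ^+ 2) ^+ 5.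
Proof. rewrite /jp; ring. Qed.

Lemma jp_bound x : 0 <= x <= 1 ->
  [/\ `|jp1 x| <= 160, `|jp2 x| <= 800 & `|jp6 x| <= 240 * 1080].
Proof.
move=> /andP[x0 x1].
have p k : 0 <= x ^+ k <= 1 by rewrite exprn_ge0//= exprn_ile1.
have /andP[? ?] := p 2; have /andP[? ?] := p 3; have /andP[? ?] := p 4.
have /andP[? ?] := p 5; have /andP[? ?] := p 6; have /andP[? ?] := p 7.
have /andP[? ?] := p 8; have /andP[? ?] := p 9.
rewrite /jp1 /jp2 /jp6 !ler_norml.
by split; apply/andP; split; lra.
Qed.

(** The boundary terms of six integrations by parts are collected in [P]. At 0 the sine and the odd
    derivatives vanish. At 1 only [jp5 1 = - 240 * 16] survives, and [240 * 1080] bounds the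
    remainder [jp6]; together they give 1096. *)
Lemma cosint_jac_decay d : 0 < d -> `|cosint jac d^-1| <= (240 * 1096) * d ^+ 6.
Proof.
move=> d0; set x := d^-1.
have ftc : continuous (fun xi => jp xi * cos (x * xi)).
  by move=> xi; apply: continuousM; [exact: dcont (djp xi)|exact: cos_cont].
have [G dG] := ex_prim ftc.
have -> : cosint jac x = G 1 - G 0.
  rewrite -(itg_FTC ler01 dG ftc); apply: eq_itg => xi h.
  by rewrite jacE// jpE.
pose P xi := sin (x * xi) * (jp xi * d - jp2 xi * d ^+ 3 + jp4 xi * d ^+ 5) +
             cos (x * xi) * (jp1 xi * d ^+ 2 - jp3 xi * d ^+ 4 + jp5 xi * d ^+ 6).
have dx xi : has_deriv (fun y => x * y) xi x by apply: dval (dscale x (did xi)) _; rewrite mulr1.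
have dP xi : has_deriv P xi (jp xi * cos (x * xi) + jp6 xi * (cos (x * xi) * d ^+ 6)).
  apply: dval (dadd
    (dmul (dsin (dx xi)) (dadd (dsub (dmul (djp xi) (dcst d xi)) (dmul (djp2 xi) (dcst (d ^+ 3) xi))) (dmul (djp4 xi) (dcst (d ^+ 5) xi))))
    (dmul (dcos (dx xi)) (dadd (dsub (dmul (djp1 xi) (dcst (d ^+ 2) xi)) (dmul (djp3 xi) (dcst (d ^+ 4) xi))) (dmul (djp5 xi) (dcst (d ^+ 6) xi))))) _.
  by rewrite /x /=; field; rewrite gt_eqF.
have d60 : 0 <= d ^+ 6 by rewrite exprn_ge0// ltW.
have I : `|(P 1 - G 1) - (P 0 - G 0)| <= (240 * 1080) * d ^+ 6 * 1 - (240 * 1080) * d ^+ 6 * 0.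
  apply: (@mvt_le _ (fun xi => P xi - G xi) (fun xi => jp6 xi * (cos (x * xi) * d ^+ 6))
    (fun xi => (240 * 1080) * d ^+ 6 * xi) (fun xi => (240 * 1080) * d ^+ 6 * 1) _ _ ler01).
  - by move=> xi _; apply: dval (dsub (dP xi) (dG xi)) _; ring.
  - by move=> xi _; apply: dscale; exact: did.
  - move=> xi /jp_bound[_ _ h]; rewrite normrM [X in _ * X]normrM (ger0_norm d60) mulr1.
    apply: ler_pM => //; first by rewrite mulr_ge0.
    by rewrite ler_piMl// cos_le1.
have P0 : P 0 = 0 by rewrite /P mulr0 sin0 /jp1 /jp3 /jp5; ring.
have P1 : `|P 1| <= (240 * 16) * d ^+ 6.
  have -> : P 1 = cos (x * 1) * (- (240 * 16) * d ^+ 6) by rewrite /P /jp /jp2 /jp4 /jp1 /jp3 /jp5 !expr1n; ring.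
  rewrite normrM -[leRHS]mul1r; apply: ler_pM => //; first exact: cos_le1.
  rewrite mulNr normrN ger0_norm; first exact: lexx.
  by apply: mulr_ge0 d60; apply: mulr_ge0; exact: ler0n.
move: I P1; rewrite P0 !ler_norml => /andP[? ?] /andP[? ?]; apply/andP; split; lra.
Qed.

Lemma lmeas_jac : lmeas jac.
Proof. exact: continuous_lebesgue cont_jac. Qed.

Lemma jac_decay t : `|kern jac t| * (1 + `|t|) ^+ 6 <= 240 * 1096 * 2 ^+ 6.
Proof.
have pi1 : (0 <= (pi^-1 : R)) && ((pi^-1 : R) <= 1).
  rewrite invr_ge0 pi_ge0/= invf_le1 ?pi_gt0//; have := @pi_ge2 R; lra.
have /andP[pi0 pi1'] := pi1.
rewrite /kern normrM (ger0_norm pi0).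
have e : `|cosint jac t| = `|cosint jac `|t| |.
  by have [t0|t0] := leP 0 t; [rewrite (ger0_norm t0)|rewrite (ltr0_norm t0) cosintN].
have C0 : `|cosint jac t| * (1 + `|t|) ^+ 6 <= 240 * 1096 * 2 ^+ 6.
  have [t1|t1] := leP `|t| 1.
    have h := cosint_le t lmeas_jac jac_norm.
    apply: (@le_trans _ _ (1 * 2 ^+ 6)); last by lra.
    apply: ler_pM => //.
    by apply: lerXn2r; rewrite ?nnegrE ?addr_ge0//; lra.
  have t0 : 0 < `|t| by lra.
  have h := @cosint_jac_decay `|t|^-1; rewrite invr_gt0 invrK -e in h.
  apply: le_trans (ler_wpM2r _ (h t0)) _; first by rewrite exprn_ge0// addr_ge0.
  rewrite -(mulrA (240 * 1096)) -exprMn; apply: (@le_trans _ _ ((240 * 1096) * 2 ^+ 6)); last exact: lexx.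
  apply: ler_wpM2l; first by apply: mulr_ge0; exact: ler0n.
  apply: lerXn2r; rewrite ?nnegrE; [|exact: ler0n|by rewrite ler_pdivrMl//; lra].
  by rewrite mulr_ge0 ?invr_ge0 ?addr_ge0.
rewrite -(mulrA pi^-1); apply: le_trans C0; rewrite ler_piMl// mulr_ge0// exprn_ge0// addr_ge0//.
Qed.

End JacksonKernel.

(** * Decay of the remaining kernels *)

Section KernelDecays.
Variable alpha : R.
Hypothesis alpha0 : 0 < alpha.
Local Notation a := (aexp alpha).

Let a01 : 0 < a <= 2^-1. Proof. exact: aexp01. Qed.

Lemma tame_jac : tame a jac.
Proof.
apply: (tame_eq (f := jp)).
  by move=> x /andP[x0 x1]; rewrite jpE jacE// (ltW x0) (ltW x1).
apply: (tame_smooth a01 (b1 := jp1) (b2 := jp2) (C := 800)) => [x _|x _|x /andP[x0 x1]].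
- exact: djp.
- exact: djp1.
- have x01 : 0 <= x <= 1 by rewrite (ltW x0) (ltW x1).
  have [h1 h2 _] := jp_bound x01; split => //; last by apply: le_trans h1 _; lra.
  by rewrite jpE -jacE//; apply: le_trans (jac_norm x) _; lra.
Qed.

Lemma tame_lin (c k : R) : tame a (fun x => c + k * x).
Proof.
apply: (tame_smooth a01 (b1 := fun=> k) (b2 := fun=> 0) (C := `|c| + `|k|)) => // [x _|x _|x /andP[x0 x1]].
- by apply: dval (dadd (dcst c x) (dscale k (did x))) _; rewrite add0r mulr1.
- exact: dcst.
- split.
  + apply: le_trans (ler_normD _ _) _; rewrite lerD2l normrM ler_piMr//.
    by rewrite gtr0_norm// ltW.
  + by rewrite lerDr.
  + by rewrite normr0 addr_ge0.
Qed.

Lemma jac_edge x : 0 <= x <= 1 -> `|jac x| <= 2 * (1 - x) `^ a.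
Proof.
move=> x01; have /andP[x0 x1] := x01; have /andP[a0 a12] := a01.
rewrite ger0_norm; last by case/andP: (jac_itv x).
have y0 : 0 <= 1 - x ^+ 2 by rewrite subr_ge0 exprn_ile1.
have y1 : 1 - x ^+ 2 <= 1 by rewrite lerBlDr lerDl sqr_ge0.
rewrite jacE//; apply: (@le_trans _ _ (1 - x ^+ 2)).
  by rewrite -[leRHS]expr1; apply: ler_wiXn2l.
apply: (@le_trans _ _ (2 * (1 - x))); first by rewrite expr2; nra.
rewrite ler_wpM2l//; have [->|x1'] := eqVneq x 1.
  by rewrite subrr powR_ge0.
have h : 0 < 1 - x by rewrite subr_gt0 lt_neqAle x1'.
rewrite -[leLHS]powRr1; last exact: ltW.
by apply: ger_powR; [rewrite h/=; lra|lra].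
Qed.

Lemma bmeas_inv : measurable_fun [set: R] (fun x : R => x^-1).
Proof.
rewrite -(setvU [set 0 : R]); apply/measurable_funU => //; first exact: measurableC.
split; last exact: measurable_fun_set1.
apply: open_continuous_measurable_fun; first by rewrite openC; apply: accessible_closed_set1; apply: hausdorff_accessible; exact: norm_hausdorff.
by move=> x; rewrite inE => /eqP x0; exact: inv_continuous.
Qed.

(* [gsym] governs the lower estimate for [rho]; [msym] and [zsym] govern the upper estimates for
   [rho] and [phi]. *)
Definition gsym x := x ^+ 2 * rho alpha x / (1 - rho alpha x).
Definition msym x := jac x * (1 - rho alpha x) / x ^+ 2.
Definition zsym x := jac x * `|x|.

Lemma rho_lt1 x : x != 0 -> rho alpha x < 1.
Proof.
move=> x0; have [x1|x1] := leP 1 `|x|; first by rewrite (rho_out alpha0 x1).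
have e : rho alpha x = rho alpha `|x|.
  by have [h|h] := leP 0 x; [rewrite ger0_norm|rewrite ltr0_norm// rho_even].
have p : 0 < `|x| < 1 by rewrite normr_gt0 x0.
have := qsym_lb alpha0 p; rewrite /qsym -e => h.
have c0 : 0 < alpha / (1 + alpha) by rewrite divr_gt0// addr_gt0.
have : 0 < (1 - rho alpha x) / `|x| ^+ 2 by exact: lt_le_trans h.
by rewrite pmulr_lgt0 ?invr_gt0 ?exprn_gt0 ?normr_gt0// subr_gt0.
Qed.

(** At 0 the quotient has the default value 0 and both sides vanish; elsewhere [rho < 1] permits the
    division. *)
Lemma gsymE x : (1 - rho alpha x) * gsym x = x ^+ 2 * rho alpha x.
Proof.
rewrite /gsym; have [->|x0] := eqVneq x 0; first by rewrite expr0n/= !mul0r mulr0.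
by have := rho_lt1 x0 => h; rewrite mulrC divfK// subr_eq0 eq_sym lt_eqF.
Qed.

(** At 0 the default value 0 of [msym] stands in place of the limit [alpha]; the factor [x^2] hides
    the difference. *)
Lemma msymE x : x ^+ 2 * msym x = jac x * (1 - rho alpha x).
Proof.
rewrite /msym; have [->|x0] := eqVneq x 0; last by rewrite mulrC divfK// expf_neq0.
rewrite expr0n/= !mul0r; have -> : rho alpha 0 = 1.
  by rewrite rhoE ?lexx ?ler01// expr0n subr0 powR1.
by rewrite subrr mulr0.
Qed.

Lemma qsym_ub : exists2 C : R, 0 <= C & forall x, 0 < `|x| < 1 -> `|(1 - rho alpha x) / x ^+ 2| <= C.
Proof.
have [C [b1 [b2 [C0 h]]]] := tame_qsym alpha0.
exists C => // x /h[_ _ h3 _ _]; rewrite /qsym in h3.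
have e : rho alpha x = rho alpha `|x|.
  by have [h'|h'] := leP 0 x; [rewrite ger0_norm|rewrite ltr0_norm// rho_even].
by rewrite e -(real_normK (num_real x)).
Qed.

(** Away from 0 the symbol is [rho / qsym], and [qsym_lb] bounds the denominator from below. *)
Lemma gsym_le x : `|gsym x| <= (1 + alpha) / alpha * rho alpha x.
Proof.
have r0 : 0 <= rho alpha x by case/andP: (rho_itv alpha0 x).
have c0 : 0 < (1 + alpha) / alpha by rewrite divr_gt0// addr_gt0.
have [->|x0] := eqVneq x 0.
  by rewrite /gsym expr0n/= !mul0r normr0 mulr_ge0 ?(ltW c0)//; case/andP: (rho_itv alpha0 0).
have [x1|x1] := leP 1 `|x|.
  by rewrite /gsym (rho_out alpha0 x1) mulr0 mul0r normr0 mulr0.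
have e : rho alpha x = rho alpha `|x|.
  by have [h|h] := leP 0 x; [rewrite ger0_norm|rewrite ltr0_norm// rho_even].
have p : 0 < `|x| < 1 by rewrite normr_gt0 x0.
have := qsym_lb alpha0 p; rewrite /qsym -e real_normK ?num_real// => h.
have n0 : 0 < 1 - rho alpha x by rewrite subr_gt0 rho_lt1.
have x20 : 0 < x ^+ 2 by rewrite exprn_even_gt0.
rewrite /gsym mulrAC ger0_norm; last by rewrite mulr_ge0// divr_ge0 ?(ltW n0) ?(ltW x20).
rewrite ler_wpM2r// -[leLHS]invrK -[leRHS]invrK lef_pV2 ?posrE ?invr_gt0 ?divr_gt0 ?n0 ?addr_gt0//.
by rewrite !invf_div.
Qed.

Lemma gsym_norm x : `|gsym x| <= (1 + alpha) / alpha.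
Proof.
apply: le_trans (gsym_le x) _; rewrite ler_piMr ?divr_ge0 ?addr_ge0 ?(ltW alpha0)//.
by case/andP: (rho_itv alpha0 x).
Qed.

Lemma bmeas_gsym : measurable_fun [set: R] gsym.
Proof.
have mr := bmeas_rho alpha.
have ms : measurable_fun [set: R] (fun x : R => x ^+ 2) by exact: (continuous_measurable_fun (@exprn_continuous R 2)).
apply: measurable_funM; first exact: measurable_funM.
have mi : measurable_fun [set: R] (fun x : R => x^-1) by exact: bmeas_inv.
by apply: (measurableT_comp mi); apply: measurable_funB.
Qed.

Lemma bmeas_msym : measurable_fun [set: R] msym.
Proof.
have mr := bmeas_rho alpha.
have ms : measurable_fun [set: R] (fun x : R => x ^+ 2) by exact: (continuous_measurable_fun (@exprn_continuous R 2)).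
have mj : measurable_fun [set: R] jac by exact: continuous_measurable_fun cont_jac.
have mi : measurable_fun [set: R] (fun x : R => x^-1) by exact: bmeas_inv.
apply: measurable_funM.
  by apply: measurable_funM => //; apply: measurable_funB.
exact: (measurableT_comp mi ms).
Qed.

(** Inside (0, 1) the symbol is [rho / qsym], tame by closure under products and inverses; its
    vanishing at the edge is inherited from [rho]. *)
Lemma kdec_gsym : exists K, kdec (2 `^ (- a)) K (kern gsym).
Proof.
have c0 : 0 < alpha / (1 + alpha) by rewrite divr_gt0// addr_gt0.
apply: (tame_kdec a01 _ (borel_lebesgue bmeas_gsym) gsym_norm (C := 2 * ((1 + alpha) / alpha))).
- apply: (tame_eq (f := fun x => rho alpha x * (qsym alpha x)^-1)).
    move=> x /andP[x0 x1]; have n0 : rho alpha x < 1 by rewrite rho_lt1// gt_eqF.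
    by rewrite /qsym /gsym invf_div; ring.
  apply: tameM => //; first exact: tame_rho.
  apply: (tameV a01 c0) => [x|]; [exact: qsym_lb|exact: tame_qsym].
- by rewrite mulr_ge0// divr_ge0 ?addr_ge0 ?(ltW alpha0).
- move=> x x01; apply: le_trans (gsym_le x) _.
  have r0 : 0 <= rho alpha x by case/andP: (rho_itv alpha0 x).
  have := rho_edge alpha0 x01; rewrite ger0_norm// => h.
  rewrite (_ : _ * _ * (1 - x) `^ a = (1 + alpha) / alpha * (2 * (1 - x) `^ a)); last by ring.
  by rewrite ler_wpM2l// divr_ge0 ?addr_ge0 ?(ltW alpha0).
Qed.

Lemma msym_bd : exists2 C : R, 0 <= C & forall x, `|msym x| <= C * jac x.
Proof.
have [C C0 h] := qsym_ub; exists C => // x.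
have j0 : 0 <= jac x by case/andP: (jac_itv x).
have [->|x0] := eqVneq x 0.
  by rewrite /msym expr0n/= invr0 mulr0 normr0 mulr_ge0//; case/andP: (jac_itv 0).
have [x1|x1] := leP 1 `|x|.
  by rewrite /msym (jac_out x1) !mul0r normr0 mulr0.
have p : 0 < `|x| < 1 by rewrite normr_gt0 x0.
by rewrite /msym -mulrA normrM mulrC (ger0_norm j0) ler_wpM2r// h.
Qed.

Lemma kdec_msym : exists K, kdec (2 `^ (- a)) K (kern msym).
Proof.
have [C C0 h] := msym_bd.
apply: (tame_kdec a01 _ (borel_lebesgue bmeas_msym) (B := C) _ (C := C * 2)).
- apply: (tame_eq (f := fun x => jac x * qsym alpha x)).
    by move=> x _; rewrite /qsym /msym mulrA.
  by apply: tameM => //; [exact: tame_jac|exact: tame_qsym].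
- move=> x; apply: le_trans (h x) _; rewrite ler_piMr//.
  by case/andP: (jac_itv x).
- by rewrite mulr_ge0.
- move=> x x01; apply: le_trans (h x) _; rewrite -mulrA ler_wpM2l//.
  by have := jac_edge x01; rewrite ger0_norm//; case/andP: (jac_itv x).
Qed.

Lemma lmeas_phi : lmeas (@phi R).
Proof. exact: continuous_lebesgue cont_phi. Qed.

Lemma lin_edge x : 0 <= x <= 1 -> 1 - x <= (1 - x) `^ a.
Proof.
move=> /andP[x0 x1]; have /andP[a0 a12] := a01.
have [->|x1'] := eqVneq x 1; first by rewrite subrr powR_ge0.
have h : 0 < 1 - x by rewrite subr_gt0 lt_neqAle x1'.
rewrite -[leLHS]powRr1; last exact: ltW.
by apply: ger_powR; [rewrite h/=; lra|lra].
Qed.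

Lemma kdec_phi : exists K, kdec (2 `^ (- a)) K (kern (@phi R)).
Proof.
apply: (tame_kdec a01 _ lmeas_phi phi_norm (C := 1)) => //.
- apply: (tame_eq (f := fun x => 1 + (- 1) * x)); last exact: tame_lin.
  by move=> x /andP[x0 x1]; rewrite phiE ?(ltW x0) ?(ltW x1)// mulN1r.
- move=> x x01; rewrite mul1r; apply: le_trans (lin_edge x01); rewrite phiE// ger0_norm//.
  by case/andP: x01; rewrite subr_ge0.
Qed.

Lemma cont_zsym : continuous zsym.
Proof. by move=> x; apply: continuousM; [exact: cont_jac|exact: norm_continuous]. Qed.

Lemma zsym_norm x : `|zsym x| <= 1.
Proof.
have /andP[j0 j1] := jac_itv x.
rewrite /zsym normrM normr_id (ger0_norm j0); have [x1|x1] := leP 1 `|x|.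
  by rewrite (jac_out x1) mul0r.
by apply: le_trans (ler_pM _ _ j1 (ltW x1)) _ => //; rewrite mulr1.
Qed.

Lemma kdec_zsym : exists K, kdec (2 `^ (- a)) K (kern zsym).
Proof.
apply: (tame_kdec a01 _ (continuous_lebesgue cont_zsym) zsym_norm (C := 2)) => //.
- apply: (tame_eq (f := fun x => jac x * (0 + 1 * x))).
    by move=> x /andP[x0 _]; rewrite /zsym gtr0_norm// add0r mul1r.
  by apply: tameM => //; [exact: tame_jac|exact: tame_lin].
- move=> x x01; have /andP[x0 x1] := x01.
  rewrite /zsym normrM normr_id (ger0_norm x0).
  by rewrite -[leRHS]mulr1; apply: ler_pM => //; exact: jac_edge.
Qed.

End KernelDecays.
End OtherSymbols.

(** * Absolutely convergent sums over the integers *)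

Section IntegerSums.
Context {R : realType}.
Implicit Types (F G : int -> R) (C e : R) (r : seq int).

Lemma cvg_epsP (u : nat -> R) (l : R) : (u n @[n --> \oo] --> l) <->
  forall e, 0 < e -> exists N, forall n, (N <= n)%N -> `|l - u n| <= e.
Proof.
split=> [/cvgrPdist_le h e e0|h].
  by have [N _ hN] := h e e0; exists N => n; exact: hN.
by apply/cvgrPdist_le => e e0; have [N hN] := h e e0; exists N.
Qed.

Lemma ex_inv_le (K e : R) : 0 < e -> exists N, forall n, (N <= n)%N -> K / n.+1%:R <= e.
Proof.
move=> e0; exists (Num.bound `|K / e|) => n hn.
rewrite ler_pdivrMr// -ler_pdivrMl// mulrC.
apply: le_trans (ler_norm _) _; apply: ltW; apply: lt_le_trans (archi_boundP (normr_ge0 _)) _.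
by rewrite ler_nat; apply: leq_trans (leqnSn n).
Qed.

Definition zpart F m n := \sum_(0 <= k < n) F (Posz k) + \sum_(0 <= k < m) F (Negz k).
Definition zlim F := limn (fun n => zpart F n n).
(** Absolute summability with its constant, stated on finite sets so that termwise comparison and
    restriction are immediate. *)
Definition zbdd F C := forall r, uniq r -> \sum_(k <- r) `|F k| <= C.

Definition zrange N m n : seq int :=
  [seq Posz k | k <- iota N (n - N)] ++ [seq Negz k | k <- iota N (m - N)].

Lemma zrange_uniq N m n : uniq (zrange N m n).
Proof.
rewrite cat_uniq !map_inj_uniq ?iota_uniq ?andbT//=; [|by move=> ? ? []|by move=> ? ? []].
by apply/hasPn => _ /mapP[k _ ->]; apply/negP => /mapP[].
Qed.

Lemma mem_zrange N m n k : k \in zrange N m n =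
  match k with Posz j => (N <= j < n)%N | Negz j => (N <= j < m)%N end.
Proof.
rewrite mem_cat; case: k => j.
  rewrite mem_map; last by move=> ? ? [].
  rewrite mem_iota [X in _ || X](_ : _ = false) ?orbF; last by apply/negP => /mapP[].
  by apply/idP/idP; lia.
rewrite [X in X || _](_ : _ = false) /=; last by apply/negP => /mapP[].
rewrite mem_map; last by move=> ? ? [].
by rewrite mem_iota; apply/idP/idP; lia.
Qed.

Lemma zpartE F m n : zpart F m n = \sum_(k <- zrange 0 m n) F k.
Proof. by rewrite big_cat !big_map !subn0 /zpart /index_iota !subn0. Qed.

Lemma zpart_sub F N m n : (N <= m)%N -> (N <= n)%N ->
  zpart F m n - zpart F N N = \sum_(k <- zrange N m n) F k.
Proof.
move=> hm hn; rewrite big_cat !big_map /zpart.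
rewrite (big_cat_nat (leq0n N) hn) (big_cat_nat (leq0n N) hm) /= /index_iota; ring.
Qed.

(** Some finite set comes within [e] of the supremum of all finite sums; a finite sum disjoint from
    it is at most [e]. *)
Lemma zbdd_tail F C e : zbdd F C -> 0 < e ->
  exists N, forall r, uniq r -> (forall k, k \in r -> k \notin zrange 0 N N) ->
    \sum_(k <- r) `|F k| <= e.
Proof.
move=> FC e0; pose E := [set x | exists2 r, uniq r & x = \sum_(k <- r) `|F k|].
have hE : has_sup E.
  split; first by exists 0; exists [::] => //; rewrite big_nil.
  by exists C => _ [r ur ->]; exact: FC.
have [_ [r0 ur0 ->] h] := sup_adherent e0 hE.
have [N hN] : exists N, forall k, k \in r0 -> k \in zrange 0 N N.
  elim: r0 {ur0 h} => [|k r0 [N hN]]; first by exists 0%N.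
  exists (maxn N `|k|.+1)%N => l; rewrite inE => /predU1P[->|/hN].
    by rewrite mem_zrange; case: k => j /=; lia.
  by rewrite !mem_zrange; case: l => j; lia.
exists N => r ur hr.
have : \sum_(k <- r ++ r0) `|F k| <= sup E.
  apply: ub_le_sup; first by case: hE.
  exists (r ++ r0) => //; rewrite cat_uniq ur ur0 andbT /=.
  apply/hasPn => k /hN kN; apply/negP => /hr; by rewrite kN.
rewrite big_cat /=; move: h; lra.
Qed.

Lemma zlimP F C e : zbdd F C -> 0 < e -> exists N, forall m n, (N <= m)%N -> (N <= n)%N ->
  `|zlim F - zpart F m n| <= e.
Proof.
move=> FC e0.
have tail e' : 0 < e' -> exists N, forall m n, (N <= m)%N -> (N <= n)%N ->
    `|zpart F m n - zpart F N N| <= e'.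
  move=> e'0; have [N hN] := zbdd_tail FC e'0; exists N => m n hm hn.
  rewrite zpart_sub//; apply: le_trans (ler_norm_sum _ _ _) _; apply: hN.
    exact: zrange_uniq.
  by move=> k; rewrite !mem_zrange; case: k => j; lia.
have cv : cvgn (fun n => zpart F n n).
  apply/cauchy_cvgP/cauchy_exP => e' e'0.
  have e2 : 0 < e' / 2 by rewrite divr_gt0.
  have [N hN] := tail _ e2; exists (zpart F N N); exists N => // n /= hn.
  rewrite /ball/= distrC; apply: le_lt_trans (hN n n hn hn) _; lra.
have e3 : 0 < e / 3 by rewrite divr_gt0.
have [N hN] := tail _ e3; exists N => m n hm hn.
have [M hM] := (cvg_epsP _ _).1 cv _ e3.
have h1 := hM (maxn M N) (leq_maxl _ _); have h2 := hN _ _ (leq_maxr M N) (leq_maxr M N).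
have h3 := hN m n hm hn; move: h1 h2 h3; rewrite -/(zlim F) !ler_norml.
move=> /andP[? ?] /andP[? ?] /andP[? ?]; apply/andP; split; lra.
Qed.

Lemma zlim_cvg F C : zbdd F C -> zpart F n n @[n --> \oo] --> zlim F.
Proof.
move=> FC; apply/cvg_epsP => e e0; have [N hN] := zlimP FC e0.
by exists N => n hn; exact: hN.
Qed.

(** The range [- n <= k <= n], in which the terms [k] and [- k] can be paired. *)
Lemma zlim_cvgS F C : zbdd F C -> zpart F n n.+1 @[n --> \oo] --> zlim F.
Proof.
move=> FC; apply/cvg_epsP => e e0; have [N hN] := zlimP FC e0.
by exists N => n hn; apply: hN => //; exact: leq_trans hn _.
Qed.

Lemma zpart_le F C m n : zbdd F C -> `|zpart F m n| <= C.
Proof.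
move=> FC; rewrite zpartE; apply: le_trans (ler_norm_sum _ _ _) _.
by apply: FC; exact: zrange_uniq.
Qed.

Lemma zlim_le F C : zbdd F C -> `|zlim F| <= C.
Proof.
move=> FC; apply/ler_addgt0Pr => e e0; have [N hN] := zlimP FC e0.
rewrite -(subrK (zpart F N N) (zlim F)); apply: le_trans (ler_normD _ _) _.
by rewrite addrC; apply: lerD; [exact: zpart_le|exact: hN].
Qed.

Lemma zlim_eq F l : zpart F n n @[n --> \oo] --> l -> zlim F = l.
Proof. by move=> h; exact: (cvg_lim _ h). Qed.

Lemma zbdd_le F G C : (forall k, `|F k| <= `|G k|) -> zbdd G C -> zbdd F C.
Proof.
by move=> h GC r ur; apply: le_trans (GC r ur); apply: ler_sum => k _; exact: h.
Qed.

Lemma zbddD F G C D : zbdd F C -> zbdd G D -> zbdd (fun k => F k + G k) (C + D).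
Proof.
move=> FC GD r ur; apply: le_trans (lerD (FC r ur) (GD r ur)).
by rewrite -big_split; apply: ler_sum => k _; exact: ler_normD.
Qed.

Lemma zbddZ F C a : zbdd F C -> zbdd (fun k => a * F k) (`|a| * C).
Proof.
move=> FC r ur; under eq_bigr do rewrite normrM.
by rewrite -mulr_sumr ler_wpM2l// FC.
Qed.

Lemma zpartD F G m n : zpart (fun k => F k + G k) m n = zpart F m n + zpart G m n.
Proof. by rewrite /zpart !big_split /=; ring. Qed.

Lemma zpartZ F a m n : zpart (fun k => a * F k) m n = a * zpart F m n.
Proof. by rewrite /zpart -!mulr_sumr mulrDr. Qed.

Lemma zlimD F G C D : zbdd F C -> zbdd G D -> zlim (fun k => F k + G k) = zlim F + zlim G.
Proof.
move=> FC GD; apply: zlim_eq; under eq_fun do rewrite zpartD.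
by apply: cvgD; [exact: zlim_cvg FC|exact: zlim_cvg GD].
Qed.

Lemma zlimZ F C a : zbdd F C -> zlim (fun k => a * F k) = a * zlim F.
Proof.
move=> FC; apply: zlim_eq; under eq_fun do rewrite zpartZ.
by apply: cvgMr; exact: zlim_cvg FC.
Qed.

Lemma zlimB F G C D : zbdd F C -> zbdd G D -> zlim (fun k => F k - G k) = zlim F - zlim G.
Proof.
move=> FC GD; under eq_fun do rewrite -mulN1r.
by rewrite (zlimD FC (zbddZ _ GD)) (zlimZ _ GD) mulN1r.
Qed.

End IntegerSums.

(** * Kernels summed over the integers *)

Section KernelSums.
Context {R : realType}.
Implicit Types (x t : R) (r : seq int).

(** Each counted integer owns a unit cell inside an interval of length [2 * t + 1]. *)
Lemma kcount x t r : 0 <= t -> uniq r ->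
  \sum_(k <- r) ((`|x - k%:~R| <= t)%R)%:R <= 2 * t + 1.
Proof.
move=> t0 ur; pose s := [seq k <- r | `|x - k%:~R| <= t].
have -> : \sum_(k <- r) ((`|x - k%:~R| <= t)%R)%:R = \sum_(k <- s) (1 : R).
  rewrite big_filter [RHS]big_mkcond /=; apply: eq_bigr => k _.
  by case: ifP.
have l1 : locint (st 1 (fun=> 1 : R)) by exact: (@cont_locint R (fun=> 1) (@cst_continuous R R 1)).
have := @sum_le_itg R 1 ltr01 (fun=> 1) s (x - t) (x + t + 1) (filter_uniq _ ur) l1 (fun=> ler01).
have -> : itg (x - t) (x + t + 1) (st 1 (fun=> 1)) = 1 * (x + t + 1 - (x - t)).
  by apply: itg_cst; lra.
move=> h; apply: le_trans (h _) _; last by lra.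
move=> k; rewrite mem_filter => /andP[]; rewrite ler_distl !divr1 intrD => /andP[? ?] _.
by split; lra.
Qed.

Variable theta : R.
Hypothesis theta12 : 2^-1 <= theta < 1.

Definition Cks C := 2 / theta * C * (3 / (1 - theta)).

(** Scale [j] involves at most [2 * 2^j + 1 <= 3 * 2^j] integers; the weights [dwt] reduce this to
    [3 * theta^j], uniformly in [x]. *)
Lemma ksum1 C K x : kdec theta C K -> zbdd (fun k => K (x - k%:~R)) (Cks C).
Proof.
move=> KC r ur; have t0 := theta_gt0 theta12; have t1 := theta_lt1 theta12.
have C0 := kdec_ge0 KC.
have [J hJ] := @seq_dyadic R 1 r x; rewrite mul1r in hJ.
apply: (@le_trans _ _ (\sum_(k <- r) 2 / theta * C *
    \sum_(j < J.+1) dwt theta j * ((`|x - k%:~R| <= 2 ^+ j)%R)%:R)).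
  rewrite !big_seq; apply: ler_sum => k kr; apply: kdec_dyadic => //; exact: hJ.
rewrite -mulr_sumr exchange_big /=; apply: ler_wpM2l.
  by rewrite mulr_ge0// divr_ge0// ltW.
apply: (@le_trans _ _ (\sum_(j < J.+1) 3 * theta ^+ j)).
  apply: ler_sum => j _; rewrite -mulr_sumr.
  apply: (@le_trans _ _ (dwt theta j * (2 * 2 ^+ j + 1))).
    by rewrite ler_wpM2l ?(dwt_ge0 theta12)// kcount// exprn_ge0.
  have h : 1 <= 2 ^+ j :> R by rewrite exprn_ege1// ler1n.
  have h2 : 0 < 2 ^+ j :> R by rewrite exprn_gt0.
  rewrite /dwt exprMn exprVn -mulrA (mulrC 3) ler_wpM2l ?exprn_ge0 ?(ltW t0)//.
  by rewrite ler_pdivrMl//; lra.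
by rewrite -mulr_sumr ler_wpM2l// geo_le// (ltW t0).
Qed.

End KernelSums.

(** * Dirichlet and Fejer kernels *)

Section Fejer.
Context {R : realType}.
Implicit Types (t x y B : R) (n N : nat) (g : R -> R).

Definition dirichlet n t : R := 1 + \sum_(k < n) 2 * cos (k.+1%:R * t).
(** Not normalised: [N] times the usual Fejer kernel, of mass [2 * pi * N] over a period. *)
Definition fejer N t : R := \sum_(n < N) dirichlet n t.

Lemma dirichletE n t : (1 - cos t) * dirichlet n t = cos (n%:R * t) - cos (n.+1%:R * t).
Proof.
elim: n => [|n IH]; first by rewrite /dirichlet big_ord0 addr0 mulr1 mul0r cos0 mul1r.
rewrite /dirichlet big_ord_recr /= addrA mulrDr -/(dirichlet n t) IH.
have e1 : cos (n%:R * t) = cos (n.+1%:R * t - t).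
  by congr cos; rewrite -natr1; ring.
have e2 : cos (n.+2%:R * t) = cos (n.+1%:R * t + t).
  by congr cos; rewrite -(@natr1 R n.+1); ring.
rewrite e1 e2 cosB cosD; ring.
Qed.

(** The closed form is kept multiplied by [1 - cos t], so that it holds at the multiples of [2 * pi]
    as well. *)
Lemma fejerE N t : (1 - cos t) * fejer N t = 1 - cos (N%:R * t).
Proof.
elim: N => [|N IH]; first by rewrite /fejer big_ord0 mulr0 mul0r cos0 subrr.
by rewrite /fejer big_ord_recr /= mulrDr -/(fejer N t) IH dirichletE; ring.
Qed.

Lemma fejer_ge0 N t : 0 <= fejer N t.
Proof.
have : 0 <= 1 - cos t by have := cos_le1 t; rewrite ler_norml => /andP[_]; lra.
rewrite le_eqVlt => /predU1P[/esym e|h]; last first.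
  rewrite -(pmulr_rge0 _ h) fejerE; have := cos_le1 (N%:R * t).
  rewrite ler_norml => /andP[_]; lra.
(* Here the closed form gives no information, but every cosine in the sum equals 1. *)
have c1 : cos t = 1 by lra.
have s0 : sin t = 0.
  by apply/eqP; rewrite -sqrf_eq0; have := cos2Dsin2 t; rewrite c1 expr1n => h; apply/eqP; lra.
have h k : cos (k%:R * t) = 1 /\ sin (k%:R * t) = 0.
  elim: k => [|k [h1 h2]]; first by rewrite mul0r cos0 sin0.
  rewrite -natr1 mulrDl mul1r cosD sinD h1 h2 c1 s0; split; ring.
apply: sumr_ge0 => n _; apply: addr_ge0 => //; apply: sumr_ge0 => k _.
by rewrite (h k.+1).1 mulr1.
Qed.

Lemma fejer_le N t d : 0 < d -> d <= `|t| -> `|t| <= pi -> fejer N t <= 2 / (1 - cos d).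
Proof.
move=> d0 dt tpi; have pi0 := @pi_gt0 R.
have mem u : 0 <= u <= pi -> u \in `[0, pi] by rewrite in_itv.
have c1 : 0 < 1 - cos d.
  rewrite subr_gt0 -cos0 ltr_cos ?in_itv/= ?lexx ?(ltW pi0)//.
  by rewrite (ltW d0) (le_trans dt).
have c2 : cos t <= cos d.
  have -> : cos t = cos `|t| by have [h|h] := leP 0 t; [rewrite ger0_norm|rewrite ltr0_norm// cosN].
  rewrite leNgt ltr_cos ?in_itv/= ?normr_ge0// -?leNgt//.
  by rewrite (ltW d0) (le_trans dt).
have c3 : 0 < 1 - cos t by lra.
rewrite ler_pdivlMr// mulrC; apply: (@le_trans _ _ ((1 - cos t) * fejer N t)).
  by apply: ler_wpM2r; [exact: fejer_ge0|lra].
by rewrite fejerE; have := cos_le1 (N%:R * t); rewrite ler_norml => /andP[]; lra.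
Qed.

Lemma sin_natpi n : sin (n%:R * pi) = 0 :> R.
Proof.
by elim: n => [|n IH]; rewrite ?mul0r ?sin0// -natr1 mulrDl mul1r sinDpi IH oppr0.
Qed.

Lemma isd_cos_shift (c t : R) : c != 0 ->
  isd (fun x => c^-1 * sin (c * (x - t))) (fun x => cos (c * (x - t))).
Proof.
move=> c0 x; have h : has_deriv (fun x => c * (x - t)) x (c * 1).
  by apply: dscale; apply: dval (dsub (did x) (dcst t x)) _; rewrite subr0.
by apply: dval (dscale c^-1 (dsin h)) _; rewrite mulr1 mulrA mulVf// mul1r.
Qed.

Lemma cont_cos_shift (c t : R) : continuous (fun x => cos (c * (x - t))).
Proof.
move=> x; apply: (@dcont R x (fun x => cos (c * (x - t))) (- (c * 1) * sin (c * (x - t)))).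
by apply: dcos; apply: dscale; apply: dval (dsub (did x) (dcst t x)) _; rewrite subr0.
Qed.

Lemma cont_cst (k : R) : continuous (fun _ : R => k).
Proof. exact: cst_continuous. Qed.

Lemma cont_add (f g : R -> R) : continuous f -> continuous g -> continuous (fun x => f x + g x).
Proof. by move=> hf hg x; apply: continuousD; [exact: hf|exact: hg]. Qed.

Lemma cont_sub (f g : R -> R) : continuous f -> continuous g -> continuous (fun x => f x - g x).
Proof. by move=> hf hg x; apply: continuousB; [exact: hf|exact: hg]. Qed.

Lemma cont_mul (f g : R -> R) : continuous f -> continuous g -> continuous (fun x => f x * g x).
Proof. by move=> hf hg x; apply: continuousM; [exact: hf|exact: hg]. Qed.

Lemma cont_sumf (I : Type) (r : seq I) (F : I -> R -> R) : (forall i, continuous (F i)) ->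
  continuous (fun x => \sum_(i <- r) F i x).
Proof.
move=> h; elim: r => [|i r IH].
  under eq_fun do rewrite big_nil; exact: cst_continuous.
under eq_fun do rewrite big_cons.
by apply: cont_add.
Qed.

Lemma cont_dirichlet n t : continuous (fun x => dirichlet n (x - t)).
Proof.
apply: cont_add; first exact: cont_cst.
by apply: cont_sumf => k; apply: cont_mul; [exact: cont_cst|exact: cont_cos_shift].
Qed.

Lemma cont_fejer N t : continuous (fun x => fejer N (x - t)).
Proof. by apply: cont_sumf => n; exact: cont_dirichlet. Qed.

Lemma itg_dirichlet n t : itg (t - pi) (t + pi) (fun x => dirichlet n (x - t)) = 2 * pi.
Proof.
have pi0 := @pi_gt0 R; have ab : t - pi <= t + pi by lra.
have lc k : locint (fun x : R => 2 * cos (k.+1%:R * (x - t))).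
  by apply: cont_locint; apply: cont_mul; [exact: cont_cst|exact: cont_cos_shift].
rewrite /dirichlet itgD.
- rewrite itg_cst// itg_sum// big1 ?addr0 ?mul1r; first by ring.
  move=> k _; rewrite itgZ; last by apply: cont_locint; exact: cont_cos_shift.
  rewrite (itg_FTC ab (isd_cos_shift t _) (@cont_cos_shift _ t)) ?pnatr_eq0//.
  have -> : t + pi - t = pi by ring.
  have -> : t - pi - t = - pi by ring.
  by rewrite mulrN sinN sin_natpi oppr0 !mulr0 subr0 mulr0.
- by apply: cont_locint; exact: cont_cst.
- exact: locint_sum.
Qed.

Lemma itg_fejer N t : itg (t - pi) (t + pi) (fun x => fejer N (x - t)) = N%:R * (2 * pi).
Proof.
rewrite /fejer itg_sum => [|n]; last by apply: cont_locint; exact: cont_dirichlet.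
under eq_bigr do rewrite itg_dirichlet.
by rewrite sumr_const card_ord -[LHS]mulr_natl.
Qed.

Lemma itg01_le (f : R -> R) (C : R) : locint f -> (forall x, 0 <= x <= 1 -> f x <= C) ->
  itg 0 1 f <= C.
Proof.
move=> lf h; apply: (@le_trans _ _ (itg 0 1 (fun=> C))); last by rewrite itg_cst// subr0 mulr1.
by apply: itg_le => //; by apply: cont_locint; exact: cont_cst.
Qed.

Lemma lmeas_cont (f : R -> R) : continuous f -> lmeas f.
Proof. by move=> h; exact: continuous_lebesgue. Qed.

Lemma fejer_bd N t : `|fejer N t| <= N%:R * (1 + 2 * N%:R).
Proof.
apply: le_trans (ler_norm_sum _ _ _) _.
apply: (@le_trans _ _ (\sum_(n < N) (1 + 2 * N%:R))); last first.
  by rewrite sumr_const card_ord -[leLHS]mulr_natl.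
apply: ler_sum => n _; apply: le_trans (ler_normD _ _) _; rewrite normr1 lerD2l.
apply: le_trans (ler_norm_sum _ _ _) _.
apply: (@le_trans _ _ (\sum_(k < n) 2)).
  by apply: ler_sum => k _; rewrite normrM ger0_norm// ler_piMr// cos_le1.
by rewrite sumr_const card_ord -[leLHS]mulr_natl mulrC ler_wpM2l// ler_nat ltnW.
Qed.

Lemma locint_mulf g B (f : R -> R) C : lmeas g -> (forall x, `|g x| <= B) ->
  lmeas f -> (forall x, `|f x| <= C) -> locint (fun x => g x * f x).
Proof.
move=> mg gB mf fC; apply: (@locint_bounded _ _ (B * C)); first exact: lmeasM.
by move=> x; rewrite normrM ler_pM.
Qed.

Lemma locint_fejer g B N t : lmeas g -> (forall x, `|g x| <= B) ->
  locint (fun x => g x * fejer N (x - t)).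
Proof.
move=> mg gB; apply: (locint_mulf mg gB (lmeas_cont (@cont_fejer N t))) => x.
exact: fejer_bd.
Qed.

(** For [x] in [0, 1] the sum [x + t] stays between [t] and [2 <= pi], away from the peaks, where
    the kernel is bounded and the factor [1 / (N + 1)] removes it. *)
Lemma fejer_far g B t : lmeas g -> (forall x, `|g x| <= B) -> 0 < t < 1 ->
  N.+1%:R^-1 * itg 0 1 (fun x => g x * fejer N.+1 (x + t)) @[N --> \oo] --> (0 : R).
Proof.
move=> mg gB /andP[t0 t1]; apply/cvg_epsP => e e0.
set c := 2 / (1 - cos t).
have [M hM] := @ex_inv_le R (B * c) e e0; exists M => N hN; rewrite sub0r normrN.
apply: le_trans (hM N hN); rewrite normrM ger0_norm ?invr_ge0// mulrC ler_wpM2r ?invr_ge0//.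
have lf : locint (fun x => g x * fejer N.+1 (x + t)).
  by have := locint_fejer N.+1 (- t) mg gB; under eq_fun do rewrite opprK.
apply: le_trans (itg_norm _ _ lf) _; apply: itg01_le; first exact: locint_abs.
move=> x /andP[x0 x1]; have pi2 := @pi_ge2 R.
rewrite normrM (ger0_norm (fejer_ge0 _ _)); apply: ler_pM => //; first exact: fejer_ge0.
by apply: fejer_le => //; rewrite ger0_norm; lra.
Qed.

(** Fejer's theorem at an interior point. The part of a period outside [0, 1] stays away from the
    peak at [t], so its mass is bounded and disappears after division by [N + 1]. *)
Lemma fejer_near g B t : lmeas g -> (forall x, `|g x| <= B) -> 0 < t < 1 ->
  {for t, continuous g} ->
  N.+1%:R^-1 * itg 0 1 (fun x => g x * fejer N.+1 (x - t)) @[N --> \oo] --> 2 * pi * g t.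
Proof.
move=> mg gB /andP[t0 t1] gc; apply/cvg_epsP => e e0.
have pi2 := @pi_ge2 R; have B0 : 0 <= B by exact: le_trans (gB 0).
(* The kernel has mass [2 * pi * n], so this tolerance contributes [e / 2] after division by [n]. *)
pose e1 := e / (4 * pi); have e10 : 0 < e1 by rewrite divr_gt0//; lra.
have [d [d0 dt dt1 hd]] : exists d, [/\ 0 < d, d <= t, d <= 1 - t &
    forall x, `|x - t| < d -> `|g x - g t| <= e1].
  move/cvgrPdist_le: gc => /(_ e1 e10)[d0 /= d00 h].
  exists (Num.min d0 (Num.min t (1 - t))); split.
  - by rewrite !lt_min d00 t0/= subr_gt0.
  - by rewrite !ge_min lexx ?orbT.
  - by rewrite !ge_min lexx ?orbT.
  - move=> x; rewrite lt_min => /andP[xd _]; rewrite distrC; apply: h.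
    by rewrite /= distrC.
set c := 2 / (1 - cos d).
have far N x : d <= `|x - t| -> `|x - t| <= pi -> 0 <= fejer N (x - t) <= c.
  by move=> h1 h2; rewrite fejer_ge0 (fejer_le _ d0).
have c0 : 0 <= c.
  have e3 : `|t + d - t| = d by rewrite addrC addKr gtr0_norm.
  have /andP[h1 h2] : 0 <= fejer 1 (t + d - t) <= c by apply: far; rewrite e3//; lra.
  exact: le_trans h2.
pose K := 2 * B * c + B * (2 * pi * c).
have e2 : 0 < e / 2 by rewrite divr_gt0.
have [M hM] := @ex_inv_le R K _ e2; exists M => N hN.
set n := N.+1; have n0 : 0 < n%:R :> R by rewrite ltr0n.
have lF : locint (fun x => fejer n (x - t)) by apply: cont_locint; exact: cont_fejer.
(* Both outer parts of the period lie at distance at least [d] from [t], where the kernel is at most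
   [c]. *)
have I1 : 0 <= n%:R * (2 * pi) - itg 0 1 (fun x => fejer n (x - t)) <= 2 * pi * c.
  rewrite -(itg_fejer n t) (@itg_add _ _ 0 _ _ lF); [|lra|lra].
  rewrite (@itg_add _ 0 1 _ _ lF); [|lra|lra].
  have h1 : 0 <= itg (t - pi) 0 (fun x => fejer n (x - t)) <= pi * c.
    rewrite itg_ge0/=; last by move=> x; exact: fejer_ge0.
    apply: (@le_trans _ _ (itg (t - pi) 0 (fun=> c))).
      apply: itg_le => // [|x /andP[x0 x1]]; first by apply: cont_locint; exact: cont_cst.
      have nx : `|x - t| = t - x by rewrite ler0_norm; lra.
      have /andP[//] : 0 <= fejer n (x - t) <= c by apply: far; rewrite nx; lra.
    by rewrite itg_cst; [rewrite mulrC; apply: ler_wpM2r; lra|lra].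
  have h2 : 0 <= itg 1 (t + pi) (fun x => fejer n (x - t)) <= pi * c.
    rewrite itg_ge0/=; last by move=> x; exact: fejer_ge0.
    apply: (@le_trans _ _ (itg 1 (t + pi) (fun=> c))).
      apply: itg_le => // [|x /andP[x0 x1]]; first by apply: cont_locint; exact: cont_cst.
      have nx : `|x - t| = x - t by rewrite ger0_norm; lra.
      have /andP[//] : 0 <= fejer n (x - t) <= c by apply: far; rewrite nx; lra.
    by rewrite itg_cst; [rewrite mulrC; apply: ler_wpM2r; lra|lra].
  move: h1 h2 => /andP[? ?] /andP[? ?]; apply/andP; split; lra.
have lgF := locint_fejer n t mg gB.
have lh : locint (fun x => (g x - g t) * fejer n (x - t)).
  by under eq_fun do rewrite mulrBl; apply: locintB => //; exact: locintZ.
have I2 : `|itg 0 1 (fun x => (g x - g t) * fejer n (x - t))| <= e1 * (n%:R * (2 * pi)) + 2 * B * c.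
  apply: le_trans (itg_norm _ _ lh) _.
  apply: (@le_trans _ _ (itg 0 1 (fun x => e1 * fejer n (x - t) + 2 * B * c))).
    apply: itg_le; first exact: locint_abs.
      by apply: locintD; [exact: locintZ|apply: cont_locint; exact: cont_cst].
    move=> x /andP[x0 x1]; rewrite normrM (ger0_norm (fejer_ge0 _ _)).
    have [xd|xd] := ltP `|x - t| d.
      apply: (@le_trans _ _ (e1 * fejer n (x - t))).
        by rewrite ler_wpM2r ?fejer_ge0// hd.
      by rewrite lerDl mulr_ge0// mulr_ge0.
    have /andP[f0 fc] : 0 <= fejer n (x - t) <= c by apply: far => //; rewrite ler_norml; apply/andP; split; lra.
    apply: (@le_trans _ _ (2 * B * c)); last by rewrite lerDr mulr_ge0// ltW.
    apply: ler_pM => //; apply: le_trans (ler_normB _ _) _.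
    have := gB x; have := gB t; lra.
  rewrite itgD; [|exact: locintZ|by apply: cont_locint; exact: cont_cst].
  rewrite itgZ// itg_cst// subr0 mulr1 lerD2r ler_wpM2l ?(ltW e10)//.
  by case/andP: I1; lra.
have E : itg 0 1 (fun x => g x * fejer n (x - t)) = itg 0 1 (fun x => (g x - g t) * fejer n (x - t)) +
    g t * itg 0 1 (fun x => fejer n (x - t)).
  rewrite -itgZ// -itgD//; last exact: locintZ.
  by apply: eq_itg => x _; ring.
have -> : 2 * pi * g t - n%:R^-1 * itg 0 1 (fun x => g x * fejer n (x - t)) =
  n%:R^-1 * (g t * (n%:R * (2 * pi) - itg 0 1 (fun x => fejer n (x - t))) -
     itg 0 1 (fun x => (g x - g t) * fejer n (x - t))).
  by rewrite E; field; rewrite gt_eqF.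
rewrite normrM gtr0_norm ?invr_gt0// ler_pdivrMl//.
apply: le_trans (ler_normB _ _) _; rewrite normrM.
have h3 : `|g t| * `|n%:R * (2 * pi) - itg 0 1 (fun x => fejer n (x - t))| <= B * (2 * pi * c).
  by case/andP: I1 => i1 i2; apply: ler_pM => //; rewrite ger0_norm.
apply: le_trans (lerD h3 I2) _.
have := hM N hN; rewrite -/n ler_pdivrMr// /K => h4.
have -> : e1 * (n%:R * (2 * pi)) = e / 2 * n%:R.
  by rewrite /e1; field; rewrite gt_eqF//; lra.
lra.
Qed.

End Fejer.

(** * Bounded convergence on intervals *)

Section BoundedConvergence.
Context {R : realType}.
Implicit Types (a b B : R) (g : R -> R).

(** Dominated convergence with the end points discarded as a null set; the convergence in [csum_cvg]
    is available only at interior frequencies. *)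
Lemma itg_bdd_cvg a b B (f : nat -> R -> R) g : (forall n, lmeas (f n)) -> lmeas g ->
  (forall n x, `|f n x| <= B) -> (forall x, a < x < b -> f n x @[n --> \oo] --> g x) ->
  itg a b (f n) @[n --> \oo] --> itg a b g.
Proof.
move=> mf mg fB fg; pose D := `[a, b]%classic : set (lebR R).
have mD : measurable D by exact: mitv.
have mfD n : measurable_fun D (EFin \o f n).
  by apply/measurable_EFinP; apply: measurable_funS (mf n).
have mgD : measurable_fun D (EFin \o g).
  by apply/measurable_EFinP; apply: measurable_funS mg.
have aefg : {ae @cmu R, forall x, D x -> (EFin \o f n) x @[n --> \oo] --> (EFin \o g) x}.
  exists ([set a] `|` [set b]); split.
  - by rewrite -[[set a]]set_itv1 -[[set b]]set_itv1; apply: measurableU; exact: mitv.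
  - by rewrite measureU0; [exact: lebesgue_measure_set1|rewrite -set_itv1; exact: mitv|
      rewrite -set_itv1; exact: mitv|exact: lebesgue_measure_set1].
  - move=> x /= /not_implyP[Dx h]; apply: contrapT => h'.
    move: Dx; rewrite /D /= in_itv/= => /andP[ax xb].
    apply: h; apply: cvg_EFin; first by near=> n.
    by apply: fg; rewrite !lt_neqAle ax xb !andbT; apply/andP; split; apply/eqP => e; apply: h'; [left|right].
have iB : (@cmu R).-integrable D (EFin \o (fun=> B)).
  by apply: cont_locint; exact: cont_cst.
have [] := @dominated_convergence _ (lebR R) R (@cmu R) D mD (fun n => EFin \o f n)
  (EFin \o g) (EFin \o (fun=> B)) mfD mgD aefg iB.
  by apply: aeW => x n _; rewrite /= lee_fin.
move=> ig _ h; rewrite /itg /Rintegral.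
apply: fine_cvg; rewrite fineK; last exact: integrable_fin_num.
exact: h.
Unshelve. all: by end_near. Qed.

End BoundedConvergence.

(** * The sampling identity for products of symbols *)

Section SamplingIdentity.
Context {R : realType}.
Variables (theta : R) (m1 m2 : R -> R) (B1 B2 C1 : R).
Hypothesis theta12 : 2^-1 <= theta < 1.
Hypothesis lm1 : lmeas m1.
Hypothesis lm2 : lmeas m2.
Hypothesis m1B : forall x, `|m1 x| <= B1.
Hypothesis m2B : forall x, `|m2 x| <= B2.
Hypothesis m1c : forall t, 0 < t < 1 -> {for t, continuous m1}.
Hypothesis K1 : kdec theta C1 (kern m1).
Implicit Types (x y xi : R).

(** Reconstruction of a cosine wave of frequency [xi] from its integer samples; the limit is the
    wave multiplied by [m1 xi]. *)
Let csum x y xi := zpart (fun k => kern m1 (x - k%:~R) * cos (xi * (k%:~R - y))).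

Let integrand x y xi (d e : R -> R) eta :=
  m1 eta * cos (x * eta - xi * y) * d (eta - xi) + m1 eta * cos (x * eta + xi * y) * e (eta + xi).

Let m1cos (a b : R) : lmeas (fun eta => m1 eta * cos (a * eta + b)) /\
  (forall eta, `|m1 eta * cos (a * eta + b)| <= B1).
Proof.
split; last by move=> eta; rewrite normrM -[leRHS]mulr1 ler_pM// cos_le1.
apply: lmeasM => //; apply: lmeas_cont => eta.
apply: (@dcont R eta (fun eta => cos (a * eta + b)) (- (a * 1 + 0) * sin (a * eta + b))).
by apply: dcos; apply: dadd (dcst b eta); apply: dscale; exact: did.
Qed.

(** Pairing [k] with [- k] and the product formula leave cosines of [k * (eta - xi)] and
    [k * (eta + xi)], the summands of Dirichlet kernels. *)
Lemma csum_pair x y xi (k : R) :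
  kern m1 (x - k) * cos (xi * (k - y)) + kern m1 (x - - k) * cos (xi * (- k - y)) =
  pi^-1 * itg 0 1 (fun eta => m1 eta * cos (x * eta - xi * y) * cos (k * (eta - xi)) +
    m1 eta * cos (x * eta + xi * y) * cos (k * (eta + xi))).
Proof.
have l1 t : locint (fun eta => m1 eta * cos (t * eta)) by exact: (cosint_locint t lm1 m1B).
rewrite /kern /cosint -!mulrA -mulrDr; congr (_ * _).
rewrite [itg _ _ _ * _]mulrC [X in _ + X]mulrC -!itgZ// -itgD; [|exact: locintZ|exact: locintZ].
apply: eq_itg => eta _.
have cc (a b : R) : 2 * (cos a * cos b) = cos (a + b) + cos (a - b) by rewrite cosD cosB; ring.
apply: (@mulfI _ 2); first by rewrite pnatr_eq0.
have -> : 2 * (cos (xi * (k - y)) * (m1 eta * cos ((x - k) * eta)) +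
     cos (xi * (- k - y)) * (m1 eta * cos ((x - - k) * eta))) =
  m1 eta * (2 * (cos ((x - k) * eta) * cos (xi * (k - y))) +
            2 * (cos ((x - - k) * eta) * cos (xi * (- k - y)))) by ring.
have -> : 2 * (m1 eta * cos (x * eta - xi * y) * cos (k * (eta - xi)) +
     m1 eta * cos (x * eta + xi * y) * cos (k * (eta + xi))) =
  m1 eta * (2 * (cos (x * eta - xi * y) * cos (k * (eta - xi))) +
    2 * (cos (x * eta + xi * y) * cos (k * (eta + xi)))) by ring.
rewrite !cc; congr (_ * _).
have -> : (x - k) * eta + xi * (k - y) = x * eta - xi * y - k * (eta - xi) by ring.
have -> : (x - k) * eta - xi * (k - y) = x * eta + xi * y - k * (eta + xi) by ring.
have -> : (x - - k) * eta + xi * (- k - y) = x * eta - xi * y + k * (eta - xi) by ring.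
have -> : (x - - k) * eta - xi * (- k - y) = x * eta + xi * y + k * (eta + xi) by ring.
ring.
Qed.

Let lint x y xi n : locint (integrand x y xi (dirichlet n) (dirichlet n)).
Proof.
have [h1 h2] := m1cos x (- (xi * y)); have [h3 h4] := m1cos x (xi * y).
have bd (t : R) : `|dirichlet n t| <= 1 + 2 * n%:R.
  apply: le_trans (ler_normD _ _) _; rewrite normr1 lerD2l.
  apply: le_trans (ler_norm_sum _ _ _) _.
  apply: (@le_trans _ _ (\sum_(k < n) 2)).
    by apply: ler_sum => k _; rewrite normrM ger0_norm// ler_piMr// cos_le1.
  by rewrite sumr_const card_ord -[leLHS]mulr_natr.
apply: locintD.
  exact: (locint_mulf h1 h2 (lmeas_cont (@cont_dirichlet R n xi)) (fun t => bd (t - xi))).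
have c : continuous (fun t => dirichlet n (t + xi)).
  by have := @cont_dirichlet R n (- xi); under eq_fun do rewrite opprK.
exact: (locint_mulf h3 h4 (lmeas_cont c) (fun t => bd (t + xi))).
Qed.

Lemma csumE x y xi n : csum x y xi n n.+1 =
  (2 * pi)^-1 * itg 0 1 (integrand x y xi (dirichlet n) (dirichlet n)).
Proof.
elim: n => [|n IH].
  rewrite /csum /zpart big_nat1 big_geq// addr0 mulr0z subr0.
  have := csum_pair x y xi 0; rewrite !oppr0 addr0 -mulr2n => h.
  apply: (@mulfI _ 2); first by rewrite pnatr_eq0.
  rewrite [LHS]mulr_natl h invfM !mulrA mulfV ?pnatr_eq0// mul1r; congr (_ * _).
  apply: eq_itg => eta _; rewrite /integrand /dirichlet !big_ord0.
  by rewrite !mul0r cos0 !addr0.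
have -> : csum x y xi n.+1 n.+2 = csum x y xi n n.+1 +
   (kern m1 (x - n.+1%:R) * cos (xi * (n.+1%:R - y)) +
    kern m1 (x - - n.+1%:R) * cos (xi * (- n.+1%:R - y))).
  rewrite /csum /zpart big_nat_recr//= [X in _ + X]big_nat_recr//= NegzE mulrNz.
  by rewrite -!pmulrn; ring.
rewrite IH csum_pair.
set J := itg 0 1 (integrand _ _ _ _ _).
set E := (fun eta => _ + _).
have [h1 h2] := m1cos x (- (xi * y)); have [h3 h4] := m1cos x (xi * y).
have cb (k t : R) : `|cos (k * t)| <= 1 by exact: cos_le1.
have lE : locint E.
  apply: locintD.
    exact: (locint_mulf h1 h2 (lmeas_cont (@cont_cos_shift R n.+1%:R xi)) (fun t => cb _ (t - xi))).
  have c : continuous (fun t => cos (n.+1%:R * (t + xi))).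
    by have := @cont_cos_shift R n.+1%:R (- xi); under eq_fun do rewrite opprK.
  exact: (locint_mulf h3 h4 (lmeas_cont c) (fun t => cb _ (t + xi))).
have -> : integrand x y xi (dirichlet n.+1) (dirichlet n.+1) =
    (fun eta => integrand x y xi (dirichlet n) (dirichlet n) eta + 2 * E eta).
  apply/funext => eta; rewrite /integrand /dirichlet !big_ord_recr /= /E; ring.
rewrite [in RHS]itgD; [|exact: lint|exact: locintZ].
rewrite (itgZ 0 1 2 lE) [RHS]mulrDr; congr (_ + _).
by rewrite invfM mulrACA mulVf ?pnatr_eq0// mul1r.
Qed.

Let ksumxi x y xi : zbdd (fun k => kern m1 (x - k%:~R) * cos (xi * (k%:~R - y))) (Cks theta C1).
Proof.
apply: zbdd_le (ksum1 theta12 x K1) => k.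
by rewrite normrM ler_piMr// cos_le1.
Qed.

(* The kernel decay gives convergence of the symmetric partial sums, so the limit can be computed
   from their Cesaro means, which are Fejer integrals. *)
Lemma csum_cvg x y xi : 0 < xi < 1 ->
  csum x y xi n n.+1 @[n --> \oo] --> m1 xi * cos (xi * (x - y)).
Proof.
move=> xi01; have pi0 := @pi_gt0 R.
have cv := zlim_cvgS (@ksumxi x y xi); rewrite -/(csum x y xi) in cv.
suff -> : m1 xi * cos (xi * (x - y)) = zlim (fun k => kern m1 (x - k%:~R) * cos (xi * (k%:~R - y))) by [].
apply/esym; have := cesaro cv.
set a := arithmetic_mean _.
have [h1 h2] := m1cos x (- (xi * y)); have [h3 h4] := m1cos x (xi * y).
have -> : a = (fun N => (2 * pi)^-1 *
  (N.+1%:R^-1 * itg 0 1 (fun eta => m1 eta * cos (x * eta - xi * y) * fejer N.+1 (eta - xi)) +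
   N.+1%:R^-1 * itg 0 1 (fun eta => m1 eta * cos (x * eta + xi * y) * fejer N.+1 (eta + xi)))).
  apply/funext => N; rewrite /a /arithmetic_mean /series /=.
  rewrite big_mkord; under eq_bigr do rewrite csumE.
  rewrite -mulr_sumr -itg_sum; last by move=> n; exact: lint.
  rewrite -mulrDr mulrCA; congr (_ * (_ * _)); rewrite -itgD.
  - apply: eq_itg => eta _; rewrite /integrand /fejer big_split /= -!mulr_sumr.
    by [].
  - exact: locint_fejer h1 h2.
  - by have := @locint_fejer R _ _ N.+1 (- xi) h3 h4; under eq_fun do rewrite opprK.
move=> cva; apply: (cvg_unique _ cva); first exact: Rhausdorff.
rewrite (_ : m1 xi * _ = (2 * pi)^-1 * (2 * pi * (m1 xi * cos (x * xi - xi * y)) + 0)); last first.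
  rewrite addr0 mulKf; last by rewrite mulf_neq0 ?pnatr_eq0// gt_eqF.
  by congr (_ * cos _); ring.
apply: cvgMr; apply: cvgD.
  apply: (fejer_near h1 h2 xi01); apply: continuousM; first exact: m1c.
  apply: (@dcont R xi (fun eta => cos (x * eta + - (xi * y))) (- (x * 1 + 0) * sin (x * xi + - (xi * y)))).
  by apply: dcos; apply: dadd (dcst (- (xi * y)) xi); apply: dscale; exact: did.
exact: (fejer_far h3 h4 xi01).
Qed.

(** Writing the second kernel as an integral over [xi] leaves the partial sums [csum]. They are
    bounded uniformly by [ksum1] and converge for [0 < xi < 1], so bounded convergence yields the
    kernel of the product. *)
Lemma sampling_identity x y :
  zlim (fun k => kern m1 (x - k%:~R) * kern m2 (k%:~R - y)) = kern (fun t => m1 t * m2 t) (x - y).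
Proof.
have pi0 := @pi_gt0 R.
have k2b t : `|kern m2 t| <= pi^-1 * B2.
  by rewrite normrM ger0_norm ?invr_ge0 ?(ltW pi0)// ler_wpM2l ?invr_ge0 ?(ltW pi0)// cosint_le.
have zb : zbdd (fun k => kern m1 (x - k%:~R) * kern m2 (k%:~R - y)) (`|pi^-1 * B2| * Cks theta C1).
  apply: zbdd_le (zbddZ (pi^-1 * B2) (ksum1 theta12 x K1)) => k.
  by rewrite [leRHS]normrM mulrC normrM ler_wpM2r// (le_trans (k2b _)) ?ler_norm.
apply: (cvg_unique _ (zlim_cvgS zb)); first exact: Rhausdorff.
have lmc n : lmeas (fun xi => m2 xi * csum x y xi n n.+1).
  apply: lmeasM => //; apply: lmeas_cont.
  rewrite /csum; under eq_fun do rewrite zpartE.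
  apply: cont_sumf => k; apply: cont_mul; first exact: cont_cst.
  by under eq_fun do rewrite mulrC; exact: cos_cont.
have -> : (fun n => zpart (fun k => kern m1 (x - k%:~R) * kern m2 (k%:~R - y)) n n.+1) =
    (fun n => pi^-1 * itg 0 1 (fun xi => m2 xi * csum x y xi n n.+1)).
  apply/funext => n; rewrite zpartE /kern /cosint.
  have l2 t : locint (fun xi => m2 xi * cos (t * xi)) by exact: (cosint_locint t lm2 m2B).
  rewrite (_ : (fun xi => _) = (fun xi => \sum_(k <- zrange 0 n n.+1)
     kern m1 (x - k%:~R) * (m2 xi * cos ((k%:~R - y) * xi)))); last first.
    apply/funext => xi; rewrite /csum zpartE mulr_sumr; apply: eq_bigr => k _.
    by rewrite (mulrC _ xi); ring.
  rewrite itg_sum; last by move=> k; exact: locintZ.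
  rewrite mulr_sumr; apply: eq_bigr => k _; rewrite itgZ// /kern /cosint; ring.
rewrite /kern; apply: cvgMr; rewrite /cosint.
apply: (itg_bdd_cvg (B := B2 * Cks theta C1)) => [//||n xi|xi xi01].
- by apply: lmeasM; [exact: lmeasM|apply: lmeas_cont; exact: cos_cont].
- by rewrite normrM ler_pM//; apply: zpart_le; exact: ksumxi.
- rewrite (mulrC (m1 xi)) -mulrA (mulrC _ xi); apply: cvgMr; exact: csum_cvg.
Qed.

End SamplingIdentity.

(** * Differentiation under the integral sign *)

Section DifferentiationUnderIntegral.
Context {R : realType} d (T : measurableType d) (mu : {measure set T -> \bar R}).
Variables (D : set T) (f df : R -> T -> R) (G : T -> R).
Hypothesis mD : measurable D.
Hypothesis intf : forall x, mu.-integrable D (EFin \o f x).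
Hypothesis dfE : forall x y, D y -> has_deriv (f ^~ y) x (df x y).
Hypothesis intG : mu.-integrable D (EFin \o G).
Hypothesis dfG : forall x y, D y -> `|df x y| <= G y.

Lemma deriv_under_integral x :
  has_deriv (fun x => \int[mu]_(y in D) f x y) x (\int[mu]_(y in D) df x y).
Proof.
have xI : x \in (`]x - 1, x + 1[ : interval R) by rewrite in_itv/= ltrBlDr ltrDl ltr01.
have d1E z y : D y -> partial1of2 f z y = df z y.
  by move=> Dy; rewrite partial1of2E; have [_ ->] := dfE z Dy.
have intf' z : `]x - 1, x + 1[%classic z -> mu.-integrable D (EFin \o f z) by move=> _.
have der z y : `]x - 1, x + 1[%classic z -> D y -> derivable (f ^~ y) z 1.
  by move=> _ Dy; have [] := dfE z Dy.
pose G' y := `|G y|.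
have G'0 y : 0 <= G' y by exact: normr_ge0.
have intG' : mu.-integrable D (EFin \o G') by exact: integrable_norm.
have G'u z y : `]x - 1, x + 1[%classic z -> D y -> `|partial1of2 f z y| <= G' y.
  by move=> _ Dy; rewrite d1E// (le_trans (dfG _ Dy))// ler_norm.
have h1 := derivable_under_integral mD xI intf' der G'0 intG' G'u.
have h2 := differentiation_under_integral mD xI intf' der G'0 intG' G'u.
split => //; rewrite -derive1E h2.
by apply: eq_Rintegral => y; rewrite inE => Dy; exact: d1E.
Qed.

End DifferentiationUnderIntegral.

(** * Trigonometric integrals over bounded frequencies *)

Section TrigonometricIntegrals.
Context {R : realType}.
Implicit Types (a b : R -> R) (x xi B : R).

Definition trig a b x := itg 0 1 (fun xi => a xi * cos (x * xi) + b xi * sin (x * xi)).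
(** The frequency on [0, 1], kept bounded on the rest of the line so that multiplication by it
    preserves [bddm]. *)
Definition clip (xi : R) : R := cutoff 0 1 xi.

Lemma clip_id xi : 0 <= xi <= 1 -> clip xi = xi.
Proof. exact: cutoff_id. Qed.

Lemma clip_le1 xi : `|clip xi| <= 1.
Proof. by have /andP[h0 h1] := @cutoff_itv R 0 1 xi ler01; rewrite ger0_norm. Qed.

Lemma lmeas_clip : lmeas clip.
Proof. by apply: lmeas_cont; exact: cutoff_cont. Qed.

Definition bddm a B := lmeas a /\ forall xi, `|a xi| <= B.

Lemma bddm_clip a B : bddm a B -> bddm (fun xi => clip xi * a xi) B.
Proof.
move=> [ma aB]; split; first by apply: lmeasM => //; exact: lmeas_clip.
by move=> xi; rewrite normrM; apply: le_trans (aB xi); rewrite ler_piMl// clip_le1.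
Qed.

Lemma bddmN a B : bddm a B -> bddm (fun xi => - a xi) B.
Proof.
move=> [ma aB]; split; last by move=> xi; rewrite normrN.
by have := lmeasM (lmeas_cst (-1)) ma; under eq_fun do rewrite mulN1r.
Qed.

Lemma trig_locint a b B x : bddm a B -> bddm b B ->
  locint (fun xi => a xi * cos (x * xi) + b xi * sin (x * xi)).
Proof.
move=> [ma aB] [mb bB]; apply: locintD; first exact: cosint_locint ma aB.
apply: (locint_mulb mb _ bB); last by move=> xi; exact: sin_le1.
by apply: lmeas_cont => xi; exact: sin_cont.
Qed.

Lemma trig_le a b B x : bddm a B -> bddm b B -> `|trig a b x| <= 2 * B.
Proof.
move=> ha hb; have l := trig_locint x ha hb; case: ha hb => [ma aB] [mb bB].
apply: le_trans (itg_norm _ _ l) _; apply: itg01_le; first exact: locint_abs.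
move=> xi _; apply: le_trans (ler_normD _ _) _; rewrite !normrM mulr2n mulrDl mul1r.
by apply: lerD; rewrite -[leRHS]mulr1 ler_pM// ?cos_le1 ?sin_le1.
Qed.

Lemma isd_trig a b B : bddm a B -> bddm b B ->
  isd (trig a b) (trig (fun xi => clip xi * b xi) (fun xi => - (clip xi * a xi))).
Proof.
move=> ha hb x; have hca := bddmN (bddm_clip ha); have hcb := bddm_clip hb.
apply: (@deriv_under_integral R _ _ (@cmu R) `[0, 1]%classic
  (fun x xi => a xi * cos (x * xi) + b xi * sin (x * xi))
  (fun x xi => clip xi * b xi * cos (x * xi) + - (clip xi * a xi) * sin (x * xi)) (fun=> 2 * B)).
- exact: mitv.
- by move=> z; exact: (trig_locint z ha hb).
- move=> z xi; rewrite /= in_itv/= => /clip_id ->.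
  have dz : has_deriv (fun z => z * xi) z xi.
    by apply: dval (dmul (did z) (dcst xi z)) _; rewrite mul1r mulr0 addr0.
  apply: dval (dadd (dscale (a xi) (dcos dz)) (dscale (b xi) (dsin dz))) _; ring.
- by apply: cont_locint; exact: cont_cst.
- move=> z xi _; case: hca hcb => [_ h1] [_ h2].
  apply: le_trans (ler_normD _ _) _; rewrite normrM [X in _ + X]normrM mulr2n mulrDl mul1r.
  by apply: lerD; rewrite -[leRHS]mulr1 ler_pM// ?cos_le1 ?sin_le1.
Qed.

Lemma cont_trig a b B : bddm a B -> bddm b B -> continuous (trig a b).
Proof. by move=> ha hb; exact: isd_cont (isd_trig ha hb). Qed.

Lemma cosintE m x : cosint m x = trig m (fun=> 0) x.
Proof. by apply: eq_itg => xi _; rewrite mul0r addr0. Qed.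

Lemma bddm0 B : 0 <= B -> bddm (fun=> 0) B.
Proof. by move=> B0; split; [exact: lmeas_cst|move=> xi; rewrite normr0]. Qed.

Lemma bddm_ge0 a B : bddm a B -> 0 <= B.
Proof. by move=> [_ h]; exact: le_trans (h 0). Qed.

Lemma cont_kern m B : bddm m B -> continuous (kern m).
Proof.
move=> hm; apply: cont_mul; first exact: cont_cst.
rewrite (_ : cosint m = trig m (fun=> 0)); last by apply/funext => x; exact: cosintE.
exact: cont_trig hm (bddm0 (bddm_ge0 hm)).
Qed.

End TrigonometricIntegrals.

(** * Integrals over the line and Fubini's theorem *)

Section IntegralsOnLine.
Context {R : realType}.
Implicit Types (f g : R -> R) (a b : R).

(* Borel measurability, which Fubini requires; [lmeas] refers to the completed sigma-algebra. *)
Definition bmeas f := measurable_fun [set: R] f.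
Definition L1 f := (@lmu R).-integrable [set: R] (EFin \o f).
Definition rint f := \int[@lmu R]_(x in [set: R]) f x.

Lemma L1_bmeas f : L1 f -> bmeas f.
Proof. by move=> /measurable_int /measurable_EFinP. Qed.

Lemma L1_le f g : bmeas f -> L1 g -> (forall x, `|f x| <= g x) -> L1 f.
Proof.
move=> mf ig h; apply: (le_integrable measurableT _ _ ig); first exact/measurable_EFinP.
by move=> x _; rewrite lee_fin (le_trans (h x))// ler_norm.
Qed.

Lemma L1D f g : L1 f -> L1 g -> L1 (fun x => f x + g x).
Proof. by move=> hf hg; have := integrableD measurableT hf hg. Qed.

Lemma L1Z (k : R) f : L1 f -> L1 (fun x => k * f x).
Proof. by move=> hf; have := integrableZl measurableT k hf. Qed.

Lemma rintD f g : L1 f -> L1 g -> rint (fun x => f x + g x) = rint f + rint g.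
Proof. by move=> hf hg; exact: RintegralD. Qed.

Lemma rintZ (k : R) f : L1 f -> rint (fun x => k * f x) = k * rint f.
Proof. by move=> hf; exact: RintegralZl. Qed.

Lemma rint_norm f : L1 f -> `|rint f| <= rint (fun x => `|f x|).
Proof. by move=> hf; exact: le_normr_Rintegral. Qed.

Lemma rint_le f g : L1 f -> L1 g -> (forall x, f x <= g x) -> rint f <= rint g.
Proof. by move=> hf hg h; apply: le_Rintegral. Qed.

Lemma L1_locint f : L1 f -> locint f.
Proof.
move=> hf a b; apply: integrable_completed; first exact: measurable_itv.
exact: integrableS hf.
Qed.

Lemma rint_lim f : L1 f -> itg (- n%:R) n%:R f @[n --> \oo] --> rint f.
Proof.
move=> hf; have mf := L1_bmeas hf.
have mN n : measurable (`[(- n%:R), n%:R]%classic : set R) by exact: measurable_itv.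
pose fN n := f \_ `[- n%:R, n%:R].
have mfn n : measurable_fun [set: R] (EFin \o fN n).
  by apply/measurable_EFinP; apply/measurable_restrict => //; apply: measurable_funS mf.
have [] := @dominated_convergence _ _ R (@lmu R) setT measurableT
  (fun n => EFin \o fN n) (EFin \o f) (fun x => (`|f x|)%:E) mfn.
- exact/measurable_EFinP.
- apply: aeW => x _; apply/cvg_EFin; first by near=> n.
  apply/cvg_epsP => e e0; exists (Num.bound `|x|) => n hn.
  rewrite /= /fN patchE mem_set ?subrr ?normr0 ?(ltW e0)//= in_itv/=.
  rewrite -ler_norml; apply: ltW; apply: lt_le_trans (archi_boundP (normr_ge0 x)) _.
  by rewrite ler_nat.
- exact: integrable_norm.
- apply: aeW => x n _ /=; rewrite lee_fin /fN patchE; case: ifP => // _.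
  by rewrite normr0.
move=> _ _ h.
rewrite (_ : (fun n => itg _ _ f) = (fun n => fine (\int[@lmu R]_x (EFin \o fN n) x)%E)); last first.
  apply/funext => n; rewrite itgE; last by apply: measurable_funS mf.
  rewrite /Rintegral integral_mkcond; congr fine; apply: eq_integral => x _.
  by rewrite /fN /= !patchE; case: ifP.
apply: fine_cvg; rewrite fineK; last exact: integrable_fin_num.
exact: h.
Unshelve. all: by end_near. Qed.

Lemma rint_FTC F f : isd F f -> continuous f -> L1 f ->
  (F n%:R - F (- n%:R)) @[n --> \oo] --> rint f.
Proof.
move=> dF cf hf; have := rint_lim hf.
rewrite (_ : (fun n => itg _ _ f) = (fun n => F n%:R - F (- n%:R)))//.
by apply/funext => n; rewrite (itg_FTC _ dF cf)// ge0_cp.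
Qed.

Lemma rint_odd f : continuous f -> L1 f -> (forall x, f (- x) = - f x) -> rint f = 0.
Proof.
move=> cf hf fo; have [F dF] := ex_prim cf.
have e y : F y = F (- y).
  have h : `|(F y - F (- y)) - (F 0 - F (- 0))| <= 0 * `|y| - 0 * 0.
    have dd z : has_deriv (fun z => F z - F (- z)) z 0.
      apply: dval (dsub (dF z) (dcomp (dF (- z)) (dopp (did z)))) _; rewrite fo; ring.
    have key z : 0 <= z -> `|(F z - F (- z)) - (F 0 - F (- 0))| <= 0 * z - 0 * 0.
      move=> z0; apply: (@mvt_le R (fun z => F z - F (- z)) (fun=> 0) (fun z => 0 * z) (fun=> 0)) => // [w _|w _].
        by apply: dval (dscale 0 (did w)) _; rewrite mulr1.
      by rewrite normr0.
    have [y0|y0] := leP 0 y; first by rewrite (ger0_norm y0); exact: key.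
    rewrite (ltr0_norm y0) -normrN.
    have -> : - (F y - F (- y) - (F 0 - F (- 0))) = F (- y) - F (- - y) - (F 0 - F (- 0)).
      by rewrite oppr0 opprK; ring.
    by apply: key; lra.
  move: h; rewrite !mul0r subrr oppr0 subrr subr0 normr_le0 subr_eq0 => /eqP //.
apply: (cvg_unique _ (rint_FTC dF cf hf)); first exact: Rhausdorff.
rewrite (_ : (fun n => _) = fun=> 0); first exact: cvg_cst.
by apply/funext => n; rewrite -e subrr.
Qed.

(** The interval is encoded by an indicator, so that Tonelli's theorem on the plane applies; the
    uniform bound on the sections gives integrability of the product. *)
Lemma Fubini01 (F : R * R -> R) B M : measurable_fun [set: R * R] F ->
  (forall z, `|F z| <= B) ->
  (forall eta, (\int[@lmu R]_x (`|F (x, eta)|)%:E <= M%:E)%E) ->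
  [/\ L1 (fun x => itg 0 1 (fun eta => F (x, eta))),
      bmeas (fun eta => rint (fun x => F (x, eta))) &
      rint (fun x => itg 0 1 (fun eta => F (x, eta))) =
      itg 0 1 (fun eta => rint (fun x => F (x, eta)))].
Proof.
move=> mF FB FM.
have mFx x : bmeas (fun eta => F (x, eta)) by exact: measurableT_comp mF (measurable_pair1 x).
have mFe eta : bmeas (fun x => F (x, eta)) by exact: measurableT_comp mF (measurable_pair2 eta).
have M0 : 0 <= M.
  by rewrite -lee_fin; apply: le_trans (FM 0); apply: integral_ge0 => x _; rewrite lee_fin.
have m01 : measurable (`[0, 1]%classic : set R) by exact: measurable_itv.
pose F1 z := (F z * \1_`[0, 1] z.2)%:E.
have mF1 : measurable_fun [set: R * R] F1.
  apply/measurable_EFinP; apply: measurable_funM => //.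
  exact: measurableT_comp (measurable_indic m01) measurable_snd.
have L1e eta : L1 (fun x => F (x, eta)).
  apply/integrableP; split; first by apply/measurable_EFinP; exact: mFe.
  by apply: le_lt_trans (FM eta) _; rewrite ltry.
have i1 : (@lmu R \x @lmu R)%E.-integrable [set: R * R] F1.
  apply/(integrable21ltyP (@lmu R) (@lmu R) mF1).
  apply: (@le_lt_trans _ _ (\int[@lmu R]_y (M * \1_`[0, 1] y)%:E)%E).
    apply: ge0_le_integral => //.
    - by move=> y _; apply: integral_ge0.
    - apply: (@measurable_fun_fubini_tonelli_G _ _ _ _ R (@lmu R) (abse \o F1)) => //=.
      exact: measurableT_comp.
    - by apply/measurable_EFinP; apply: measurable_funM => //; exact: measurable_indic.
    - move=> y _; rewrite /F1 /= indicE; case: (_ \in _).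
        by under eq_integral do rewrite mulr1; rewrite mulr1; exact: FM.
      under eq_integral do rewrite mulr0 normr0; by rewrite integral0 mulr0.
  have iM : (@lmu R).-integrable `[0, 1]%classic (EFin \o (fun=> M)) by apply: cont_itgable; exact: cont_cst.
  have : (\int[@lmu R]_(x in `[0%R, 1%R]) M%:E)%E \is a fin_num by apply: integrable_fin_num.
  rewrite integral_mkcond fin_numElt => /andP[_]; congr (_ < _)%E.
  by apply: eq_integral => y _; rewrite patchE indicE; case: ifP; rewrite ?mulr1 ?mulr0.
have EF x : fubini_F (@lmu R) F1 x = (itg 0 1 (fun eta => F (x, eta)))%:E.
  rewrite /fubini_F itgE; last by apply: measurable_funS (mFx x).
  rewrite /Rintegral fineK.
    rewrite [RHS]integral_mkcond; apply: eq_integral => y _.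
    by rewrite /F1 patchE /= indicE; case: ifP; rewrite ?mulr1 ?mulr0.
  apply: integrable_fin_num => //.
  have iB : (@lmu R).-integrable `[0, 1]%classic (EFin \o (fun=> B)) by apply: cont_itgable; exact: cont_cst.
  apply: (le_integrable _ _ _ iB) => //.
    by apply/measurable_EFinP; apply: measurable_funS (mFx x).
  by move=> y _; rewrite lee_fin (le_trans (FB _))// ler_norm.
have EG eta : (\int[@lmu R]_x F1 (x, eta))%E = (rint (fun x => F (x, eta)) * \1_`[0, 1] eta)%:E.
  rewrite /F1 /= indicE; case: (_ \in _).
    under eq_integral do rewrite mulr1.
    by rewrite mulr1 /rint /Rintegral fineK//; apply: integrable_fin_num => //; exact: L1e.
  under eq_integral do rewrite mulr0; by rewrite integral0 mulr0.
have mG : bmeas (fun eta => rint (fun x => F (x, eta))).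
  have mE : measurable_fun [set: R * R] (EFin \o F) by exact/measurable_EFinP.
  apply/measurable_EFinP; rewrite (_ : EFin \o _ = (fun eta => \int[@lmu R]_x (EFin \o F)^\+ (x, eta)) \-
      (fun eta => \int[@lmu R]_x (EFin \o F)^\- (x, eta)))%E; last first.
    apply/funext => eta; rewrite /= /rint /Rintegral fineK; first by rewrite integralE; congr (_ - _)%E; apply: eq_integral => x _; rewrite ?funeposE ?funenegE.
    by apply: integrable_fin_num => //; exact: L1e.
  apply: emeasurable_funB.
    by apply: (@measurable_fun_fubini_tonelli_G _ _ _ _ R (@lmu R) (EFin \o F)^\+%E) => //; exact: measurable_funepos.
  by apply: (@measurable_fun_fubini_tonelli_G _ _ _ _ R (@lmu R) (EFin \o F)^\-%E) => //; exact: measurable_funeneg.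
have iF := integrable_fubini_F i1; have fub := Fubini i1.
have iE : L1 (fun x => itg 0 1 (fun eta => F (x, eta))).
  rewrite /L1 (_ : EFin \o _ = fubini_F (@lmu R) F1); first exact: iF.
  by apply/funext => x; rewrite EF.
split; [exact: iE|exact: mG|].
have {}fub : (\int[@lmu R]_x (itg 0 1 (fun eta => F (x, eta)))%:E =
    \int[@lmu R]_y (rint (fun x => F (x, y)) * \1_`[0%R, 1%R] y)%:E)%E.
  by under eq_integral do rewrite -EF; under [in RHS]eq_integral do rewrite -EG.
rewrite /rint /Rintegral fub itgE; last by apply: measurable_funS mG.
rewrite /Rintegral [in RHS]integral_mkcond; congr fine; apply: eq_integral => y _.
by rewrite patchE indicE; case: ifP; rewrite ?mulr1 ?mulr0.
Qed.

End IntegralsOnLine.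

(** * Gaussians and normal densities *)

Section Gaussians.
Context {R : realType}.
Implicit Types (e s t x y l B : R) (h : R -> R).

Lemma deriv0_const (F : R -> R) : (forall x, has_deriv F x 0) -> forall x y, F x = F y.
Proof.
move=> dF; suff h x y : x <= y -> F x = F y.
  by move=> x y; have [xy|/ltW xy] := leP x y; [exact: h|rewrite (h _ _ xy)].
move=> xy; have : `|F y - F x| <= 0 * y - 0 * x.
  apply: (@mvt_le R F (fun=> 0) (fun z => 0 * z) (fun=> 0)) => // [w _|w _].
    by apply: dval (dscale 0 (did w)) _; rewrite mulr1.
  by rewrite normr0.
by rewrite !mul0r subrr normr_le0 subr_eq0 => /eqP.
Qed.

Definition gs e x := expR (- (e * x) ^+ 2 / 2).

Lemma gs_gt0 e x : 0 < gs e x. Proof. exact: expR_gt0. Qed.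

Lemma gs_le1 e x : gs e x <= 1.
Proof. by rewrite -[leRHS]expR0 ler_expR mulNr oppr_le0 divr_ge0// sqr_ge0. Qed.

Lemma dexpR (f : R -> R) x a : has_deriv f x a -> has_deriv (fun y => expR (f y)) x (a * expR (f x)).
Proof. by move=> hf; exact: dcomp (is_derive_expR _) hf. Qed.

Lemma dgs e x : has_deriv (gs e) x (- (e ^+ 2 * x) * gs e x).
Proof.
have h : has_deriv (fun y => - (e * y) ^+ 2 / 2) x (- (e ^+ 2 * x)).
  by apply: dval (dmul (dopp (dexp 1 (dscale e (did x)))) (dcst 2^-1 x)) _; field.
exact: dexpR h.
Qed.

Lemma cont_gs e : continuous (gs e).
Proof. exact: isd_cont (dgs e). Qed.

Lemma cont_bmeas h : continuous h -> bmeas h.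
Proof. by move=> hc; exact: continuous_measurable_fun. Qed.

Lemma gsE e x : 0 < e -> gs e x = (normal_peak e^-1)^-1 * normal_pdf 0 e^-1 x.
Proof.
move=> e0; have e1 : e^-1 != 0 by rewrite invr_neq0// gt_eqF.
rewrite normal_pdfE// mulKf; last by rewrite gt_eqF// normal_peak_gt0.
by rewrite /normal_fun /gs subr0; congr expR; field; rewrite gt_eqF.
Qed.

Lemma L1_pdf l s : 0 < s -> L1 (normal_pdf l s).
Proof. by move=> s0; apply: integrable_normal_pdf; rewrite gt_eqF. Qed.

Lemma rint_pdf l s : 0 < s -> rint (normal_pdf l s) = 1.
Proof. by move=> s0; rewrite /rint /Rintegral integral_normal_pdf// gt_eqF. Qed.

Lemma L1_gs e : 0 < e -> L1 (gs e).
Proof.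
move=> e0; rewrite (_ : gs e = fun x => (normal_peak e^-1)^-1 * normal_pdf 0 e^-1 x).
  by apply: L1Z; apply: L1_pdf; rewrite invr_gt0.
by apply/funext => x; exact: gsE.
Qed.

Lemma rint_gs e : 0 < e -> rint (gs e) = (normal_peak e^-1)^-1.
Proof.
move=> e0; rewrite (_ : gs e = fun x => (normal_peak e^-1)^-1 * normal_pdf 0 e^-1 x).
  by rewrite rintZ ?rint_pdf ?mulr1 ?L1_pdf ?invr_gt0.
by apply/funext => x; exact: gsE.
Qed.

(** A factor [y] costs doubling the width: with [z = e * |y|], [z <= 1 + 3 * z^2 / 8 <= exp (3 * z^2
    / 8)]. *)
Lemma gs_moment e y : 0 < e -> `|y| * gs e y <= e^-1 * gs (e / 2) y.
Proof.
move=> e0; have -> : gs e y = expR (- (3 * (e * y) ^+ 2 / 8)) * gs (e / 2) y.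
  by rewrite /gs -expRD; congr expR; field.
rewrite mulrA ler_wpM2r ?(ltW (gs_gt0 _ _))// expRN ler_pdivrMr ?expR_gt0//.
rewrite ler_pdivlMl//; apply: le_trans (expR_ge1Dx _).
have -> : e * `|y| = `|e * y| by rewrite normrM gtr0_norm.
rewrite -[(e * y) ^+ 2]real_normK ?num_real//; set z := `|e * y|.
have : 0 <= (z - 2) ^+ 2 by exact: sqr_ge0.
by rewrite sqrrB; nra.
Qed.

Lemma L1_gs_bdd e h B : 0 < e -> bmeas h -> (forall x, `|h x| <= B) -> L1 (fun x => gs e x * h x).
Proof.
move=> e0 mh hB; apply: (L1_le (g := fun x => B * gs e x)).
- by apply: measurable_funM => //; apply: cont_bmeas; exact: cont_gs.
- by apply: L1Z; exact: L1_gs.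
- by move=> x; rewrite normrM (gtr0_norm (gs_gt0 e x)) mulrC ler_wpM2r// ltW// gs_gt0.
Qed.

Lemma L1_mom e h : 0 < e -> bmeas h -> (forall x, `|h x| <= 1) -> L1 (fun x => x * gs e x * h x).
Proof.
move=> e0 mh hB; apply: (L1_le (g := fun x => e^-1 * gs (e / 2) x)).
- apply: measurable_funM => //; apply: measurable_funM => //.
  by apply: cont_bmeas; exact: cont_gs.
- by apply: L1Z; apply: L1_gs; rewrite divr_gt0.
- move=> x; rewrite normrM; apply: le_trans (gs_moment x e0).
  by rewrite normrM (gtr0_norm (gs_gt0 e x)) ler_piMr// mulr_ge0// ltW// gs_gt0.
Qed.

Definition cgs e t := rint (fun y => gs e y * cos (t * y)).

(** Integration by parts; together with differentiation under the integral it gives the differential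
    equation [dcgs]. *)
Lemma gs_parts e t : 0 < e ->
  rint (fun y => y * gs e y * sin (t * y)) = t / e ^+ 2 * cgs e t.
Proof.
move=> e0; pose P y := - (e ^- 2) * (gs e y * sin (t * y)).
pose D y := y * gs e y * sin (t * y) + - (t / e ^+ 2) * (gs e y * cos (t * y)).
have dt y : has_deriv (fun y => t * y) y t by apply: dval (dscale t (did y)) _; rewrite mulr1.
have dP : isd P D.
  move=> y; apply: dval (dscale (- (e ^- 2)) (dmul (dgs e y) (dsin (dt y)))) _.
  by rewrite /D; field; rewrite gt_eqF.
have l1 : L1 (fun y => y * gs e y * sin (t * y)).
  apply: L1_mom => //; first by apply: cont_bmeas; exact: sin_cont.
  by move=> x; exact: sin_le1.
have l2 : L1 (fun y => gs e y * cos (t * y)).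
  apply: (L1_gs_bdd (B := 1)) => //; first by apply: cont_bmeas; exact: cos_cont.
  by move=> x; exact: cos_le1.
have cD : continuous D.
  apply: cont_add; apply: cont_mul.
  - by apply: cont_mul; [move=> x; exact: cvg_id|exact: cont_gs].
  - exact: sin_cont.
  - exact: cont_cst.
  - by apply: cont_mul; [exact: cont_gs|exact: cos_cont].
have lD : L1 D by apply: L1D => //; exact: L1Z.
have P0 : (P n%:R - P (- n%:R)) @[n --> \oo] --> (0 : R).
  apply/cvg_epsP => r r0.
  have [N hN] := @ex_inv_le R (4 * e ^- 2 * e^-1) r r0; exists N.+1 => -[//|n] hn.
  apply: le_trans (hN n hn); rewrite sub0r normrN.
  have bd z : `|z| = n.+1%:R -> `|P z| <= e ^- 2 * e^-1 / n.+1%:R.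
    move=> zn; have e2 : 0 <= e ^- 2 by rewrite invr_ge0 exprn_ge0// ltW.
    rewrite /P normrM normrN (ger0_norm e2).
    rewrite -mulrA ler_wpM2l ?invr_ge0 ?exprn_ge0 ?(ltW e0)// normrM.
    apply: (@le_trans _ _ (gs e z)); first by rewrite gtr0_norm ?gs_gt0// ler_piMr ?sin_le1// ltW// gs_gt0.
    have := gs_moment z e0; rewrite zn => h; rewrite ler_pdivlMr ?ltr0n// mulrC.
    by apply: le_trans h _; rewrite ler_piMr ?invr_ge0 ?(ltW e0)// gs_le1.
  apply: le_trans (ler_normB _ _) _.
  have h1 : `|P n.+1%:R| <= e ^- 2 * e^-1 / n.+1%:R by apply: bd; rewrite ger0_norm.
  have h2 : `|P (- n.+1%:R)| <= e ^- 2 * e^-1 / n.+1%:R by apply: bd; rewrite normrN ger0_norm.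
  apply: le_trans (lerD h1 h2) _.
  have A0 : 0 <= e ^- 2 * e^-1 / n.+1%:R by rewrite !mulr_ge0 ?invr_ge0 ?exprn_ge0 ?ler0n// ltW.
  apply: (@le_trans _ _ (4 * (e ^- 2 * e^-1 / n.+1%:R))); last by rewrite !mulrA.
  move: A0; set A := _ / _; lra.
have : rint D = 0 by apply: (cvg_unique _ (rint_FTC dP cD lD) P0); exact: Rhausdorff.
rewrite /D rintD; [|exact: l1|exact: L1Z].
by rewrite (rintZ _ l2) -/(cgs e t) mulNr => /eqP; rewrite subr_eq0 => /eqP.
Qed.

Lemma dcgs e t : 0 < e -> has_deriv (cgs e) t (- (t / e ^+ 2) * cgs e t).
Proof.
move=> e0; rewrite mulNr -gs_parts//.
have l1 u : L1 (fun y => y * gs e y * sin (u * y)).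
  apply: L1_mom => //; first by apply: cont_bmeas; exact: sin_cont.
  by move=> x; exact: sin_le1.
have -> : - rint (fun y => y * gs e y * sin (t * y)) = rint (fun y => - (y * gs e y * sin (t * y))).
  by rewrite -mulN1r -rintZ//; congr rint; apply/funext => y; rewrite mulN1r.
apply: (@deriv_under_integral R _ _ (@lmu R) setT (fun t y => gs e y * cos (t * y))
  (fun t y => - (y * gs e y * sin (t * y))) (fun y => e^-1 * gs (e / 2) y)) => //.
- move=> u; apply: (L1_gs_bdd (B := 1)) => //; first by apply: cont_bmeas; exact: cos_cont.
  by move=> x; exact: cos_le1.
- move=> u y _; have du : has_deriv (fun z => z * y) u y.
    by apply: dval (dmul (did u) (dcst y u)) _; rewrite mul1r mulr0 addr0.
  by apply: dval (dscale (gs e y) (dcos du)) _; ring.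
- by apply: L1Z; apply: L1_gs; rewrite divr_gt0.
- move=> u y _; rewrite normrN normrM; apply: le_trans (gs_moment y e0).
  rewrite normrM (gtr0_norm (gs_gt0 e y)) ler_piMr ?sin_le1// mulr_ge0//.
  by rewrite ltW// gs_gt0.
Qed.

(** By [dcgs] the product of the transform with the inverse Gaussian is constant; its value at 0 is
    the total mass. *)
Lemma cgsE e t : 0 < e -> cgs e t = 2 * pi * normal_pdf 0 e t.
Proof.
move=> e0; pose F t := cgs e t * expR (t ^+ 2 / (e ^+ 2 * 2)).
have dF u : has_deriv F u 0.
  have d2 : has_deriv (fun v => v ^+ 2 / (e ^+ 2 * 2)) u (u / e ^+ 2).
    apply: dval (dmul (dexp 1 (did u)) (dcst (e ^+ 2 * 2)^-1 u)) _.
    by field; rewrite gt_eqF.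
  by apply: dval (dmul (dcgs u e0) (dexpR d2)) _; ring.
have := deriv0_const dF t 0; rewrite /F expr0n/= mul0r expR0 mulr1.
have -> : cgs e 0 = (normal_peak e^-1)^-1.
  by rewrite -rint_gs//; congr rint; apply/funext => y; rewrite mul0r cos0 mulr1.
have pi0 := @pi_gt0 R.
move=> h; have -> : cgs e t = (normal_peak e^-1)^-1 * expR (- (t ^+ 2 / (e ^+ 2 * 2))).
  by rewrite -h -mulrA -expRD subrr expR0 mulr1.
rewrite normal_pdfE ?gt_eqF// mulrA; congr (_ * _); last first.
  by rewrite /normal_fun subr0 mulNr; congr expR; rewrite -[in RHS]mulr_natr.
have q (a b : R) : a != 0 -> (a^-1 ^+ 2 * b *+ 2) * (a ^+ 2 * b *+ 2) = (2 * b) ^+ 2.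
  by move=> a0; rewrite !mulr2n; field.
rewrite /normal_peak invrK; apply: (@mulIf _ (Num.sqrt (e ^+ 2 * pi *+ 2))).
  by rewrite gt_eqF// sqrtr_gt0 mulrn_wgt0// mulr_gt0// exprn_gt0.
rewrite mulfVK; last by rewrite gt_eqF// sqrtr_gt0 mulrn_wgt0// mulr_gt0// exprn_gt0.
rewrite -sqrtrM; last by rewrite mulrn_wge0// mulr_ge0 ?exprn_ge0 ?invr_ge0 ?ltW.
rewrite q ?gt_eqF// sqrtr_sqr gtr0_norm// mulr_gt0//.
Qed.

Lemma sgs0 e t : 0 < e -> rint (fun y => gs e y * sin (t * y)) = 0.
Proof.
move=> e0; apply: rint_odd.
- by apply: cont_mul; [exact: cont_gs|exact: sin_cont].
- apply: (L1_gs_bdd (B := 1)) => //; first by apply: cont_bmeas; exact: sin_cont.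
  by move=> x; exact: sin_le1.
- by move=> x; rewrite /gs mulrN sqrrN mulrN sinN mulrN.
Qed.

(** In place of a tail estimate: at distance at least [d] from [l], the density of width [s] is at
    most [6 * s^2 / d^2] times the density of width [2 * s], which has mass 1. *)
Lemma pdf_approx h B l : bmeas h -> (forall x, `|h x| <= B) -> {for l, continuous h} ->
  rint (fun x => normal_pdf l n.+1%:R^-1 x * h x) @[n --> \oo] --> h l.
Proof.
move=> mh hB hc; have B0 : 0 <= B by exact: le_trans (hB l).
apply/cvg_epsP => r r0; have r2 : 0 < r / 2 by rewrite divr_gt0.
move/cvgrPdist_le: hc => /(_ _ r2)[d /= d0 hd].
have K0 : 0 < 2 * B * (6 / d ^+ 2) + 1.
  by rewrite ltr_wpDl// !mulr_ge0// invr_ge0 exprn_ge0// ltW.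
have [N hN] := @ex_inv_le R (2 * B * (6 / d ^+ 2)) _ r2; exists N => n hn.
set s := n.+1%:R^-1; have s0 : 0 < s by rewrite invr_gt0.
have s1 : s ^+ 2 <= s by rewrite expr2 ler_piMl ?(ltW s0)// invf_le1 ?ltr0n// ler1n.
have s20 : 0 < 2 * s by rewrite mulr_gt0.
have lp := L1_pdf l s0.
have lph : L1 (fun x => normal_pdf l s x * h x).
  apply: (L1_le (g := fun x => B * normal_pdf l s x)).
  - by apply: measurable_funM => //; exact: measurable_normal_pdf.
  - exact: L1Z.
  - by move=> x; rewrite normrM (ger0_norm (normal_pdf_ge0 l s x)) mulrC ler_wpM2r// normal_pdf_ge0.
have -> : h l - rint (fun x => normal_pdf l s x * h x) =
   rint (fun x => h l * normal_pdf l s x + - 1 * (normal_pdf l s x * h x)).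
  by rewrite rintD ?rintZ ?rint_pdf ?mulr1 ?mulN1r//; exact: L1Z.
have l3 : L1 (fun x => h l * normal_pdf l s x + - 1 * (normal_pdf l s x * h x)).
  by apply: L1D; exact: L1Z.
apply: le_trans (rint_norm l3) _.
(* Continuity of [h] near [l], the ratio of densities elsewhere. That ratio is
   [2 * exp (- 3 * z / 4)] with [z >= d^2 / (2 * s^2)], hence at most [6 * s^2 / d^2]. *)
pose g x := r / 2 * normal_pdf l s x + 2 * B * (6 / d ^+ 2) * s ^+ 2 * normal_pdf l (2 * s) x.
have lg : L1 g by apply: L1D; apply: L1Z => //; exact: L1_pdf.
apply: (@le_trans _ _ (rint g)); last first.
  rewrite rintD ?rintZ ?rint_pdf ?mulr1//; [|exact: L1_pdf|exact: L1Z|by apply: L1Z; exact: L1_pdf].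
  have h1 := hN n hn; rewrite -/s in h1.
  have : 2 * B * (6 / d ^+ 2) * s ^+ 2 <= 2 * B * (6 / d ^+ 2) * s.
    by rewrite ler_wpM2l// !mulr_ge0// invr_ge0 exprn_ge0// ltW.
  lra.
apply: rint_le => //.
  apply: (L1_le (g := fun x => `|h l * normal_pdf l s x + - 1 * (normal_pdf l s x * h x)|)).
  - by apply: measurable_normr; exact: L1_bmeas.
  - by have := integrable_norm l3.
  - by move=> x; rewrite normr_id.
move=> x; have -> : h l * normal_pdf l s x + - 1 * (normal_pdf l s x * h x) =
   (h l - h x) * normal_pdf l s x by ring.
have p0 := normal_pdf_ge0 l s x; have p1 := normal_pdf_ge0 l (2 * s) x.
have C0 : 0 <= 2 * B * (6 / d ^+ 2) * s ^+ 2.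
  by rewrite !mulr_ge0 ?invr_ge0 ?exprn_ge0// ltW.
rewrite normrM (ger0_norm p0); have [xd|xd] := ltP `|l - x| d.
  apply: (@le_trans _ _ (r / 2 * normal_pdf l s x)); last by rewrite lerDl mulr_ge0.
  by rewrite ler_wpM2r// hd.
apply: (@le_trans _ _ (2 * B * (6 / d ^+ 2) * s ^+ 2 * normal_pdf l (2 * s) x)); last first.
  by rewrite lerDr mulr_ge0// ltW.
rewrite (_ : 2 * B * (6 / d ^+ 2) * s ^+ 2 * normal_pdf l (2 * s) x =
  2 * B * (6 / d ^+ 2 * s ^+ 2 * normal_pdf l (2 * s) x)); last by ring.
apply: ler_pM => //.
  by apply: le_trans (ler_normB _ _) _; have := hB l; have := hB x; lra.
have sn : s != 0 by rewrite gt_eqF.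
have s2n : 2 * s != 0 by rewrite gt_eqF.
have pk : normal_peak s = 2 * normal_peak (2 * s).
  rewrite /normal_peak (_ : (2 * s) ^+ 2 * pi *+ 2 = 2 ^+ 2 * (s ^+ 2 * pi *+ 2)); last by rewrite !mulr2n; ring.
  rewrite sqrtrM ?sqr_ge0// sqrtr_sqr ger0_norm//.
  by rewrite invfM mulrA mulfV ?pnatr_eq0// mul1r.
rewrite !normal_pdfE// pk.
set z := (x - l) ^+ 2 / (s ^+ 2 *+ 2).
have -> : normal_fun l s x = expR (- (3 * z / 4)) * normal_fun l (2 * s) x.
  have q (a b : R) : b != 0 -> - a / (b ^+ 2 *+ 2) = - (3 * (a / (b ^+ 2 *+ 2)) / 4) + - a / ((2 * b) ^+ 2 *+ 2).
    by move=> b0; rewrite -[b ^+ 2 *+ 2]mulr_natr -[(2 * b) ^+ 2 *+ 2]mulr_natr; field.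
  by rewrite /normal_fun -expRD; congr expR; exact: q.
have q0 : 0 <= normal_peak (2 * s) * normal_fun l (2 * s) x.
  by rewrite mulr_ge0 ?normal_peak_ge0 ?normal_fun_ge0.
rewrite (_ : 2 * normal_peak (2 * s) * (expR (- (3 * z / 4)) * normal_fun l (2 * s) x) =
   2 * expR (- (3 * z / 4)) * (normal_peak (2 * s) * normal_fun l (2 * s) x)); last by ring.
rewrite ler_wpM2r//.
have dz : d ^+ 2 / (s ^+ 2 *+ 2) <= z.
  rewrite ler_wpM2r ?invr_ge0 ?mulrn_wge0 ?sqr_ge0//.
  by rewrite -(real_normK (num_real (x - l))) distrC; apply: lerXn2r; rewrite ?nnegrE// ltW.
rewrite expRN ler_pdivrMr ?expR_gt0//.
have e1 := expR_ge1Dx (3 * z / 4).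
have d2 : 0 < d ^+ 2 by rewrite exprn_gt0.
have s2 : 0 < s ^+ 2 by rewrite exprn_gt0.
apply: (@le_trans _ _ (6 / d ^+ 2 * s ^+ 2 * (3 * z / 4))); last first.
  by rewrite ler_wpM2l ?mulr_ge0 ?invr_ge0 ?(ltW d2) ?(ltW s2)//; lra.
have := ler_wpM2l (ltW s2) dz; rewrite -mulr_natr invfM.
have -> : s ^+ 2 * (d ^+ 2 * (s ^- 2 / 2)) = d ^+ 2 / 2 by field.
move=> h3; rewrite -(ler_pM2l d2).
have -> : d ^+ 2 * (6 / d ^+ 2 * s ^+ 2 * (3 * z / 4)) = 9 / 2 * (s ^+ 2 * z) by field; rewrite gt_eqF.
lra.
Qed.

End Gaussians.

(** * Schwartz functions obtained with a Gaussian factor *)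

Section GaussianSchwartz.
Context {R : realType}.
Variable e : R.
Hypothesis e0 : 0 < e.
Implicit Types (u f g : R -> R) (x : R).

(** The successive derivatives are supplied as one sequence of bounded functions, so that
    differentiating is a shift of the sequence. *)
Definition smoothb u := exists us : nat -> R -> R, us 0%N = u /\
  forall n, isd (us n) (us n.+1) /\ exists C, forall x, `|us n x| <= C.

Lemma smoothbZ c u : smoothb u -> smoothb (fun x => c * u x).
Proof.
move=> [us [<- h]]; exists (fun n x => c * us n x); split => // n; have [h1 [C h2]] := h n.
split; first by move=> x; exact: dscale.
by exists (`|c| * C) => x; rewrite normrM ler_wpM2l.
Qed.

Lemma smoothb_deriv u : smoothb u -> exists v, smoothb v /\ isd u v.
Proof.
move=> [us [<- h]]; exists (us 1%N); split; last by have [] := h 0%N.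
by exists (fun n => us n.+1); split => // n; exact: h.
Qed.

Lemma smoothb_bd u : smoothb u -> exists C, forall x, `|u x| <= C.
Proof. by move=> [us [<- h]]; have [] := h 0%N. Qed.

(** A class stable under differentiation, with every member bounded against every power of [x]; its
    members are therefore Schwartz functions. *)
Inductive gpoly : (R -> R) -> Prop :=
| gpoly_mono j u of smoothb u : gpoly (fun x => x ^+ j * u x * gs e x)
| gpoly_add f g of gpoly f & gpoly g : gpoly (fun x => f x + g x).

Lemma gpoly_deriv f : gpoly f -> exists g, gpoly g /\ isd f g.
Proof.
elim=> [j u hu|f1 f2 _ [g1 [h1 d1]] _ [g2 [h2 d2]]]; last first.
  exists (fun x => g1 x + g2 x); split; first exact: gpoly_add.
  by move=> x; exact: dadd.
have [v [hv dv]] := smoothb_deriv hu.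
exists (fun x => x ^+ j.-1 * (j%:R * u x) * gs e x +
  (x ^+ j * v x * gs e x + x ^+ j.+1 * (- e ^+ 2 * u x) * gs e x)); split.
  by do 2?apply: gpoly_add; apply: gpoly_mono => //; exact: smoothbZ.
move=> x; case: j => [|j].
  rewrite (_ : (fun x => _) = fun x => u x * gs e x); last first.
    by apply/funext => y; rewrite expr0 mul1r.
  by apply: dval (dmul (dv x) (dgs e x)) _; rewrite expr0 expr1; ring.
apply: dval (dmul (dmul (dexp j (did x)) (dv x)) (dgs e x)) _.
by rewrite /= mulr1 (exprS x j.+1); ring.
Qed.

Lemma gs_pow k : forall d : R, 0 < d -> exists C, forall x, `|x| ^+ k * gs d x <= C.
Proof.
elim: k => [|k IH] d d0; first by exists 1 => x; rewrite expr0 mul1r gs_le1.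
have d2 : 0 < d / 2 by rewrite divr_gt0.
have [C hC] := IH _ d2; exists (d^-1 * C) => x.
rewrite exprSr -mulrA; apply: le_trans (ler_wpM2l _ (gs_moment x d0)) _; first exact: exprn_ge0.
by rewrite mulrCA ler_wpM2l ?invr_ge0 ?(ltW d0).
Qed.

Lemma gpoly_bd f m : gpoly f -> exists C, forall x, `|x ^+ m * f x| <= C.
Proof.
elim=> [j u hu|f1 f2 _ [C1 h1] _ [C2 h2]]; last first.
  by exists (C1 + C2) => x; rewrite mulrDr (le_trans (ler_normD _ _))// lerD.
have [C hC] := smoothb_bd hu; have [D hD] := gs_pow (m + j) e0.
exists (D * C) => x.
have -> : x ^+ m * (x ^+ j * u x * gs e x) = (x ^+ (m + j) * gs e x) * u x by rewrite exprD; ring.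
by rewrite normrM ler_pM// normrM normrX (gtr0_norm (gs_gt0 e x)).
Qed.

Lemma derive1_isd f g : isd f g -> (f^`())%classic = g.
Proof. by move=> h; apply/funext => x; rewrite derive1E; have [_ ->] := h x. Qed.

Lemma gpoly_derive1n f n : gpoly f -> gpoly (derive1n n f).
Proof.
move=> hf; elim: n => [//|n IH]; rewrite derive1nS.
by have [g [hg /derive1_isd ->]] := gpoly_deriv IH.
Qed.

Lemma gpoly_schwartz f : gpoly f -> schwartz_real f.
Proof.
move=> hf; split=> [n x|m n].
  by have [g [_ h]] := gpoly_deriv (gpoly_derive1n n hf); have [] := h x.
by apply: gpoly_bd; exact: gpoly_derive1n.
Qed.

Lemma schwartz_real0 : schwartz_real (fun _ : R => 0 : R).
Proof.
have h : smoothb (fun=> 0).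
  exists (fun _ _ => 0); split => // n; split; first by move=> x; exact: dcst.
  by exists 0 => x; rewrite normr0.
have := gpoly_schwartz (gpoly_mono 0 h).
by rewrite (_ : (fun x => _) = fun=> 0)//; apply/funext => x; rewrite mulr0 mul0r.
Qed.

Lemma schwartz_of_real f : schwartz_real f -> schwartz (of_real f).
Proof. by move=> hf; split => //; exact: schwartz_real0. Qed.

Lemma smoothb_trig a b B sigma : bddm a B -> bddm b B ->
  smoothb (fun x => trig a b (sigma * x)).
Proof.
move=> ha hb.
(* Each derivative sends the amplitudes [(a, b)] to [(xi b, - xi a)], up to the factor [sigma]. *)
pose ab := fix ab n : (R -> R) * (R -> R) := if n is m.+1 then
  let: (c, d) := ab m in ((fun xi => clip xi * d xi), (fun xi => - (clip xi * c xi))) else (a, b).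
have hab n : bddm (ab n).1 B /\ bddm (ab n).2 B.
  elim: n => [//|n]; rewrite /=; case: (ab n) => c d [/= hc hd].
  by split; [exact: bddm_clip|apply: bddmN; exact: bddm_clip].
exists (fun n x => sigma ^+ n * trig (ab n).1 (ab n).2 (sigma * x)); split.
  by apply/funext => x; rewrite expr0 mul1r.
move=> n; have [h1 h2] := hab n; split; last first.
  exists (`|sigma ^+ n| * (2 * B)) => x; rewrite normrM ler_wpM2l//; exact: trig_le.
move=> x; have := isd_trig h1 h2 (sigma * x); rewrite /=; case: (ab n) => c d /= dt.
apply: dval (dscale (sigma ^+ n) (dcomp dt (dscale sigma (did x)))) _.
by rewrite exprSr; ring.
Qed.

Lemma trig_gs_schwartz a b B sigma : bddm a B -> bddm b B ->
  schwartz (of_real (fun x => trig a b (sigma * x) * gs e x)).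
Proof.
move=> ha hb; apply: schwartz_of_real; apply: gpoly_schwartz.
have := gpoly_mono 0 (smoothb_trig sigma ha hb).
by rewrite (_ : (fun x => _) = fun x => trig a b (sigma * x) * gs e x)//; apply/funext => x; rewrite expr0 mul1r.
Qed.

End GaussianSchwartz.

(** * Hilbert transform of regularised trigonometric integrals *)

Lemma hilbert_algebra (F : fieldType) (q s s1 c1 u v a b : F) : q != 0 -> 2 != 0 :> F ->
  s * ((2 * q)^-1 * (s1 * (a * (q * (u + v))) + c1 * (b * (q * (v - u))))) =
  2^-1 * (a * (u * (s * s1) + v * (s * s1)) - b * (u * (s * c1) - v * (s * c1))).
Proof. by move=> q0 t0; field; rewrite ?q0 ?t0. Qed.

Section HilbertTrigonometric.
Context {R : realType}.
Variables (a b : R -> R) (B sigma : R).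
Hypothesis ma : bmeas a.
Hypothesis mb : bmeas b.
Hypothesis aB : forall xi, `|a xi| <= B.
Hypothesis bB : forall xi, `|b xi| <= B.
Hypothesis sigma0 : 0 < sigma.
Implicit Types (e x y xi eta l : R).

Let ha : bddm a B. Proof. by split; [exact: borel_lebesgue|]. Qed.
Let hb : bddm b B. Proof. by split; [exact: borel_lebesgue|]. Qed.
Let B0 : 0 <= B. Proof. exact: bddm_ge0 ha. Qed.

Lemma bmeas_sg : bmeas (fun x : R => Num.sg x).
Proof.
apply: nondecreasing_measurable => // x y xy.
case: (ltrgtP x 0) => [x0|x0|x0].
- rewrite (ltr0_sg x0); case: (ltrgtP y 0) => [y0|y0|->]; last by rewrite sgr0; lra.
    by rewrite (ltr0_sg y0).
  by rewrite (gtr0_sg y0); lra.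
- by rewrite !gtr0_sg// (lt_le_trans x0).
- by rewrite x0 sgr0 sgr_ge0 -x0.
Qed.

Lemma hilbert_reE (w : R -> R) x : complex.Re (hilbert (of_real w) x) =
  \int[@cmu R]_(xi in [set: R]) (Num.sg xi * ((2 * pi)^-1 *
    (sin (xi * x) * \int[@cmu R]_(y in [set: R]) (w y * cos (xi * y)) +
     cos (xi * x) * \int[@cmu R]_(y in [set: R]) (w y * sin (- xi * y))))).
Proof.
rewrite /hilbert /fourier_multiplier /cintegral /=.
apply: eq_Rintegral => xi _.
rewrite /fourier /cintegral /cis /of_real /=.
rewrite (_ : (fun y => w y * cos _ - _) = fun y => w y * cos (xi * y)); last first.
  by apply/funext => y; rewrite mul0r subr0 cosN (mulrC y).
rewrite (_ : (fun y => w y * sin _ + _) = fun y => w y * sin (- xi * y)); last first.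
  by apply/funext => y; rewrite mul0r addr0 mulNr (mulrC y).
ring.
Qed.

Section Regularized.
Variable e : R.
Hypothesis e0 : 0 < e.
Let w x := trig a b (sigma * x) * gs e x.

Let measR2 (h : R -> R) (k : R * R -> R) : bmeas h -> measurable_fun [set: R * R] k ->
  measurable_fun [set: R * R] (fun z => h (k z)).
Proof. by move=> mh mk; exact: measurableT_comp mh mk. Qed.

Let bcos : bmeas (cos : R -> R). Proof. by apply: cont_bmeas; exact: continuous_cos. Qed.
Let bsin : bmeas (sin : R -> R). Proof. by apply: cont_bmeas; exact: continuous_sin. Qed.
Let bgs : bmeas (gs e). Proof. by apply: cont_bmeas; exact: cont_gs. Qed.

Let mlin (c : R) : measurable_fun [set: R * R] (fun z : R * R => c * z.1 * z.2).
Proof.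
apply: measurable_funM => //; apply: measurable_funM => //.
Qed.

Let trig2 (z : R * R) := a z.2 * cos (sigma * z.1 * z.2) + b z.2 * sin (sigma * z.1 * z.2).

Let mtrig2 : measurable_fun [set: R * R] trig2.
Proof.
apply: measurable_funD; apply: measurable_funM.
- exact: (measR2 ma measurable_snd).
- exact: (measR2 bcos (mlin sigma)).
- exact: (measR2 mb measurable_snd).
- exact: (measR2 bsin (mlin sigma)).
Qed.

Let trig2_le z : `|trig2 z| <= 2 * B.
Proof.
apply: le_trans (ler_normD _ _) _; rewrite !normrM mulr2n mulrDl mul1r.
by apply: lerD; rewrite -[leRHS]mulr1 ler_pM// ?cos_le1 ?sin_le1.
Qed.

Let wint (h : R -> R) : bmeas h -> (forall x, `|h x| <= 1) ->
  rint (fun y => w y * h y) = itg 0 1 (fun eta => rint (fun y => trig2 (y, eta) * (gs e y * h y))).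
Proof.
move=> mh h1.
have h2 : forall z : R * R, `|trig2 z * (gs e z.1 * h z.1)| <= 2 * B * gs e z.1.
  move=> z; rewrite normrM; apply: ler_pM => //.
  by rewrite normrM (gtr0_norm (gs_gt0 e _)) ler_piMr// ltW// gs_gt0.
have lg : L1 (fun x => 2 * B * gs e x) by apply: L1Z; exact: L1_gs.
have [||eta|l1 _] := @Fubini01 R (fun z => trig2 z * (gs e z.1 * h z.1)) (2 * B) (rint (fun x => 2 * B * gs e x)).
- apply: measurable_funM => //; apply: measurable_funM.
  + exact: (measR2 bgs measurable_fst).
  + exact: (measR2 mh measurable_fst).
- by move=> z; apply: le_trans (h2 z) _; rewrite ler_piMr ?gs_le1// mulr_ge0.
- have -> : (rint (fun x => 2 * B * gs e x))%:E = (\int[@lmu R]_x (2 * B * gs e x)%:E)%E.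
    by rewrite /rint /Rintegral fineK//; exact: integrable_fin_num.
  apply: ge0_le_integral => //.
  + apply/measurable_EFinP; apply: measurable_normr; apply: measurable_funM.
      exact: measurableT_comp mtrig2 (measurable_pair2 eta).
    exact: measurable_funM.
  + by apply/measurable_EFinP; exact: L1_bmeas lg.
  + by move=> x _; rewrite lee_fin; exact: h2 (x, eta).
move=> <-; congr rint; apply/funext => y.
rewrite -[LHS]mulrA mulrC -itgZ; last exact: (trig_locint _ ha hb).
by apply: eq_itg => eta _; rewrite /trig2 /= mulrC.
Qed.

Let cc (p q : R) : cos p * cos q = 2^-1 * (cos (q - p) + cos (q + p)).
Proof. by rewrite cosB cosD; field. Qed.
Let ss (p q : R) : sin p * sin q = 2^-1 * (cos (q - p) - cos (q + p)).
Proof. by rewrite cosB cosD; field. Qed.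
Let sc (p q : R) : sin p * cos q = 2^-1 * (sin (q + p) - sin (q - p)).
Proof. by rewrite sinB sinD; field. Qed.
Let cs (p q : R) : cos p * sin q = 2^-1 * (sin (q + p) + sin (q - p)).
Proof. by rewrite sinB sinD; field. Qed.

Let L1c t : L1 (fun y => gs e y * cos (t * y)).
Proof.
apply: (L1_gs_bdd (B := 1)) => //; first by apply: cont_bmeas; exact: cos_cont.
by move=> x; exact: cos_le1.
Qed.

Let L1s t : L1 (fun y => gs e y * sin (t * y)).
Proof.
apply: (L1_gs_bdd (B := 1)) => //; first by apply: cont_bmeas; exact: sin_cont.
by move=> x; exact: sin_le1.
Qed.

Let rint4 (c1 c2 c3 c4 t1 t2 : R) :
  rint (fun y => (c1 * (gs e y * cos (t1 * y)) + c2 * (gs e y * cos (t2 * y))) +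
                 (c3 * (gs e y * sin (t1 * y)) + c4 * (gs e y * sin (t2 * y)))) =
  c1 * cgs e t1 + c2 * cgs e t2.
Proof.
have l1 := L1Z c1 (L1c t1); have l2 := L1Z c2 (L1c t2).
have l3 := L1Z c3 (L1s t1); have l4 := L1Z c4 (L1s t2).
rewrite rintD; [|exact: L1D|exact: L1D].
rewrite (rintD l1 l2) (rintD l3 l4) (rintZ _ (L1c t1)) (rintZ _ (L1c t2)).
by rewrite (rintZ _ (L1s t1)) (rintZ _ (L1s t2)) !sgs0// !mulr0 !addr0.
Qed.

Let pdf0 := normal_pdf (0 : R) e.

(** The Gaussian factor smears the frequency [sigma * eta] into normal densities of width [e] around
    [sigma * eta] and [- sigma * eta]. *)
Lemma wcos xi : rint (fun y => w y * cos (xi * y)) =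
  itg 0 1 (fun eta => a eta * (pi * (pdf0 (xi - sigma * eta) + pdf0 (xi + sigma * eta)))).
Proof.
rewrite wint; [|by apply: cont_bmeas; exact: cos_cont|by move=> x; exact: cos_le1].
apply: eq_itg => eta _.
transitivity (2^-1 * a eta * cgs e (xi - sigma * eta) + 2^-1 * a eta * cgs e (xi + sigma * eta)).
  rewrite -(rint4 _ _ (- (2^-1 * b eta)) (2^-1 * b eta)); congr rint; apply/funext => y.
  rewrite /trig2 /= (_ : _ * _ = gs e y * (a eta * (cos (sigma * y * eta) * cos (xi * y)) +
     b eta * (sin (sigma * y * eta) * cos (xi * y)))); last by ring.
  rewrite cc sc (_ : xi * y - sigma * y * eta = (xi - sigma * eta) * y); last by ring.
  rewrite (_ : xi * y + sigma * y * eta = (xi + sigma * eta) * y); last by ring.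
  ring.
by rewrite !cgsE// -/pdf0; field.
Qed.

Lemma wsin xi : rint (fun y => w y * sin (xi * y)) =
  itg 0 1 (fun eta => b eta * (pi * (pdf0 (xi - sigma * eta) - pdf0 (xi + sigma * eta)))).
Proof.
rewrite wint; [|by apply: cont_bmeas; exact: sin_cont|by move=> x; exact: sin_le1].
apply: eq_itg => eta _.
transitivity (2^-1 * b eta * cgs e (xi - sigma * eta) + - (2^-1 * b eta) * cgs e (xi + sigma * eta)).
  rewrite -(rint4 _ _ (2^-1 * a eta) (2^-1 * a eta)); congr rint; apply/funext => y.
  rewrite /trig2 /= (_ : _ * _ = gs e y * (a eta * (cos (sigma * y * eta) * sin (xi * y)) +
     b eta * (sin (sigma * y * eta) * sin (xi * y)))); last by ring.
  rewrite cs ss (_ : xi * y - sigma * y * eta = (xi - sigma * eta) * y); last by ring.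
  rewrite (_ : xi * y + sigma * y * eta = (xi + sigma * eta) * y); last by ring.
  ring.
by rewrite !cgsE// -/pdf0; field.
Qed.

Let pdfB xi l : pdf0 (xi - l) = normal_pdf l e xi.
Proof. by rewrite /pdf0 !normal_pdfE ?gt_eqF// /normal_fun subr0. Qed.

Let pdfD xi l : pdf0 (xi + l) = normal_pdf (- l) e xi.
Proof. by rewrite -pdfB opprK. Qed.

Let pdfN xi : pdf0 (- xi) = pdf0 xi.
Proof. by rewrite /pdf0 !normal_pdfE ?gt_eqF// /normal_fun !subr0 sqrrN. Qed.

Let bpdf0 : bmeas pdf0. Proof. exact: measurable_normal_pdf. Qed.

Let pdf0_bd t : `|pdf0 t| <= normal_peak e.
Proof. by rewrite ger0_norm ?normal_pdf_ge0// normal_pdf_ub// gt_eqF. Qed.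

Definition gavg l (h : R -> R) := rint (fun xi => normal_pdf l e xi * h xi).

Lemma L1_gavg l (h : R -> R) : bmeas h -> (forall x, `|h x| <= 1) -> L1 (fun xi => normal_pdf l e xi * h xi).
Proof.
move=> mh h1; apply: (L1_le _ (L1_pdf l e0)).
  by apply: measurable_funM => //; exact: measurable_normal_pdf.
by move=> x; rewrite normrM (ger0_norm (normal_pdf_ge0 _ _ _)) ler_piMr// normal_pdf_ge0.
Qed.

Lemma gavg_le l (h : R -> R) : bmeas h -> (forall x, `|h x| <= 1) -> `|gavg l h| <= 1.
Proof.
move=> mh h1; have lh := L1_gavg l mh h1.
apply: le_trans (rint_norm lh) _; rewrite -(rint_pdf l e0); apply: rint_le.
- by have := integrable_norm lh.
- exact: L1_pdf.
- by move=> x; rewrite normrM (ger0_norm (normal_pdf_ge0 _ _ _)) ler_piMr// normal_pdf_ge0.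
Qed.

Definition hsin x xi := Num.sg xi * sin (xi * x).
Definition hcos x xi := Num.sg xi * cos (xi * x).

Let sg_le1 (xi : R) : `|Num.sg xi| <= 1.
Proof. by rewrite normr_sg; case: (xi != 0). Qed.

Let bsinx x : bmeas (fun xi => sin (xi * x)).
Proof. by apply: cont_bmeas; under eq_fun do rewrite mulrC; exact: sin_cont. Qed.
Let bcosx x : bmeas (fun xi => cos (xi * x)).
Proof. by apply: cont_bmeas; under eq_fun do rewrite mulrC; exact: cos_cont. Qed.

Lemma bmeas_hsin x : bmeas (hsin x).
Proof. exact: (measurable_funM bmeas_sg (bsinx x)). Qed.
Lemma bmeas_hcos x : bmeas (hcos x).
Proof. exact: (measurable_funM bmeas_sg (bcosx x)). Qed.
Lemma hsin_le1 x xi : `|hsin x xi| <= 1.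
Proof. by rewrite normrM mulr_ile1 ?sin_le1. Qed.
Lemma hcos_le1 x xi : `|hcos x xi| <= 1.
Proof. by rewrite normrM mulr_ile1 ?cos_le1. Qed.

(** Contribution of [eta] to the Hilbert transform: the multiplier [sg] averaged around the two
    smeared frequencies. *)
Definition havg x eta := 2^-1 *
  (a eta * (gavg (sigma * eta) (hsin x) + gavg (- (sigma * eta)) (hsin x)) -
   b eta * (gavg (sigma * eta) (hcos x) - gavg (- (sigma * eta)) (hcos x))).

Let F2 x (z : R * R) := 2^-1 *
  (a z.2 * (pdf0 (z.1 - sigma * z.2) * hsin x z.1 + pdf0 (z.1 + sigma * z.2) * hsin x z.1) -
   b z.2 * (pdf0 (z.1 - sigma * z.2) * hcos x z.1 - pdf0 (z.1 + sigma * z.2) * hcos x z.1)).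

Let mF2 x : measurable_fun [set: R * R] (F2 x).
Proof.
have m1 : measurable_fun [set: R * R] (fun z : R * R => pdf0 (z.1 - sigma * z.2)).
  by apply: measR2 => //; apply: measurable_funB => //; exact: measurable_funM.
have m2 : measurable_fun [set: R * R] (fun z : R * R => pdf0 (z.1 + sigma * z.2)).
  by apply: measR2 => //; apply: measurable_funD => //; exact: measurable_funM.
have m3 : measurable_fun [set: R * R] (fun z : R * R => hsin x z.1).
  by apply: measR2 => //; exact: bmeas_hsin.
have m4 : measurable_fun [set: R * R] (fun z : R * R => hcos x z.1).
  by apply: measR2 => //; exact: bmeas_hcos.
have m5 : measurable_fun [set: R * R] (fun z : R * R => a z.2) by apply: measR2.
have m6 : measurable_fun [set: R * R] (fun z : R * R => b z.2) by apply: measR2.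
apply: measurable_funM => //; apply: measurable_funB; apply: measurable_funM => //.
  by apply: measurable_funD; exact: measurable_funM.
by apply: measurable_funB; exact: measurable_funM.
Qed.

Let F2_le x z : `|F2 x z| <= B * (pdf0 (z.1 - sigma * z.2) + pdf0 (z.1 + sigma * z.2)).
Proof.
rewrite /F2; set p1 := pdf0 _; set p2 := pdf0 (_ + _).
have p10 : 0 <= p1 by exact: normal_pdf_ge0.
have p20 : 0 <= p2 by exact: normal_pdf_ge0.
have h1 (c u v : R) : `|c| <= B -> `|u| <= p1 -> `|v| <= p2 -> `|c * (u + v)| <= B * (p1 + p2).
  by move=> *; rewrite normrM ler_pM// (le_trans (ler_normD _ _))// lerD.
have h (k t : R) : 0 <= k -> `|t| <= 1 -> `|k * t| <= k.
  by move=> k0 t1; rewrite normrM ger0_norm// ler_piMr.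
rewrite normrM ger0_norm ?invr_ge0// ler_pdivrMl//.
apply: le_trans (ler_normB _ _) _; rewrite mulr2n mulrDl mul1r; apply: lerD.
  by apply: h1 => //; apply: h => //; exact: hsin_le1.
by apply: h1 => //; rewrite ?normrN; apply: h => //; exact: hcos_le1.
Qed.

(** The integrals over [xi] and [eta] are exchanged, so that the sign in the multiplier acts inside
    the averages [gavg]. *)
Lemma hilbert_reg x : complex.Re (hilbert (of_real w) x) = itg 0 1 (havg x) /\
  bmeas (havg x).
Proof.
have pk0 : 0 <= normal_peak e by exact: normal_peak_ge0.
have bw : bmeas w.
  apply: cont_bmeas; apply: cont_mul; last exact: cont_gs.
  move=> y; apply: (@dcont R y (fun y => trig a b (sigma * y)) (sigma * 1 * _)).
  by apply: dcomp (isd_trig ha hb (sigma * y)) (dscale sigma (did y)).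
have [||eta|l1 m1 f1] := @Fubini01 R (F2 x) (B * (normal_peak e + normal_peak e)) (B * (1 + 1)).
- exact: mF2.
- move=> z; apply: le_trans (F2_le x z) _; rewrite ler_wpM2l// lerD//.
    by have := pdf0_bd (z.1 - sigma * z.2); rewrite ger0_norm// normal_pdf_ge0.
  by have := pdf0_bd (z.1 + sigma * z.2); rewrite ger0_norm// normal_pdf_ge0.
- have lg : L1 (fun xi => B * (normal_pdf (sigma * eta) e xi + normal_pdf (- (sigma * eta)) e xi)).
    by apply: L1Z; apply: L1D; exact: L1_pdf.
  have -> : (B * (1 + 1))%:E = (\int[@lmu R]_xi (B * (normal_pdf (sigma * eta) e xi + normal_pdf (- (sigma * eta)) e xi))%:E)%E.
    have := rintZ B (L1D (L1_pdf (sigma * eta) e0) (L1_pdf (- (sigma * eta)) e0)).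
    rewrite rintD; [|exact: L1_pdf|exact: L1_pdf]; rewrite !rint_pdf// => <-.
    by rewrite /rint /Rintegral fineK//; exact: integrable_fin_num.
  apply: ge0_le_integral => //.
  + apply/measurable_EFinP; apply: measurable_normr.
    exact: measurableT_comp (mF2 x) (measurable_pair2 eta).
  + by apply/measurable_EFinP; exact: L1_bmeas lg.
  + by move=> xi _; rewrite lee_fin -pdfB -pdfD; exact: F2_le x (xi, eta).
have E eta : rint (fun xi => F2 x (xi, eta)) = havg x eta.
  have ls l := L1_gavg l (bmeas_hsin x) (hsin_le1 x).
  have lc l := L1_gavg l (bmeas_hcos x) (hcos_le1 x).
  have lz l := L1Z (-1) (lc l).
  have l12 := L1D (ls (sigma * eta)) (ls (- (sigma * eta))).
  have l34 := L1D (lc (sigma * eta)) (lz (- (sigma * eta))).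
  rewrite (_ : (fun xi => F2 x (xi, eta)) = fun xi => 2^-1 *
    (a eta * (normal_pdf (sigma * eta) e xi * hsin x xi + normal_pdf (- (sigma * eta)) e xi * hsin x xi) +
     - b eta * (normal_pdf (sigma * eta) e xi * hcos x xi + -1 * (normal_pdf (- (sigma * eta)) e xi * hcos x xi)))); last first.
    by apply/funext => xi; rewrite /F2 /= pdfB pdfD; ring.
  rewrite (rintZ _ (L1D (L1Z (a eta) l12) (L1Z (- b eta) l34))) (rintD (L1Z _ l12) (L1Z _ l34)).
  rewrite (rintZ _ l12) (rintZ _ l34) (rintD (ls _) (ls _)) (rintD (lc _) (lz _)) (rintZ _ (lc _)).
  by rewrite mulN1r mulNr.
have E1 : (fun eta => rint (fun xi => F2 x (xi, eta))) = havg x by apply/funext.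
rewrite E1 in m1 f1; split => //; rewrite -f1 hilbert_reE.
have lam (h : R -> R) : bddm h (normal_peak e + normal_peak e) -> locint (fun eta => a eta * (pi * h eta)).
  move=> [mh hh]; under eq_fun do rewrite mulrCA; apply: locintZ.
  by apply: (locint_mulf _ aB mh hh); exact: borel_lebesgue.
have lbm (h : R -> R) : bddm h (normal_peak e + normal_peak e) -> locint (fun eta => b eta * (pi * h eta)).
  move=> [mh hh]; under eq_fun do rewrite mulrCA; apply: locintZ.
  by apply: (locint_mulf _ bB mh hh); exact: borel_lebesgue.
have bh1 t : bddm (fun eta => pdf0 (t - sigma * eta) + pdf0 (t + sigma * eta)) (normal_peak e + normal_peak e).
  split; last by move=> eta; apply: le_trans (ler_normD _ _) _; apply: lerD.
  apply: borel_lebesgue; apply: measurable_funD; apply: measurableT_comp bpdf0 _.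
    by apply: measurable_funB => //; exact: measurable_funM.
  by apply: measurable_funD => //; exact: measurable_funM.
have bh2 t : bddm (fun eta => pdf0 (t - sigma * eta) - pdf0 (t + sigma * eta)) (normal_peak e + normal_peak e).
  split; last by move=> eta; apply: le_trans (ler_normB _ _) _; apply: lerD.
  apply: borel_lebesgue; apply: measurable_funB; apply: measurableT_comp bpdf0 _.
    by apply: measurable_funB => //; exact: measurable_funM.
  by apply: measurable_funD => //; exact: measurable_funM.
transitivity (\int[@cmu R]_(xi in [set: R]) itg 0 1 (fun eta => F2 x (xi, eta))); last first.
  by rewrite Rintegral_completed; [|exact: measurableT|exact: L1_bmeas l1].
apply: eq_Rintegral => xi _.
rewrite !Rintegral_completed//; [|by apply: measurable_funM => //; apply: cont_bmeas; exact: sin_cont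
  |by apply: measurable_funM => //; apply: cont_bmeas; exact: cos_cont].
rewrite -!/(rint _) wcos wsin -!itgZ; [|exact: lbm|exact: lam].
rewrite -itgD; [|apply: locintZ; exact: lam|apply: locintZ; exact: lbm].
have pi0 := @pi_gt0 R; have pin : pi != 0 :> R by rewrite gt_eqF.
rewrite -itgZ; last by apply: locintD; apply: locintZ; [exact: lam|exact: lbm].
rewrite -itgZ; last by apply: locintZ; apply: locintD; apply: locintZ; [exact: lam|exact: lbm].
apply: eq_itg => eta _; rewrite /F2 /hsin /hcos /=.
have -> : pdf0 (- xi - sigma * eta) = pdf0 (xi + sigma * eta) by rewrite -pdfN; congr pdf0; ring.
have -> : pdf0 (- xi + sigma * eta) = pdf0 (xi - sigma * eta) by rewrite -pdfN; congr pdf0; ring.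
exact: hilbert_algebra.
Qed.

Lemma havg_le x eta : `|havg x eta| <= 2 * B.
Proof.
have gs' l := gavg_le l (bmeas_hsin x) (hsin_le1 x).
have gc' l := gavg_le l (bmeas_hcos x) (hcos_le1 x).
have h (c u v : R) : `|c| <= B -> `|u| <= 1 -> `|v| <= 1 -> `|c * (u + v)| <= B * (1 + 1).
  by move=> *; rewrite normrM ler_pM// (le_trans (ler_normD _ _))// lerD.
rewrite /havg normrM ger0_norm ?invr_ge0// ler_pdivrMl//.
apply: le_trans (ler_normB _ _) _.
apply: le_trans (lerD (h _ _ _ (aB eta) (gs' _) (gs' _)) (h _ _ (- _) (bB eta) (gc' _) _)) _.
  by rewrite normrN gc'.
lra.
Qed.

End Regularized.

(** As the width shrinks the averages concentrate at [sigma * eta] and its opposite, near which the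
    sign is constant because [eta > 0]. *)
Lemma havg_cvg x eta : 0 < eta < 1 ->
  havg n.+1%:R^-1 x eta @[n --> \oo] --> a eta * sin (sigma * x * eta) - b eta * cos (sigma * x * eta).
Proof.
move=> /andP[t0 _]; set l := sigma * eta; have l0 : 0 < l by rewrite mulr_gt0.
have csg (m : R) (h : R -> R) : m != 0 -> continuous h -> {for m, continuous (fun xi => Num.sg xi * h xi)}.
  move=> m0 hc.
  have near_sg : \forall y \near m, Num.sg m * h y = Num.sg y * h y.
    have [ml|mg|e] := ltrgtP m 0; last by rewrite e eqxx in m0.
      near=> y; rewrite (ltr0_sg ml) ltr0_sg//; near: y; exact: lt_nbhsl.
    near=> y; rewrite (gtr0_sg mg) gtr0_sg//; near: y; exact: lt_nbhsr.
  rewrite /continuous_at; apply: cvg_trans; first by apply: near_eq_cvg; exact: near_sg.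
  by apply: (@cont_mul R (fun=> Num.sg m) h (@cont_cst R _) hc m).
have cs1 : continuous (fun xi => sin (xi * x)) by under eq_fun do rewrite mulrC; exact: sin_cont.
have cc1 : continuous (fun xi => cos (xi * x)) by under eq_fun do rewrite mulrC; exact: cos_cont.
have l1 : l != 0 by rewrite gt_eqF.
have l2 : - l != 0 by rewrite oppr_eq0.
have c1 := pdf_approx (bmeas_hsin x) (hsin_le1 x) (csg _ _ l1 cs1).
have c2 := pdf_approx (bmeas_hsin x) (hsin_le1 x) (csg _ _ l2 cs1).
have c3 := pdf_approx (bmeas_hcos x) (hcos_le1 x) (csg _ _ l1 cc1).
have c4 := pdf_approx (bmeas_hcos x) (hcos_le1 x) (csg _ _ l2 cc1).
have -> : a eta * sin (sigma * x * eta) - b eta * cos (sigma * x * eta) =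
  2^-1 * (a eta * (hsin x l + hsin x (- l)) - b eta * (hcos x l - hcos x (- l))).
  by rewrite /hsin /hcos sgrN (gtr0_sg l0) /l (mulrAC sigma x) !mulNr sinN cosN; field.
by rewrite /havg /gavg; apply: cvgMr; apply: cvgB; apply: cvgMr; [exact: (cvgD c1 c2)|exact: (cvgB c3 c4)].
Unshelve. all: by end_near. Qed.

End HilbertTrigonometric.

(** * Hilbert transform bounds in the lattice *)

Section HilbertLattice.
Context {R : realType} (X : banach_lattice R).
Local Notation S := (rset X).
Local Notation p := (rnorm X).

Lemma re_bl (f : R -> R[i]) : X f -> S (fun x => complex.Re (f x)) /\
  p (fun x => complex.Re (f x)) <= bl_norm X f.
Proof.
move=> Xf; have [mf _] := bl_measurable Xf; apply: bl_ideal => //.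
by apply: aeW => x; rewrite normc_real; case: (f x) => u v /=; rewrite -sqrtr_sqr ler_wsqrtr// lerDl sqr_ge0.
Qed.

Lemma im_bl (f : R -> R[i]) : X f -> S (fun x => complex.Im (f x)) /\
  p (fun x => complex.Im (f x)) <= bl_norm X f.
Proof.
move=> Xf; have [_ mf] := bl_measurable Xf; apply: bl_ideal => //.
by apply: aeW => x; rewrite normc_real; case: (f x) => u v /=; rewrite -sqrtr_sqr ler_wsqrtr// lerDr sqr_ge0.
Qed.

Variable C : R.
Hypothesis C0 : 0 <= C.
Hypothesis hilb : forall f, schwartz f -> X (hilbert f) /\ bl_norm X (hilbert f) <= C * bl_norm X f.

(* Multiplied by a wide Gaussian, the trigonometric integral becomes a Schwartz function; as the
   Gaussian widens, the real part of its Hilbert transform tends to the conjugate integral. *)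
Lemma hilbert_trig (a b : R -> R) B sigma : bmeas a -> bmeas b ->
  (forall xi, `|a xi| <= B) -> (forall xi, `|b xi| <= B) -> 0 < sigma ->
  S (fun x => trig a b (sigma * x)) ->
  S (fun x => trig (fun xi => - b xi) a (sigma * x)) /\
  p (fun x => trig (fun xi => - b xi) a (sigma * x)) <= C * p (fun x => trig a b (sigma * x)).
Proof.
move=> ma mb aB bB sigma0 Su.
pose w n x := trig a b (sigma * x) * gs n.+1%:R^-1 x.
have ha : bddm a B by split; [exact: borel_lebesgue|].
have hb : bddm b B by split; [exact: borel_lebesgue|].
have e0 n : 0 < n.+1%:R^-1 :> R by rewrite invr_gt0.
have sw n : schwartz (of_real (w n)) by exact: (trig_gs_schwartz (e0 n) sigma ha hb).
have pw n : S (w n) /\ p (w n) <= p (fun x => trig a b (sigma * x)).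
  apply: rset_le => //.
    apply: lmeasM; first exact: (rmeas Su).
    by apply: lmeas_cont; exact: cont_gs.
  by move=> x; rewrite normrM (gtr0_norm (gs_gt0 _ _)) ler_piMr ?gs_le1.
have hw n := hilb (sw n).
apply: (rset_liminf (u := fun n x => complex.Re (hilbert (of_real (w n)) x))) => [n|n|x].
- exact: (re_bl (hw n).1).1.
- apply: le_trans (re_bl (hw n).1).2 _; apply: le_trans (hw n).2 _.
  by apply: ler_wpM2l => //; exact: (pw n).2.
- have hr n := hilbert_reg sigma ma mb aB bB (e0 n) x.
  rewrite (_ : (fun n => _) = (fun n => itg 0 1 (havg a b sigma n.+1%:R^-1 x))); last first.
    by apply/funext => n; rewrite -(hr n).1.
  have -> : trig (fun xi => - b xi) a (sigma * x) =
      itg 0 1 (fun xi => a xi * sin (sigma * x * xi) - b xi * cos (sigma * x * xi)).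
    by apply: eq_itg => xi _; ring.
  apply: (itg_bdd_cvg (B := 2 * B)) => [n||n xi|xi].
  + exact: borel_lebesgue (hr n).2.
  + apply: lmeasB; apply: lmeasM; rewrite ?(borel_lebesgue ma) ?(borel_lebesgue mb)//.
    * exact: borel_lebesgue.
    * by apply: lmeas_cont; exact: sin_cont.
    * exact: borel_lebesgue.
    * by apply: lmeas_cont; exact: cos_cont.
  + exact: havg_le.
  + exact: havg_cvg.
Qed.

End HilbertLattice.

(** * The sampling operator on sequences *)

Section SamplingOperator.
Context {R : realType} (X : banach_lattice R).
Local Notation S := (rset X).
Local Notation p := (rnorm X).
Variables (CA theta sigma : R).
Hypothesis hCA : steklov_bound X CA.
Hypothesis theta12 : 2^-1 <= theta < 1.
Hypothesis sigma0 : 0 < sigma.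
Implicit Types (s u : R -> R) (c d : int -> R) (x y C D : R).
Local Notation maj := (maj theta sigma).
Local Notation st := (st sigma).
Local Notation sabs := (sabs sigma).
Let theta0 := theta_gt0 theta12.

Definition nodes u : int -> R := fun k => u (node sigma k).

Lemma nodesE u k : nodes u k = u (node sigma k). Proof. by []. Qed.

Lemma majd_rset s u D : lmeas u -> S s -> (forall y, 0 <= s y) -> 0 <= D ->
  (forall x, `|u x| <= D * maj s x) -> S u /\ p u <= D * Cmaj CA theta * p s.
Proof.
move=> mu Ss s0 D0 h; have [Sm pm] := maj_rset hCA theta12 sigma0 Ss s0.
have [Su pu] : S u /\ p u <= p (fun x => D * maj s x).
  apply: rset_le => //; first exact: rsetZ.
  by move=> x; apply: le_trans (h x) (ler_norm _).
split => //; apply: le_trans pu _; rewrite rnormZ// ger0_norm// -mulrA ler_wpM2l//.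
Qed.

Lemma node_dist x : `|node sigma (Num.floor (sigma * x)) - x| <= sigma^-1.
Proof.
have /andP[h1 h2] := floor_itv (sigma * x).
rewrite /node; set k := (Num.floor _)%:~R : R in h1 h2 *.
have e : x = sigma * x / sigma by field; rewrite gt_eqF.
have -> : k / sigma - x = (k - sigma * x) / sigma by rewrite {1}e; field; rewrite gt_eqF.
rewrite normrM (gtr0_norm (_ : 0 < sigma^-1)) ?invr_gt0// ler_piMl ?invr_ge0 ?(ltW sigma0)//.
by move: h2; rewrite intrD ler_norml => h2; apply/andP; split; lra.
Qed.

(** A node lies within [1 / sigma] of every point of its cell, so [maj_shift] spreads the bound at
    the node over the cell. *)
Lemma majd_node s u D : S s -> (forall y, 0 <= s y) -> 0 <= D ->
  (forall x, `|u x| <= D * maj s x) ->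
  S (st (nodes u)) /\ p (st (nodes u)) <= 2 / theta * D * Cmaj CA theta * p s.
Proof.
move=> Ss s0 D0 h; have t0 : 0 <= 2 / theta by rewrite divr_ge0// ltW.
apply: majd_rset => //; first exact: lmeas_st.
  exact: mulr_ge0.
move=> x; apply: le_trans (h _) _; rewrite (mulrC _ D) -mulrA ler_wpM2l//.
by apply: (maj_shift hCA theta12 sigma0 Ss s0); rewrite distrC; exact: node_dist.
Qed.

Lemma st_abs c : S (st c) -> S (sabs c) /\ p (sabs c) = p (st c).
Proof. by move=> h; split; [exact: rset_abs|exact: rnorm_abs]. Qed.

Lemma st_le c d : S (st d) -> (forall k, `|c k| <= `|d k|) -> S (st c) /\ p (st c) <= p (st d).
Proof. by move=> Sd h; apply: rset_le => //; [exact: lmeas_st|move=> x; exact: h]. Qed.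

Section OneKernel.
Variables (K : R -> R) (CK : R).
Hypothesis KC : kdec theta CK K.
Hypothesis contK : continuous K.

Definition Qop c x := zlim (fun k => c k * K (sigma * x - k%:~R)).

Definition CQ := (2 / theta) ^+ 2 * CK.

Lemma CQ_ge0 : 0 <= CQ.
Proof. by rewrite mulr_ge0 ?(kdec_ge0 KC)// exprn_ge0// divr_ge0// ltW. Qed.

Lemma Q_zbdd c x : S (st c) -> zbdd (fun k => c k * K (sigma * x - k%:~R)) (CQ * maj (sabs c) x).
Proof.
move=> Sc r ur; under eq_bigr do rewrite normrM.
by apply: (ksum_le hCA theta12 sigma0 x KC) => //; exact: (st_abs Sc).1.
Qed.

Lemma Q_le c x : S (st c) -> `|Qop c x| <= CQ * maj (sabs c) x.
Proof. by move=> Sc; apply: zlim_le; exact: Q_zbdd. Qed.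

Lemma lmeas_shift k : lmeas (fun x => K (sigma * x - k)).
Proof.
apply: lmeas_cont => x; apply: (@continuous_comp _ _ _ (fun x => sigma * x - k) K); last exact: contK.
apply: (@dcont R x (fun x => sigma * x - k) (sigma * 1 - 0)).
by apply: dsub (dcst k x); apply: dscale; exact: did.
Qed.

Lemma lmeas_zpart c m n : lmeas (fun x => zpart (fun k => c k * K (sigma * x - k%:~R)) m n).
Proof.
under eq_fun do rewrite zpartE.
elim: (zrange 0 m n) => [|k r IH]; first by under eq_fun do rewrite big_nil; exact: lmeas_cst.
under eq_fun do rewrite big_cons; apply: lmeasD => //.
by apply: lmeasM; [exact: lmeas_cst|exact: lmeas_shift].
Qed.

Lemma lmeas_Q c : S (st c) -> lmeas (Qop c).
Proof.
move=> Sc; apply: (lmeas_lim (w := fun n x => zpart (fun k => c k * K (sigma * x - k%:~R)) n n)).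
  by move=> n; exact: lmeas_zpart.
by move=> x; exact: zlim_cvg (Q_zbdd x Sc).
Qed.

Lemma Q_rset c : S (st c) -> S (Qop c) /\ p (Qop c) <= CQ * Cmaj CA theta * p (st c).
Proof.
move=> Sc; have [Sa pa] := st_abs Sc; rewrite -pa.
apply: majd_rset => //; [exact: lmeas_Q|exact: sabs_ge0|exact: CQ_ge0|].
by move=> x; exact: Q_le.
Qed.

Lemma Q_node c : S (st c) -> S (st (nodes (Qop c))) /\
  p (st (nodes (Qop c))) <= 2 / theta * CQ * Cmaj CA theta * p (st c).
Proof.
move=> Sc; have [Sa pa] := st_abs Sc; rewrite -pa.
apply: majd_node => //; [exact: sabs_ge0|exact: CQ_ge0|].
by move=> x; exact: Q_le.
Qed.

Lemma QD c d x : S (st c) -> S (st d) -> Qop (fun k => c k + d k) x = Qop c x + Qop d x.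
Proof.
move=> Sc Sd; rewrite -(zlimD (Q_zbdd x Sc) (Q_zbdd x Sd)).
by congr zlim; apply/funext => k; rewrite mulrDl.
Qed.

Lemma QB c d x : S (st c) -> S (st d) -> Qop (fun k => c k - d k) x = Qop c x - Qop d x.
Proof.
move=> Sc Sd; rewrite -(zlimB (Q_zbdd x Sc) (Q_zbdd x Sd)).
by congr zlim; apply/funext => k; rewrite mulrBl.
Qed.

(** Removal of the central range: the remainder of the sampling series of [c] is the full series of
    this sequence. *)
Definition off m n c k := if k \in zrange 0 m n then 0 else c k.

Lemma off_le m n N c k : (N <= m)%N -> (N <= n)%N -> `|off m n c k| <= `|off N N c k|.
Proof.
move=> hm hn; rewrite /off; case: ifP; first by rewrite normr0.
case: ifP => // kN; rewrite mem_zrange => /negP h; exfalso; apply: h.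
by move: kN; rewrite mem_zrange; case: k => j; lia.
Qed.

Lemma off_st m n c : S (st c) -> S (st (off m n c)).
Proof.
move=> Sc; apply: (st_le Sc _).1 => k; rewrite /off; case: ifP => //.
by rewrite normr0.
Qed.

Lemma Q_off m n c x : S (st c) ->
  Qop c x - zpart (fun k => c k * K (sigma * x - k%:~R)) m n = Qop (off m n c) x.
Proof.
move=> Sc; apply/esym; apply: zlim_eq; apply/cvg_epsP => e e0.
have [N hN] := zlimP (Q_zbdd x Sc) e0; exists (maxn N (maxn m n)) => M hM.
have [hN' [hm hn]] : (N <= M)%N /\ (m <= M)%N /\ (n <= M)%N.
  by rewrite !geq_max in hM; case/and3P: hM.
have -> : zpart (fun k => off m n c k * K (sigma * x - k%:~R)) M M =
    zpart (fun k => c k * K (sigma * x - k%:~R)) M M - zpart (fun k => c k * K (sigma * x - k%:~R)) m n.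
  rewrite /zpart.
  rewrite (big_cat_nat (leq0n n) hn) (big_cat_nat (leq0n m) hm) /=.
  rewrite [in RHS](big_cat_nat (leq0n n) hn) [in RHS](big_cat_nat (leq0n m) hm) /=.
  have z1 : \sum_(0 <= k < n) off m n c (Posz k) * K (sigma * x - (Posz k)%:~R) = 0.
    rewrite big_nat big1// => k /andP[_ kn]; rewrite /off mem_zrange kn leq0n mul0r//.
  have z2 : \sum_(0 <= k < m) off m n c (Negz k) * K (sigma * x - (Negz k)%:~R) = 0.
    rewrite big_nat big1// => k /andP[_ kn]; rewrite /off mem_zrange kn leq0n mul0r//.
  have z3 : \sum_(n <= k < M) off m n c (Posz k) * K (sigma * x - (Posz k)%:~R) =
      \sum_(n <= k < M) c (Posz k) * K (sigma * x - (Posz k)%:~R).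
    rewrite !big_nat; apply: eq_bigr => k /andP[kn _]; rewrite /off mem_zrange.
    by rewrite ltnNge kn andbF.
  have z4 : \sum_(m <= k < M) off m n c (Negz k) * K (sigma * x - (Negz k)%:~R) =
      \sum_(m <= k < M) c (Negz k) * K (sigma * x - (Negz k)%:~R).
    rewrite !big_nat; apply: eq_bigr => k /andP[kn _]; rewrite /off mem_zrange.
    by rewrite ltnNge kn andbF.
  by rewrite z1 z2 z3 z4; ring.
by rewrite opprB addrA subrK; apply: hN.
Qed.

(** Every point lies in a cell whose index is eventually removed, so the step functions decrease to
    0 pointwise and order continuity applies. *)
Lemma st_off_cvg c e : roc X -> S (st c) -> 0 < e -> exists N, forall n, (N <= n)%N ->
  p (st (off n n c)) <= e.
Proof.
move=> rocX Sc e0.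
have So n := off_st n n Sc.
have [||N hN] := rocX (fun n => sabs (off n n c)) e (fun n => (st_abs (So n)).1) _ _ e0.
- by move=> x m n mn; apply: off_le.
- move=> x; apply/cvg_epsP => r r0.
  exists (`|Num.floor (sigma * x)|.+1)%N => n hn; rewrite sub0r normrN.
  rewrite sabsE /off normr_id ifT ?normr0 ?(ltW r0)//.
  by rewrite mem_zrange; move: hn; case: (Num.floor _) => j /=; lia.
by exists N => n hn; rewrite -(st_abs (So n)).2; exact: hN.
Qed.

Lemma Q_cvg c e : roc X -> S (st c) -> 0 < e -> exists N, forall m n, (N <= m)%N -> (N <= n)%N ->
  p (fun x => Qop c x - zpart (fun k => c k * K (sigma * x - k%:~R)) m n) <= e.
Proof.
move=> rocX Sc e0; have CC : 0 <= CQ * Cmaj CA theta by rewrite mulr_ge0 ?CQ_ge0// (Cmaj_ge0 hCA theta12).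
have e1 : 0 < e / (CQ * Cmaj CA theta + 1) by rewrite divr_gt0// ltr_wpDl.
have [N hN] := st_off_cvg rocX Sc e1; exists N => m n hm hn.
have So := off_st m n Sc.
rewrite (_ : (fun x => _) = Qop (off m n c)); last by apply/funext => x; exact: Q_off.
apply: le_trans (Q_rset So).2 _.
have [_ h] := st_le (off_st N N Sc) (fun k => @off_le m n N c k hm hn).
apply: (@le_trans _ _ ((CQ * Cmaj CA theta + 1) * (e / (CQ * Cmaj CA theta + 1)))); last first.
  by rewrite mulrC divfK// gt_eqF// ltr_wpDl.
apply: ler_pM => //; first exact: rnorm_ge0.
  by rewrite lerDl.
exact: le_trans h (hN _ (leqnn N)).
Qed.

End OneKernel.

Lemma Q_fin (K : R -> R) (r : seq int) c x : uniq r -> (forall k, k \notin r -> c k = 0) ->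
  Qop K c x = \sum_(k <- r) c k * K (sigma * x - k%:~R).
Proof.
move=> ur hr; apply: zlim_eq; apply/cvg_epsP => e e0.
have [N hN] : exists N, forall k, k \in r -> k \in zrange 0 N N.
  elim: r {ur hr} => [|k r0 [N hN]]; first by exists 0%N.
  exists (maxn N `|k|.+1)%N => l; rewrite inE => /predU1P[->|/hN].
    by rewrite mem_zrange; case: k => j /=; lia.
  by rewrite !mem_zrange; case: l => j; lia.
exists N => n hn; rewrite zpartE.
suff -> : \sum_(k <- zrange 0 n n) c k * K (sigma * x - k%:~R) = \sum_(k <- r) c k * K (sigma * x - k%:~R).
  by rewrite subrr normr0 ltW.
rewrite (bigID (fun k => k \in r)) /= [X in _ + X]big1 ?addr0; last first.
  by move=> k /hr ->; rewrite mul0r.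
rewrite -big_filter; apply: perm_big; apply: uniq_perm => //.
  by apply: filter_uniq; exact: zrange_uniq.
move=> k; rewrite mem_filter; case: (boolP (k \in r)) => //= /hN.
by rewrite !mem_zrange; case: k => j; lia.
Qed.

Lemma rset_st_fin (r : seq int) c : (forall k, k \notin r -> c k = 0) -> S (st c).
Proof.
move=> hr.
have [C hC] : exists C, forall k, `|c k| <= C.
  exists (\sum_(k <- r) `|c k|) => k; have [kr|/hr ->] := boolP (k \in r); last by rewrite normr0 sumr_ge0.
  by rewrite (big_rem _ kr) /= lerDl sumr_ge0.
have [M hM] : exists M : R, forall k, k \in r -> `|k%:~R| <= M.
  exists (\sum_(k <- r) `|k%:~R|) => k kr.
  by rewrite (big_rem _ kr) /= lerDl sumr_ge0.
apply: (@rset_bounded _ _ _ (- ((M + 1) / sigma)) ((M + 1) / sigma) C); first exact: lmeas_st.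
  by move=> x; exact: hC.
move=> x hx; apply: hr; apply/negP => /hM h.
have /andP[h1 h2] := floor_itv (sigma * x).
move/negP: hx; apply; rewrite -ler_norml ler_pdivlMr// -(gtr0_norm sigma0) -normrM mulrC.
move: h h1 h2; rewrite intrD; set k := (Num.floor _)%:~R : R.
by rewrite !ler_norml => /andP[? ?] ? ?; apply/andP; split; lra.
Qed.

End SamplingOperator.

(** * One-sided and centred averages *)

Section Averages.
Context {R : realType}.
Implicit Types (u v T : R -> R) (h x y t : R).

Definition adot h u x := h^-1 * itg x (x + h) u.
(** [I] minus the one-sided average, a difference of first order; [cdiff] uses the centred average
    and is of second order. *)
Definition fdiff h u x := u x - adot h u x.
Definition cdiff h u x := u x - stek h u x.

Lemma stekB h u v x : locint u -> locint v -> stek h (fun y => u y - v y) x = stek h u x - stek h v x.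
Proof. by move=> lu lv; rewrite /stek itgB// mulrBr. Qed.

Lemma adotB h u v x : locint u -> locint v -> adot h (fun y => u y - v y) x = adot h u x - adot h v x.
Proof. by move=> lu lv; rewrite /adot itgB// mulrBr. Qed.

Lemma adot_prim h u P x : 0 <= h -> isd P u -> continuous u -> adot h u x = h^-1 * (P (x + h) - P x).
Proof. by move=> h0 dP cu; rewrite /adot (itg_FTC _ dP cu)// lerDl. Qed.

Lemma stek_prim h u P x : 0 <= h -> isd P u -> continuous u ->
  stek h u x = h^-1 * (P (x + h / 2) - P (x - h / 2)).
Proof. by move=> h0 dP cu; rewrite /stek (itg_FTC _ dP cu)//; lra. Qed.

Lemma dshift (F f : R -> R) k x : isd F f -> has_deriv (fun y => F (y + k)) x (f (x + k)).
Proof.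
move=> dF; apply: dval (@dcomp R x (fun y => y + k) F _ _ (dF (x + k)) (dadd (did x) (dcst k x))) _.
by rewrite addr0 mul1r.
Qed.

Lemma isd_adot h u u1 : 0 < h -> isd u u1 -> continuous u1 -> isd (adot h u) (adot h u1).
Proof.
move=> h0 du cu1 x; have [P dP] := ex_prim (isd_cont du).
rewrite (_ : adot h u = fun x => h^-1 * (P (x + h) - P x)); last first.
  by apply/funext => y; apply: adot_prim => //; [exact: ltW|exact: isd_cont du].
apply: dval (dscale h^-1 (dsub (dshift h x dP) (dP x))) _.
by rewrite (adot_prim x _ du cu1)// ltW.
Qed.

Lemma isd_fdiff h u u1 : 0 < h -> isd u u1 -> continuous u1 -> isd (fdiff h u) (fdiff h u1).
Proof. by move=> h0 du cu1 x; apply: dsub (du x) _; exact: isd_adot. Qed.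

Lemma cont_shift (F : R -> R) k : continuous F -> continuous (fun y => F (y + k)).
Proof.
move=> cF x; apply: (@continuous_comp _ _ _ (fun y => y + k) F); last exact: cF.
by apply: cont_add; [move=> y; exact: cvg_id|exact: cont_cst].
Qed.

Lemma cont_adot h u : 0 < h -> continuous u -> continuous (adot h u).
Proof.
move=> h0 cu; have [P dP] := ex_prim cu; have cP := isd_cont dP.
rewrite (_ : adot h u = fun x => h^-1 * (P (x + h) - P x)); last first.
  by apply/funext => y; apply: adot_prim => //; exact: ltW.
by apply: cont_mul; [exact: cont_cst|apply: cont_sub => //; exact: cont_shift].
Qed.

Lemma cont_stek h u : 0 < h -> continuous u -> continuous (stek h u).
Proof.
move=> h0 cu; have [P dP] := ex_prim cu; have cP := isd_cont dP.
rewrite (_ : stek h u = fun x => h^-1 * (P (x + h / 2) - P (x - h / 2))); last first.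
  by apply/funext => y; apply: stek_prim => //; exact: ltW.
by apply: cont_mul; [exact: cont_cst|apply: cont_sub; exact: cont_shift].
Qed.

Lemma cont_fdiff h u : 0 < h -> continuous u -> continuous (fdiff h u).
Proof. by move=> h0 cu; apply: cont_sub => //; exact: cont_adot. Qed.

Lemma cont_cdiff h u : 0 < h -> continuous u -> continuous (cdiff h u).
Proof. by move=> h0 cu; apply: cont_sub => //; exact: cont_stek. Qed.

Lemma cont_iter_cdiff h u r : 0 < h -> continuous u -> continuous (iter r (cdiff h) u).
Proof. by move=> h0 cu; elim: r => [//|r IH]; exact: cont_cdiff. Qed.

Lemma cont_norm u : continuous u -> continuous (fun x => `|u x|).
Proof. by move=> cu x; apply: (@continuous_comp _ _ _ u (fun y => `|y|)); [exact: cu|exact: norm_continuous]. Qed.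

Lemma diff_le u u1 x y : isd u u1 -> continuous u1 -> x <= y -> `|u y - u x| <= itg x y (fun t => `|u1 t|).
Proof.
move=> du cu xy; rewrite -(itg_FTC xy du cu); apply: itg_norm.
exact: cont_locint.
Qed.

Lemma itg_mono (f : R -> R) a b c d : continuous f -> (forall x, 0 <= f x) -> c <= a -> b <= d ->
  itg a b f <= itg c d f.
Proof. by move=> cf f0 ca bd; apply: itg_sub => //; exact: cont_locint. Qed.

Lemma avg_le (f : R -> R) a b h K : continuous f -> 0 < h -> b = a + h ->
  (forall t, a <= t <= b -> `|f t| <= K) -> `|h^-1 * itg a b f| <= K.
Proof.
move=> cf h0 -> hf; rewrite normrM gtr0_norm ?invr_gt0// ler_pdivrMl//.
apply: le_trans (itg_norm _ _ (cont_locint cf)) _.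
apply: (@le_trans _ _ (itg a (a + h) (fun=> K))); last first.
  by rewrite itg_cst; [rewrite mulrC addrC addKr|rewrite lerDl ltW].
apply: itg_le => //; apply: cont_locint; [exact: cont_norm|exact: cont_cst].
Qed.

Lemma fdiff_avg h u x : 0 < h -> continuous u -> fdiff h u x = h^-1 * itg x (x + h) (fun t => u x - u t).
Proof.
move=> h0 cu; rewrite itgB; [|by apply: cont_locint; exact: cont_cst|exact: cont_locint].
rewrite itg_cst ?lerDl ?ltW// /fdiff /adot; field; by rewrite gt_eqF.
Qed.

Lemma fdiff_le h u u1 x : 0 < h -> isd u u1 -> continuous u1 ->
  `|fdiff h u x| <= itg x (x + h) (fun t => `|u1 t|).
Proof.
move=> h0 du cu1; have cu := isd_cont du; rewrite fdiff_avg//.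
apply: avg_le => //; first by apply: cont_sub => //; exact: cont_cst.
move=> t /andP[xt th]; rewrite distrC; apply: le_trans (diff_le du cu1 xt) _.
by apply: itg_mono => //; exact: cont_norm.
Qed.

Lemma fdiff2_le h u u1 u2 x : 0 < h -> isd u u1 -> isd u1 u2 -> continuous u2 ->
  `|fdiff h (fdiff h u) x| <= h * itg x (x + 2 * h) (fun t => `|u2 t|).
Proof.
move=> h0 du du1 cu2; have cu1 := isd_cont du1.
apply: le_trans (fdiff_le x h0 (isd_fdiff h0 du cu1) (cont_fdiff h0 cu1)) _.
set K := itg x (x + 2 * h) _.
apply: (@le_trans _ _ (itg x (x + h) (fun=> K))); last first.
  by rewrite itg_cst; [rewrite mulrC addrC addKr|rewrite lerDl ltW].
apply: itg_le; [by apply: cont_locint; apply: cont_norm; exact: cont_fdiff|by apply: cont_locint; exact: cont_cst|].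
move=> t /andP[xt th]; apply: le_trans (fdiff_le t h0 du1 cu2) _.
apply: itg_mono => //; [exact: cont_norm|lra].
Qed.

Lemma cdiff_le h u u1 x : 0 < h -> isd u u1 -> continuous u1 ->
  `|cdiff h u x| <= itg (x - h / 2) (x + h / 2) (fun t => `|u1 t|).
Proof.
move=> h0 du cu1; have cu := isd_cont du.
have -> : cdiff h u x = h^-1 * itg (x - h / 2) (x + h / 2) (fun t => u x - u t).
  rewrite itgB; [|by apply: cont_locint; exact: cont_cst|exact: cont_locint].
  rewrite itg_cst /cdiff /stek; last by lra.
  by field; rewrite gt_eqF.
apply: avg_le => //; [by apply: cont_sub => //; exact: cont_cst|lra|].
move=> t /andP[xt th]; have [tx|/ltW tx] := leP t x.
  apply: le_trans (diff_le du cu1 tx) _; apply: itg_mono => //; [exact: cont_norm|lra].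
rewrite distrC; apply: le_trans (diff_le du cu1 tx) _; apply: itg_mono => //; [exact: cont_norm|lra].
Qed.

(** Symmetry cancels the first derivative: the second difference at distance [t] is at most [I * t],
    and one more integration, carried out on a primitive of [u], yields the average. *)
Lemma cdiff2_le h u u1 u2 x : 0 < h -> isd u u1 -> isd u1 u2 -> continuous u2 ->
  `|cdiff h u x| <= h * itg (x - h / 2) (x + h / 2) (fun t => `|u2 t|).
Proof.
move=> h0 du du1 cu2; have cu1 := isd_cont du1; have cu := isd_cont du.
set I := itg _ _ _.
have I0 : 0 <= I by exact: itg_ge0.
have [P dP] := ex_prim cu.
have dm (F f : R -> R) t : isd F f -> has_deriv (fun t => F (x - t)) t (- f (x - t)).
  move=> dF; apply: dval (@dcomp R t (fun t => x - t) F _ _ (dF (x - t)) (dsub (dcst x t) (did t))) _; ring.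
have dp (F f : R -> R) t : isd F f -> has_deriv (fun t => F (x + t)) t (f (x + t)).
  move=> dF; apply: dval (@dcomp R t (fun t => x + t) F _ _ (dF (x + t)) (dadd (dcst x t) (did t))) _; ring.
have h1 t : 0 <= t <= h / 2 -> `|u (x + t) + u (x - t) - 2 * u x| <= I * t.
  move=> /andP[t0 th].
  have := @mvt_le R (fun t => u (x + t) + u (x - t)) (fun t => u1 (x + t) - u1 (x - t))
    (fun t => I * t) (fun=> I) 0 t t0.
  rewrite addr0 subr0 mulr0 subr0 mulr2n mulrDl mul1r; apply => w /andP[w0 wt].
  - exact: dadd (dp _ _ _ du) (dm _ _ _ du).
  - by apply: dval (dscale I (did w)) _; rewrite mulr1.
  - have xw : x - w <= x + w by lra.
    by apply: le_trans (diff_le du1 cu2 xw) _; apply: itg_mono => //; [exact: cont_norm|lra|lra].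
have h2 : `|P (x + h / 2) - P (x - h / 2) - 2 * (h / 2) * u x| <= I * (h / 2) ^+ 2.
  have hh : 0 <= h / 2 by rewrite divr_ge0// ltW.
  have := @mvt_le R (fun t => P (x + t) - P (x - t) - 2 * t * u x)
    (fun t => u (x + t) + u (x - t) - 2 * u x) (fun t => I * t ^+ 2) (fun t => I * (2 * t)) 0 (h / 2) hh.
  rewrite addr0 subr0 subrr !mulr0 mul0r !subr0 expr0n/= mulr0 subr0; apply => w /andP[w0 wt].
  - apply: dval (dsub (dsub (dp _ _ _ dP) (dm _ _ _ dP)) (dmul (dscale 2 (did w)) (dcst (u x) w))) _; ring.
  - by apply: dval (dscale I (dexp 1 (did w))) _; rewrite expr1; ring.
  - apply: le_trans (h1 w _) _; first by rewrite w0.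
    by rewrite ler_wpM2l//; lra.
rewrite /cdiff (stek_prim x (ltW h0) dP cu).
have -> : u x - h^-1 * (P (x + h / 2) - P (x - h / 2)) =
   - h^-1 * (P (x + h / 2) - P (x - h / 2) - 2 * (h / 2) * u x) by field; rewrite gt_eqF.
have hi : 0 < h^-1 by rewrite invr_gt0.
rewrite normrM normrN (gtr0_norm hi) ler_pdivrMl//.
by apply: le_trans h2 _; nra.
Qed.

Lemma cdiff_local h u x K : 0 < h -> continuous u -> (forall y, `|y - x| <= h -> `|u y| <= K) ->
  `|cdiff h u x| <= 2 * K.
Proof.
move=> h0 cu hK; rewrite mulr2n mulrDl mul1r; apply: le_trans (ler_normB _ _) _; apply: lerD.
  by apply: hK; rewrite subrr normr0 ltW.
apply: avg_le => //; first by lra.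
by move=> t /andP[t1 t2]; apply: hK; rewrite ler_norml; apply/andP; split; lra.
Qed.

Lemma iter_cdiff_local h u r x K : 0 < h -> continuous u ->
  (forall y, `|y - x| <= r%:R * h -> `|u y| <= K) -> `|iter r (cdiff h) u x| <= 2 ^+ r * K.
Proof.
move=> h0 cu; elim: r x => [|r IH] x hK.
  by rewrite expr0 mul1r; apply: hK; rewrite subrr normr0 mul0r.
rewrite exprS -mulrA; apply: cdiff_local => //; first exact: cont_iter_cdiff.
move=> y yx; apply: IH => z zy; apply: hK.
rewrite -(subrKA y) -natr1 mulrDl mul1r; apply: le_trans (ler_normD _ _) _.
by apply: lerD.
Qed.

(* [b] selects between the first ([false]) and the second ([true]) derivative. *)
Definition derivs (b : bool) u us := continuous us /\
  if b then exists u1, isd u u1 /\ isd u1 us else isd u us.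

Lemma derivs_cont b u us : derivs b u us -> continuous u.
Proof. by case: b => -[_]; [move=> [u1 [du _]]|move=> du]; exact: isd_cont du. Qed.

Lemma fdiffs_le b h u us x : 0 < h -> derivs b u us ->
  `|iter b.+1 (fdiff h) u x| <= h ^+ b * itg (x - 2 * h) (x + 2 * h) (fun t => `|us t|).
Proof.
move=> h0; case: b => -[cus]; last first.
  move=> du; rewrite mul1r; apply: le_trans (fdiff_le x h0 du cus) _.
  by apply: itg_mono => //; [exact: cont_norm|lra|lra].
move=> [u1 [du du1]]; rewrite expr1; apply: le_trans (fdiff2_le x h0 du du1 cus) _.
by rewrite ler_pM2l//; apply: itg_mono => //; [exact: cont_norm|lra].
Qed.

Lemma cdiffs_le b h u us x : 0 < h -> derivs b u us ->
  `|cdiff h u x| <= h ^+ b * itg (x - h) (x + h) (fun t => `|us t|).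
Proof.
move=> h0; case: b => -[cus]; last first.
  move=> du; rewrite mul1r; apply: le_trans (cdiff_le x h0 du cus) _.
  by apply: itg_mono => //; [exact: cont_norm|lra|lra].
move=> [u1 [du du1]]; rewrite expr1; apply: le_trans (cdiff2_le x h0 du du1 cus) _.
by rewrite ler_pM2l//; apply: itg_mono => //; [exact: cont_norm|lra|lra].
Qed.

End Averages.

(** * Averages and differences in the lattice *)

Section AveragesLattice.
Context {R : realType} (X : banach_lattice R).
Local Notation S := (rset X).
Local Notation p := (rnorm X).
Variables (CA sigma gamma : R).
Hypothesis hCA : steklov_bound X CA.
Hypothesis sigma0 : 0 < sigma.
Hypothesis gamma0 : 0 < gamma.
Hypothesis gamma1 : gamma <= 1.
Implicit Types (u v : R -> R) (x y : R).
Local Notation h := (gamma / sigma).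
Local Notation st := (st sigma).
Local Notation nodes := (nodes sigma).

Let h0 : 0 < h. Proof. exact: divr_gt0. Qed.
Let CA0 : 0 <= CA. Proof. by case: hCA. Qed.
Let hs : h <= sigma^-1. Proof. by rewrite ler_piMl// invr_ge0 ltW. Qed.

Lemma adot_rset u : S u -> S (adot h u) /\ p (adot h u) <= 2 * CA * p u.
Proof.
move=> Su; have lu := rset_locint Su; have Sa := rset_abs Su.
have h2 : 0 < 2 * h by rewrite mulr_gt0.
have [_ /(_ _ _ Sa h2)[Ss ps]] := hCA; rewrite rnorm_abs// in ps.
have [S1 p1] : S (adot h u) /\ p (adot h u) <= p (fun x => 2 * stek (2 * h) (fun y => `|u y|) x).
  apply: rset_le; last 1 first.
  - move=> x; rewrite (ger0_norm (_ : 0 <= 2 * _)); last first.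
      by rewrite mulr_ge0// mulr_ge0 ?itg_ge0// invr_ge0 ltW.
    rewrite /adot /stek normrM gtr0_norm ?invr_gt0// (_ : 2 * ((2 * h)^-1 * _) = h^-1 * itg (x - 2 * h / 2) (x + 2 * h / 2) (fun y => `|u y|)); last by rewrite [(2 * h)^-1]invfM !mulrA mulfV ?pnatr_eq0// mul1r.
    rewrite ler_wpM2l ?invr_ge0 ?(ltW h0)//; apply: le_trans (itg_norm _ _ lu) _.
    by apply: itg_sub; [exact: locint_abs|by move=> y; exact: normr_ge0|have := h0; lra|have := h0; lra].
  - by apply: lmeasM; [exact: lmeas_cst|apply: itg_window_meas => //; exact: ltW].
  - exact: rsetZ.
split => //; apply: le_trans p1 _; rewrite rnormZ// ger0_norm// -mulrA ler_wpM2l//.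
Qed.

Lemma fdiff_rset u : S u -> S (fdiff h u) /\ p (fdiff h u) <= (1 + 2 * CA) * p u.
Proof.
move=> Su; have [Sa pa] := adot_rset Su; split; first exact: rsetB.
by apply: le_trans (rnormB Su Sa) _; rewrite mulrDl mul1r lerD2l.
Qed.

Lemma cdiff_rset u : S u -> S (cdiff h u) /\ p (cdiff h u) <= (1 + CA) * p u.
Proof.
move=> Su; have [_ /(_ _ _ Su h0)[Sa pa]] := hCA; split; first exact: rsetB.
by apply: le_trans (rnormB Su Sa) _; rewrite mulrDl mul1r lerD2l.
Qed.

Lemma iter_fdiff_rset r u : S u -> S (iter r (fdiff h) u) /\
  p (iter r (fdiff h) u) <= (1 + 2 * CA) ^+ r * p u.
Proof.
move=> Su; elim: r => [|r [IS Ip]]; first by rewrite expr0 mul1r.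
have [S1 p1] := fdiff_rset IS; split => //; apply: le_trans p1 _.
by rewrite exprS -mulrA ler_wpM2l// addr_ge0// mulr_ge0.
Qed.

Lemma iter_cdiff_rset r u : S u -> S (iter r (cdiff h) u) /\
  p (iter r (cdiff h) u) <= (1 + CA) ^+ r * p u.
Proof.
move=> Su; elim: r => [|r [IS Ip]]; first by rewrite expr0 mul1r.
have [S1 p1] := cdiff_rset IS; split => //; apply: le_trans p1 _.
by rewrite exprS -mulrA ler_wpM2l// addr_ge0.
Qed.

Lemma iter_fdiffB r u v : S u -> S v ->
  iter r (fdiff h) (fun x => u x - v x) = (fun x => iter r (fdiff h) u x - iter r (fdiff h) v x).
Proof.
move=> Su Sv; elim: r => [//|r IH]; rewrite /= IH; apply/funext => x; rewrite /fdiff adotB.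
- ring.
- exact: rset_locint (iter_fdiff_rset r Su).1.
- exact: rset_locint (iter_fdiff_rset r Sv).1.
Qed.

Lemma iter_cdiffB r u v : S u -> S v ->
  iter r (cdiff h) (fun x => u x - v x) = (fun x => iter r (cdiff h) u x - iter r (cdiff h) v x).
Proof.
move=> Su Sv; elim: r => [//|r IH]; rewrite /= IH; apply/funext => x; rewrite /cdiff stekB.
- ring.
- exact: rset_locint (iter_cdiff_rset r Su).1.
- exact: rset_locint (iter_cdiff_rset r Sv).1.
Qed.

Lemma loc_norm j s : S s -> S (loc sigma j s) /\ p (loc sigma j s) <= 2 ^+ j.+1 * CA * sigma^-1 * p s.
Proof.
move=> Ss; have [S1 p1] := loc_rset hCA sigma0 j Ss; split => //.
by rewrite -mulrA mulrCA ler_pdivlMl.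
Qed.

Lemma st_loc j s f C : S s -> (forall y, 0 <= s y) -> 0 <= C ->
  (forall x y, `|x - y| <= sigma^-1 -> `|f y| <= C * loc sigma j s x) ->
  S (st (nodes f)) /\ p (st (nodes f)) <= C * (2 ^+ j.+1 * CA * sigma^-1) * p s.
Proof.
move=> Ss s0 C0 hf; have [Sl pl] := loc_norm j Ss.
have [S1 p1] : S (st (nodes f)) /\ p (st (nodes f)) <= p (fun x => C * loc sigma j s x).
  apply: rset_le; [exact: lmeas_st|exact: rsetZ|move=> x].
  rewrite (ger0_norm (_ : 0 <= C * _)); last by rewrite mulr_ge0// loc_ge0.
  by apply: hf; rewrite distrC; exact: node_dist.
split => //; apply: le_trans p1 _; rewrite rnormZ// ger0_norm// -mulrA ler_wpM2l//.
Qed.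

(** Since [h <= 1 / sigma], the window of the average at a node lies in the window of [loc 1] at
    every point of its cell. Node values of an average are thus controlled by the norm of [u]. *)
Lemma stek_node u : S u -> S (st (nodes (stek h u))) /\
  p (st (nodes (stek h u))) <= 4 * CA / gamma * p u.
Proof.
move=> Su; have lu := rset_locint Su; have Sa := rset_abs Su; have hi : 0 <= h^-1 by rewrite invr_ge0 ltW.
have [||S1 p1] := @st_loc 1 (fun y => `|u y|) (stek h u) h^-1 Sa _ hi; first by move=> y; exact: normr_ge0.
  move=> x y xy; rewrite /stek normrM (ger0_norm hi) ler_wpM2l//.
  apply: le_trans (itg_norm _ _ lu) _; rewrite /loc expr1.
  have hh := hs; have hp := h0; have : 0 < sigma^-1 by rewrite invr_gt0.
  move: xy; rewrite ler_norml => /andP[? ?] ?.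
  by apply: itg_sub; [exact: locint_abs|by move=> z; exact: normr_ge0|lra|lra].
split => //; apply: le_trans p1 _; rewrite rnorm_abs//.
rewrite (_ : h^-1 * _ = 4 * CA / gamma)// expr2; field.
by rewrite !gt_eqF.
Qed.

Definition Csub r : R := \sum_(j < r) (4 * CA / gamma * (1 + CA) ^+ j).

Lemma Csub_ge0 r : 0 <= Csub r.
Proof.
apply: sumr_ge0 => j _; rewrite mulr_ge0 ?exprn_ge0 ?addr_ge0//.
by rewrite !mulr_ge0 ?invr_ge0 ?(ltW gamma0).
Qed.

(** Telescoping: [u - (I - A)^r u] is the sum of [A (I - A)^j u] over [j < r], and [stek_node]
    bounds each term at the nodes. *)
Lemma sub_cdiff_rset r u : S u ->
  (S (fun x => u x - iter r (cdiff h) u x) /\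
   p (fun x => u x - iter r (cdiff h) u x) <= (1 + (1 + CA) ^+ r) * p u) /\
  (S (st (nodes (fun x => u x - iter r (cdiff h) u x))) /\
   p (st (nodes (fun x => u x - iter r (cdiff h) u x))) <= Csub r * p u).
Proof.
move=> Su; have [Sr pr] := iter_cdiff_rset r Su; have pu0 := rnorm_ge0 Su.
split.
  split; first exact: rsetB.
  by apply: le_trans (rnormB Su Sr) _; rewrite mulrDl mul1r lerD2l.
  elim: r {Sr pr} => [|r [IS Ip]].
    rewrite /Csub big_ord0 mul0r (_ : st _ = fun=> 0).
      by split; [exact: rset0|rewrite rnorm0].
    by apply/funext => x; rewrite !stE !nodesE /= subrr.
  have [Sr pr] := iter_cdiff_rset r Su; have [Sn pn] := stek_node Sr.
  rewrite (_ : st _ = fun x => st (nodes (fun x => u x - iter r (cdiff h) u x)) x +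
      st (nodes (stek h (iter r (cdiff h) u))) x); last first.
    by apply/funext => x; rewrite !stE !nodesE /= /cdiff; ring.
  split; first exact: rsetD.
  apply: le_trans (rnormD IS Sn) _; rewrite /Csub big_ord_recr /= mulrDl; apply: lerD => //.
  by apply: le_trans pn _; rewrite -(mulrA (4 * CA / gamma)) ler_wpM2l// !mulr_ge0 ?invr_ge0 ?(ltW gamma0).
Qed.

(** [4 * CA] comes from the window [loc 1] of the one-sided differences; the rest from [loc r.+1]
    and the factor [2^r] of [iter_cdiff_local]. *)
Definition Cder r : R := 4 * CA + 2 ^+ r * (2 ^+ r.+2 * CA).

Lemma Cder_ge0 r : 0 <= Cder r.
Proof.
have pw k : 0 <= 2 ^+ k :> R by exact: exprn_ge0.
by apply: addr_ge0; [|apply: mulr_ge0 => //]; apply: mulr_ge0.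
Qed.

(** One centred difference turns [u] into local integrals of the derivative. The other [r] only
    enlarge the constant and the window, and a wider window also covers the passage from a node to
    its cell. *)
Lemma derivs_bound (b : bool) r u us : derivs b u us -> S us ->
  [/\ S (iter b.+1 (fdiff h) u) /\ p (iter b.+1 (fdiff h) u) <= Cder r * (sigma ^- b.+1 * p us),
      S (iter r.+1 (cdiff h) u) /\ p (iter r.+1 (cdiff h) u) <= Cder r * (sigma ^- b.+1 * p us) &
      S (st (nodes (iter r.+1 (cdiff h) u))) /\
      p (st (nodes (iter r.+1 (cdiff h) u))) <= Cder r * (sigma ^- b.+1 * p us)].
Proof.
have si0 : 0 < sigma^-1 by rewrite invr_gt0.
have hb : h ^+ b <= sigma ^- b by rewrite -exprVn lerXn2r ?nnegrE ?(ltW h0) ?(ltW si0).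
have sb0 : 0 <= sigma ^- b by rewrite invr_ge0 exprn_ge0// ltW.
(* From a point of the cell, the node is one unit [1 / sigma] away, the [r] outer differences add
   [r] and the inner one adds 1; the total [r + 2] fits the radius of [loc r.+1]. *)
have r2 : r.+2%:R <= 2 ^+ r.+1 :> R.
  elim: (r) => [|k IH]; first by rewrite expr1.
  rewrite exprS -natr1; have : 1 <= k.+2%:R :> R by rewrite ler1n.
  lra.
move=> du Sus; have Sa := rset_abs Sus; have cu := derivs_cont du.
have pu0 := rnorm_ge0 Sus; have cus : continuous us by case: du.
have ca := cont_norm cus.
have K1 : 0 <= sigma ^- b.+1 * p us by rewrite mulr_ge0// invr_ge0 exprn_ge0// ltW.
have [Sl1 pl1] := loc_norm 1 Sa; rewrite rnorm_abs// in pl1.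
have [Slr plr] := loc_norm r.+1 Sa; rewrite rnorm_abs// in plr.
have hf x : `|iter b.+1 (fdiff h) u x| <= sigma ^- b * loc sigma 1 (fun t => `|us t|) x.
  apply: le_trans (fdiffs_le x h0 du) _; apply: ler_pM => //; first by rewrite exprn_ge0// ltW.
    by apply: itg_ge0 => t.
  by have hh := hs; apply: itg_mono => //; rewrite expr1; lra.
have hc x y : `|x - y| <= sigma^-1 -> `|iter r.+1 (cdiff h) u y| <= 2 ^+ r * sigma ^- b * loc sigma r.+1 (fun t => `|us t|) x.
  move=> xy; rewrite iterSr -mulrA; apply: iter_cdiff_local => //; first exact: cont_cdiff.
  move=> z zy; apply: le_trans (cdiffs_le z h0 du) _; apply: ler_pM => //; first by rewrite exprn_ge0// ltW.
    by apply: itg_ge0 => t.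
  have rh : r%:R * h <= r%:R * sigma^-1 by rewrite ler_wpM2l.
  have r2' : r.+2%:R * sigma^-1 <= 2 ^+ r.+1 / sigma by rewrite ler_wpM2r// ltW.
  have e2 : r.+2%:R * sigma^-1 = r%:R * sigma^-1 + 2 * sigma^-1 by rewrite -addn2 natrD mulrDl.
  have hh := hs.
  move: xy zy; rewrite !ler_norml => /andP[? ?] /andP[? ?].
  by apply: itg_mono => //; lra.
have es : sigma ^- b * sigma^-1 = sigma ^- b.+1 by rewrite -!exprVn exprSr.
have fin (v : R -> R) j (C : R) : lmeas v -> 0 <= C -> (forall x, `|v x| <= C * sigma ^- b * loc sigma j (fun t => `|us t|) x) ->
    S v /\ p v <= C * (2 ^+ j.+1 * CA) * (sigma ^- b.+1 * p us).
  move=> mv C0 hv; have [Sl pl] := loc_norm j Sa; rewrite rnorm_abs// in pl.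
  have Cb : 0 <= C * sigma ^- b by exact: mulr_ge0.
  have [S1 p1] : S v /\ p v <= p (fun x => C * sigma ^- b * loc sigma j (fun t => `|us t|) x).
    apply: rset_le => //; first exact: rsetZ.
    by move=> x; rewrite [leRHS]ger0_norm// mulr_ge0// loc_ge0.
  split => //; apply: le_trans p1 _; rewrite rnormZ// ger0_norm//.
  apply: le_trans (ler_wpM2l Cb pl) _; rewrite -es le_eqVlt; apply/orP; left; apply/eqP; ring.
have pw0 : 0 <= 2 ^+ r :> R by exact: exprn_ge0.
have cfd : continuous (iter b.+1 (fdiff h) u).
  by elim: (b.+1 : nat) => [//|k IH]; exact: cont_fdiff.
have [||S1 p1] := fin (iter b.+1 (fdiff h) u) 1%N 1 _ ler01 _.
- exact: lmeas_cont.
- by move=> x; rewrite mul1r.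
have [||S2 p2] := fin (iter r.+1 (cdiff h) u) r.+1 (2 ^+ r) _ pw0 _.
- by apply: lmeas_cont; exact: cont_iter_cdiff.
- by move=> x; apply: hc; rewrite subrr normr0 ltW.
have [||S3 p3] := fin (st (nodes (iter r.+1 (cdiff h) u))) r.+1 (2 ^+ r) _ pw0 _.
- exact: lmeas_st.
- by move=> x; apply: hc; rewrite distrC; exact: node_dist.
have c1 : 0 <= 4 * CA by rewrite mulr_ge0.
have c2 : 0 <= 2 ^+ r * (2 ^+ r.+2 * CA) by apply: mulr_ge0 => //; apply: mulr_ge0 => //; exact: exprn_ge0.
have e4 : 1 * (2 ^+ 2 * CA) = 4 * CA by rewrite mul1r; congr (_ * _); rewrite expr2; ring.
split; split => //; rewrite /Cder mulrDl.
- by apply: le_trans p1 _; rewrite e4 lerDl mulr_ge0.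
- by apply: le_trans p2 _; rewrite lerDr mulr_ge0.
- by apply: le_trans p3 _; rewrite lerDr mulr_ge0.
Qed.

End AveragesLattice.

(** * Finite combinations of shifted kernels *)

Section Combinations.
Context {R : realType}.
Variable sigma : R.
Implicit Types (m : R -> R) (c : int -> R) (r : seq int) (x t : R).

Lemma kernN m x : kern m (- x) = kern m x.
Proof. by rewrite /kern cosintN. Qed.

Lemma kernB m1 m2 B x : bddm m1 B -> bddm m2 B ->
  kern (fun t => m1 t - m2 t) x = kern m1 x - kern m2 x.
Proof.
move=> [l1 b1] [l2 b2]; rewrite /kern /cosint -mulrBr -itgB; [|exact: cosint_locint l1 b1|exact: cosint_locint l2 b2].
by congr (_ * _); apply: eq_itg => xi _; rewrite mulrBl.
Qed.

Lemma eq_kern m1 m2 x : (forall t, 0 <= t <= 1 -> m1 t = m2 t) -> kern m1 x = kern m2 x.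
Proof. by move=> h; congr (_ * _); apply: eq_itg => t /h ->. Qed.

Definition comb m c r x := \sum_(l <- r) c l * kern m (sigma * x - l%:~R).
(** Cosine and sine amplitudes of the samples; through [combE] a finite sampling sum becomes a
    trigonometric integral, on which differentiation acts by multiplication. *)
Definition csumc c r t : R := pi^-1 * \sum_(l <- r) c l * cos (l%:~R * t).
Definition csums c r t : R := pi^-1 * \sum_(l <- r) c l * sin (l%:~R * t).

Lemma cont_csumc c r : continuous (csumc c r).
Proof.
apply: cont_mul; first exact: cont_cst.
by apply: cont_sumf => l; apply: cont_mul; [exact: cont_cst|exact: cos_cont].
Qed.

Lemma cont_csums c r : continuous (csums c r).
Proof.
apply: cont_mul; first exact: cont_cst.
by apply: cont_sumf => l; apply: cont_mul; [exact: cont_cst|exact: sin_cont].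
Qed.

Let pi0 : 0 <= pi^-1 :> R. Proof. by rewrite invr_ge0 pi_ge0. Qed.

Lemma csumc_le c r t : `|csumc c r t| <= pi^-1 * \sum_(l <- r) `|c l|.
Proof.
rewrite normrM (ger0_norm pi0) ler_wpM2l//; apply: le_trans (ler_norm_sum _ _ _) _.
by apply: ler_sum => l _; rewrite normrM ler_piMr// cos_le1.
Qed.

Lemma csums_le c r t : `|csums c r t| <= pi^-1 * \sum_(l <- r) `|c l|.
Proof.
rewrite normrM (ger0_norm pi0) ler_wpM2l//; apply: le_trans (ler_norm_sum _ _ _) _.
by apply: ler_sum => l _; rewrite normrM ler_piMr// sin_le1.
Qed.

Lemma bddm_csum m B c r : bddm m B ->
  bddm (fun t => m t * csumc c r t) (B * (pi^-1 * \sum_(l <- r) `|c l|)) /\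
  bddm (fun t => m t * csums c r t) (B * (pi^-1 * \sum_(l <- r) `|c l|)).
Proof.
move=> [lm mB]; split; split.
- by apply: lmeasM => //; apply: lmeas_cont; exact: cont_csumc.
- by move=> t; rewrite normrM ler_pM// csumc_le.
- by apply: lmeasM => //; apply: lmeas_cont; exact: cont_csums.
- by move=> t; rewrite normrM ler_pM// csums_le.
Qed.

Lemma combE m B c r x : bddm m B ->
  comb m c r x = trig (fun t => m t * csumc c r t) (fun t => m t * csums c r t) (sigma * x).
Proof.
move=> [lm mB].
have lc t : locint (fun xi => m xi * cos (t * xi)) by exact: cosint_locint lm mB.
transitivity (itg 0 1 (fun xi => \sum_(l <- r) (c l * pi^-1) * (m xi * cos ((sigma * x - l%:~R) * xi)))).
  rewrite itg_sum; last by move=> l; exact: locintZ.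
  by apply: eq_bigr => l _; rewrite itgZ// -mulrA.
apply: eq_itg => xi _; rewrite /csumc /csums !mulr_sumr !mulr_suml -big_split /=.
by apply: eq_bigr => l _; rewrite mulrBl cosB; ring.
Qed.

Lemma zlim_sum (r : seq int) (a : int -> R) (F : int -> int -> R) :
  (forall l, exists C, zbdd (F l) C) ->
  zlim (fun k => \sum_(l <- r) a l * F l k) = \sum_(l <- r) a l * zlim (F l) /\
  exists C, zbdd (fun k => \sum_(l <- r) a l * F l k) C.
Proof.
move=> hF; elim: r => [|l r [IH [C hC]]].
  rewrite big_nil; split.
    apply: zlim_eq; rewrite (_ : (fun n => _) = fun=> 0); first exact: cvg_cst.
    by apply/funext => n; rewrite /zpart !big1 ?addr0// => k _; rewrite big_nil.
  by exists 0 => r _; rewrite big1// => k _; rewrite big_nil normr0.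
have [D hD] := hF l.
have -> : (fun k => \sum_(j <- l :: r) a j * F j k) = (fun k => a l * F l k + \sum_(j <- r) a j * F j k).
  by apply/funext => k; rewrite big_cons.
rewrite (zlimD (zbddZ (a l) hD) hC) (zlimZ (a l) hD) big_cons IH; split => //.
by eexists; exact: zbddD (zbddZ (a l) hD) hC.
Qed.

End Combinations.

(** * The error at the nodes and the lower estimate *)

Section DiscreteError.
Context {R : realType} (X : banach_lattice R).
Local Notation S := (rset X).
Local Notation p := (rnorm X).
Variables (CA theta sigma : R).
Hypothesis hCA : steklov_bound X CA.
Hypothesis theta12 : 2^-1 <= theta < 1.
Hypothesis sigma0 : 0 < sigma.
Variables (psi : R -> R) (Bpsi CK : R).
Hypothesis hpsi : bddm psi Bpsi.
Hypothesis psic : forall t, 0 < t < 1 -> {for t, continuous psi}.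
Hypothesis KC : kdec theta CK (kern psi).
Implicit Types (c : int -> R) (r : seq int) (x t : R).
Local Notation st := (st sigma).
Local Notation nodes := (nodes sigma).
Local Notation Q := (Qop sigma (kern psi)).

Let cK : continuous (kern psi). Proof. exact: cont_kern hpsi. Qed.

Definition derr c k := c k - nodes (Q c) k.

Lemma derr_rset c : S (st c) -> S (st (derr c)) /\
  p (st (derr c)) <= (1 + 2 / theta * CQ theta CK * Cmaj CA theta) * p (st c).
Proof.
move=> Sc; have [Sn pn] := Q_node hCA theta12 sigma0 KC Sc.
rewrite (_ : st (derr c) = fun x => st c x - st (nodes (Q c)) x)//.
split; first exact: rsetB.
by apply: le_trans (rnormB Sc Sn) _; rewrite mulrDl mul1r lerD2l.
Qed.

(** By the sampling identity, evaluating [Q c] at the nodes and resampling with the kernel of [m2]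
    has symbol [psi * m2]; subtraction from the kernel of [m2] leaves [(1 - psi) * m2]. *)
Lemma derr_comb m2 B2 C2 c r x : bddm m2 B2 -> kdec theta C2 (kern m2) ->
  uniq r -> (forall k, k \notin r -> c k = 0) ->
  Qop sigma (kern m2) (derr c) x = comb sigma (fun t => (1 - psi t) * m2 t) c r x.
Proof.
move=> hm2 K2 ur hr.
have Sc : S (st c) by apply: rset_st_fin hr.
have [Sn _] := Q_node hCA theta12 sigma0 KC Sc.
have [[lp pB] [l2 b2]] := (hpsi, hm2).
rewrite (QB hCA theta12 sigma0 K2 x Sc Sn) (Q_fin theta12 sigma0 _ _ ur hr).
have k2b t : `|kern m2 t| <= C2 by case: K2.
have zF (l : int) : exists C, zbdd (fun k => kern psi (l%:~R - k%:~R) * kern m2 (k%:~R - sigma * x)) C.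
  eexists; apply: zbdd_le (zbddZ C2 (ksum1 theta12 l%:~R KC)) => k.
  by rewrite [leRHS]normrM mulrC normrM ler_wpM2r// (le_trans (k2b _)) ?ler_norm.
have -> : Qop sigma (kern m2) (nodes (Q c)) x = \sum_(l <- r) c l * kern (fun t => psi t * m2 t) (l%:~R - sigma * x).
  have := (zlim_sum r c zF).1.
  under [X in _ = X -> _]eq_bigr do rewrite (sampling_identity theta12 lp l2 pB b2 psic KC).
  move=> <-; congr zlim; apply/funext => k.
  rewrite !nodesE (Q_fin theta12 sigma0 _ _ ur hr) mulr_suml; apply: eq_bigr => l _.
  rewrite -mulrA (_ : sigma * node sigma k = k%:~R); last by rewrite /node mulrC divfK// gt_eqF.
  by rewrite -kernN opprB -[kern m2 _]kernN opprB.
rewrite /comb -sumrB; apply: eq_bigr => l _; rewrite -mulrBr; congr (_ * _).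
rewrite -[kern _ (l%:~R - _)]kernN opprB.
have hM : bddm m2 (B2 + Bpsi * B2) /\ bddm (fun t => psi t * m2 t) (B2 + Bpsi * B2).
  have B0 := bddm_ge0 hpsi; have B20 := bddm_ge0 hm2.
  split; split => //; first by move=> t; rewrite (le_trans (b2 t))// lerDl mulr_ge0.
    exact: lmeasM.
  by move=> t; rewrite normrM (le_trans (ler_pM _ _ (pB t) (b2 t)))// lerDr.
by rewrite -(kernB _ hM.1 hM.2); apply: eq_kern => t _; ring.
Qed.

Variables (gamma : R) (b : bool) (L : R).
Hypothesis gamma0 : 0 < gamma.
Hypothesis gamma1 : gamma <= 1.
Hypothesis rocX : roc X.
Hypothesis L0 : 0 <= L.
(** The derivative of order [b.+1] of a finite sampling sum, bounded by the error at the nodes;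
    [lower_rho] and [lower_phi] provide it. *)
Hypothesis hL : forall r c, uniq r -> (forall k, k \notin r -> c k = 0) ->
  exists us, [/\ derivs b (Q c) us, S us & p us <= sigma ^+ b.+1 * L * p (st (derr c))].
Local Notation h := (gamma / sigma).

Lemma rnorm_split u v w C1 C2 : S v -> S w -> u = (fun x => v x + w x) -> p v <= C1 -> p w <= C2 ->
  S u /\ p u <= C1 + C2.
Proof.
move=> Sv Sw -> hv hw; split; first exact: rsetD.
by apply: le_trans (rnormD Sv Sw) _; exact: lerD.
Qed.

Lemma le_eps (A B D : R) : 0 <= D -> (forall e, 0 < e -> A <= B + D * e) -> A <= B.
Proof.
move=> D0 hA; apply/ler_addgt0Pr => e e0; have D1 : 0 < D + 1 by rewrite ltr_wpDl.
have := hA (e / (D + 1)) (divr_gt0 e0 D1).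
have : D * (e / (D + 1)) <= e by rewrite mulrA ler_pdivrMr//; nra.
lra.
Qed.

(** The hypothesis [hL] covers finite samples only. The samples are split into a central part and a
    tail of norm at most [e]; all operators involved are bounded on the tail, and [e] is
    arbitrary. *)
Lemma Qop_smooth j c : S (st c) ->
  p (iter b.+1 (fdiff h) (Q c)) <= Cder CA j * L * p (st (derr c)) /\
  S (st (nodes (iter j.+1 (cdiff h) (Q c)))) /\
  p (st (nodes (iter j.+1 (cdiff h) (Q c)))) <= Cder CA j * L * p (st (derr c)).
Proof.
move=> Sc; have CA0 : 0 <= CA by case: hCA.
have t0 := theta_gt0 theta12.
have cq0 : 0 <= CQ theta CK * Cmaj CA theta by rewrite mulr_ge0 ?(CQ_ge0 theta12 KC)// (Cmaj_ge0 hCA theta12).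
have cd0 : 0 <= Cder CA j * L by rewrite mulr_ge0// (Cder_ge0 hCA).
have n0 : 0 <= 2 / theta * CQ theta CK * Cmaj CA theta.
  by rewrite -mulrA mulr_ge0// divr_ge0// ltW.
have De0 : 0 <= 1 + 2 / theta * CQ theta CK * Cmaj CA theta by exact: addr_ge0.
(* Factors with which the tail enters: through its error at the nodes, through the one-sided
   differences, and through node values. *)
pose D1 := Cder CA j * L * (1 + 2 / theta * CQ theta CK * Cmaj CA theta).
pose D2 := (1 + 2 * CA) ^+ b.+1 * (CQ theta CK * Cmaj CA theta).
pose D3 := 2 / theta * CQ theta CK * Cmaj CA theta + Csub CA gamma j.+1 * (CQ theta CK * Cmaj CA theta).
have D10 : 0 <= D1 by rewrite mulr_ge0.
have D20 : 0 <= D2 by rewrite mulr_ge0// exprn_ge0// addr_ge0// mulr_ge0.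
have D30 : 0 <= D3.
  by apply: addr_ge0 => //; apply: mulr_ge0 => //; exact: (Csub_ge0 hCA gamma0).
have key e : 0 < e ->
    p (iter b.+1 (fdiff h) (Q c)) <= Cder CA j * L * p (st (derr c)) + (D1 + D2) * e /\
    S (st (nodes (iter j.+1 (cdiff h) (Q c)))) /\
    p (st (nodes (iter j.+1 (cdiff h) (Q c)))) <= Cder CA j * L * p (st (derr c)) + (D1 + D3) * e.
  move=> e0; have [N /(_ N (leqnn N)) hN] := st_off_cvg theta12 sigma0 rocX Sc e0.
  pose c' := off N N c; pose d k := c k - c' k.
  have Sc' : S (st c') by exact: off_st.
  have dr k : k \notin zrange 0 N N -> d k = 0.
    by move=> kN; rewrite /d /c' /off (negbTE kN) subrr.
  have Sd : S (st d) by apply: rset_st_fin dr.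
  have [us [du Sus pus]] := hL (zrange_uniq 0 N N) dr.
  have Qd : Q d = fun x => Q c x - Q c' x by apply/funext => x; apply: (QB hCA theta12 sigma0 KC).
  have [SQ pQ] := Q_rset hCA theta12 sigma0 KC cK Sc.
  have [SQ' pQ'] := Q_rset hCA theta12 sigma0 KC cK Sc'.
  have [Sn' pn'] := Q_node hCA theta12 sigma0 KC Sc'.
  have [Se pe] := derr_rset Sc; have [Se' pe'] := derr_rset Sc'.
  have edE : st (derr d) = fun x => st (derr c) x - st (derr c') x.
    by apply/funext => x; rewrite !stE /derr !nodesE Qd /d; ring.
  have pd : p (st (derr d)) <= p (st (derr c)) + (1 + 2 / theta * CQ theta CK * Cmaj CA theta) * e.
    rewrite edE; apply: le_trans (rnormB Se Se') _; rewrite lerD2l.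
    by apply: le_trans pe' _; rewrite ler_wpM2l.
  have pd2 : Cder CA j * (sigma ^- b.+1 * p us) <= Cder CA j * L * p (st (derr c)) + D1 * e.
    have s0 : 0 < sigma ^+ b.+1 by rewrite exprn_gt0.
    apply: (@le_trans _ _ (Cder CA j * (L * p (st (derr d))))).
      by rewrite ler_wpM2l ?(Cder_ge0 hCA)// ler_pdivrMl// mulrA.
    by rewrite mulrA /D1 -[X in _ <= _ + X]mulrA -mulrDr; apply: ler_wpM2l.
  have [[S1 p1] _ [S2 p2]] := derivs_bound hCA sigma0 gamma0 gamma1 j du Sus.
  have [If pIf] := iter_fdiff_rset hCA sigma0 gamma0 b.+1 SQ'.
  have [Ic pIc] := iter_cdiff_rset hCA sigma0 gamma0 j.+1 SQ'.
  have [_ [Sb pb]] := sub_cdiff_rset hCA sigma0 gamma0 gamma1 j.+1 SQ'.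
  have fE : iter b.+1 (fdiff h) (Q c) = fun x => iter b.+1 (fdiff h) (Q d) x + iter b.+1 (fdiff h) (Q c') x.
    by apply/funext => x; rewrite Qd (iter_fdiffB hCA sigma0 gamma0 b.+1 SQ SQ') subrK.
  have cE : st (nodes (iter j.+1 (cdiff h) (Q c))) = fun x => st (nodes (iter j.+1 (cdiff h) (Q d))) x +
      (st (nodes (Q c')) x - st (nodes (fun x => Q c' x - iter j.+1 (cdiff h) (Q c') x)) x).
    apply/funext => x; rewrite !stE !nodesE Qd (iter_cdiffB hCA sigma0 gamma0 j.+1 SQ SQ'); ring.
  have q1 : p (iter b.+1 (fdiff h) (Q c')) <= D2 * e.
    apply: le_trans pIf _; rewrite -mulrA ler_wpM2l ?exprn_ge0 ?addr_ge0 ?mulr_ge0//.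
    by apply: le_trans pQ' _; rewrite ler_wpM2l.
  have q2 : p (fun x => st (nodes (Q c')) x - st (nodes (fun x => Q c' x - iter j.+1 (cdiff h) (Q c') x)) x) <= D3 * e.
    apply: le_trans (rnormB Sn' Sb) _; rewrite mulrDl; apply: lerD.
      by apply: le_trans pn' _; rewrite ler_wpM2l.
    apply: le_trans pb _; rewrite -mulrA ler_wpM2l ?(Csub_ge0 hCA gamma0)//.
    by apply: le_trans pQ' _; rewrite ler_wpM2l.
  have [_ r1] := rnorm_split S1 If fE (le_trans p1 pd2) q1.
  have [s2 r2] := rnorm_split S2 (rsetB Sn' Sb) cE (le_trans p2 pd2) q2.
  by rewrite (mulrDl D1 D2) (mulrDl D1 D3) !addrA.
split; first by apply: (@le_eps _ _ (D1 + D2)); [exact: addr_ge0|move=> e /key[]].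
split; first by have [_ []] := key 1 ltr01.
by apply: (@le_eps _ _ (D1 + D3)); [exact: addr_ge0|move=> e /key[_ []]].
Qed.

Lemma lower_alg (a1 a2 a3 pv pe : R) : 0 <= a1 -> 0 <= a2 -> 0 <= a3 -> 0 <= pv -> 0 <= pe ->
  a1 * pv + a3 * pe + (a3 * pe + (pe + a2 * pv)) <= (a1 + (1 + a2) + 2 * a3) * (pv + pe).
Proof.
move=> a10 a20 a30 pv0 pe0.
have := mulr_ge0 a10 pe0; have := mulr_ge0 a20 pe0; have := mulr_ge0 a30 pv0.
rewrite !mulrDl !mulrDr; lra.
Qed.

Definition Clow j : R := (1 + 2 * CA) ^+ b.+1 + (1 + Csub CA gamma j.+1) + 2 * (Cder CA j * L).

(** Write [u = v + Q u]: [Qop_smooth] handles [Q u], and the one-sided differences are bounded on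
    [v]. At the nodes [v] coincides with [derr], so only [v - (I - A)^r v] remains, which the norm
    of [v] controls. *)
Lemma lower_real j u : S u -> S (st (nodes u)) ->
  p (iter b.+1 (fdiff h) u) + p (st (nodes (iter j.+1 (cdiff h) u))) <=
  Clow j * (p (fun x => u x - Q (nodes u) x) + p (st (derr (nodes u)))).
Proof.
move=> Su Sn; have [SQ _] := Q_rset hCA theta12 sigma0 KC cK Sn.
have [p1 [S2 p2]] := Qop_smooth j Sn.
have [Se _] := derr_rset Sn; have CA0 : 0 <= CA by case: hCA.
pose v x := u x - Q (nodes u) x; have Sv : S v by exact: rsetB.
have [Iv pIv] := iter_fdiff_rset hCA sigma0 gamma0 b.+1 Sv.
have [IQ _] := iter_fdiff_rset hCA sigma0 gamma0 b.+1 SQ.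
have [_ [Sb pb]] := sub_cdiff_rset hCA sigma0 gamma0 gamma1 j.+1 Sv.
have fE : iter b.+1 (fdiff h) u = fun x => iter b.+1 (fdiff h) v x + iter b.+1 (fdiff h) (Q (nodes u)) x.
  by apply/funext => x; rewrite (iter_fdiffB hCA sigma0 gamma0 b.+1 Su SQ) subrK.
have cE : st (nodes (iter j.+1 (cdiff h) u)) = fun x => st (nodes (iter j.+1 (cdiff h) (Q (nodes u)))) x +
    (st (derr (nodes u)) x - st (nodes (fun x => v x - iter j.+1 (cdiff h) v x)) x).
  by apply/funext => x; rewrite /v !stE /derr !nodesE (iter_cdiffB hCA sigma0 gamma0 j.+1 Su SQ); ring.
have pv0 := rnorm_ge0 Sv; have pe0 := rnorm_ge0 Se.
have q2 : p (fun x => st (derr (nodes u)) x - st (nodes (fun x => v x - iter j.+1 (cdiff h) v x)) x) <=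
    p (st (derr (nodes u))) + Csub CA gamma j.+1 * p v.
  by apply: le_trans (rnormB Se Sb) _; rewrite lerD2l.
have [_ r1] := rnorm_split Iv IQ fE pIv p1.
have [_ r2] := rnorm_split S2 (rsetB Se Sb) cE p2 q2.
apply: le_trans (lerD r1 r2) _; rewrite -/v /Clow.
have a1 : 0 <= (1 + 2 * CA) ^+ b.+1 by rewrite exprn_ge0// addr_ge0// mulr_ge0.
have a2 : 0 <= Csub CA gamma j.+1 by exact: (Csub_ge0 hCA gamma0).
have a3 : 0 <= Cder CA j * L by rewrite mulr_ge0// (Cder_ge0 hCA).
exact: lower_alg.
Qed.

End DiscreteError.

(** * Derivatives of sampled functions for rho and phi *)

Section LowerKernels.
Context {R : realType} (X : banach_lattice R).
Local Notation S := (rset X).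
Local Notation p := (rnorm X).
Variables (CA theta sigma : R).
Hypothesis hCA : steklov_bound X CA.
Hypothesis theta12 : 2^-1 <= theta < 1.
Hypothesis sigma0 : 0 < sigma.
Implicit Types (c : int -> R) (r : seq int) (x t : R).
Local Notation st := (st sigma).
Local Notation nodes := (nodes sigma).

Lemma isd_scaled (F f : R -> R) : isd F f -> isd (fun x => F (sigma * x)) (fun x => sigma * f (sigma * x)).
Proof.
move=> dF x; apply: dval (@dcomp R x (fun x => sigma * x) F _ _ (dF (sigma * x)) (dscale sigma (did x))) _.
by rewrite mulr1.
Qed.

Lemma cont_scaled (F : R -> R) : continuous F -> continuous (fun x => F (sigma * x)).
Proof.
move=> cF x; apply: (@continuous_comp _ _ _ (fun x => sigma * x) F); last exact: cF.
by apply: (@dcont R x _ (sigma * 1)); apply: dscale; exact: did.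
Qed.

Lemma trigN (a b : R -> R) B x : bddm a B -> bddm b B ->
  trig (fun xi => - a xi) (fun xi => - b xi) x = - trig a b x.
Proof.
move=> ha hb; rewrite -mulN1r /trig -itgZ; last exact: trig_locint ha hb.
by apply: eq_itg => xi _; ring.
Qed.

Lemma eq_trig (a a' b b' : R -> R) x : (forall t, 0 <= t <= 1 -> a t = a' t) ->
  (forall t, 0 <= t <= 1 -> b t = b' t) -> trig a b x = trig a' b' x.
Proof. by move=> ha hb; apply: eq_itg => t t01; rewrite ha// hb. Qed.

Lemma rho_cont_itv alpha t : 0 < alpha -> 0 < t < 1 -> {for t, continuous (rho alpha : R -> R)}.
Proof. by move=> a0 t01; have [C [b1 [b2 [_ /(_ t t01)[/dcont]]]]] := tame_rho a0. Qed.

Lemma lower_rho alpha CK Cg : 0 < alpha -> kdec theta CK (kern (rho alpha)) ->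
  kdec theta Cg (kern (gsym alpha)) -> forall r c, uniq r -> (forall k, k \notin r -> c k = 0) ->
  exists us, [/\ derivs true (Qop sigma (kern (rho alpha)) c) us, S us &
    p us <= sigma ^+ 2 * (CQ theta Cg * Cmaj CA theta) * p (st (derr sigma (rho alpha) c))].
Proof.
move=> a0 KC Kg r c ur hr.
have hpsi : bddm (rho alpha) (1 : R) by split; [exact: lmeas_rho|move=> t; exact: rho_norm].
have hg : bddm (gsym alpha) ((1 + alpha) / alpha).
  by split; [apply: borel_lebesgue; exact: bmeas_gsym|move=> t; exact: gsym_norm].
have Sc : S (st c) by apply: rset_st_fin hr.
have [Se _] := derr_rset hCA theta12 sigma0 KC Sc.
have [Sg pg] := Q_rset hCA theta12 sigma0 Kg (cont_kern hg) Se.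
have [ha hb] := bddm_csum c r hpsi.
have hca := bddm_clip ha; have hcb := bddm_clip hb.
have d1 := isd_trig ha hb.
have d2 := isd_trig hcb (bddmN hca).
pose G := Qop sigma (kern (gsym alpha)) (derr sigma (rho alpha) c).
pose us x := - sigma ^+ 2 * G x.
have usE x : us x = sigma * (sigma * trig (fun xi => clip xi * - (clip xi * (rho alpha xi * csumc c r xi)))
      (fun xi => - (clip xi * (clip xi * (rho alpha xi * csums c r xi)))) (sigma * x)).
  rewrite /us /G (derr_comb hCA theta12 sigma0 hpsi _ KC x hg Kg ur hr); last by move=> t; exact: rho_cont_itv.
  have hm : bddm (fun t => (1 - rho alpha t) * gsym alpha t) (2 * ((1 + alpha) / alpha)).
    split; first by apply: lmeasM hg.1; apply: lmeasB; [exact: lmeas_cst|exact: lmeas_rho].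
    move=> t; rewrite normrM ler_pM// ?gsym_norm//; apply: le_trans (ler_normB _ _) _.
    by rewrite normr1 (_ : 2 = 1 + 1)// lerD2l rho_norm.
  rewrite (combE sigma c r x hm) expr2 mulNr -(mulrA sigma sigma) -!mulrN; congr (_ * (_ * _)).
  have [h1 h2] := bddm_csum c r hm.
  rewrite -(trigN (sigma * x) h1 h2); apply: eq_trig => t t01; rewrite clip_id// gsymE//; ring.
exists us; split.
- split; last first.
    exists (fun x => sigma * trig (fun xi => clip xi * (rho alpha xi * csums c r xi))
       (fun xi => - (clip xi * (rho alpha xi * csumc c r xi))) (sigma * x)); split.
      rewrite (_ : Qop _ _ _ = fun x => trig (fun t => rho alpha t * csumc c r t) (fun t => rho alpha t * csums c r t) (sigma * x)); first exact: isd_scaled d1.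
      by apply/funext => x; rewrite (Q_fin theta12 sigma0 _ _ ur hr) -(combE sigma c r x hpsi).
    move=> x; apply: dval (dscale sigma (isd_scaled d2 x)) _; by rewrite usE.
  rewrite (_ : us = fun x => sigma * (sigma * trig (fun xi => clip xi * - (clip xi * (rho alpha xi * csumc c r xi)))
      (fun xi => - (clip xi * (clip xi * (rho alpha xi * csums c r xi)))) (sigma * x))); last exact/funext.
  apply: cont_mul; first exact: cont_cst.
  apply: cont_mul; first exact: cont_cst.
  by apply: cont_scaled; apply: cont_trig (bddm_clip (bddmN hca)) (bddmN (bddm_clip hcb)).
- exact: rsetZ.
- by rewrite rnormZ// normrN ger0_norm ?sqr_ge0// -mulrA ler_wpM2l// sqr_ge0.
Qed.

(** With [m2 = phi], [derr_comb] has the symbol [(1 - phi) * phi], equal to [xi * phi] on [0, 1].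
    The derivative of the sampled function has these amplitudes exchanged up to sign, so it is
    [- sigma] times the conjugate integral in [hilbert_trig]. *)
Lemma lower_phi CK CH : 0 <= CH -> (forall f, schwartz f ->
    X (hilbert f) /\ bl_norm X (hilbert f) <= CH * bl_norm X f) ->
  kdec theta CK (kern (@phi R)) -> forall r c, uniq r -> (forall k, k \notin r -> c k = 0) ->
  exists us, [/\ derivs false (Qop sigma (kern (@phi R)) c) us, S us &
    p us <= sigma ^+ 1 * (CH * (CQ theta CK * Cmaj CA theta)) * p (st (derr sigma (@phi R) c))].
Proof.
move=> CH0 hilb KC r c ur hr.
have hpsi : bddm (@phi R) (1 : R) by split; [exact: lmeas_phi|move=> t; exact: phi_norm].
have Sc : S (st c) by apply: rset_st_fin hr.
have [Se _] := derr_rset hCA theta12 sigma0 KC Sc.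
have [Sg pg] := Q_rset hCA theta12 sigma0 KC (cont_kern hpsi) Se.
have [ha hb] := bddm_csum c r hpsi.
have hca := bddm_clip ha; have hcb := bddm_clip hb.
have d1 := isd_trig ha hb.
have QE x : Qop sigma (kern (@phi R)) (derr sigma (@phi R) c) x =
    trig (fun xi => clip xi * (phi xi * csumc c r xi)) (fun xi => clip xi * (phi xi * csums c r xi)) (sigma * x).
  rewrite (derr_comb hCA theta12 sigma0 hpsi _ KC x hpsi KC ur hr); last by move=> t _; exact: cont_phi.
  have hm : bddm (fun t => (1 - phi t) * phi t) (2 * 1 : R).
    split; first by apply: lmeasM lmeas_phi; apply: lmeasB lmeas_phi; exact: lmeas_cst.
    move=> t; rewrite normrM ler_pM// ?phi_norm//; apply: le_trans (ler_normB _ _) _.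
    by rewrite normr1 (_ : 2 = 1 + 1)// lerD2l phi_norm.
  rewrite (combE sigma c r x hm); apply: eq_trig => t t01; rewrite clip_id// phiE//; ring.
have Su : S (fun x => trig (fun xi => clip xi * (phi xi * csumc c r xi)) (fun xi => clip xi * (phi xi * csums c r xi)) (sigma * x)).
  by rewrite -(funext QE).
have bm (w : R -> R) : continuous w -> bmeas (fun xi => clip xi * (phi xi * w xi)).
  move=> cw; apply: cont_bmeas; apply: cont_mul; first exact: cutoff_cont.
  by apply: cont_mul => //; exact: cont_phi.
have [Sv pv] := hilbert_trig CH0 hilb (bm _ (@cont_csumc R c r)) (bm _ (@cont_csums R c r)) hca.2 hcb.2 sigma0 Su.
pose v x := trig (fun xi => - (clip xi * (phi xi * csums c r xi))) (fun xi => clip xi * (phi xi * csumc c r xi)) (sigma * x).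
exists (fun x => - sigma * v x); split.
- split.
    apply: cont_mul; first exact: cont_cst.
    by apply: cont_scaled; apply: cont_trig (bddmN hcb) hca.
  rewrite (_ : Qop _ _ _ = fun x => trig (fun t => phi t * csumc c r t) (fun t => phi t * csums c r t) (sigma * x)).
    move=> x; apply: dval (isd_scaled d1 x) _.
    rewrite mulNr -mulrN; congr (_ * _); rewrite /v -(trigN _ (bddmN hcb) hca).
    by apply: eq_trig => t _ //; rewrite opprK.
  by apply/funext => x; rewrite (Q_fin theta12 sigma0 _ _ ur hr) -(combE sigma c r x hpsi).
- exact: rsetZ.
- rewrite rnormZ// normrN gtr0_norm// expr1 -mulrA ler_wpM2l ?(ltW sigma0)//.
  apply: le_trans pv _; rewrite -mulrA ler_wpM2l//.
  by rewrite (_ : (fun x => _) = Qop sigma (kern (@phi R)) (derr sigma (@phi R) c))//; apply/funext => x; rewrite QE.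
Qed.

End LowerKernels.

(** * Primitives of decaying functions *)

Section Tails.
Context {R : realType}.
Implicit Types (F f g U V W : R -> R) (x y t C : R).

Lemma ex_prim0 f : continuous f -> exists2 F, isd F f & F 0 = 0.
Proof.
move=> /ex_prim[F dF]; exists (fun x => F x - F 0); last by rewrite subrr.
by move=> x; apply: dval (dsub (dF x) (dcst (F 0) x)) _; rewrite subr0.
Qed.

Lemma prim_even F f : isd F f -> (forall x, f (- x) = f x) -> forall x, F (- x) = 2 * F 0 - F x.
Proof.
move=> dF fe x.
have h y : has_deriv (fun y => F (- y) + F y) y 0.
  by apply: dval (dadd (dcomp (dF (- y)) (dopp (did y))) (dF y)) _; rewrite fe; ring.
have := deriv0_const h x 0; rewrite oppr0 => e; rewrite mulr2n mulrDl mul1r; lra.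
Qed.

Lemma prim_odd F f : isd F f -> (forall x, f (- x) = - f x) -> forall x, F (- x) = F x.
Proof.
move=> dF fo x.
have h y : has_deriv (fun y => F (- y) - F y) y 0.
  by apply: dval (dsub (dcomp (dF (- y)) (dopp (did y))) (dF y)) _; rewrite fo; ring.
have := deriv0_const h x 0; rewrite oppr0 => e; lra.
Qed.

Definition pinv (j : nat) t : R := (1 + t)^-1 ^+ j.

Lemma pinv_ge0 j t : 0 <= t -> 0 <= pinv j t.
Proof. by move=> t0; rewrite exprn_ge0// invr_ge0 addr_ge0. Qed.

Lemma dpinv j t : 0 <= t -> has_deriv (pinv j) t (- j%:R * pinv j.+1 t).
Proof.
move=> t0; have t1 : 1 + t != 0 by rewrite gt_eqF// ltr_wpDr.
have h : has_deriv (fun y : R => (1 + y)^-1) t (- (1 + t)^-1 ^+ 2).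
  by apply: dval (dinv t1 (dadd (dcst 1 t) (did t))) _; rewrite add0r mulNr mul1r exprVn.
elim: j => [|j IH]; first by apply: dval (dcst 1 t) _; rewrite oppr0 mul0r.
rewrite (_ : pinv j.+1 = fun y => (1 + y)^-1 * pinv j y); last first.
  by apply/funext => y; rewrite /pinv exprS.
apply: dval (dmul h IH) _; rewrite /pinv -natr1 !exprS; ring.
Qed.

(** Every [W s + G s] lies below every [W t - G t]; the limit [k] is the supremum of the former, so
    no improper integral is involved. *)
Lemma tail_limit W V C j : 0 <= C -> isd W V -> (forall t, 0 <= t -> `|V t| <= C * pinv j.+2 t) ->
  exists k, forall t, 0 <= t -> `|W t - k| <= C * pinv j.+1 t.
Proof.
move=> C0 dW hV; pose G t := - C * pinv j.+1 t.
have G0 t : 0 <= t -> G t <= 0 by move=> t0; rewrite /G mulNr oppr_le0 mulr_ge0// pinv_ge0.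
have key s t : 0 <= s -> s <= t -> `|W t - W s| <= G t - G s.
  move=> s0 st; apply: (@mvt_le R W V G (fun t => C * j.+1%:R * pinv j.+2 t)) => // [x|x] /andP[sx _].
    by apply: dval (dscale (- C) (dpinv j.+1 (le_trans s0 sx))) _; ring.
  have x0 := le_trans s0 sx; apply: le_trans (hV x x0) _.
  by rewrite -mulrA ler_wpM2l// ler_peMl ?pinv_ge0// ler1n.
have cross s t : 0 <= s -> 0 <= t -> W s + G s <= W t - G t.
  move=> s0 t0; have Gs := G0 s s0; have Gt := G0 t t0.
  case: (leP s t) => [st|/ltW ts].
    by have := key _ _ s0 st; rewrite ler_norml => /andP[h1 h2]; lra.
  by have := key _ _ t0 ts; rewrite ler_norml => /andP[h1 h2]; lra.
pose E := [set W s + G s | s in [set s | 0 <= s]].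
have hE : has_sup E.
  split; first by exists (W 0 + G 0); exists 0 => //=.
  by exists (W 0 - G 0) => _ [s /= s0 <-]; exact: cross.
exists (sup E) => t t0; rewrite ler_distl; apply/andP; split.
  rewrite lerBlDr; have := cross t t t0 t0.
  have : sup E <= W t - G t.
    by apply: ge_sup => [|_ [s /= s0 <-]]; [exact: hE.1|exact: cross].
  by rewrite /G; lra.
have : W t + G t <= sup E by apply: (ub_le_sup hE.2); exists t.
by rewrite /G; lra.
Qed.

End Tails.

(** * Integration against compactly supported functions *)

Section CompactSupport.
Context {R : realType}.
Implicit Types (F f g h : R -> R) (x y t C B : R).

Lemma csuppM h g : bdd_supp g -> bdd_supp (fun x => h x * g x).
Proof. by move=> [n hn]; exists n => x /hn ->; rewrite mulr0. Qed.

Lemma L1_csupp g : continuous g -> bdd_supp g -> L1 g.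
Proof.
move=> cg [n hn]; have hi := cont_itgable (- n) n cg.
have e : (EFin \o g) \_ `[- n, n] = EFin \o g.
  apply/funext => x; rewrite patchE; case: ifPn => // /negP xn /=.
  rewrite hn//; rewrite ltNge; apply/negP; rewrite ler_norml => h.
  by apply: xn; rewrite inE /= in_itv.
rewrite /L1 -e -integrable_mkcond//.
Qed.

Lemma csupp_bounded g : continuous g -> bdd_supp g -> exists M, forall x, `|g x| <= M.
Proof.
move=> cg [n hn]; have [n0|n0] := leP 0 n; last first.
  by exists 0 => x; rewrite hn ?normr0// (lt_le_trans n0).
have cn := cont_norm cg.
have n1 : - n <= n by rewrite ge0_cp.
have [c _ hc] := EVT_max n1 (@cont_within R _ (- n) n cn).
exists `|g c| => x; have [hx|/hn->] := leP `|x| n; last by rewrite normr0.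
by apply: hc; rewrite in_itv /= -ler_norml.
Qed.

Lemma L1_bddM h g B : bmeas h -> (forall x, `|h x| <= B) -> continuous g -> bdd_supp g ->
  L1 (fun x => h x * g x).
Proof.
move=> mh hB cg sg; apply: (@L1_le _ _ (fun x => B * `|g x|)).
- by apply: measurable_funM => //; exact: cont_bmeas.
- by apply: L1Z; exact: integrable_norm (L1_csupp cg sg).
- by move=> x; rewrite normrM ler_wpM2r.
Qed.

Lemma rint_bound f C : L1 f -> (forall a b, itg a b (fun x => `|f x|) <= C) -> `|rint f| <= C.
Proof.
move=> hf hC; have hc : `|itg (- n%:R) n%:R f| @[n --> \oo] --> `|rint f|.
  by apply: cvg_norm; exact: rint_lim.
have hl := cvg_lim (@Rhausdorff R) hc.
rewrite -hl; apply: limr_le; first by apply: cvgP hc.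
by near=> n; apply: le_trans (itg_norm _ _ (L1_locint hf)) (hC _ _).
Unshelve. all: by end_near. Qed.

Lemma rint_eventually f l : L1 f -> (exists N, forall n : nat, (N <= n)%N -> itg (- n%:R) n%:R f = l) -> rint f = l.
Proof.
move=> hf [N hN]; apply: (cvg_unique _ (rint_lim hf)); first exact: Rhausdorff.
by apply/cvg_epsP => e e0; exists N => n /hN ->; rewrite subrr normr0 ltW.
Qed.

Lemma bdd_supp_nat g : bdd_supp g -> exists N, forall (n : nat) x, (N <= n)%N -> n%:R <= `|x| -> g x = 0.
Proof.
move=> [m hm]; exists (Num.bound `|m|) => n x hn hx; apply: hm.
apply: le_lt_trans (ler_norm m) _; apply: lt_le_trans (archi_boundP (normr_ge0 m)) _.
by apply: le_trans hx; rewrite ler_nat.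
Qed.

Lemma rint_prim F f : isd F f -> continuous f -> bdd_supp F -> bdd_supp f -> rint f = 0.
Proof.
move=> dF cf sF sf; apply: rint_eventually (L1_csupp cf sf) _.
have [N hN] := bdd_supp_nat sF; exists N => n hn.
have n0 : 0 <= n%:R :> R by [].
by rewrite (itg_FTC _ dF cf) ?ge0_cp// !(hN n) ?normrN ?(ger0_norm n0)// subrr.
Qed.

Lemma rint_parts F f g g1 : isd F f -> continuous f -> isd g g1 -> continuous g1 ->
  bdd_supp g -> bdd_supp g1 -> rint (fun y => f y * g y) = - rint (fun y => F y * g1 y).
Proof.
move=> dF cf dg cg1 sg sg1; have cF := isd_cont dF; have cg := isd_cont dg.
have c1 := cont_mul cf cg; have c2 := cont_mul cF cg1.
have s1 := csuppM f sg; have s2 := csuppM F sg1.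
apply/eqP; rewrite -addr_eq0 -rintD; [|exact: L1_csupp|exact: L1_csupp].
apply/eqP; apply: (rint_prim (F := fun y => F y * g y)).
- by move=> y; exact: dmul.
- exact: cont_add.
- exact: csuppM.
- have [N1 h1] := s1; have [N2 h2] := s2; exists (Num.max N1 N2) => y hy.
  by rewrite h1 ?h2 ?addr0// (le_lt_trans _ hy)// le_max lexx ?orbT.
Qed.

Lemma isd_supp g g1 : isd g g1 -> bdd_supp g -> bdd_supp g1.
Proof.
move=> dg [n hn]; exists n => x hx.
have h0 : has_deriv g x 0.
  have hl : \forall y \near x, n < `|y|.
    by have /cvgr_gt := @norm_continuous R R x; apply.
  apply: (near_eq_is_derive _ (dcst 0 x)).
  by near=> y; rewrite hn//; near: y.
by have [_ <-] := dg x; have [_ ->] := h0.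
Unshelve. all: by end_near. Qed.

Lemma eq_itg_oo a b f g B : lmeas f -> lmeas g -> (forall x, `|f x| <= B) ->
  (forall x, a < x < b -> f x = g x) -> itg a b f = itg a b g.
Proof.
move=> lf lg fB fg.
have h : itg a b f @[_ --> \oo] --> itg a b g.
  apply: (itg_bdd_cvg (f := fun=> f) (B := B)) => // x /fg ->; exact: cvg_cst.
by apply: (cvg_unique _ _ h); [exact: Rhausdorff|exact: cvg_cst].
Qed.

End CompactSupport.

(** * Total mass of the kernel of the cutoff *)

Section JacksonMass.
Context {R : realType}.
Implicit Types (x y t C : R).
Local Notation V := (kern (@jac R)).

Lemma bddm_jac : bddm (@jac R) 1. Proof. by split; [exact: lmeas_jac|exact: jac_norm]. Qed.

Lemma cont_V : continuous V. Proof. exact: cont_kern bddm_jac. Qed.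

Lemma itg_reflect f n : 0 <= n -> continuous f -> (forall x, f (- x) = f x) ->
  itg (- n) n f = 2 * itg 0 n f :> R.
Proof.
move=> n0 cf fe; have [F dF F0] := ex_prim0 cf.
rewrite !(itg_FTC _ dF cf) ?ge0_cp// (prim_even dF fe) F0; ring.
Qed.

Lemma rint_reflect f : continuous f -> (forall x, f (- x) = f x) -> (forall x, 1 <= `|x| -> f x = 0) ->
  rint f = 2 * itg 0 1 f :> R.
Proof.
move=> cf fe fo; rewrite -(itg_reflect ler01 cf fe).
have sf : bdd_supp f by exists 1 => x /ltW; exact: fo.
apply: rint_eventually (L1_csupp cf sf) _; exists 1%N => n n1; have n1' : 1 <= n%:R :> R by rewrite ler1n.
have li := cont_locint cf.
rewrite (itg_add (b := - 1)) ?lerN2//; last by lra.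
rewrite (itg_add (a := - 1) (b := 1))//.
rewrite (eq_itg (g := fun=> 0)); last first.
  by move=> x /andP[_ h]; apply: fo; rewrite ler0_norm; lra.
rewrite [X in _ + (_ + X)](eq_itg (g := fun=> 0)); last first.
  by move=> x /andP[h _]; apply: fo; rewrite ger0_norm; lra.
by rewrite !itg_cst ?lerN2// !mul0r add0r addr0.
Qed.

Lemma cont_pdf l (s : R) : 0 < s -> continuous (normal_pdf l s).
Proof. by move=> s0; apply: continuous_normal_pdf; rewrite gt_eqF. Qed.

(** Fubini and the transform of a Gaussian: pairing [V] with a wide Gaussian averages [jac] against
    a narrow normal density. *)
Lemma rint_V_gs e : 0 < e ->
  L1 (fun y => V y * gs e y) /\ rint (fun y => V y * gs e y) = rint (fun x => normal_pdf 0 e x * jac x).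
Proof.
move=> e0; pose F (z : R * R) := jac z.2 * cos (z.1 * z.2) * gs e z.1.
have mF : measurable_fun [set: R * R] F.
  apply: measurable_funM; first apply: measurable_funM.
  - by apply: measurableT_comp measurable_snd; apply: cont_bmeas; exact: cont_jac.
  - apply: measurableT_comp; first by apply: cont_bmeas; exact: continuous_cos.
    by apply: measurable_funM.
  - by apply: measurableT_comp measurable_fst; apply: cont_bmeas; exact: cont_gs.
have c1 (z : R * R) : `|jac z.2 * cos (z.1 * z.2)| <= 1.
  by rewrite normrM mulr_ile1// ?jac_norm ?cos_le1.
have FB z : `|F z| <= gs e z.1.
  by rewrite normrM (ger0_norm (ltW (gs_gt0 _ _))) ler_piMl// ltW// gs_gt0.
have F1 z : `|F z| <= 1 by apply: le_trans (FB z) _; exact: gs_le1.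
have FM eta : (\int[@lmu R]_x (`|F (x, eta)|)%:E <= (rint (gs e))%:E)%E.
  have -> : (rint (gs e))%:E = (\int[@lmu R]_x (gs e x)%:E)%E.
    by rewrite /rint /Rintegral fineK//; apply: integrable_fin_num => //; exact: L1_gs.
  apply: ge0_le_integral => //.
  - apply/measurable_EFinP; apply: measurable_normr.
    exact: measurableT_comp mF (measurable_pair2 eta).
  - by apply/measurable_EFinP; apply: cont_bmeas; exact: cont_gs.
  - by move=> x _; rewrite lee_fin (FB (x, eta)).
have [L _ E] := Fubini01 mF F1 FM.
have VE y : V y * gs e y = pi^-1 * itg 0 1 (fun eta => F (y, eta)).
  rewrite /kern /cosint -mulrA; congr (_ * _); rewrite [LHS]mulrC.
  rewrite -itgZ; last by apply: cosint_locint lmeas_jac (@jac_norm R).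
  by apply: eq_itg => t _; rewrite /F /= mulrC.
split; first by rewrite (funext VE); exact: L1Z.
rewrite (funext VE) rintZ// E.
have -> : itg 0 1 (fun eta => rint (fun x => F (x, eta))) = itg 0 1 (fun eta => pi * (2 * (normal_pdf 0 e eta * jac eta))).
  apply: eq_itg => eta _; rewrite (_ : (fun x => F (x, eta)) = fun x => jac eta * (gs e x * cos (eta * x))).
    rewrite rintZ; first by rewrite -/(cgs e eta) (cgsE _ e0); ring.
    apply: L1_gs_bdd => //; last by move=> x; exact: cos_le1.
    by apply: cont_bmeas; exact: cos_cont.
  by apply/funext => x; rewrite /F /= (mulrC x eta); ring.
have cpj : continuous (fun x => normal_pdf 0 e x * jac x).
  by apply: cont_mul; [exact: cont_pdf|exact: cont_jac].
have li := cont_locint cpj.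
rewrite itgZ; last exact: locintZ.
rewrite itgZ// mulrA mulVf ?mul1r ?gt_eqF ?pi_gt0//; apply/esym; apply: rint_reflect => //.
- by move=> x; rewrite jac_even; congr (_ * _); rewrite !normal_pdfE ?gt_eqF// /normal_fun !subr0 sqrrN.
- by move=> x /jac_out ->; rewrite mulr0.
Qed.

Lemma V_pinv : exists2 C, 0 <= C & forall j t, (j <= 6)%N -> 0 <= t -> `|V t| <= C * pinv j t.
Proof.
have [C hC] : exists C, forall t, `|V t| * (1 + `|t|) ^+ 6 <= C by eexists; exact: jac_decay.
have C0 : 0 <= C by apply: le_trans (hC 0); rewrite mulr_ge0// exprn_ge0// addr_ge0.
exists C => // j t j6 t0; have := hC t; rewrite (ger0_norm t0) => h.
have t1 : 0 < 1 + t by rewrite ltr_wpDr.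
rewrite /pinv exprVn ler_pdivlMr ?exprn_gt0//; apply: le_trans h.
by rewrite ler_wpM2l// ler_weXn2l// lerDl.
Qed.

Lemma V_even t : V (- t) = V t. Proof. exact: kernN. Qed.

Lemma pinv_le_inv t : 1 <= t -> pinv 3 t <= t^-1.
Proof.
move=> t1; have t0 : 0 < t by lra.
rewrite /pinv exprVn lef_pV2 ?posrE ?exprn_gt0//; last lra.
have := exprn_ege1 2 (_ : 1 <= 1 + t); rewrite (exprS _ 2) => h; have {}h := h ltac:(lra).
have := mulr_ge0 (ltW t0) (_ : 0 <= (1 + t) ^+ 2 - 1) => /(_ ltac:(lra)); nra.
Qed.

Lemma cont_V_gs e : continuous (fun y => V y * gs e y).
Proof. by apply: cont_mul; [exact: cont_V|exact: cont_gs]. Qed.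

Lemma V_gs_pointwise C e x : 0 <= C -> 0 <= x -> `|V x| <= C * pinv 4 x ->
  `|V x - V x * gs e x| <= C * e ^+ 2 / 2 * pinv 2 x.
Proof.
move=> C0 x0 hV; rewrite -{1}[V x]mulr1 -mulrBr normrM.
have hg : `|1 - gs e x| <= (e * x) ^+ 2 / 2.
  rewrite ger0_norm ?subr_ge0 ?gs_le1// /gs lerBlDr -lerBlDl.
  by have := expR_ge1Dx (- (e * x) ^+ 2 / 2); lra.
apply: le_trans (ler_pM _ _ hV hg) _ => //.
have px : x ^+ 2 * pinv 4 x <= pinv 2 x.
  have x1 : 0 < 1 + x by rewrite ltr_wpDr.
  have e4 : pinv 4 x = pinv 2 x * pinv 2 x by rewrite /pinv; ring.
  rewrite e4 mulrA ler_piMl ?pinv_ge0//.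
  rewrite /pinv exprVn ler_pdivrMr ?exprn_gt0// mul1r ler_pXn2r ?nnegrE ?(ltW x1)//; lra.
have a0 : 0 <= C * e ^+ 2 / 2 by rewrite divr_ge0// mulr_ge0// sqr_ge0.
have := ler_wpM2l a0 px; rewrite exprMn => h.
by apply: le_trans h; rewrite le_eqVlt; apply/orP; left; apply/eqP; ring.
Qed.

Lemma V_gs_itg C e n : 0 <= C -> 0 <= n -> (forall t, 0 <= t -> `|V t| <= C * pinv 4 t) ->
  `|itg (- n) n V - itg (- n) n (fun y => V y * gs e y)| <= C * e ^+ 2.
Proof.
move=> C0 n0 hV; have lV := cont_locint cont_V; have lVs := cont_locint (@cont_V_gs e).
rewrite -itgB//; apply: le_trans (itg_norm _ _ (locintB lV lVs)) _.
have cd : continuous (fun y => `|V y - V y * gs e y|).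
  by apply: cont_norm; apply: cont_sub; [exact: cont_V|exact: cont_V_gs].
rewrite itg_reflect//; last by move=> x; rewrite V_even /gs mulrN sqrrN.
have [F dF F0] := ex_prim0 cd; rewrite (itg_FTC n0 dF cd) F0 subr0.
pose a := C * e ^+ 2 / 2.
have a0 : 0 <= a by rewrite divr_ge0// mulr_ge0// sqr_ge0.
have h : `|F n - F 0| <= - a * pinv 1 n - (- a * pinv 1 0).
  apply: (@mvt_le R F (fun y => `|V y - V y * gs e y|) (fun t => - a * pinv 1 t)
     (fun t => a * pinv 2 t) 0 n n0) => [x _|x|x].
  - exact: dF.
  - move=> /andP[x0 _].
    by apply: dval (dscale (- a) (dpinv 1 x0)) _; ring.
  - by move=> /andP[x0 _]; rewrite normr_id; apply: V_gs_pointwise => //; exact: hV.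
have p1 := mulr_ge0 a0 (pinv_ge0 1 n0).
have p0 : pinv 1 (0 : R) = 1 by rewrite /pinv addr0 invr1 expr1n.
rewrite F0 subr0 p0 in h.
have := le_trans (ler_norm _) h; rewrite (_ : C * e ^+ 2 = 2 * a); last by rewrite /a; field.
by lra.
Qed.

(** As [e] tends to 0, the Gaussian-weighted mass of [V] tends both to the total mass [2 * k] and to
    [jac 0 = 1]. *)
Lemma V_half W C k : 0 <= C -> (forall t, 0 <= t -> `|V t| <= C * pinv 4 t) ->
  isd W V -> W 0 = 0 -> (forall t, 0 <= t -> `|W t - k| <= C * pinv 3 t) -> k = 2^-1.
Proof.
move=> C0 hV dW W0 hk.
have c1 := pdf_approx (cont_bmeas (@cont_jac R)) (@jac_norm R) (@cont_jac R 0).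
rewrite jac0 in c1.
(* The error comes from [1 - gs e x <= (e * x)^2 / 2] and is uniform in the interval of integration,
   so the limit in [n] can be taken with [e] fixed. *)
have key e : 0 < e -> `|2 * k - rint (fun y => V y * gs e y)| <= C * e ^+ 2.
  move=> e0; have [hL _] := rint_V_gs e0.
  have c2 : itg (- n%:R) n%:R (fun y => V y * gs e y) @[n --> \oo] --> rint (fun y => V y * gs e y) by exact: rint_lim.
  apply/ler_addgt0Pr => d d0.
  have [N1 h1] := (cvg_epsP _ _).1 c2 (d / 2) (divr_gt0 d0 (ltr0n _ 2)).
  have [N2 h2] := ex_inv_le (2 * C) (divr_gt0 d0 (ltr0n _ 2)).
  pose m := maxn N1 N2; pose n := m.+1; have n0 : 0 <= n%:R :> R by [].
  have g1 := h1 n (leqW (leq_maxl _ _)).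
  have g2 : `|2 * k - itg (- n%:R) n%:R V| <= d / 2.
    rewrite (itg_reflect n0 cont_V V_even) (itg_FTC n0 dW cont_V) W0 subr0 -mulrBr normrM (ger0_norm (_ : 0 <= 2))//.
    rewrite distrC; apply: le_trans (ler_wpM2l _ (hk _ n0)) _ => //.
    apply: le_trans (h2 m (leq_maxr _ _)); rewrite -mulrA !ler_wpM2l//.
    by apply: pinv_le_inv; rewrite ler1n.
  have g3 : `|itg (- n%:R) n%:R V - itg (- n%:R) n%:R (fun y => V y * gs e y)| <= C * e ^+ 2 by exact: V_gs_itg.
  have -> : 2 * k - rint (fun y => V y * gs e y) = (2 * k - itg (- n%:R) n%:R V) +
     (itg (- n%:R) n%:R V - itg (- n%:R) n%:R (fun y => V y * gs e y)) -
     (rint (fun y => V y * gs e y) - itg (- n%:R) n%:R (fun y => V y * gs e y)) by ring.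
  apply: le_trans (ler_normB _ _) _; apply: le_trans (lerD (ler_normD _ _) (lexx _)) _; lra.
have c3 : C * n.+1%:R^-1 ^+ 2 @[n --> \oo] --> (0 : R).
  rewrite -[X in _ --> X](mulr0 C); apply: cvgMr.
  rewrite (_ : (fun n : nat => _) = (fun n : nat => n.+1%:R^-1 * n.+1%:R^-1)); last by apply/funext => n; rewrite expr2.
  have h := cvgM (@cvg_harmonic R) (@cvg_harmonic R); rewrite mulr0 in h; exact: h.
have : `|2 * k - 1| <= 0.
  apply/ler_addgt0Pr => d d0; rewrite add0r.
  have d2 : 0 < d / 2 by rewrite divr_gt0.
  have [N1 h1] := (cvg_epsP _ _).1 c1 _ d2; have [N2 h2] := (cvg_epsP _ _).1 c3 _ d2.
  pose n := maxn N1 N2; have g1 := h1 n (leq_maxl _ _); have := h2 n (leq_maxr _ _).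
  rewrite sub0r normrN => /(le_trans (ler_norm _)) g2.
  have n0 : 0 < n.+1%:R^-1 :> R by rewrite invr_gt0.
  have g3 := key _ n0; rewrite (rint_V_gs n0).2 in g3.
  have -> : 2 * k - 1 = (2 * k - rint (fun x => normal_pdf 0 n.+1%:R^-1 x * jac x)) - (1 - rint (fun x => normal_pdf 0 n.+1%:R^-1 x * jac x)) by ring.
  by rewrite [d]splitr; apply: le_trans (ler_normB _ _) _; apply: lerD => //; exact: le_trans g3 g2.
rewrite normr_le0 subr_eq0 => /eqP h; apply: (mulfI (_ : 2 != 0 :> R)) => //.
by rewrite mulfV.
Qed.

End JacksonMass.

(** * Kernels for the deviation from convolution with the cutoff *)

Section ErrorKernels.
Context {R : realType}.
Implicit Types (g : R -> R) (x y t C : R) (b : bool).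
Local Notation V := (kern (@jac R)).

(** Quadratic decay gives [4^(-j)], at most [(theta / 2)^j] because [theta >= 1/2]. *)
Lemma kdec_pinv theta C (K : R -> R) : 2^-1 <= theta < 1 -> 0 <= C ->
  (forall t, `|K t| <= C * pinv 2 `|t|) -> kdec theta C K.
Proof.
move=> /andP[t1 t2] C0 hK; split=> [t|j t jt].
  apply: le_trans (hK t) _; rewrite ler_piMr// /pinv exprn_ile1 ?invr_ge0 ?addr_ge0//.
  by rewrite invf_le1 ?ltr_wpDr// lerDl.
apply: le_trans (hK t) _; rewrite ler_wpM2l//.
have p0 : 0 < 2 ^+ j :> R by rewrite exprn_gt0.
have h1 : (1 + `|t|)^-1 <= (2 ^+ j)^-1 by rewrite lef_pV2 ?posrE ?ltr_wpDr//; lra.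
have h0 : 0 <= (1 + `|t|)^-1 by rewrite invr_ge0 addr_ge0.
apply: (@le_trans _ _ ((2 ^+ j)^-1 ^+ 2)); first by rewrite ler_pXn2r ?nnegrE ?invr_ge0 ?(ltW p0).
rewrite -exprVn -exprM mulnC exprM lerXn2r ?nnegrE ?sqr_ge0//; first by rewrite divr_ge0//; lra.
by rewrite expr2 mulrC ler_wpM2r ?invr_ge0.
Qed.

Lemma bmeas_sgn : bmeas (fun x : R => Num.sg x).
Proof. exact: bmeas_sg. Qed.

Section Identity.
Variables (W U : R -> R) (k2 : R).
Hypothesis dW : isd W V.
Hypothesis dU : isd U W.

(* Antiderivatives of [V - delta]: they turn [g - V * g] into a convolution of a derivative of
   [g]. *)
Definition err1 t := W t - 2^-1 * Num.sg t.
Definition err2 t := U t - 2^-1 * `|t| - k2.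

Let cW : continuous W. Proof. exact: isd_cont dW. Qed.
Let cU : continuous U. Proof. exact: isd_cont dU. Qed.

Lemma isd_refl (F f : R -> R) s x : isd F f -> isd (fun y => F (s * (x - y))) (fun y => - s * f (s * (x - y))).
Proof.
move=> dF y; apply: dval (dcomp (dF _) (dscale s (dsub (dcst x y) (did y)))) _; ring.
Qed.

Lemma cont_refl (F : R -> R) s x : continuous F -> continuous (fun y => F (s * (x - y))).
Proof.
move=> cF y; apply: (@continuous_comp _ _ _ (fun y => s * (x - y)) F); last exact: cF.
by apply: (@dcont R y _ (s * (0 - 1))); apply: dscale; apply: dsub (dcst x y) (did y).
Qed.

Lemma rint_refl_parts (F f g g1 : R -> R) s x : isd F f -> continuous f -> isd g g1 -> continuous g1 ->
  bdd_supp g -> s * rint (fun y => f (s * (x - y)) * g y) = rint (fun y => F (s * (x - y)) * g1 y).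
Proof.
move=> dF cf dg cg1 sg; have sg1 := isd_supp dg sg; have cg := isd_cont dg.
have := rint_parts (isd_refl s x dF) _ dg cg1 sg sg1.
have cr := @cont_refl f s x cf.
have -> : rint (fun y => - s * f (s * (x - y)) * g y) = - (s * rint (fun y => f (s * (x - y)) * g y)).
  rewrite -mulNr -rintZ; last by apply: L1_csupp; [exact: cont_mul|exact: csuppM].
  by congr rint; apply/funext => y; rewrite mulrA.
by move=> h; apply: oppr_inj; rewrite h//; apply: cont_mul => //; exact: cont_cst.
Qed.

(** Half of the sign is a primitive of the unit mass at 0: integrating [g1] separately on both sides
    of [x] leaves [2 * g x]. *)
Lemma rint_sg s g g1 x : 0 < s -> isd g g1 -> continuous g1 -> bdd_supp g ->
  rint (fun y => Num.sg (s * (x - y)) * g1 y) = 2 * g x.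
Proof.
move=> s0 dg cg1 sg; have sg1 := isd_supp dg sg.
have msg : bmeas (fun y => Num.sg (s * (x - y))).
  by apply: measurableT_comp bmeas_sgn _; apply: cont_bmeas; apply: (@cont_refl id) => y; exact: cvg_id.
have sgB y : `|Num.sg (s * (x - y))| <= 1 by rewrite normr_sg lern1 leq_b1.
have hL := L1_bddM msg sgB cg1 sg1.
apply: (rint_eventually hL).
have [N hN] := bdd_supp_nat sg; exists (maxn N (Num.bound `|x|)) => n; rewrite geq_max => /andP[n1 n2].
have xn : `|x| < n%:R by apply: lt_le_trans (archi_boundP (normr_ge0 x)) _; rewrite ler_nat.
have /andP[x1 x2] : - n%:R <= x <= n%:R by rewrite -ler_norml ltW.
have n0 : 0 <= n%:R :> R by [].
have [M gM] := csupp_bounded cg1 sg1.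
have hM y : `|Num.sg (s * (x - y)) * g1 y| <= M by rewrite normrM -[M]mul1r ler_pM.
rewrite (itg_add (b := x))//; last exact: L1_locint hL.
have ls := borel_lebesgue (L1_bmeas hL).
rewrite (eq_itg_oo (g := g1) (B := M))//; [|exact: lmeas_cont|]; last first.
  by move=> y /andP[_ yx]; rewrite gtr0_sg ?mul1r// mulr_gt0// subr_gt0.
rewrite [X in _ + X](eq_itg_oo (g := fun y => - 1 * g1 y) (B := M))//; [|by apply: lmeas_cont; apply: cont_mul => //; exact: cont_cst|]; last first.
  by move=> y /andP[yx _]; rewrite ltr0_sg// pmulr_rlt0// subr_lt0.
rewrite itgZ; last exact: cont_locint.
rewrite !(itg_FTC _ dg cg1)// (hN n n%:R n1) ?(hN n (- n%:R) n1) ?normrN ?(ger0_norm n0)//; ring.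
Qed.

Lemma rint_abs s g g1 g2 x : 0 < s -> isd g g1 -> isd g1 g2 -> continuous g2 -> bdd_supp g ->
  rint (fun y => `|s * (x - y)| * g2 y) = s * (2 * g x).
Proof.
move=> s0 dg dg1 cg2 sg; have sg1 := isd_supp dg sg; have sg2 := isd_supp dg1 sg1.
have ca : continuous (fun y => `|s * (x - y)|) by apply: cont_norm; apply: (@cont_refl id) => y; exact: cvg_id.
have cag : continuous (fun y => `|s * (x - y)| * g2 y) by exact: cont_mul.
apply: rint_eventually; first by apply: L1_csupp => //; exact: csuppM.
have [N hN] := bdd_supp_nat sg; have [N1 hN1] := bdd_supp_nat sg1.
exists (maxn (maxn N N1) (Num.bound `|x|)) => n; rewrite !geq_max => /andP[/andP[n1 n1'] n2].
have xn : `|x| < n%:R by apply: lt_le_trans (archi_boundP (normr_ge0 x)) _; rewrite ler_nat.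
have /andP[x1 x2] : - n%:R <= x <= n%:R by rewrite -ler_norml ltW.
have n0 : 0 <= n%:R :> R by [].
rewrite (itg_add (b := x))//; last exact: cont_locint.
have dF : isd (fun y => s * ((x - y) * g1 y + g y)) (fun y => s * (x - y) * g2 y).
  move=> y; apply: dval (dscale s (dadd (dmul (dsub (dcst x y) (did y)) (dg1 y)) (dg y))) _; ring.
have cF : continuous (fun y => s * (x - y) * g2 y).
  by apply: cont_mul => //; apply: (@cont_refl id) => y; exact: cvg_id.
rewrite (eq_itg (g := fun y => s * (x - y) * g2 y)); last first.
  by move=> y /andP[_ yx]; rewrite ger0_norm// mulr_ge0 ?(ltW s0)// subr_ge0.
rewrite [X in _ + X](eq_itg (g := fun y => - 1 * (s * (x - y) * g2 y))); last first.
  by move=> y /andP[yx _]; rewrite ler0_norm ?mulN1r ?mulNr// pmulr_rle0// subr_le0.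
rewrite itgZ; last exact: cont_locint.
rewrite !(itg_FTC _ dF cF)// (hN n n%:R n1) ?(hN n (- n%:R) n1) ?(hN1 n n%:R n1') ?(hN1 n (- n%:R) n1') ?normrN ?(ger0_norm n0)//; ring.
Qed.

Lemma err1E s g g1 x : 0 < s -> isd g g1 -> continuous g1 -> bdd_supp g ->
  s * rint (fun y => V (s * (x - y)) * g y) - g x = rint (fun y => err1 (s * (x - y)) * g1 y).
Proof.
move=> s0 dg cg1 sg; have sg1 := isd_supp dg sg.
have msg : bmeas (fun y => Num.sg (s * (x - y))).
  by apply: measurableT_comp bmeas_sgn _; apply: cont_bmeas; apply: (@cont_refl id) => y; exact: cvg_id.
have sgB y : `|Num.sg (s * (x - y))| <= 1 by rewrite normr_sg lern1 leq_b1.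
have hL := L1_bddM msg sgB cg1 sg1.
have hW : L1 (fun y => W (s * (x - y)) * g1 y) by apply: L1_csupp; [apply: cont_mul => //; exact: cont_refl|exact: csuppM].
rewrite (_ : (fun y => err1 _ * _) = fun y => W (s * (x - y)) * g1 y + (- 2^-1) * (Num.sg (s * (x - y)) * g1 y)); last first.
  by apply/funext => y; rewrite /err1; ring.
rewrite rintD//; last exact: L1Z.
by rewrite rintZ// (rint_sg x s0 dg cg1 sg) (rint_refl_parts s x dW cont_V dg cg1 sg); field.
Qed.

Lemma err2E s g g1 g2 x : 0 < s -> isd g g1 -> isd g1 g2 -> continuous g2 -> bdd_supp g ->
  s * rint (fun y => V (s * (x - y)) * g y) - g x = s^-1 * rint (fun y => err2 (s * (x - y)) * g2 y).
Proof.
move=> s0 dg dg1 cg2 sg; have sg1 := isd_supp dg sg; have sg2 := isd_supp dg1 sg1.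
have hU : L1 (fun y => U (s * (x - y)) * g2 y) by apply: L1_csupp; [apply: cont_mul => //; exact: cont_refl|exact: csuppM].
have ha : L1 (fun y => `|s * (x - y)| * g2 y).
  apply: L1_csupp; last exact: csuppM.
  by apply: cont_mul => //; apply: cont_norm; apply: (@cont_refl id) => y; exact: cvg_id.
have hg2 : L1 g2 by exact: L1_csupp.
rewrite (_ : (fun y => err2 _ * _) = fun y => U (s * (x - y)) * g2 y + ((- 2^-1) * (`|s * (x - y)| * g2 y) + (- k2) * g2 y)); last first.
  by apply/funext => y; rewrite /err2; ring.
rewrite rintD//; last by apply: L1D; exact: L1Z.
rewrite rintD//; [|exact: L1Z|exact: L1Z].
rewrite !rintZ// (rint_abs x s0 dg dg1 cg2 sg) (rint_prim dg1 cg2 sg1 sg2).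
rewrite -(rint_refl_parts s x dU cW dg1 cg2 sg1) (rint_refl_parts s x dW cont_V dg (isd_cont dg1) sg).
field; rewrite gt_eqF//.
Qed.

End Identity.

(** By [V_half] the odd primitive [W] tends to [1/2], and [k2] is the limit of [U t - t / 2]. Each
    use of [tail_limit] costs one order: decay 4 of [V] leaves 3 for [err1] and 2 for [err2]. *)
Lemma error_kernels theta : 2^-1 <= theta < 1 -> exists K C, forall b, [/\ bmeas (K b), 0 <= C,
  kdec theta C (K b) & forall (s : R) g gs x, 0 < s -> derivs b g gs -> bdd_supp g ->
    s * rint (fun y => V (s * (x - y)) * g y) - g x = s ^- b * rint (fun y => K b (s * (x - y)) * gs y)].
Proof.
move=> theta12; have [C C0 hV] := @V_pinv R.
have [W dW W0] := ex_prim0 (@cont_V R); have cW := isd_cont dW.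
have [U dU U0] := ex_prim0 cW.
have [k hk] : exists k, forall t, 0 <= t -> `|W t - k| <= C * pinv 3 t.
  by apply: (tail_limit C0 dW) => t; exact: hV.
have kE : k = 2^-1 by apply: (V_half C0 _ dW W0 hk) => t; exact: hV.
have Wo t : W (- t) = - W t by rewrite (prim_even dW (@V_even R)) W0 mulr0 sub0r.
have Ue := prim_odd dU Wo.
have dU2 : isd (fun t => U t - 2^-1 * t) (fun t => W t - 2^-1).
  by move=> t; apply: dval (dsub (dU t) (dscale 2^-1 (did t))) _; rewrite mulr1.
have [k2 hk2] : exists k, forall t, 0 <= t -> `|U t - 2^-1 * t - k| <= C * pinv 2 t.
  by apply: (tail_limit C0 dU2) => t t0; rewrite -kE; exact: hk.
exists (fun b => if b then err2 U k2 else err1 W), C; case; split => //.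
- apply: measurable_funB; last exact: measurable_cst.
  apply: cont_bmeas; apply: cont_sub; first exact: isd_cont dU.
  by apply: cont_mul; [exact: cont_cst|apply: cont_norm => t; exact: cvg_id].
- apply: kdec_pinv => // t; rewrite /err2.
  have -> : U t = U `|t| by case: (leP 0 t) => [/ger0_norm|/ltr0_norm] -> //; rewrite Ue.
  by apply: hk2.
- by move=> s g gs x s0 [cgs [g1 [dg dg1]]] sg; rewrite expr1; exact: (@err2E W U k2 dW dU s g g1 gs x s0 dg dg1 cgs sg).
- apply: measurable_funB; first exact: cont_bmeas.
  by apply: measurable_funM; [exact: measurable_cst|exact: bmeas_sgn].
- apply: kdec_pinv => // t; rewrite /err1.
  have p32 : C * pinv 3 `|t| <= C * pinv 2 `|t|.
    rewrite ler_wpM2l// /pinv ler_wiXn2l// ?invr_ge0 ?addr_ge0//.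
    by rewrite invf_le1 ?ltr_wpDr// lerDl.
  move: p32; have [t0|t0|t0] := ltrgt0P t => p32.
  + by apply: le_trans p32; rewrite gtr0_sg// mulr1 -kE; apply: hk; exact: ltW.
  + rewrite ltr0_sg// mulrN1 -normrN (_ : - (W t - - 2^-1) = W (- t) - 2^-1); last by rewrite Wo; ring.
    by apply: le_trans p32; rewrite -kE; apply: hk; rewrite oppr_ge0 ltW.
  + by rewrite t0 W0 sgr0 mulr0 subrr normr0 mulr_ge0// pinv_ge0.
- by move=> s g gs x s0 [cgs dg] sg; rewrite expr0 invr1 mul1r; exact: (@err1E W dW s g gs x s0 dg cgs sg).
Qed.

End ErrorKernels.

(** * Convolutions as trigonometric integrals *)

Section Convolution.
Context {R : realType}.
Variable sigma : R.
Hypothesis sigma0 : 0 < sigma.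
Implicit Types (m g K : R -> R) (x y xi B C : R).

Lemma rint_sum (I : Type) (r : seq I) (F : I -> R -> R) : (forall i, L1 (F i)) ->
  L1 (fun y => \sum_(i <- r) F i y) /\
  rint (fun y => \sum_(i <- r) F i y) = \sum_(i <- r) rint (F i).
Proof.
move=> hF; elim: r => [|i r [IH1 IH2]].
  under eq_fun do rewrite big_nil; rewrite big_nil; split.
    exact: integrable0.
  by rewrite /rint /Rintegral integral0.
under eq_fun do rewrite big_cons; rewrite big_cons -IH2; split; first exact: L1D.
exact: rintD.
Qed.

Lemma rint_dominated (f : nat -> R -> R) (h G : R -> R) : (forall n, bmeas (f n)) -> bmeas h ->
  L1 G -> (forall n x, `|f n x| <= G x) -> (forall x, f n x @[n --> \oo] --> h x) ->
  rint (f n) @[n --> \oo] --> rint h.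
Proof.
move=> mf mh hG fG fh.
have hL n : L1 (f n) by exact: L1_le hG (fG n).
have hh : L1 h.
  apply: (L1_le mh hG) => x.
  have c : `|f n x| @[n --> \oo] --> `|h x| by exact: cvg_norm.
  rewrite -(cvg_lim (@Rhausdorff R) c); apply: limr_le; first exact: cvgP c.
  by near=> n; exact: fG.
have [] := @dominated_convergence _ _ R (@lmu R) setT measurableT
  (fun n => EFin \o f n) (EFin \o h) (EFin \o G).
- by move=> n; apply/measurable_EFinP; exact: mf.
- by apply/measurable_EFinP.
- by apply: aeW => x _; apply/cvg_EFin; [near=> n|exact: fh].
- exact: hG.
- by apply: aeW => x n _ /=; rewrite lee_fin.
move=> _ _ c; apply: fine_cvg; rewrite fineK; last exact: integrable_fin_num.
exact: c.
Unshelve. all: by end_near. Qed.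

Lemma bmeas_affine K x : bmeas K -> bmeas (fun y => K (sigma * (x - y))).
Proof.
move=> mK; apply: measurableT_comp mK _; apply: cont_bmeas; apply: (@cont_refl R id) => y; exact: cvg_id.
Qed.

Definition conv K g x := sigma * rint (fun y => K (sigma * (x - y)) * g y).

Lemma conv_L1 K C g x : bmeas K -> (forall t, `|K t| <= C) -> continuous g -> bdd_supp g ->
  L1 (fun y => K (sigma * (x - y)) * g y).
Proof. by move=> mK KC; apply: L1_bddM => //; exact: bmeas_affine. Qed.

Lemma convB K1 K2 C g x : bmeas K1 -> (forall t, `|K1 t| <= C) -> bmeas K2 -> (forall t, `|K2 t| <= C) ->
  continuous g -> bdd_supp g -> conv (fun t => K1 t - K2 t) g x = conv K1 g x - conv K2 g x.
Proof.
move=> m1 b1 m2 b2 cg sg; rewrite /conv -mulrBr; congr (_ * _).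
have l1 := conv_L1 x m1 b1 cg sg; have l2 := conv_L1 x m2 b2 cg sg.
rewrite -[- rint _]mulN1r -rintZ// -rintD//; last exact: L1Z.
by congr rint; apply/funext => y; ring.
Qed.

(** Coefficients of [g] at the frequency [sigma * xi], normalised so that convolution with [kern m]
    has the amplitudes [m * fcos] and [m * fsin]. *)
Definition fcos g xi := sigma * (pi^-1 * rint (fun y => cos (sigma * xi * y) * g y)).
Definition fsin g xi := sigma * (pi^-1 * rint (fun y => sin (sigma * xi * y) * g y)).
Definition fbound g := sigma * (pi^-1 * rint (fun y => `|g y|)).

Lemma conv_trig_alg (q s a b c d e : R) : q != 0 -> s != 0 ->
  a * b * c + a * d * e = q / s * (a * (s * (q^-1 * c)) * b + a * (s * (q^-1 * e)) * d).
Proof. by move=> q0 s0; field; rewrite q0 s0. Qed.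

Lemma conv_trig_alg0 (q s t : R) : q != 0 -> s != 0 -> s * (q^-1 * (q / s * t)) = t.
Proof. by move=> q0 s0; field; rewrite q0 s0. Qed.

Section Transform.
Variable g : R -> R.
Hypothesis cg : continuous g.
Hypothesis sg : bdd_supp g.

Let Lg : L1 g. Proof. exact: L1_csupp. Qed.
Let Lag : L1 (fun y => `|g y|). Proof. exact: integrable_norm Lg. Qed.
Let pi0 : 0 <= pi^-1 :> R. Proof. by rewrite invr_ge0 pi_ge0. Qed.

Let trig_L1 (c : R -> R) xi : bmeas c -> (forall t, `|c t| <= 1) -> L1 (fun y => c (sigma * xi * y) * g y).
Proof.
move=> mc c1; apply: (L1_bddM (B := 1)) => //.
by apply: measurableT_comp mc _; apply: measurable_funM => //; exact: measurable_cst.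
Qed.

Let bcos : bmeas (cos : R -> R). Proof. by apply: cont_bmeas; exact: continuous_cos. Qed.
Let bsin : bmeas (sin : R -> R). Proof. by apply: cont_bmeas; exact: continuous_sin. Qed.
Let Lcos xi := trig_L1 xi bcos (@cos_le1 R).
Let Lsin xi := trig_L1 xi bsin (@sin_le1 R).

Let trig_bd (c : R -> R) xi : bmeas c -> (forall t, `|c t| <= 1) ->
  `|sigma * (pi^-1 * rint (fun y => c (sigma * xi * y) * g y))| <= fbound g.
Proof.
move=> mc c1; have L := trig_L1 xi mc c1.
rewrite !normrM (gtr0_norm sigma0) (ger0_norm pi0) ler_wpM2l ?(ltW sigma0)// ler_wpM2l//.
apply: le_trans (rint_norm L) _; apply: rint_le => //; first exact: integrable_norm L.
by move=> y; rewrite normrM ler_piMl.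
Qed.

Lemma fcos_le xi : `|fcos g xi| <= fbound g. Proof. exact: trig_bd bcos (@cos_le1 R). Qed.
Lemma fsin_le xi : `|fsin g xi| <= fbound g. Proof. exact: trig_bd bsin (@sin_le1 R). Qed.

Let FubiniP (F : R * R -> R) B : measurable_fun [set: R * R] F -> (forall z, `|F z| <= B * `|g z.1|) ->
  [/\ L1 (fun x => itg 0 1 (fun eta => F (x, eta))),
      bmeas (fun eta => rint (fun x => F (x, eta))) &
      rint (fun x => itg 0 1 (fun eta => F (x, eta))) =
      itg 0 1 (fun eta => rint (fun x => F (x, eta)))].
Proof.
move=> mF FB; have [M gM] := csupp_bounded cg sg.
have LB : L1 (fun y => B * `|g y|) by exact: L1Z.
apply: (Fubini01 (B := `|B| * M) (M := rint (fun y => B * `|g y|))) => // [z|eta].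
  apply: le_trans (FB z) _; apply: le_trans (ler_norm _) _.
  by rewrite normrM normr_id ler_wpM2l.
have -> : (rint (fun y => B * `|g y|))%:E = (\int[@lmu R]_x (B * `|g x|)%:E)%E.
  by rewrite /rint /Rintegral fineK//; exact: integrable_fin_num.
apply: ge0_le_integral => //.
- apply/measurable_EFinP; apply: measurable_normr.
  exact: measurableT_comp mF (measurable_pair2 eta).
- exact: measurable_int LB.
- by move=> x _; rewrite lee_fin; exact: (FB (x, eta)).
Qed.

Let mprod (c : R -> R) : bmeas c -> measurable_fun [set: R * R] (fun z : R * R => c (sigma * z.2 * z.1) * g z.1).
Proof.
move=> mc; apply: measurable_funM.
  apply: measurableT_comp mc _; apply: measurable_funM => //.
  by apply: measurable_funM => //; exact: measurable_cst.
by apply: measurableT_comp measurable_fst; exact: cont_bmeas.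
Qed.

Let bmeas_f (c : R -> R) : bmeas c -> (forall t, `|c t| <= 1) ->
  bmeas (fun xi => sigma * (pi^-1 * rint (fun y => c (sigma * xi * y) * g y))).
Proof.
move=> mc c1; have [|_ m _] := FubiniP (B := 1) (mprod mc).
  by move=> z; rewrite normrM ler_wpM2r.
by apply: measurable_funM; [exact: measurable_cst|apply: measurable_funM => //; exact: measurable_cst].
Qed.

Lemma bmeas_fcos : bmeas (fcos g). Proof. exact: bmeas_f bcos (@cos_le1 R). Qed.
Lemma bmeas_fsin : bmeas (fsin g). Proof. exact: bmeas_f bsin (@sin_le1 R). Qed.

Lemma conv_trig m B x : bmeas m -> (forall t, `|m t| <= B) ->
  conv (kern m) g x = trig (fun xi => m xi * fcos g xi) (fun xi => m xi * fsin g xi) (sigma * x).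
Proof.
move=> mm mB; pose F (z : R * R) := m z.2 * cos (sigma * (x - z.1) * z.2) * g z.1.
have mF : measurable_fun [set: R * R] F.
  apply: measurable_funM; last by apply: measurableT_comp measurable_fst; exact: cont_bmeas.
  apply: measurable_funM; first exact: measurableT_comp mm measurable_snd.
  apply: measurableT_comp bcos _; apply: measurable_funM => //.
  apply: measurable_funM; first exact: measurable_cst.
  by apply: measurable_funB => //; exact: measurable_cst.
have [|_ _ E] := FubiniP (B := B) mF.
  move=> z; rewrite /F !normrM ler_wpM2r// -[B]mulr1 ler_pM//; exact: cos_le1.
have lm : lmeas m by exact: borel_lebesgue.
transitivity (sigma * (pi^-1 * rint (fun y => itg 0 1 (fun eta => F (y, eta))))).
  rewrite -rintZ; last by have [] := FubiniP (B := B) mF; move=> // z; rewrite /F !normrM ler_wpM2r// -[B]mulr1 ler_pM//; exact: cos_le1.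
  congr (_ * _); congr rint; apply/funext => y; rewrite /kern /cosint -mulrA; congr (_ * _).
  rewrite mulrC -itgZ; last exact: cosint_locint lm mB.
  by apply: eq_itg => t _; rewrite mulrC.
have hM : bddm m B by [].
have lf (f : R -> R) : bmeas f -> (forall t, `|f t| <= fbound g) -> bddm (fun t => m t * f t) (B * fbound g).
  move=> bf f1; split; first by apply: lmeasM => //; exact: borel_lebesgue.
  by move=> t; rewrite normrM ler_pM.
have hc := lf _ bmeas_fcos fcos_le; have hs := lf _ bmeas_fsin fsin_le.
rewrite E (eq_itg (g := fun eta => (pi / sigma) * (m eta * fcos g eta * cos (sigma * x * eta) +
   m eta * fsin g eta * sin (sigma * x * eta)))).
  rewrite itgZ; last exact: trig_locint hc hs.
  by apply: conv_trig_alg0; rewrite gt_eqF ?pi_gt0.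
move=> eta _.
rewrite (_ : (fun y => F (y, eta)) = fun y => (m eta * cos (sigma * x * eta)) * (cos (sigma * eta * y) * g y) +
   (m eta * sin (sigma * x * eta)) * (sin (sigma * eta * y) * g y)); last first.
  apply/funext => y; rewrite /F /= (_ : sigma * (x - y) * eta = sigma * x * eta - sigma * eta * y); last ring.
  by rewrite cosB; ring.
rewrite rintD ?rintZ//; [|exact: L1Z|exact: L1Z].
rewrite /fcos /fsin; apply: conv_trig_alg; rewrite gt_eqF ?pi_gt0//.
Qed.

End Transform.
Section Parts.
Variables (g g1 : R -> R).
Hypothesis dg : isd g g1.
Hypothesis cg1 : continuous g1.
Hypothesis sg : bdd_supp g.

Let sg1 : bdd_supp g1. Proof. exact: isd_supp dg sg. Qed.
Let cg : continuous g. Proof. exact: isd_cont dg. Qed.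

Let dlin xi y : has_deriv (fun y => sigma * xi * y) y (sigma * xi).
Proof. by apply: dval (dscale (sigma * xi) (did y)) _; rewrite mulr1. Qed.

Lemma fcos_deriv xi : fcos g1 xi = sigma * xi * fsin g xi.
Proof.
have d : isd (fun y => cos (sigma * xi * y)) (fun y => - (sigma * xi) * sin (sigma * xi * y)).
  by move=> y; apply: dval (dcos (dlin xi y)) _; ring.
have c : continuous (fun y => sin (sigma * xi * y)) by exact: sin_cont.
have c' : continuous (fun y => - (sigma * xi) * sin (sigma * xi * y)) by apply: cont_mul => //; exact: cont_cst.
have := rint_parts d c' dg cg1 sg sg1.
rewrite (_ : (fun y => - (sigma * xi) * sin _ * g y) = fun y => - (sigma * xi) * (sin (sigma * xi * y) * g y)); last by apply/funext => y; rewrite mulrA.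
rewrite rintZ; last by apply: L1_csupp; [exact: cont_mul|exact: csuppM].
by rewrite /fcos /fsin mulNr => /oppr_inj <-; ring.
Qed.

Lemma fsin_deriv xi : fsin g1 xi = - (sigma * xi * fcos g xi).
Proof.
have d : isd (fun y => sin (sigma * xi * y)) (fun y => (sigma * xi) * cos (sigma * xi * y)).
  by move=> y; apply: dval (dsin (dlin xi y)) _; ring.
have c : continuous (fun y => cos (sigma * xi * y)) by exact: cos_cont.
have c' : continuous (fun y => (sigma * xi) * cos (sigma * xi * y)) by apply: cont_mul => //; exact: cont_cst.
have := rint_parts d c' dg cg1 sg sg1.
rewrite (_ : (fun y => (sigma * xi) * cos _ * g y) = fun y => (sigma * xi) * (cos (sigma * xi * y) * g y)); last by apply/funext => y; rewrite mulrA.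
rewrite rintZ; last by apply: L1_csupp; [exact: cont_mul|exact: csuppM].
rewrite /fcos /fsin => h; rewrite -[rint (fun y => sin _ * g1 y)]opprK -h; ring.
Qed.

End Parts.

(** For each [y] the sampling identity sums the products of the two kernels. The partial sums are
    bounded uniformly in [y], so dominated convergence permits integration against [g]. *)
Lemma conv_sampling theta psi Bpsi CK g x : 2^-1 <= theta < 1 -> bmeas psi -> (forall t, `|psi t| <= Bpsi) ->
  (forall t, 0 < t < 1 -> {for t, continuous psi}) -> kdec theta CK (kern psi) ->
  continuous g -> bdd_supp g ->
  Qop sigma (kern psi) (nodes sigma (conv (kern (@jac R)) g)) x = conv (kern (fun t => psi t * jac t)) g x.
Proof.
move=> theta12 mpsi pB psic KC cg sg; have lpsi := borel_lebesgue mpsi.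
have [CV CV0 hV] := @V_pinv R.
have VB t : `|kern (@jac R) t| <= CV.
  have := hV 0%N `|t| isT (normr_ge0 t); rewrite /pinv expr0 mulr1; apply: le_trans.
  by case: (leP 0 t) => [/ger0_norm|/ltr0_norm] -> //; rewrite V_even.
pose T k y := kern psi (sigma * x - k%:~R) * kern (@jac R) (k%:~R - sigma * y).
have Tz y : zbdd (fun k => T k y) (`|CV| * Cks theta CK).
  apply: zbdd_le (zbddZ CV (ksum1 theta12 (sigma * x) KC)) => k.
  by rewrite /T [leRHS]normrM mulrC normrM ler_wpM2r// (le_trans (VB _)) ?ler_norm.
have eN (k : int) y : sigma * (node sigma k - y) = k%:~R - sigma * y.
  by rewrite mulrBr /node [sigma * (_ / _)]mulrC divfK// gt_eqF.
have cV (k : int) : continuous (fun y => kern (@jac R) (k%:~R - sigma * y)).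
  rewrite (_ : (fun y => _) = fun y => kern (@jac R) (sigma * (node sigma k - y))).
    by apply: cont_refl; exact: cont_V.
  by apply/funext => y; rewrite eN.
have cT k : continuous (T k) by apply: cont_mul => //; exact: cont_cst.
have LT k : L1 (fun y => T k y * g y) by apply: L1_csupp; [exact: cont_mul|exact: csuppM].
apply: zlim_eq.
have zE n : zpart (fun k => nodes sigma (conv (kern (@jac R)) g) k * kern psi (sigma * x - k%:~R)) n n =
    sigma * rint (fun y => zpart (fun k => T k y) n n * g y).
  rewrite zpartE; have [_ e] := rint_sum (zrange 0 n n) LT.
  rewrite (_ : (fun y => zpart _ n n * g y) = fun y => \sum_(k <- zrange 0 n n) T k y * g y); last first.
    by apply/funext => y; rewrite zpartE mulr_suml.
  rewrite e mulr_sumr; apply: eq_bigr => k _.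
  rewrite /nodes /conv -mulrA; congr (_ * _); rewrite mulrC -rintZ; last first.
    apply: (conv_L1 (C := CV)) => //; apply: cont_bmeas; exact: cont_V.
  congr rint; apply/funext => y; by rewrite /T mulrA eN.
rewrite (funext zE); apply: cvgMr.
have [M gM] := csupp_bounded cg sg; have Lg := L1_csupp cg sg.
have mz n : bmeas (fun y => zpart (fun k => T k y) n n).
  apply: cont_bmeas; rewrite (_ : (fun y => _) = fun y => \sum_(k <- zrange 0 n n) T k y).
    exact: cont_sumf.
  by apply/funext => y; rewrite zpartE.
have hB : bddm (fun t => psi t * jac t) Bpsi.
  split; first by apply: lmeasM => //; exact: lmeas_jac.
  by move=> t; rewrite normrM -[Bpsi]mulr1 ler_pM// jac_norm.
apply: (rint_dominated (G := fun y => `|CV| * Cks theta CK * `|g y|)).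
- by move=> n; apply: measurable_funM; [exact: mz|exact: cont_bmeas].
- by apply: measurable_funM; [apply: bmeas_affine; apply: cont_bmeas; exact: cont_kern hB|exact: cont_bmeas].
- by apply: L1Z; exact: integrable_norm Lg.
- by move=> n y; rewrite normrM ler_wpM2r//; exact: zpart_le (Tz y).
- move=> y; apply: cvgMl.
  have := zlim_cvg (Tz y); rewrite /T (sampling_identity theta12 lpsi (@lmeas_jac R) pB (@jac_norm R) psic KC).
  by rewrite mulrBr.
Qed.

End Convolution.

(** * Sampling error of smooth functions *)

Section SmoothUpper.
Context {R : realType} (X : banach_lattice R).
Local Notation S := (rset X).
Local Notation p := (rnorm X).
Variables (CA theta sigma : R).
Hypothesis hCA : steklov_bound X CA.
Hypothesis theta12 : 2^-1 <= theta < 1.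
Hypothesis sigma0 : 0 < sigma.
Implicit Types (c : int -> R) (x t C D : R) (g gs : R -> R) (b : bool).
Local Notation st := (st sigma).
Local Notation nodes := (nodes sigma).
Local Notation conv := (conv sigma).
Local Notation maj := (maj theta sigma).
Local Notation V := (kern (@jac R)).
Local Notation rate b := (sigma ^- b.+1).

Let theta0 := theta_gt0 theta12.
Let t0 : 0 <= 2 / theta. Proof. by rewrite divr_ge0// ltW. Qed.
Let rate0 n : 0 <= sigma ^- n. Proof. by rewrite invr_ge0 exprn_ge0// ltW. Qed.

Lemma rset_csupp g : continuous g -> bdd_supp g -> S g.
Proof.
move=> cg sg; have [M gM] := csupp_bounded cg sg; have [n hn] := sg.
apply: (@rset_bounded R X g (- n) n M) => //; first exact: lmeas_cont.
by move=> x; rewrite -ler_norml -ltNge => /hn.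
Qed.

Lemma conv_maj K C g x : bmeas K -> 0 <= C -> kdec theta C K -> continuous g -> bdd_supp g ->
  `|conv K g x| <= 2 / theta * C * maj (fun y => `|g y|) x.
Proof.
move=> mK C0 KC cg sg; have Sg := rset_csupp cg sg.
have hL := conv_L1 sigma x mK KC.1 cg sg.
have hLa : locint (fun y => `|K (sigma * (x - y))| * `|g y|).
  by have := locint_abs (L1_locint hL); under eq_fun do rewrite normrM.
rewrite /conv normrM (gtr0_norm sigma0) -ler_pdivlMl//; apply: rint_bound => // a d.
rewrite ler_pdivlMl//; under eq_itg do rewrite normrM.
by apply: (kconv_le hCA theta12 sigma0 _ _ KC) => //; [exact: borel_lebesgue|exact: rset_abs].
Qed.

Lemma conv_cont m B g : bmeas m -> (forall t, `|m t| <= B) -> continuous g -> bdd_supp g ->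
  continuous (conv (kern m) g).
Proof.
move=> mm mB cg sg; rewrite (_ : conv _ _ = fun x => trig (fun xi => m xi * fcos sigma g xi) (fun xi => m xi * fsin sigma g xi) (sigma * x)); last first.
  by apply/funext => x; exact: (conv_trig sigma0 cg sg x mm mB).
have lf (f : R -> R) : bmeas f -> (forall t, `|f t| <= fbound sigma g) -> bddm (fun t => m t * f t) (B * fbound sigma g).
  move=> bf f1; split; first by apply: lmeasM; exact: borel_lebesgue.
  by move=> t; rewrite normrM ler_pM.
apply: cont_scaled; apply: cont_trig (lf _ _ _) (lf _ _ _).
- exact: bmeas_fcos.
- exact: fcos_le.
- exact: bmeas_fsin.
- exact: fsin_le.
Qed.

Lemma maj_bounds u s D : continuous u -> continuous s -> bdd_supp s -> 0 <= D ->
  (forall x, `|u x| <= D * maj (fun y => `|s y|) x) ->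
  [/\ S u, p u <= D * Cmaj CA theta * p s, S (st (nodes u)) &
      p (st (nodes u)) <= 2 / theta * (D * Cmaj CA theta) * p s].
Proof.
move=> cu cs ss D0 h; have Ss := rset_csupp cs ss; have Sa := rset_abs Ss.
have [h1 h2] := majd_rset hCA theta12 sigma0 (lmeas_cont cu) Sa (fun y => normr_ge0 _) D0 h.
have [h3 h4] := majd_node hCA theta12 sigma0 Sa (fun y => normr_ge0 _) D0 h.
by rewrite rnorm_abs// in h2 h4; split => //; rewrite mulrA.
Qed.

(** By [conv_sampling], what sampling with [psi] misses of [conv V g]. *)
Definition residual psi g := conv (kern (fun t => jac t - psi t * jac t)) g.

Definition residual_bound b psi Z := forall g gs, derivs b g gs -> bdd_supp g ->
  [/\ S (residual psi g), p (residual psi g) <= Z * (rate b * p gs), S (st (nodes (residual psi g))) &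
      p (st (nodes (residual psi g))) <= Z * (rate b * p gs)].

Lemma derivs_supp b g gs : derivs b g gs -> bdd_supp g -> [/\ continuous g, continuous gs & bdd_supp gs].
Proof.
case: b => -[cgs]; first move=> [g1 [dg dg1]] sg.
  by split => //; [exact: isd_cont dg|exact: isd_supp dg1 (isd_supp dg sg)].
by move=> dg sg; split => //; [exact: isd_cont dg|exact: isd_supp dg sg].
Qed.

Definition Crho C := (1 + 2 / theta) * (2 / theta * C * Cmaj CA theta).

Lemma residual_rho alpha C : 0 < alpha -> 0 <= C -> kdec theta C (kern (msym alpha)) ->
  residual_bound true (rho alpha) (Crho C).
Proof.
move=> a0 C0 KC g gs dgs sg; have [cg cgs sgs] := derivs_supp dgs sg.
have [_ [g1 [dg dg1]]] := dgs; have sg1 := isd_supp dg sg; have cg1 := isd_cont dg1.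
have [B B0 mB'] := msym_bd (R := R) a0.
have mB t : `|msym alpha t| <= B.
  by apply: le_trans (mB' t) _; rewrite ler_piMr//; apply: le_trans (ler_norm _) (jac_norm t).
have hm : bddm (msym alpha) B by split=> //; apply: borel_lebesgue; exact: bmeas_msym.
have bm : bmeas (msym alpha) by exact: bmeas_msym.
have bk : bmeas (kern (msym alpha)) by apply: cont_bmeas; exact: cont_kern hm.
have bj : bmeas (fun t => jac t - rho alpha t * jac t).
  by apply: measurable_funB; [apply: cont_bmeas; exact: cont_jac|apply: measurable_funM; [exact: bmeas_rho|apply: cont_bmeas; exact: cont_jac]].
have jB t : `|jac t - rho alpha t * jac t| <= 2.
  apply: le_trans (ler_normB _ _) _; rewrite (_ : 2 = 1 + 1)//; apply: lerD; first exact: jac_norm.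
  by rewrite normrM mulr_ile1// ?rho_norm// jac_norm.
have e x : residual (rho alpha) g x = - (rate true) * conv (kern (msym alpha)) gs x.
  rewrite /residual (conv_trig sigma0 cg sg x bj jB) (conv_trig sigma0 cgs sgs x bm mB).
  pose q : R := rate true.
  have lf (f : R -> R) : bmeas f -> (forall t, `|f t| <= fbound sigma gs) -> bddm (fun t => msym alpha t * f t) (B * fbound sigma gs).
    move=> bf f1; split; first by apply: lmeasM; exact: borel_lebesgue.
    by move=> t; rewrite normrM ler_pM.
  have hc := lf _ (bmeas_fcos sigma cgs sgs) (fcos_le sigma0 cgs sgs).
  have hs := lf _ (bmeas_fsin sigma cgs sgs) (fsin_le sigma0 cgs sgs).
  rewrite /trig -itgZ; last exact: trig_locint hc hs.
  apply: eq_itg => xi _.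
  rewrite (fcos_deriv sigma dg1 cgs sg1) (fsin_deriv sigma dg1 cgs sg1) (fcos_deriv sigma dg cg1 sg) (fsin_deriv sigma dg cg1 sg).
  rewrite (_ : jac xi - rho alpha xi * jac xi = xi ^+ 2 * msym alpha xi); last by rewrite msymE; ring.
  by field; rewrite gt_eqF.
have cu : continuous (residual (rho alpha) g) := conv_cont bj jB cg sg.
have D0 : 0 <= rate true * (2 / theta * C) by rewrite mulr_ge0// mulr_ge0.
have h x : `|residual (rho alpha) g x| <= rate true * (2 / theta * C) * maj (fun y => `|gs y|) x.
  by rewrite e normrM normrN (ger0_norm (rate0 _)) -mulrA ler_wpM2l//; exact: conv_maj x bk C0 KC cgs sgs.
have [S1 p1 S2 p2] := maj_bounds cu cgs sgs D0 h.
have cm := Cmaj_ge0 hCA theta12; have pg := rnorm_ge0 (rset_csupp cgs sgs).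
have P0 : 0 <= rate true * p gs by exact: mulr_ge0.
have T0 : 0 <= 2 / theta * C * Cmaj CA theta * (rate true * p gs).
  by apply: mulr_ge0 => //; apply: mulr_ge0 => //; exact: mulr_ge0.
have T1 := mulr_ge0 t0 T0.
have e1 : rate true * (2 / theta * C) * Cmaj CA theta * p gs = 2 / theta * C * Cmaj CA theta * (rate true * p gs) by ring.
have e2 : 2 / theta * (rate true * (2 / theta * C) * Cmaj CA theta) * p gs = 2 / theta * (2 / theta * C * Cmaj CA theta * (rate true * p gs)) by ring.
rewrite e1 in p1; rewrite e2 in p2.
rewrite /Crho; split => //; rewrite -mulrA mulrDl mul1r; [apply: le_trans p1 _|apply: le_trans p2 _].
  by rewrite lerDl.
by rewrite lerDr.
Qed.

(** * The residual for phi *)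

Section Phi.
Variables (CH gamma : R).
Hypothesis CH0 : 0 <= CH.
Hypothesis hilb : forall f, schwartz f -> X (hilbert f) /\ bl_norm X (hilbert f) <= CH * bl_norm X f.
Hypothesis gamma0 : 0 < gamma.
Hypothesis gamma1 : gamma <= 1.

Let bz : bmeas (@zsym R). Proof. by apply: cont_bmeas; exact: cont_zsym. Qed.
Let zB (t : R) : `|zsym t| <= 1. Proof. exact: zsym_norm. Qed.
Let bjac : bmeas (@jac R). Proof. by apply: cont_bmeas; exact: cont_jac. Qed.

Lemma rnorm_scaled z : S (fun x => sigma * z x) ->
  S z /\ p z = sigma^-1 * p (fun x => sigma * z x).
Proof.
move=> Sz; have zz : z = fun x => sigma^-1 * (sigma * z x) by apply/funext => x; rewrite mulKf// gt_eqF.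
split; first by rewrite zz; exact: rsetZ.
have si : 0 <= sigma^-1 by rewrite invr_ge0 ltW.
by have := rnormZ sigma^-1 Sz; rewrite (ger0_norm si) -zz.
Qed.

Section Pair.
Variables (g gs : R -> R).
Hypothesis dg : isd g gs.
Hypothesis cgs : continuous gs.
Hypothesis sg : bdd_supp g.

Let cg : continuous g. Proof. exact: isd_cont dg. Qed.
Let sgs : bdd_supp gs. Proof. exact: isd_supp dg sg. Qed.

Let prodB f : bmeas f -> (forall t, `|f t| <= fbound sigma g) -> bddm (fun t => zsym t * f t) (fbound sigma g).
Proof.
move=> bf f1; split; first by apply: lmeasM; exact: borel_lebesgue.
by move=> t; rewrite normrM -[leRHS]mul1r ler_pM.
Qed.

Let hc := prodB (bmeas_fcos sigma cg sg) (fcos_le sigma0 cg sg).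
Let hs := prodB (bmeas_fsin sigma cg sg) (fsin_le sigma0 cg sg).

Let zE x : conv (kern (@zsym R)) g x = trig (fun xi => zsym xi * fcos sigma g xi) (fun xi => zsym xi * fsin sigma g xi) (sigma * x).
Proof. exact: (conv_trig sigma0 cg sg x bz zB). Qed.

Lemma zsym_derivs : derivs false (conv (kern (@zsym R)) g) (conv (kern (@zsym R)) gs).
Proof.
split=> [|x]; first exact: conv_cont bz zB cgs sgs.
rewrite (funext zE); apply: dval (isd_scaled sigma (isd_trig hc hs) x) _.
rewrite (conv_trig sigma0 cgs sgs x bz zB) /trig -itgZ; last exact: trig_locint (bddm_clip hs) (bddmN (bddm_clip hc)).
apply: eq_itg => xi x01; rewrite (fcos_deriv sigma dg cgs sg) (fsin_deriv sigma dg cgs sg) clip_id//; ring.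
Qed.

Let jacE x : conv V gs x = trig (fun xi => sigma * (zsym xi * fsin sigma g xi))
  (fun xi => - sigma * (zsym xi * fcos sigma g xi)) (sigma * x).
Proof.
rewrite (conv_trig sigma0 cgs sgs x bjac (@jac_norm R)); apply: eq_trig => t /andP[t1 _].
  by rewrite (fcos_deriv sigma dg cgs sg) /zsym (ger0_norm t1); ring.
by rewrite (fsin_deriv sigma dg cgs sg) /zsym (ger0_norm t1); ring.
Qed.

Let scaled_bmeas f k : bmeas f -> bmeas (fun t => k * (zsym t * f t)).
Proof. by move=> bf; apply: measurable_funM; [exact: measurable_cst|exact: measurable_funM]. Qed.

Let scaled_le f k (B : R) : `|k| = sigma -> (forall t, `|zsym t * f t| <= B) -> forall t, `|k * (zsym t * f t)| <= sigma * B.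
Proof. by move=> k1 f1 t; rewrite normrM k1; apply: ler_wpM2l (f1 t); exact: ltW. Qed.

(** Differentiation gives [conv V gs] the amplitudes [sigma * zsym * fsin] and
    [- sigma * zsym * fcos]; its conjugate integral is therefore [sigma] times the convolution with
    the kernel of [zsym]. *)
Lemma zsym_hilbert : S (conv V gs) -> S (conv (kern (@zsym R)) g) /\
  p (conv (kern (@zsym R)) g) <= CH * (rate false * p (conv V gs)).
Proof.
move=> Su; rewrite (funext jacE) in Su.
have [Sv pv] := hilbert_trig CH0 hilb (scaled_bmeas sigma (bmeas_fsin sigma cg sg))
  (scaled_bmeas (- sigma) (bmeas_fcos sigma cg sg))
  (scaled_le (gtr0_norm sigma0) hs.2) (scaled_le (etrans (normrN _) (gtr0_norm sigma0)) hc.2) sigma0 Su.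
rewrite (funext jacE).
have vE : (fun x => trig (fun xi => - (- sigma * (zsym xi * fcos sigma g xi))) (fun xi => sigma * (zsym xi * fsin sigma g xi)) (sigma * x)) =
    fun x => sigma * conv (kern (@zsym R)) g x.
  apply/funext => x; rewrite zE /trig -itgZ; last exact: trig_locint hc hs.
  by apply: eq_itg => xi _; ring.
rewrite vE in Sv pv.
have [Sz ->] := rnorm_scaled Sv; split => //.
by rewrite expr1 mulrCA ler_wpM2l// invr_ge0 ltW.
Qed.

End Pair.

Definition Cphi CV Cz := CH * (2 / theta * CV * Cmaj CA theta) +
  (Cder CA 0 * (2 / theta * Cz * Cmaj CA theta) + 4 * CA / gamma * (CH * (2 / theta * CV * Cmaj CA theta))).

(** The Hilbert transform bounds the residual [z] in the norm of [X] only. For the nodes, [z] is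
    split into [(I - A) z], controlled by the derivative of [z], and [A z], whose node values are
    controlled by the norm of [z]. *)
Lemma residual_phi CV Cz : 0 <= CV -> kdec theta CV V -> 0 <= Cz -> kdec theta Cz (kern (@zsym R)) ->
  residual_bound false (@phi R) (Cphi CV Cz).
Proof.
move=> CV0 KV Cz0 Kz g gs dgs sg; have [cg cgs sgs] := derivs_supp dgs sg.
have [_ dg] := dgs; have CA0 : 0 <= CA by case: hCA.
have hz : bddm (@zsym R) 1 by split=> //; apply: borel_lebesgue.
have -> : residual (@phi R) g = conv (kern (@zsym R)) g.
  apply/funext => x; congr (_ * rint _); apply/funext => y; congr (_ * _); apply: eq_kern => t t01.
  by rewrite /zsym phiE// ger0_norm; [ring|case/andP: t01].
have D0 : 0 <= 2 / theta * CV by exact: mulr_ge0.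
have Dz0 : 0 <= 2 / theta * Cz by exact: mulr_ge0.
have bV : bmeas V by apply: cont_bmeas; exact: cont_V.
have bkz : bmeas (kern (@zsym R)) by apply: cont_bmeas; exact: cont_kern hz.
have [Su pu _ _] := maj_bounds (conv_cont bjac (@jac_norm R) cgs sgs) cgs sgs D0 (fun x => conv_maj x bV CV0 KV cgs sgs).
have [Sw pw _ _] := maj_bounds (conv_cont bz zB cgs sgs) cgs sgs Dz0 (fun x => conv_maj x bkz Cz0 Kz cgs sgs).
have cm := Cmaj_ge0 hCA theta12; have pg := rnorm_ge0 (rset_csupp cgs sgs).
have [Sz pz0] := zsym_hilbert dg cgs sg Su.
have [_ _ [S3 p3]] := derivs_bound hCA sigma0 gamma0 gamma1 0 (zsym_derivs dg cgs sg) Sw.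
have [S4 p4] := stek_node hCA sigma0 gamma0 gamma1 Sz.
move: Sz pz0 S3 p3 S4 p4; move: (conv (kern (@zsym R)) g) => z Sz pz0 S3 p3 S4 p4.
have P0 : 0 <= rate false * p gs by exact: mulr_ge0.
have k0 : 0 <= CH * (2 / theta * CV * Cmaj CA theta) by rewrite mulr_ge0// mulr_ge0.
have kd0 : 0 <= Cder CA 0 * (2 / theta * Cz * Cmaj CA theta).
  by rewrite mulr_ge0 ?(Cder_ge0 hCA)// mulr_ge0.
have pz : p z <= CH * (2 / theta * CV * Cmaj CA theta) * (rate false * p gs).
  apply: le_trans pz0 _; rewrite -mulrA ler_wpM2l//.
  by rewrite mulrCA ler_wpM2l.
have nE : st (nodes z) = fun x => st (nodes (iter 1 (cdiff (gamma / sigma)) z)) x + st (nodes (stek (gamma / sigma) z)) x.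
  by apply/funext => x; rewrite !stE !nodesE /= /cdiff subrK.
have q3 : p (st (nodes (iter 1 (cdiff (gamma / sigma)) z))) <= Cder CA 0 * (2 / theta * Cz * Cmaj CA theta) * (rate false * p gs).
  apply: le_trans p3 _; rewrite -mulrA ler_wpM2l ?(Cder_ge0 hCA)//.
  by rewrite mulrCA ler_wpM2l.
have g0 : 0 <= 4 * CA / gamma by rewrite divr_ge0 ?mulr_ge0// ltW.
have q4 : p (st (nodes (stek (gamma / sigma) z))) <= 4 * CA / gamma * (CH * (2 / theta * CV * Cmaj CA theta)) * (rate false * p gs).
  by apply: le_trans p4 _; rewrite -[leRHS]mulrA ler_wpM2l.
have [Sn pn] : S (st (nodes z)) /\ p (st (nodes z)) <= (Cder CA 0 * (2 / theta * Cz * Cmaj CA theta) +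
    4 * CA / gamma * (CH * (2 / theta * CV * Cmaj CA theta))) * (rate false * p gs).
  rewrite nE mulrDl; split; first exact: rsetD.
  by apply: le_trans (rnormD S3 S4) _; exact: lerD.
split => //; rewrite /Cphi mulrDl; [apply: le_trans pz _|apply: le_trans pn _].
  by rewrite lerDl mulr_ge0// addr_ge0// mulr_ge0.
by rewrite lerDr mulr_ge0.
Qed.

End Phi.

Lemma smooth_alg (a an t q e P pv pvn pQ pQn pz pzn Z : R) : 0 <= t -> 0 <= q ->
  a <= pv + pQ + pz -> an <= pvn + pQn + pzn -> pv <= e * P -> pvn <= t * e * P ->
  pQ <= q * pvn -> pQn <= t * (q * pvn) -> pz <= Z * P -> pzn <= Z * P ->
  a + an <= ((1 + t) * e + (1 + t) * (q * (t * e)) + 2 * Z) * P.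
Proof.
move=> t1 q0 ha han h1 h2 h3 h4 h5 h6.
have h7 := ler_wpM2l q0 h2; have h8 := ler_wpM2l t1 h7.
have -> : ((1 + t) * e + (1 + t) * (q * (t * e)) + 2 * Z) * P =
  e * P + t * e * P + q * (t * e * P) + t * (q * (t * e * P)) + Z * P + Z * P by ring.
lra.
Qed.

Lemma kern_le m B t : bddm m B -> `|kern m t| <= B.
Proof.
move=> hm; have B0 := bddm_ge0 hm; have [lm mB] := hm.
have pi1 : 1 <= pi :> R by apply: le_trans (pi_ge2 R); rewrite ler1n.
rewrite /kern normrM gtr0_norm ?invr_gt0 ?pi_gt0//.
apply: le_trans (ler_wpM2l _ (cosint_le t lm mB)) _; first by rewrite invr_ge0 pi_ge0.
by rewrite ler_piMl// invf_le1// pi_gt0.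
Qed.

(** * Splitting a smooth function by convolution with the cutoff kernel *)

Section Smooth.
Variables (psi : R -> R) (Bpsi CK Z CE CV : R) (E : R -> R) (b : bool).
Hypothesis mpsi : bmeas psi.
Hypothesis pB : forall t, `|psi t| <= Bpsi.
Hypothesis psic : forall t, 0 < t < 1 -> {for t, continuous psi}.
Hypothesis KC : kdec theta CK (kern psi).
Hypothesis Z0 : 0 <= Z.
Hypothesis hZ : residual_bound b psi Z.
Hypothesis CV0 : 0 <= CV.
Hypothesis KV : kdec theta CV V.
Hypothesis mE : bmeas E.
Hypothesis CE0 : 0 <= CE.
Hypothesis KE : kdec theta CE E.
Hypothesis hE : forall (s : R) g gs x, 0 < s -> derivs b g gs -> bdd_supp g ->
  s * rint (fun y => V (s * (x - y)) * g y) - g x = s ^- b * rint (fun y => E (s * (x - y)) * gs y).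
Local Notation Q := (Qop sigma (kern psi)).

Let hpsi : bddm psi Bpsi. Proof. by split=> //; exact: borel_lebesgue. Qed.

Definition Cerr := 2 / theta * CE * Cmaj CA theta.
(** The summands account for [g - conv V g], for the sampling operator applied to it, and for the
    residual, each in norm and at the nodes. *)
Definition Csm := (1 + 2 / theta) * Cerr +
  (1 + 2 / theta) * (CQ theta CK * Cmaj CA theta * (2 / theta * Cerr)) + 2 * Z.

Lemma Csm_ge0 : 0 <= Csm.
Proof.
have cm := Cmaj_ge0 hCA theta12; have cq := CQ_ge0 theta12 KC.
have e0 : 0 <= Cerr by rewrite mulr_ge0// mulr_ge0.
have t1 : 0 <= 1 + 2 / theta by exact: addr_ge0.
have k0 : 0 <= CQ theta CK * Cmaj CA theta * (2 / theta * Cerr) by apply: mulr_ge0; exact: mulr_ge0.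
have z2 : 0 <= 2 * Z by exact: mulr_ge0.
by apply: addr_ge0 => //; apply: addr_ge0; exact: mulr_ge0.
Qed.

(** With [v = g - conv V g], the error of [g] is [v - Q v] plus the residual. On [v] boundedness of
    [Q] is enough, because the error kernel already expresses [v] through the derivative [gs]. *)
Lemma smooth_upper g gs : derivs b g gs -> bdd_supp g ->
  [/\ S (st (nodes g)), S (st (nodes (fun x => g x - Q (nodes g) x))) &
      p (fun x => g x - Q (nodes g) x) + p (st (nodes (fun x => g x - Q (nodes g) x))) <=
      Csm * (rate b * p gs)].
Proof.
move=> dgs sg; have [cg cgs sgs] := derivs_supp dgs sg.
have cm := Cmaj_ge0 hCA theta12; have cq := CQ_ge0 theta12 KC.
have bjac : bmeas (@jac R) by apply: cont_bmeas; exact: cont_jac.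
have bV : bmeas V by apply: cont_bmeas; exact: cont_V.
have cg1 : continuous (conv V g) := conv_cont bjac (@jac_norm R) cg sg.
have cv : continuous (fun x => g x - conv V g x) by exact: cont_sub.
have D0 : 0 <= rate b * (2 / theta * CE) by rewrite mulr_ge0// mulr_ge0.
have hv x : `|g x - conv V g x| <= rate b * (2 / theta * CE) * maj (fun y => `|gs y|) x.
  rewrite distrC (hE x sigma0 dgs sg).
  have -> : sigma ^- b * rint (fun y => E (sigma * (x - y)) * gs y) = rate b * conv E gs x.
    by rewrite /conv mulrA exprS invfM mulrC [sigma^-1 * _]mulrC mulfVK ?gt_eqF// mulrC.
  rewrite normrM (ger0_norm (rate0 _)) -[leRHS]mulrA ler_wpM2l//.
  exact: conv_maj x mE CE0 KE cgs sgs.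
pose v x := g x - conv V g x.
have [Sv pv Svn pvn] : [/\ S v, p v <= rate b * (2 / theta * CE) * Cmaj CA theta * p gs, S (st (nodes v)) &
  p (st (nodes v)) <= 2 / theta * (rate b * (2 / theta * CE) * Cmaj CA theta) * p gs].
  exact: maj_bounds cv cgs sgs D0 hv.
have DV0 : 0 <= 2 / theta * CV by exact: mulr_ge0.
have [_ _ Sg1n _] := maj_bounds cg1 cg sg DV0 (fun x => conv_maj x bV CV0 KV cg sg).
have [Sz pz Szn pzn] := hZ dgs sg.
have Sgn : S (st (nodes g)).
  rewrite (_ : st (nodes g) = fun x => st (nodes (fun x => g x - conv V g x)) x + st (nodes (conv V g)) x); first exact: rsetD.
  by apply/funext => x; rewrite !stE !nodesE subrK.
have hjp : bddm (fun t => psi t * jac t) Bpsi.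
  split; first by apply: lmeasM => //; [exact: borel_lebesgue|exact: lmeas_jac].
  by move=> t; rewrite normrM -[Bpsi]mulr1 ler_pM// jac_norm.
have B0 := bddm_ge0 hpsi.
have zE x : residual psi g x = conv V g x - Q (nodes (conv V g)) x.
  rewrite (conv_sampling sigma0 x theta12 mpsi pB psic KC cg sg).
  have kb m B : bddm m B -> forall t, `|kern m t| <= B.
    by move=> hm t; exact: kern_le hm.
  have h1 : bddm (@jac R) (1 + Bpsi) by split=> [|t]; [exact: lmeas_jac|rewrite (le_trans (jac_norm t))// lerDl].
  have h2 : bddm (fun t => psi t * jac t) (1 + Bpsi) by split=> [|t]; [exact: hjp.1|rewrite (le_trans (hjp.2 t))// lerDr].
  have bjp : bmeas (kern (fun t => psi t * jac t)) by apply: cont_bmeas; exact: cont_kern hjp.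
  rewrite -(convB sigma x bV (kb _ _ h1) bjp (kb _ _ h2) cg sg).
  congr (_ * rint _); apply/funext => y; congr (_ * _); exact: (kernB _ h1 h2).
have [SQ pQ] := Q_rset hCA theta12 sigma0 KC (cont_kern hpsi) Svn.
have [SQn pQn] := Q_node hCA theta12 sigma0 KC Svn.
have gE : (fun x => g x - Q (nodes g) x) = (fun x => (v x - Q (nodes v) x) + residual psi g x).
  apply/funext => x; rewrite zE (_ : nodes v = fun k => nodes g k - nodes (conv V g) k)//.
  by rewrite (QB hCA theta12 sigma0 KC x Sgn Sg1n) /v; ring.
rewrite gE; clear gE hv cv zE.
move: Sz pz Szn pzn; move: (residual psi g) => z Sz pz Szn pzn; clearbody v.
have Snode : st (nodes (fun x => v x - Q (nodes v) x + z x)) = fun x => (st (nodes v) x - st (nodes (Q (nodes v))) x) + st (nodes z) x by [].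
split => //; first by rewrite Snode; apply: rsetD => //; exact: rsetB.
apply: (smooth_alg (t := 2 / theta) (q := CQ theta CK * Cmaj CA theta) (e := Cerr) (P := rate b * p gs)
  (pv := p v) (pvn := p (st (nodes v))) (pQ := p (Q (nodes v))) (pQn := p (st (nodes (Q (nodes v)))))
  (pz := p z) (pzn := p (st (nodes z)))) => //.
- exact: mulr_ge0.
- by apply: le_trans (rnormD (rsetB Sv SQ) Sz) _; rewrite lerD2r; exact: rnormB.
- by rewrite Snode; apply: le_trans (rnormD (rsetB Svn SQn) Szn) _; rewrite lerD2r; exact: rnormB.
- by apply: le_trans pv _; rewrite le_eqVlt; apply/orP; left; apply/eqP; rewrite /Cerr; ring.
- by apply: le_trans pvn _; rewrite le_eqVlt; apply/orP; left; apply/eqP; rewrite /Cerr; ring.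
- by apply: le_trans pQn _; rewrite le_eqVlt; apply/orP; left; apply/eqP; ring.
Qed.

End Smooth.

End SmoothUpper.

(** * Smoothing by triangular averages *)

Section TriangularAverages.
Context {R : realType}.
Variable h : R.
Hypothesis h0 : 0 < h.
Implicit Types (f u v F : R -> R) (x y t K : R).
Local Notation D := (fdiff h).

(** The weight is chosen so that, by [jop_prim], the result is [- 2 / h] times [fdiff h] of a
    primitive: differentiating it gives exactly a one-sided difference of [u]. *)
Definition jop u x := 2 / h ^+ 2 * itg x (x + h) (fun t => (x + h - t) * u t).
(** The complementary weight: [adot h = eop + jop / 2]. Its mass is [1/2], which is why its iterates
    shrink. *)
Definition eop u x := (h ^+ 2)^-1 * itg x (x + h) (fun t => (t - x) * u t).
Definition jdiff u x := u x - jop u x.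
(* [jop] averages against a triangle, so [jop (jop u)] is twice differentiable for continuous [u],
   with derivatives that involve [u] only through [fdiff h u] and [iter 2 (fdiff h) u]. *)
Definition ndiff u x := u x - jop (jop u) x.

Let ci : continuous (fun t : R => t). Proof. by move=> t; exact: cvg_id. Qed.

Let cl1 x : continuous (fun t => x + h - t). Proof. by apply: cont_sub => //; exact: cont_cst. Qed.
Let cl2 x : continuous (fun t => t - x). Proof. by apply: cont_sub => //; exact: cont_cst. Qed.
Let h1 : h != 0. Proof. by rewrite gt_eqF. Qed.
Let xh x : x <= x + h. Proof. by rewrite lerDl ltW. Qed.

Lemma jop_prim F f x : isd F f -> continuous f -> jop f x = - (2 / h) * D F x.
Proof.
move=> dF cf; have cF := isd_cont dF; have [P dP] := ex_prim cF.
have dG : isd (fun t => (x + h - t) * F t + P t) (fun t => (x + h - t) * f t).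
  by move=> t; apply: dval (dadd (dmul (dsub (dcst (x + h) t) (did t)) (dF t)) (dP t)) _; ring.
rewrite /jop (itg_FTC _ dG) ?xh//; last exact: cont_mul.
by rewrite /fdiff (adot_prim x (ltW h0) dP cF); field.
Qed.

Lemma jopB u v x : continuous u -> continuous v -> jop (fun y => u y - v y) x = jop u x - jop v x.
Proof.
move=> cu cv; rewrite /jop -mulrBr; congr (_ * _).
rewrite -itgB; [|apply: cont_locint; exact: cont_mul|apply: cont_locint; exact: cont_mul].
by apply: eq_itg => t _; ring.
Qed.

Lemma eopD u v x : continuous u -> continuous v -> eop (fun y => u y + v y) x = eop u x + eop v x.
Proof.
move=> cu cv; rewrite /eop -mulrDr; congr (_ * _).
rewrite -itgD; [|apply: cont_locint; exact: cont_mul|apply: cont_locint; exact: cont_mul].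
by apply: eq_itg => t _; ring.
Qed.

Lemma eopE u x : continuous u -> eop u x = adot h u x - 2^-1 * jop u x.
Proof.
move=> cu; rewrite /eop /jop /adot.
have -> : itg x (x + h) (fun t => (t - x) * u t) = h * itg x (x + h) u - itg x (x + h) (fun t => (x + h - t) * u t).
  rewrite -itgZ; last exact: cont_locint.
  rewrite -itgB; [|by apply: cont_locint; apply: cont_mul => //; exact: cont_cst|apply: cont_locint; exact: cont_mul].
  by apply: eq_itg => t _; ring.
by field.
Qed.

Lemma isd_jop f : continuous f -> isd (jop f) (fun x => - (2 / h) * D f x).
Proof.
move=> cf; have [F dF] := ex_prim cf; rewrite (_ : jop f = fun x => - (2 / h) * D F x).
  by move=> x; apply: dscale; exact: isd_fdiff.
by apply/funext => x; exact: jop_prim.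
Qed.

Lemma cont_jop f : continuous f -> continuous (jop f).
Proof. by move=> /isd_jop /isd_cont. Qed.

Lemma cont_eop f : continuous f -> continuous (eop f).
Proof.
move=> cf; rewrite (_ : eop f = fun x => adot h f x - 2^-1 * jop f x).
  apply: cont_sub; first exact: cont_adot.
  by apply: cont_mul; [exact: cont_cst|exact: cont_jop].
by apply/funext => x; exact: eopE.
Qed.

Lemma jop_fdiff f : continuous f -> jop (D f) = D (jop f).
Proof.
move=> cf; apply/funext => x; have [F dF] := ex_prim cf.
have dDF := isd_fdiff h0 dF cf; have cDf := cont_fdiff h0 cf.
have cDF := isd_cont dDF.
rewrite (jop_prim x dDF cDf) (_ : jop f = fun x => - (2 / h) * D F x); last first.
  by apply/funext => y; exact: jop_prim.
rewrite [in RHS]/fdiff /adot itgZ; last exact: cont_locint.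
by rewrite [in LHS]/fdiff /adot; ring.
Qed.

Lemma fdiffB u v x : continuous u -> continuous v -> D (fun y => u y - v y) x = D u x - D v x.
Proof. by move=> cu cv; rewrite /fdiff adotB; [ring|exact: cont_locint|exact: cont_locint]. Qed.

Lemma weight_int x : itg x (x + h) (fun t => x + h - t) = h ^+ 2 / 2 /\ itg x (x + h) (fun t => t - x) = h ^+ 2 / 2.
Proof.
have d1 : isd (fun t => - ((x + h - t) * (x + h - t)) / 2) (fun t => x + h - t).
  move=> t; apply: dval (dmul (dopp (dmul (dsub (dcst (x + h) t) (did t)) (dsub (dcst (x + h) t) (did t)))) (dcst 2^-1 t)) _.
  by field.
have d2 : isd (fun t => (t - x) * (t - x) / 2) (fun t => t - x).
  move=> t; apply: dval (dmul (dmul (dsub (did t) (dcst x t)) (dsub (did t) (dcst x t))) (dcst 2^-1 t)) _.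
  by field.
by rewrite (itg_FTC _ d1) ?(itg_FTC _ d2)//; split; field.
Qed.

Lemma weight_le (w : R -> R) u x K : continuous w -> continuous u ->
  (forall t, x <= t <= x + h -> 0 <= w t) -> (forall t, x <= t <= x + h -> `|u t| <= K) ->
  `|itg x (x + h) (fun t => w t * u t)| <= itg x (x + h) w * K.
Proof.
move=> cw cu w0 uK; have cwu := cont_mul cw cu.
apply: le_trans (itg_norm _ _ (cont_locint cwu)) _; rewrite mulrC -itgZ; last exact: cont_locint.
apply: itg_le.
- exact: locint_abs (cont_locint cwu).
- by apply: locintZ; exact: cont_locint.
- by move=> t ht; rewrite normrM (ger0_norm (w0 _ ht)) mulrC ler_wpM2r ?w0 ?uK.
Qed.

Lemma jop_bound u x K : continuous u -> (forall t, x <= t <= x + h -> `|u t| <= K) -> `|jop u x| <= K.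
Proof.
move=> cu uK; have h2 : 0 < 2 / h ^+ 2 by rewrite divr_gt0// exprn_gt0.
rewrite /jop normrM (gtr0_norm h2) -ler_pdivlMl// mulrC.
have := weight_le (@cl1 x) cu _ uK; rewrite (weight_int x).1 => hw.
apply: le_trans (hw _) _; first by move=> t /andP[_]; rewrite subr_ge0.
by rewrite invf_div mulrC.
Qed.

Lemma eop_bound u x K : continuous u -> (forall t, x <= t <= x + h -> `|u t| <= K) -> `|eop u x| <= 2^-1 * K.
Proof.
move=> cu uK; have h2 : 0 < (h ^+ 2)^-1 by rewrite invr_gt0 exprn_gt0.
rewrite /eop normrM (gtr0_norm h2) -ler_pdivlMl// invrK.
have := weight_le (@cl2 x) cu _ uK; rewrite (weight_int x).2 => hw.
apply: le_trans (hw _) _; first by move=> t /andP[+ _]; rewrite subr_ge0.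
by rewrite mulrA.
Qed.

Lemma weight_avg (w : R -> R) u x : continuous w -> continuous u ->
  (forall t, x <= t <= x + h -> 0 <= w t <= h) ->
  `|itg x (x + h) (fun t => w t * u t)| <= h * itg x (x + h) (fun t => `|u t|).
Proof.
move=> cw cu wh; have cwu := cont_mul cw cu; have cnu := cont_norm cu.
apply: le_trans (itg_norm _ _ (cont_locint cwu)) _; rewrite -itgZ; last exact: cont_locint.
apply: itg_le.
- exact: locint_abs (cont_locint cwu).
- by apply: locintZ; exact: cont_locint.
- by move=> t /wh/andP[w0 w1]; rewrite normrM (ger0_norm w0) ler_wpM2r.
Qed.

Lemma jop_le u x : continuous u -> `|jop u x| <= 2 * adot h (fun t => `|u t|) x.
Proof.
move=> cu; have h2 : 0 < 2 / h ^+ 2 by rewrite divr_gt0// exprn_gt0.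
rewrite /jop normrM (gtr0_norm h2) /adot.
apply: le_trans (ler_wpM2l (ltW h2) (weight_avg (@cl1 x) cu _)) _.
  by move=> t /andP[t1 t2]; apply/andP; split; lra.
by rewrite le_eqVlt; apply/orP; left; apply/eqP; field.
Qed.

Lemma eop_le u x : continuous u -> `|eop u x| <= adot h (fun t => `|u t|) x.
Proof.
move=> cu; have h2 : 0 < (h ^+ 2)^-1 by rewrite invr_gt0 exprn_gt0.
rewrite /eop normrM (gtr0_norm h2) /adot.
apply: le_trans (ler_wpM2l (ltW h2) (weight_avg (@cl2 x) cu _)) _.
  by move=> t /andP[t1 t2]; apply/andP; split; lra.
by rewrite le_eqVlt; apply/orP; left; apply/eqP; field.
Qed.

Lemma jop_cst k x : jop (fun=> k) x = k.
Proof.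
rewrite /jop (eq_itg (g := fun t => k * (x + h - t))); last by move=> t _; rewrite mulrC.
rewrite itgZ ?(weight_int x).1; last exact: cont_locint.
by field.
Qed.

Lemma jdiff_le u u1 x : isd u u1 -> continuous u1 -> `|jdiff u x| <= itg x (x + h) (fun t => `|u1 t|).
Proof.
move=> du cu1; have cu := isd_cont du.
rewrite /jdiff -{1}(jop_cst (u x) x) -jopB//; last exact: cont_cst.
apply: jop_bound; first by apply: cont_sub => //; exact: cont_cst.
move=> t /andP[xt th]; rewrite distrC; apply: le_trans (diff_le du cu1 xt) _.
by apply: itg_mono => //; exact: cont_norm.
Qed.

Lemma cont_iter_eop n u : continuous u -> continuous (iter n eop u).
Proof. by move=> cu; elim: n => //= n IH; exact: cont_eop. Qed.

Lemma iter_eopD n u v : continuous u -> continuous v ->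
  iter n eop (fun y => u y + v y) = (fun x => iter n eop u x + iter n eop v x).
Proof.
move=> cu cv; elim: n => //= n IH; apply/funext => x; rewrite IH eopD//; exact: cont_iter_eop.
Qed.

Lemma iter_eop_le n u x : continuous u ->
  `|iter n.+1 eop u x| <= 2^-1 ^+ n * (h^-1 * itg x (x + n.+1%:R * h) (fun t => `|u t|)).
Proof.
move=> cu; have cnu := cont_norm cu; elim: n x => [|n IH] x.
  by rewrite expr0 !mul1r; exact: eop_le.
rewrite iterS exprS -mulrA; apply: eop_bound; first exact: cont_iter_eop.
move=> t /andP[xt th]; apply: le_trans (IH t) _.
rewrite ler_wpM2l ?exprn_ge0 ?invr_ge0// ler_wpM2l ?invr_ge0 ?(ltW h0)//.
by apply: itg_mono => //; rewrite -[in leRHS]natr1 mulrDl mul1r; lra.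
Qed.

(** Write [jdiff f] as [fdiff h (jdiff f) + adot h (jdiff f)] and split the average by [eopE]; [jop]
    and [fdiff h] commute with [jdiff]. *)
Lemma jdiff_split f x : continuous f -> jdiff f x = eop (jdiff f) x + (jdiff (D f) x + 2^-1 * jdiff (jop f) x).
Proof.
move=> cf; have cj := cont_jop cf; have cw : continuous (jdiff f) by exact: cont_sub.
have e1 : jop (jdiff f) x = jop f x - jop (jop f) x by exact: jopB.
have e2 : adot h (jdiff f) x = adot h f x - adot h (jop f) x by rewrite adotB//; exact: cont_locint.
have e3 : jop (D f) x = D (jop f) x by rewrite jop_fdiff.
by rewrite eopE// e1 e2 /jdiff e3 /fdiff; field.
Qed.

Lemma jop_supp u : bdd_supp u -> bdd_supp (jop u).
Proof.
move=> [n hn]; exists (`|n| + h) => x hx.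
rewrite /jop (eq_itg (g := fun=> 0)); first by rewrite itg_cst ?xh// mul0r mulr0.
move=> t /andP[xt th]; rewrite hn ?mulr0//; apply: le_lt_trans (ler_norm n) _.
have := ler_normD t (x - t); rewrite (addrC x) addrA subrr add0r.
have : `|- t + x| <= h by rewrite ler_norml; apply/andP; split; lra.
lra.
Qed.

Lemma ndiff_supp u : bdd_supp u -> bdd_supp (ndiff u).
Proof.
move=> su; have [n hn] := su; have [m hm] := jop_supp (jop_supp su).
exists (Num.max n m) => x; rewrite gt_max => /andP[/hn h2 /hm h3].
by rewrite /ndiff h2 h3 subrr.
Qed.

Lemma cont_ndiff u : continuous u -> continuous (ndiff u).
Proof. by move=> cu; apply: cont_sub => //; do 2!apply: cont_jop. Qed.

Lemma ndiff_fdiff u : continuous u -> D (ndiff u) = ndiff (D u).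
Proof.
move=> cu; have cj := cont_jop cu; have cjj := cont_jop cj.
by apply/funext => x; rewrite /ndiff fdiffB// jop_fdiff// -jop_fdiff.
Qed.

(** With [J = jop], this is [J^2] for [b = false] and [2 J^2 - J^4] for [b = true]; the deviation
    from [u] is the power [b.+1] of [ndiff]. *)
Definition smoothed (b : bool) u x := u x - iter b.+1 ndiff u x.

Definition smoothed_deriv (b : bool) u x := if b then
    (2 / h) ^+ 2 * (2 * iter 2 D u x - jop (jop (iter 2 D u)) x)
  else (- (2 / h)) * jop (D u) x.

Lemma isd_jop2 u : continuous u -> isd (jop (jop u)) (fun x => - (2 / h) * jop (D u) x).
Proof. by move=> cu; rewrite jop_fdiff//; exact: isd_jop (cont_jop cu). Qed.

Lemma isd2_jop2 u : continuous u -> isd (fun x => - (2 / h) * jop (D u) x) (fun x => (2 / h) ^+ 2 * iter 2 D u x).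
Proof.
move=> cu x; apply: dval (dscale (- (2 / h)) (isd_jop (cont_fdiff h0 cu) x)) _.
by rewrite /=; ring.
Qed.

Lemma smoothed_derivs b u : continuous u -> derivs b (smoothed b u) (smoothed_deriv b u).
Proof.
move=> cu; have cD := cont_fdiff h0 cu; have cDD := cont_fdiff h0 cD.
have cj := cont_jop cu; have cjj := cont_jop cj.
case: b; split.
- apply: cont_mul; first exact: cont_cst.
  apply: cont_sub; first by apply: cont_mul => //; exact: cont_cst.
  by do 2!apply: cont_jop.
- pose j4 := jop (jop (jop (jop u))).
  have e : smoothed true u = fun x => 2 * jop (jop u) x - j4 x.
    apply/funext => x; rewrite /smoothed /= /ndiff.
    have -> : jop (jop (fun x => u x - jop (jop u) x)) x = jop (jop u) x - j4 x.
      rewrite (_ : jop (fun x => u x - jop (jop u) x) = fun x => jop u x - jop (jop (jop u)) x); last first.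
        by apply/funext => y; exact: jopB.
      exact: (jopB x cj (cont_jop cjj)).
    by ring.
  rewrite e; exists (fun x => 2 * (- (2 / h) * jop (D u) x) - (- (2 / h) * jop (D (jop (jop u))) x)); split => x.
    by apply: dsub; [apply: dscale; exact: isd_jop2|exact: isd_jop2].
  apply: dval (dsub (dscale 2 (isd2_jop2 cu x)) (isd2_jop2 cjj x)) _.
  rewrite /smoothed_deriv /= -!jop_fdiff//; [ring|exact: cont_jop..].
- apply: cont_mul; first exact: cont_cst.
  exact: cont_jop.
- rewrite (_ : smoothed false u = jop (jop u)); first exact: isd_jop2.
  by apply/funext => x; rewrite /smoothed /= /ndiff; ring.
Qed.

Lemma smoothed_supp b u : bdd_supp u -> bdd_supp (smoothed b u).
Proof.
move=> su; have [n hn] := su.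
have [m hm] : bdd_supp (iter b.+1 ndiff u) by case: b => /=; do ?apply: ndiff_supp.
exists (Num.max n m) => x; rewrite gt_max => /andP[/hn h2 /hm h3].
by rewrite /smoothed h2 h3 subrr.
Qed.

End TriangularAverages.

(** * Norm bounds for the smoothing *)

Section SmoothingLattice.
Context {R : realType} (X : banach_lattice R).
Local Notation S := (rset X).
Local Notation p := (rnorm X).
Variables (CA h : R) (n : nat).
Hypothesis hCA : steklov_bound X CA.
Hypothesis h0 : 0 < h.
(** By [iter_eop_le], this makes the norm of [iter n.+1 eop] at most [1/2] on continuous
    functions. *)
Hypothesis hn : 4 * CA * n.+1%:R <= 2 ^+ n.
Implicit Types (f u v F : R -> R) (x y t K : R).
Local Notation D := (fdiff h).
Local Notation jop := (jop h).
Local Notation eop := (eop h).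
Local Notation jdiff := (jdiff h).
Local Notation ndiff := (ndiff h).

Let CA0 : 0 <= CA. Proof. by case: hCA. Qed.
Let A0 : 0 <= 2 * CA. Proof. exact: mulr_ge0. Qed.

Lemma adot_window m u : 0 < m -> S u -> S (adot m u) /\ p (adot m u) <= 2 * CA * p u.
Proof. by move=> m0 Su; have := adot_rset hCA ltr01 m0 Su; rewrite divr1. Qed.

Lemma fdiff_S u : S u -> S (D u) /\ p (D u) <= (1 + 2 * CA) * p u.
Proof. by move=> Su; have := fdiff_rset hCA ltr01 h0 Su; rewrite divr1. Qed.

Lemma adot_dominated m K u v : 0 < m -> 0 <= K -> continuous v -> S u ->
  (forall x, `|v x| <= K * adot m (fun t => `|u t|) x) -> S v /\ p v <= K * (2 * CA) * p u.
Proof.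
move=> m0 K0 cv Su hv; have Sa := rset_abs Su; have [S1 p1] := adot_window m0 Sa.
have [Sv pv] : S v /\ p v <= p (fun x => K * adot m (fun t => `|u t|) x).
  apply: rset_le; [exact: lmeas_cont|exact: rsetZ|].
  by move=> x; apply: le_trans (hv x) (ler_norm _).
split => //; apply: le_trans pv _; rewrite rnormZ// ger0_norm// -mulrA ler_wpM2l//.
by rewrite rnorm_abs in p1.
Qed.

Lemma jop_rset u : continuous u -> S u -> S (jop u) /\ p (jop u) <= 2 * (2 * CA) * p u.
Proof. by move=> cu Su; apply: (adot_dominated h0) => //; [exact: cont_jop|move=> x; exact: jop_le]. Qed.

Lemma eop_rset u : continuous u -> S u -> S (eop u) /\ p (eop u) <= 2 * CA * p u.
Proof.
move=> cu Su; rewrite -[2 * CA]mul1r; apply: (adot_dominated h0) => //; first exact: cont_eop.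
by move=> x; rewrite mul1r; exact: eop_le.
Qed.

Lemma iter_eop_rset k u : continuous u -> S u -> S (iter k eop u) /\ p (iter k eop u) <= (2 * CA) ^+ k * p u.
Proof.
move=> cu Su; elim: k => [|k [S1 p1]]; first by rewrite expr0 mul1r.
have [S2 p2] := eop_rset (cont_iter_eop h0 cu) S1; split => //.
by apply: le_trans p2 _; rewrite exprS -[leRHS]mulrA ler_wpM2l.
Qed.

(** The derivative of [jop f] is [- 2 / h] times [fdiff h f], and [jdiff] is bounded by a local
    integral of the derivative. *)
Lemma jdiff_jop_rset f : continuous f -> S f -> S (jdiff (jop f)) /\ p (jdiff (jop f)) <= 2 * (2 * CA) * p (D f).
Proof.
move=> cf Sf; have cD := cont_fdiff h0 cf; have [SD _] := fdiff_S Sf; have cj := cont_jop h0 cf.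
apply: (adot_dominated h0) => //.
  by apply: cont_sub => //; exact: cont_jop.
move=> x; apply: le_trans (jdiff_le h0 x (isd_jop h0 cf) _) _.
  by apply: cont_mul => //; exact: cont_cst.
rewrite (eq_itg (g := fun t => 2 / h * `|D f t|)); last first.
  have h2 : 0 < 2 / h by exact: divr_gt0.
  by move=> t _; rewrite normrM normrN (gtr0_norm h2).
by rewrite itgZ ?mulrA//; apply: cont_locint; exact: cont_norm.
Qed.

Definition remainder f x := jdiff (D f) x + 2^-1 * jdiff (jop f) x.

Lemma remainder_rset f : continuous f -> S f ->
  [/\ continuous (remainder f), S (remainder f) & p (remainder f) <= (1 + 6 * CA) * p (D f)].
Proof.
move=> cf Sf; have cD := cont_fdiff h0 cf; have [SD _] := fdiff_S Sf; have cj := cont_jop h0 cf.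
have [S1 p1] := jop_rset cD SD; have [S2 p2] := jdiff_jop_rset cf Sf.
have S3 : S (jdiff (D f)) by exact: rsetB.
have p3 : p (jdiff (D f)) <= p (D f) + 2 * (2 * CA) * p (D f).
  by apply: le_trans (rnormB SD S1) _; rewrite lerD2l.
have S4 : S (fun x => 2^-1 * jdiff (jop f) x) by exact: rsetZ.
split.
- apply: cont_add; first by apply: cont_sub => //; exact: cont_jop.
  by apply: cont_mul; [exact: cont_cst|apply: cont_sub => //; exact: cont_jop].
- exact: rsetD.
- apply: le_trans (rnormD S3 S4) _; rewrite rnormZ// ger0_norm ?invr_ge0//.
  have := ler_wpM2l (_ : 0 <= 2^-1) p2; rewrite invr_ge0 => /(_ (ler0n _ 2)) h2.
  by apply: le_trans (lerD p3 h2) _; rewrite le_eqVlt; apply/orP; left; apply/eqP; field.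
Qed.

Lemma iter_alg (a b c q r s : R) : a <= b + s * r -> b <= c + q * r -> a <= c + (s + q) * r.
Proof. by rewrite mulrDl; lra. Qed.

Lemma sqr_alg (a b c q : R) : 0 <= q -> a <= q * b -> b <= q * c -> a <= q ^+ 2 * c.
Proof. by move=> q0 ha hb; apply: le_trans ha _; rewrite expr2 -[leRHS]mulrA ler_wpM2l. Qed.

(* [jdiff f = eop (jdiff f) + remainder f] is iterated; the kernel of the [k]-th power of [eop]
   is of size [2^(1 - k) / h] on an interval of length [k h], so the first term on the right is
   eventually absorbed. *)
Lemma jdiff_iter k f : continuous f -> S f ->
  p (jdiff f) <= p (iter k eop (jdiff f)) + (\sum_(j < k) (2 * CA) ^+ j) * p (remainder f).
Proof.
move=> cf Sf; have [cr Sr pr] := remainder_rset cf Sf.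
have cw : continuous (jdiff f) by apply: cont_sub => //; exact: cont_jop.
have Sw : S (jdiff f) by apply: rsetB => //; exact: (jop_rset cf Sf).1.
elim: k => [|k IH]; first by rewrite big_ord0 mul0r addr0.
have e : iter k eop (jdiff f) = fun x => iter k.+1 eop (jdiff f) x + iter k eop (remainder f) x.
  rewrite iterSr -iter_eopD//; last exact: cont_eop.
  by congr iter; apply/funext => x; exact: jdiff_split.
have [S1 p1] := iter_eop_rset k cr Sr.
have [S2 _] := iter_eop_rset k.+1 cw Sw.
have hk : p (iter k eop (jdiff f)) <= p (iter k.+1 eop (jdiff f)) + (2 * CA) ^+ k * p (remainder f).
  by rewrite [in leLHS]e; apply: le_trans (rnormD S2 S1) _; rewrite lerD2l.
by rewrite big_ord_recr /=; exact: iter_alg IH hk.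
Qed.

(** The leading 2 is [1 / (1 - 1/2)], from absorbing the iterated term; the last factor bounds
    [remainder]. *)
Definition Cj : R := 2 * (\sum_(j < n.+1) (2 * CA) ^+ j) * (1 + 6 * CA).

Let sum0 : 0 <= \sum_(j < n.+1) (2 * CA) ^+ j.
Proof. by apply: sumr_ge0 => j _; exact: exprn_ge0. Qed.

Lemma Cj_ge0 : 0 <= Cj.
Proof. by rewrite /Cj mulr_ge0 ?mulr_ge0 ?addr_ge0 ?mulr_ge0. Qed.

Lemma jdiff_rset f : continuous f -> S f -> S (jdiff f) /\ p (jdiff f) <= Cj * p (D f).
Proof.
move=> cf Sf; have [cr Sr pr] := remainder_rset cf Sf.
have cw : continuous (jdiff f) by apply: cont_sub => //; exact: cont_jop.
have Sw : S (jdiff f) by apply: rsetB => //; exact: (jop_rset cf Sf).1.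
split => //; have := jdiff_iter n.+1 cf Sf.
have n0 : 0 < n.+1%:R * h by rewrite mulr_gt0.
have K0 : 0 <= 2^-1 ^+ n * n.+1%:R :> R by rewrite mulr_ge0 ?exprn_ge0 ?invr_ge0.
have [_ pE] : S (iter n.+1 eop (jdiff f)) /\
    p (iter n.+1 eop (jdiff f)) <= 2^-1 ^+ n * n.+1%:R * (2 * CA) * p (jdiff f).
  apply: (adot_dominated n0) => //; first exact: cont_iter_eop.
  move=> x; apply: le_trans (iter_eop_le h0 n x cw) _; rewrite /adot.
  rewrite le_eqVlt; apply/orP; left; apply/eqP; rewrite invfM -!mulrA; congr (_ * _).
  by rewrite !mulrA divff ?mul1r// pnatr_eq0.
have half : 2^-1 ^+ n * n.+1%:R * (2 * CA) <= 2^-1.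
  rewrite exprVn -mulrA ler_pdivrMl ?exprn_gt0//.
  by move: hn; rewrite ler_pdivlMr// => H; apply: le_trans H; rewrite le_eqVlt; apply/orP; left; apply/eqP; ring.
have pw0 := rnorm_ge0 Sw; have h1 := ler_wpM2r pw0 half.
have h2 := ler_wpM2l sum0 pr.
have -> : Cj * p (D f) = 2 * ((\sum_(j < n.+1) (2 * CA) ^+ j) * ((1 + 6 * CA) * p (D f))) by rewrite /Cj; ring.
lra.
Qed.

Definition Cn : R := Cj + 2 * (2 * CA).

Lemma Cn_ge0 : 0 <= Cn. Proof. by rewrite addr_ge0 ?Cj_ge0// mulr_ge0. Qed.

Lemma ndiff_rset f : continuous f -> S f -> S (ndiff f) /\ p (ndiff f) <= Cn * p (D f).
Proof.
move=> cf Sf; have [S1 p1] := jdiff_rset cf Sf; have [S2 p2] := jdiff_jop_rset cf Sf.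
have -> : ndiff f = fun x => jdiff f x + jdiff (jop f) x by apply/funext => x; rewrite /ndiff /jdiff; ring.
split; first exact: rsetD.
by apply: le_trans (rnormD S1 S2) _; rewrite /Cn mulrDl; exact: lerD.
Qed.

(** For [b = true] the bound of [ndiff] by [fdiff h] is used twice, the two operators commuting. *)
Lemma iter_ndiff_rset (b : bool) f : continuous f -> S f ->
  S (iter b.+1 ndiff f) /\ p (iter b.+1 ndiff f) <= Cn ^+ b.+1 * p (iter b.+1 D f).
Proof.
move=> cf Sf; have [S1 p1] := ndiff_rset cf Sf; case: b; last by rewrite expr1.
have cD := cont_fdiff h0 cf; have [SD _] := fdiff_S Sf.
have [S2 p2] := ndiff_rset (cont_ndiff h0 cf) S1.
have [S3 p3] := ndiff_rset cD SD.
rewrite (ndiff_fdiff h0 cf) in p2; split; first exact: S2.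
exact: sqr_alg Cn_ge0 p2 p3.
Qed.

Definition Cd : R := 2 + 2 * (2 * CA) + (2 * (2 * CA)) ^+ 2.

Lemma Cd_ge0 : 0 <= Cd. Proof. by rewrite !addr_ge0 ?exprn_ge0 ?mulr_ge0. Qed.

Lemma smoothed_alg (k a q : R) : 0 <= k * a -> q <= k * (k * a) -> 2 * a + q <= (2 + k + k ^+ 2) * a.
Proof. by move=> ka hq; rewrite expr2; nra. Qed.

Lemma smoothed_deriv_rset (b : bool) f : continuous f -> S f ->
  S (smoothed_deriv h b f) /\ p (smoothed_deriv h b f) <= (2 / h) ^+ b.+1 * (Cd * p (iter b.+1 D f)).
Proof.
move=> cf Sf; have cD := cont_fdiff h0 cf; have [SD _] := fdiff_S Sf.
have h2 : 0 <= 2 / h by rewrite divr_ge0// ltW.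
have k0 : 0 <= 2 * (2 * CA) by exact: mulr_ge0.
case: b; last first.
  have [S1 p1] := jop_rset cD SD; rewrite /smoothed_deriv; split; first exact: rsetZ.
  rewrite rnormZ// normrN ger0_norm// expr1 ler_wpM2l//; apply: le_trans p1 _.
  rewrite ler_wpM2r ?rnorm_ge0// /Cd; have := exprn_ge0 2 k0; lra.
have cDD := cont_fdiff h0 cD; have [SDD _] := fdiff_S SD.
have [S1 p1] := jop_rset cDD SDD; have [S2 p2] := jop_rset (cont_jop h0 cDD) S1.
have S3 : S (fun x => 2 * iter 2 D f x) by exact: rsetZ.
rewrite /smoothed_deriv; split; first by apply: rsetZ; exact: rsetB.
rewrite rnormZ; last exact: rsetB.
rewrite ger0_norm ?exprn_ge0// ler_wpM2l ?exprn_ge0//.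
apply: le_trans (rnormB S3 S2) _; rewrite rnormZ// ger0_norm//.
exact: smoothed_alg (mulr_ge0 k0 (rnorm_ge0 SDD)) (le_trans p2 (ler_wpM2l k0 p1)).
Qed.

End SmoothingLattice.

Lemma ex_pow2_ge (R : realType) (C : R) : exists n : nat, C * n.+1%:R <= 2 ^+ n.
Proof.
(* As [C <= m], the inequality [m * (2 * m + 1) <= 4^m] settles the exponent [n = 2 * m]. *)
pose m := (Num.bound `|C|).+1; exists m.*2.
have hm : C <= m%:R.
  apply: le_trans (ler_norm C) _; apply: ltW; apply: lt_trans (archi_boundP (normr_ge0 C)) _.
  by rewrite ltr_nat.
have key k : (k * (2 * k).+1 <= 4 ^ k)%N.
  by elim: k => [//|[|k] IH //]; rewrite expnS; move: IH; set q := (4 ^ _)%N; nia.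
apply: le_trans (ler_wpM2r _ hm) _ => //.
by rewrite -natrM -natrX ler_nat -mul2n expnM.
Qed.

(** * The upper estimate in the lattice *)

Section UpperEstimate.
Context {R : realType} (X : banach_lattice R).
Local Notation S := (rset X).
Local Notation p := (rnorm X).
Variables (CA theta sigma : R).
Hypothesis hCA : steklov_bound X CA.
Hypothesis theta12 : 2^-1 <= theta < 1.
Hypothesis sigma0 : 0 < sigma.
Variables (psi : R -> R) (Bpsi CK gamma M : R) (n j : nat) (b : bool).
Hypothesis hpsi : bddm psi Bpsi.
Hypothesis KC : kdec theta CK (kern psi).
Hypothesis gamma0 : 0 < gamma.
Hypothesis gamma1 : gamma <= 1.
Hypothesis hn : 4 * CA * n.+1%:R <= 2 ^+ n.
Hypothesis dense : rdense X.
Local Notation st := (st sigma).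
Local Notation nodes := (nodes sigma).
Local Notation Q := (Qop sigma (kern psi)).
Local Notation h := (gamma / sigma).
Local Notation modulus f := (p (iter b.+1 (fdiff h) f)).
Local Notation A := (iter j.+1 (cdiff h)).
Hypothesis M0 : 0 <= M.
Hypothesis hM : forall g gs, derivs b g gs -> bdd_supp g ->
  [/\ S (st (nodes g)), S (st (nodes (fun x => g x - Q (nodes g) x))) &
      p (fun x => g x - Q (nodes g) x) + p (st (nodes (fun x => g x - Q (nodes g) x))) <=
      M * (sigma ^- b.+1 * p gs)].
Implicit Types (f g u v : R -> R) (x e K : R).

Let h0 : 0 < h. Proof. exact: divr_gt0. Qed.
Let CA0 : 0 <= CA. Proof. by case: hCA. Qed.
Let cK : continuous (kern psi). Proof. exact: cont_kern hpsi. Qed.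
Let q0 : 0 <= CQ theta CK * Cmaj CA theta.
Proof. by apply: mulr_ge0; [exact: (CQ_ge0 theta12 KC)|exact: (Cmaj_ge0 hCA theta12)]. Qed.
Let t0 : 0 <= 2 / theta. Proof. by rewrite divr_ge0// ltW// (theta_gt0 theta12). Qed.

Definition defect u K := [/\ S u, S (st (nodes u)) &
  p (fun x => u x - Q (nodes u) x) + p (st (nodes (fun x => u x - Q (nodes u) x))) <= K].

Lemma QS u : S (st (nodes u)) -> S u -> S (fun x => u x - Q (nodes u) x) /\
  S (st (nodes (fun x => u x - Q (nodes u) x))).
Proof.
move=> Sn Su; have [SQ _] := Q_rset hCA theta12 sigma0 KC cK Sn.
have [SQn _] := Q_node hCA theta12 sigma0 KC Sn.
by split; [exact: rsetB|exact: (rsetB Sn SQn)].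
Qed.

Definition Cst := 1 + (1 + 2 / theta) * (CQ theta CK * Cmaj CA theta).

Lemma Cst_ge1 : 1 <= Cst.
Proof. by rewrite lerDl mulr_ge0// addr_ge0. Qed.

Lemma stable_alg (a1 a2 pu pn pq pqn q t : R) : a1 <= pu + pq -> a2 <= pn + pqn -> pq <= q * pn ->
  pqn <= t * (q * pn) -> a1 + a2 <= pu + (1 + (1 + t) * q) * pn.
Proof. move=> *; have -> : (1 + (1 + t) * q) * pn = pn + q * pn + t * (q * pn) by ring. lra. Qed.

(** Boundedness of the sampling operator alone; the price is that the node values of [u] enter the
    bound. *)
Lemma defect_stable u : S u -> S (st (nodes u)) -> defect u (p u + Cst * p (st (nodes u))).
Proof.
move=> Su Sn; have [SQ pQ] := Q_rset hCA theta12 sigma0 KC cK Sn.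
have [SQn pQn] := Q_node hCA theta12 sigma0 KC Sn.
split => //; apply: stable_alg (rnormB Su SQ) (rnormB Sn SQn) pQ _.
by apply: le_trans pQn _; rewrite le_eqVlt; apply/orP; left; apply/eqP; ring.
Qed.

Lemma defect_le u K K' : K <= K' -> defect u K -> defect u K'.
Proof. by move=> KK [Su Sn h1]; split => //; exact: le_trans h1 KK. Qed.

Lemma add4_alg (a b1 c d K K' s1 s2 : R) : s1 <= a + b1 -> s2 <= c + d -> a + c <= K -> b1 + d <= K' -> s1 + s2 <= K + K'.
Proof. by move=> *; lra. Qed.

Lemma defectD u v w K K' : (forall x, w x = u x + v x) -> defect u K -> defect v K' -> defect w (K + K').
Proof.
move=> /funext -> [Su Sun hu] [Sv Svn hv].
have nE : nodes (fun x => u x + v x) = fun k => nodes u k + nodes v k by [].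
have Sn : S (st (nodes (fun x => u x + v x))) by exact: (rsetD Sun Svn).
have [S1 S2] := QS Sun Su; have [S3 S4] := QS Svn Sv.
have e : (fun x => u x + v x - Q (nodes (fun x => u x + v x)) x) =
    fun x => (u x - Q (nodes u) x) + (v x - Q (nodes v) x).
  by apply/funext => x; rewrite nE (QD hCA theta12 sigma0 KC x Sun Svn); ring.
split => //; first exact: rsetD.
rewrite e; exact: add4_alg (rnormD S1 S3) (rnormD S2 S4) hu hv.
Qed.

Lemma defectB u v w K K' : (forall x, w x = u x - v x) -> defect u K -> defect v K' -> defect w (K + K').
Proof.
move=> /funext -> [Su Sun hu] [Sv Svn hv].
have nE : nodes (fun x => u x - v x) = fun k => nodes u k - nodes v k by [].
have Sn : S (st (nodes (fun x => u x - v x))) by exact: (rsetB Sun Svn).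
have [S1 S2] := QS Sun Su; have [S3 S4] := QS Svn Sv.
have e : (fun x => u x - v x - Q (nodes (fun x => u x - v x)) x) =
    fun x => (u x - Q (nodes u) x) - (v x - Q (nodes v) x).
  by apply/funext => x; rewrite nE (QB hCA theta12 sigma0 KC x Sun Svn); ring.
split => //; first exact: rsetB.
rewrite e; exact: add4_alg (rnormB S1 S3) (rnormB S2 S4) hu hv.
Qed.

Local Notation cn := (Cn CA n ^+ b.+1).
Definition Crate := (2 / gamma) ^+ b.+1 * Cd CA.
Definition Cone := (1 + CA) ^+ j.+1 * cn + Cder CA j * Crate.
Definition Csmall := (1 + (1 + CA) ^+ j.+1) + Cst * Csub CA gamma j.+1.
(** The three terms bound the defects of [w - A w], of [g] and of [A g] in [compact_estimates]. *)
Definition Ctwo := Csmall * cn + (M * Crate + (1 + Cst) * (Cder CA j * Crate)).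
Definition Cup := Cone + Ctwo + Cst.

Let cn0 : 0 <= cn. Proof. by apply: exprn_ge0; exact: (Cn_ge0 n hCA). Qed.
Let r0 : 0 <= Crate. Proof. by rewrite mulr_ge0 ?(Cd_ge0 hCA)// exprn_ge0// divr_ge0// ltW. Qed.
Let cd0 : 0 <= Cder CA j * Crate. Proof. by rewrite mulr_ge0 ?(Cder_ge0 hCA). Qed.
Let ca0 : 0 <= (1 + CA) ^+ j.+1. Proof. by rewrite exprn_ge0 ?addr_ge0. Qed.
Let cst0 : 0 <= Cst. Proof. exact: le_trans Cst_ge1. Qed.

Lemma Cone_ge0 : 0 <= Cone. Proof. by apply: addr_ge0 => //; exact: mulr_ge0. Qed.
Lemma Csmall_ge0 : 0 <= Csmall.
Proof. by rewrite !addr_ge0// mulr_ge0// (Csub_ge0 hCA gamma0). Qed.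
Lemma Ctwo_ge0 : 0 <= Ctwo.
Proof. apply: addr_ge0; first by apply: mulr_ge0; [exact: Csmall_ge0|].
by apply: addr_ge0; [exact: mulr_ge0|apply: mulr_ge0 => //; exact: addr_ge0]. Qed.

(** The node values of [u - A u] are controlled by the norm of [u], so here stability needs no
    discrete norm. *)
Lemma defect_sub u : S u -> defect (fun x => u x - A u x) (Csmall * p u).
Proof.
move=> Su; have [[S1 p1] [S2 p2]] := sub_cdiff_rset hCA sigma0 gamma0 gamma1 j.+1 Su.
apply: (defect_le _ (defect_stable S1 S2)); rewrite /Csmall [leRHS]mulrDl; apply: (lerD p1).
by rewrite -mulrA ler_wpM2l.
Qed.

Lemma smoothed_rate f : continuous f -> S f ->
  S (smoothed_deriv h b f) /\ sigma ^- b.+1 * p (smoothed_deriv h b f) <= Crate * modulus f.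
Proof.
move=> cf Sf; have [S1 p1] := smoothed_deriv_rset hCA h0 b cf Sf; split => //.
have s0 : 0 <= sigma ^- b.+1 by rewrite invr_ge0 exprn_ge0// ltW.
apply: le_trans (ler_wpM2l s0 p1) _; rewrite mulrA /Crate -[leRHS]mulrA.
rewrite (_ : sigma ^- b.+1 * (2 / h) ^+ b.+1 = (2 / gamma) ^+ b.+1)//.
rewrite -exprVn -exprMn; congr (_ ^+ _); field.
by rewrite !gt_eqF.
Qed.

(** Split [f = w + g] with [g] smoothed. The defect is estimated for [f - A f], not for [f], because
    the node values of [w] are not controlled by its norm while those of [w - A w] are. *)
Lemma compact_estimates f : continuous f -> bdd_supp f ->
  p (A f) <= Cone * modulus f /\ defect (fun x => f x - A f x) (Ctwo * modulus f).
Proof.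
move=> cf sf; have Sf := rset_csupp X cf sf.
have dg := smoothed_derivs h0 b cf; have sg := smoothed_supp h0 b sf.
pose g := smoothed h b f; pose w := iter b.+1 (ndiff h) f.
have [Sw pw] : S w /\ p w <= cn * modulus f := iter_ndiff_rset hCA h0 hn b cf Sf.
have [Sgs pgs] := smoothed_rate cf Sf.
have Sg : S g by exact: rsetB.
have [_ [S2 p2] [S3 p3]] := derivs_bound hCA sigma0 gamma0 gamma1 j dg Sgs.
have [S4 p4] := iter_cdiff_rset hCA sigma0 gamma0 j.+1 Sw.
have [S5 S6 p6] := hM dg sg.
have fE : f = fun x => w x - (fun x => - g x) x by apply/funext => x; rewrite /g /smoothed /w; ring.
have AE x : A g x = A f x - A w x by rewrite /g (iter_cdiffB hCA sigma0 gamma0 j.+1 Sf Sw).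
have P0 : 0 <= modulus f.
  by apply: rnorm_ge0; exact: (iter_fdiff_rset hCA sigma0 gamma0 b.+1 Sf).1.
have cdP : Cder CA j * (sigma ^- b.+1 * p (smoothed_deriv h b f)) <= Cder CA j * Crate * modulus f.
  by rewrite -mulrA ler_wpM2l ?(Cder_ge0 hCA).
split.
  have -> : A f = fun x => A w x + A g x by apply/funext => x; rewrite AE; ring.
  apply: le_trans (rnormD S4 S2) _; rewrite /Cone mulrDl; apply: lerD.
    by apply: le_trans p4 _; rewrite -mulrA ler_wpM2l.
  exact: le_trans p2 cdP.
have d1 : defect (fun x => w x - A w x) (Csmall * cn * modulus f).
  by apply: defect_le (defect_sub Sw); rewrite -mulrA ler_wpM2l ?Csmall_ge0.
have d2 : defect g (M * Crate * modulus f).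
  by split => //; apply: le_trans p6 _; rewrite -mulrA ler_wpM2l.
have d3 : defect (A g) ((1 + Cst) * (Cder CA j * Crate) * modulus f).
  apply: defect_le (defect_stable S2 S3); rewrite -[leRHS]mulrA [leRHS]mulrDl mul1r; apply: lerD.
    exact: le_trans p2 cdP.
  by rewrite ler_wpM2l//; exact: le_trans p3 cdP.
have d4 : defect (fun x => g x - A g x) (M * Crate * modulus f + (1 + Cst) * (Cder CA j * Crate) * modulus f).
  by apply: defectB d2 d3.
apply: defect_le (defectD _ d1 d4); last by move=> x; rewrite AE /g /smoothed /w; ring.
by rewrite /Ctwo !mulrDl.
Qed.

Lemma eps_alg (a q c m m' k d e : R) : a <= c * m' -> m' <= m + k * e -> 0 <= c -> q <= d * e ->
  a + q <= c * m + (c * k + d) * e.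
Proof.
move=> ha hm c0 hq; have := ler_wpM2l c0 hm.
have -> : c * m + (c * k + d) * e = c * (m + k * e) + d * e by ring.
lra.
Qed.

(** Both quantities depend continuously on [f] in the norm of [X] alone, so density extends them
    from continuous functions of compact support. The defect of [f] itself involves node values and
    would not pass to the limit in this way. *)
Lemma lattice_estimates f : S f ->
  p (A f) <= Cone * modulus f /\ defect (fun x => f x - A f x) (Ctwo * modulus f).
Proof.
move=> Sf; have key e : 0 < e -> exists g, [/\ continuous g, bdd_supp g, S g,
    p (fun x => f x - g x) <= e & modulus g <= modulus f + (1 + 2 * CA) ^+ b.+1 * e].
  move=> e0; have [g [cg sg pg]] := dense Sf e0; have Sg := rset_csupp X cg sg.
  exists g; split => //; first exact: ltW.
  have Sd := rsetB Sf Sg; have [S1 p1] := iter_fdiff_rset hCA sigma0 gamma0 b.+1 Sd.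
  have [S2 _] := iter_fdiff_rset hCA sigma0 gamma0 b.+1 Sf.
  have -> : iter b.+1 (fdiff h) g = fun x => iter b.+1 (fdiff h) f x - iter b.+1 (fdiff h) (fun x => f x - g x) x.
    by apply/funext => x; rewrite (iter_fdiffB hCA sigma0 gamma0 b.+1 Sf Sg); ring.
  apply: le_trans (rnormB S2 S1) _; rewrite lerD2l; apply: le_trans p1 _.
  by apply: ler_wpM2l (ltW pg); rewrite exprn_ge0// addr_ge0// mulr_ge0.
have m0 : 0 <= (1 + 2 * CA) ^+ b.+1 by rewrite exprn_ge0// addr_ge0// mulr_ge0.
have [SA _] := iter_cdiff_rset hCA sigma0 gamma0 j.+1 Sf.
have [[SB _] [SBn _]] := sub_cdiff_rset hCA sigma0 gamma0 gamma1 j.+1 Sf.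
split.
  apply: (@le_eps _ _ _ (Cone * (1 + 2 * CA) ^+ b.+1 + (1 + CA) ^+ j.+1)).
    by rewrite addr_ge0// mulr_ge0// Cone_ge0.
  move=> e /key[g [cg sg Sg pg mg]]; have [h1 _] := compact_estimates cg sg.
  have Sd := rsetB Sf Sg; have [S1 p1] := iter_cdiff_rset hCA sigma0 gamma0 j.+1 Sd.
  have [S2 _] := iter_cdiff_rset hCA sigma0 gamma0 j.+1 Sg.
  have -> : A f = fun x => A g x + A (fun x => f x - g x) x.
    by apply/funext => x; rewrite (iter_cdiffB hCA sigma0 gamma0 j.+1 Sf Sg); ring.
  apply: le_trans (rnormD S2 S1) _; apply: (eps_alg h1 mg Cone_ge0).
  by apply: le_trans p1 _; rewrite ler_wpM2l.
split => //; apply: (@le_eps _ _ _ (Ctwo * (1 + 2 * CA) ^+ b.+1 + Csmall)).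
  by rewrite addr_ge0 ?Csmall_ge0// mulr_ge0// Ctwo_ge0.
move=> e /key[g [cg sg Sg pg mg]]; have [_ d1] := compact_estimates cg sg.
have d2 := defect_sub (rsetB Sf Sg).
have [_ _] : defect (fun x => f x - A f x) (Ctwo * modulus g + Csmall * p (fun x => f x - g x)).
  apply: defectD d1 d2 => x.
  by rewrite (iter_cdiffB hCA sigma0 gamma0 j.+1 Sf Sg); ring.
move=> hd; apply: le_trans hd _; apply: (eps_alg (lexx _) mg Ctwo_ge0).
by rewrite ler_wpM2l ?Csmall_ge0.
Qed.

Lemma upper_alg (a m q c1 c2 c3 : R) : a <= c1 * m -> 0 <= m -> 0 <= q -> 0 <= c1 -> 0 <= c2 -> 0 <= c3 ->
  c2 * m + (a + c3 * q) <= (c1 + c2 + c3) * (m + q).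
Proof.
move=> ha m0 q0' c10 c20 c30.
have := mulr_ge0 c10 q0'; have := mulr_ge0 c20 q0'; have := mulr_ge0 c30 m0.
rewrite !mulrDl !mulrDr; lra.
Qed.

(** Only [A f] is missing from the estimate for [f - A f]; its node values form the second term of
    the modulus, and its norm is bounded by the first. *)
Lemma upper_real f : S f -> S (st (nodes f)) ->
  p (fun x => f x - Q (nodes f) x) + p (st (nodes (fun x => f x - Q (nodes f) x))) <=
  Cup * (modulus f + p (st (nodes (A f)))).
Proof.
move=> Sf Sn; have [p1 d1] := lattice_estimates Sf.
have [SA _] := iter_cdiff_rset hCA sigma0 gamma0 j.+1 Sf.
have SAn : S (st (nodes (A f))).
  have [_ SBn _] := d1.
  rewrite (_ : st (nodes (A f)) = fun x => st (nodes f) x - st (nodes (fun x => f x - A f x)) x); first exact: rsetB.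
  by apply/funext => x; rewrite !stE !nodesE; ring.
have d2 := defect_stable SA SAn.
have [_ _ hd] : defect f (Ctwo * modulus f + (p (A f) + Cst * p (st (nodes (A f))))).
  by apply: defectD d1 d2 => x; ring.
have P0 : 0 <= modulus f.
  by apply: rnorm_ge0; exact: (iter_fdiff_rset hCA sigma0 gamma0 b.+1 Sf).1.
have Pn := rnorm_ge0 SAn.
by apply: le_trans hd _; apply: upper_alg p1 P0 Pn _ _ _; [exact: Cone_ge0|exact: Ctwo_ge0|exact: cst0].
Qed.

End UpperEstimate.

(** * Density of continuous functions of compact support *)

Section Density.
Context {R : realType} (X : banach_lattice R).
Local Notation S := (rset X).
Local Notation p := (rnorm X).
Implicit Types (u v : R -> R) (x e : R).

Lemma schwartz_real_cont u : schwartz_real u -> continuous u.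
Proof.
move=> [du _] x; have h := du 0%N x.
by apply: differentiable_continuous; exact/derivable1_diffP.
Qed.

Definition bump (n : nat) x : R := cutoff 0 1 (n%:R - `|x|).

Lemma bump01 n x : 0 <= bump n x <= 1.
Proof. by rewrite /bump /cutoff le_max lexx/= ge_max ler01/= ge_min lexx. Qed.

Lemma bump_nondec x : {homo bump^~ x : m n / (m <= n)%N >-> m <= n}.
Proof.
move=> m n mn; have h : m%:R - `|x| <= n%:R - `|x| by rewrite lerD2r ler_nat.
by rewrite /bump /cutoff ge_max !le_max lexx /= le_min !ge_min lexx h !orbT.
Qed.

Lemma cont_bump n : continuous (bump n).
Proof.
move=> x; apply: (@continuous_comp _ _ _ (fun x => n%:R - `|x|) (cutoff 0 1)); last exact: cutoff_cont.
by apply: cont_sub; [exact: cont_cst|apply: cont_norm => y; exact: cvg_id].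
Qed.

Lemma bump_far n x : n%:R <= `|x| -> bump n x = 0.
Proof. by move=> h; rewrite /bump /cutoff max_l// ge_min subr_le0 h orbT. Qed.

Lemma bump_near n x : `|x| + 1 <= n%:R -> bump n x = 1.
Proof. by move=> h; rewrite /bump /cutoff min_l ?max_r//; lra. Qed.

Lemma blB (f g : R -> R[i]) : X f -> X g -> X (f \- g).
Proof.
move=> Xf Xg; have := bl_add Xf (bl_scale (-1) Xg).
by rewrite (_ : _ \+ _ = f \- g)//; apply/funext => x /=; rewrite mulN1r.
Qed.

(** The real part of an approximating Schwartz function is truncated by [bump]; the removed part
    decreases to 0 at every point, so order continuity makes it small in norm. *)
Lemma real_dense : roc X -> schwartz_dense X -> rdense X.
Proof.
move=> rocX [hS dense] u e Su e0; have e2 : 0 < e / 2 by rewrite divr_gt0.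
have [g sg pg] := dense _ Su _ e2; have Xg := hS g sg.
pose v x := complex.Re (g x).
have cv : continuous v by apply: schwartz_real_cont; case: sg.
have [Sv _] := re_bl Xg.
have [_ puv'] := re_bl (blB Su Xg).
have puv : p (fun x => u x - v x) < e / 2.
  apply: le_lt_trans pg; apply: le_trans puv'; rewrite le_eqVlt; apply/orP; left; apply/eqP.
  by congr rnorm; apply/funext => x; rewrite /v /=; case: (g x).
pose w n x := `|v x| * (1 - bump n x).
have c1 n x : 0 <= 1 - bump n x <= 1 by have := bump01 n x; move/andP => [? ?]; apply/andP; split; lra.
have cw n : continuous (w n).
  by apply: cont_mul; [exact: cont_norm|apply: cont_sub; [exact: cont_cst|exact: cont_bump]].
have Sw n : S (w n).
  apply: (rset_le _ Sv _).1; first exact: lmeas_cont.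
  by move=> x; have /andP[a0 a1] := c1 n x; rewrite normrM normr_id (ger0_norm a0) ler_piMr.
have wn x : nonincreasing_seq (fun n => w n x).
  by move=> m n mn; rewrite /w ler_wpM2l// lerD2l lerN2; exact: bump_nondec.
have w0 x : w n x @[n --> \oo] --> (0 : R).
  apply/cvg_epsP => d d0; exists (Num.bound (`|x| + 1)) => n hn.
  rewrite /w bump_near ?subrr ?mulr0 ?subrr ?normr0 ?(ltW d0)//.
  apply: ltW; apply: lt_le_trans (archi_boundP (_ : 0 <= `|x| + 1)) _; first by rewrite addr_ge0.
  by rewrite ler_nat.
have [N /(_ N (leqnn N)) hN] := rocX w _ Sw wn w0 e2.
exists (fun x => v x * bump N x); split.
- by apply: cont_mul => //; exact: cont_bump.
- by exists N%:R => x /ltW/bump_far ->; rewrite mulr0.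
have Sb : S (fun x => v x - v x * bump N x).
  apply: (rset_le _ (Sw N) _).1 => [|x].
    by apply: lmeas_cont; apply: cont_sub => //; apply: cont_mul => //; exact: cont_bump.
  by rewrite /w -{1}[v x]mulr1 -mulrBr !normrM normr_id.
have pb : p (fun x => v x - v x * bump N x) <= e / 2.
  apply: le_trans hN; apply: (rset_le _ (Sw N) _).2 => [|x].
    by apply: lmeas_cont; apply: cont_sub => //; apply: cont_mul => //; exact: cont_bump.
  by rewrite /w -{1}[v x]mulr1 -mulrBr !normrM normr_id.
have -> : (fun x => u x - v x * bump N x) = fun x => (u x - v x) + (v x - v x * bump N x).
  by apply/funext => x; ring.
apply: le_lt_trans (rnormD (rsetB Su Sv) Sb) _; lra.
Qed.

End Density.

(** * Continuity of rho on the whole line *)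

Section ContinuousRho.
Context {R : realType}.
Variable alpha : R.
Hypothesis alpha0 : 0 < alpha.

Lemma cont_pospow : continuous (fun z : R => Num.max z 0 `^ alpha).
Proof.
move=> z; have [z0|z0] := leP z 0; last first.
  apply: cvg_trans (_ : (fun z : R => z `^ alpha) y @[y --> z] --> _); last first.
    by have := dcont (dpow alpha z0 (did z)); rewrite max_l ?ltW.
  apply: near_eq_cvg; near=> y; rewrite max_l// ltW//; near: y; exact: lt_nbhsr.
rewrite /continuous_at max_r// powR0 ?gt_eqF//; apply/cvgrPdist_le => e e0.
have d0 : 0 < e `^ alpha^-1 by exact: powR_gt0.
near=> y; rewrite sub0r normrN ger0_norm ?powR_ge0//.
have -> : e = (e `^ alpha^-1) `^ alpha by rewrite -powRrM mulVf ?gt_eqF// powRr1// ltW.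
apply: ge0_ler_powR; [exact: ltW|by rewrite nnegrE le_max lexx orbT|by rewrite nnegrE ltW|].
rewrite ge_max (ltW d0) andbT ltW//; near: y; apply: lt_nbhsl; exact: le_lt_trans d0.
Unshelve. all: by end_near. Qed.

Lemma cont_rho : continuous (rho alpha : R -> R).
Proof.
rewrite (_ : rho alpha = (fun z => Num.max z 0 `^ alpha) \o (fun x => 1 - x ^+ 2))// => x.
apply: continuous_comp; last exact: cont_pospow.
move: x.
apply: cont_sub; first exact: cont_cst.
by move=> y; exact: exprn_continuous.
Qed.

End ContinuousRho.

(** * The equivalence for real functions and a general symbol *)

Section RealEquivalence.
Context {R : realType} (X : banach_lattice R).
Local Notation S := (rset X).
Local Notation p := (rnorm X).

Definition real_error psi sigma u :=
  let w x := u x - Qop sigma (kern psi) (nodes sigma u) x in p w + p (st sigma (nodes sigma w)).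

Definition real_smooth gamma b j sigma u :=
  p (iter b.+1 (fdiff (gamma / sigma)) u) + p (st sigma (nodes sigma (iter j.+1 (cdiff (gamma / sigma)) u))).

Definition real_equiv psi gamma (b : bool) j := exists2 C : R, 0 <= C & forall sigma u, 1 <= sigma -> S u ->
  S (st sigma (nodes sigma u)) -> real_smooth gamma b j sigma u <= C * real_error psi sigma u /\
  real_error psi sigma u <= C * real_smooth gamma b j sigma u.

Variables (CA gamma : R).
Hypothesis hCA : steklov_bound X CA.
Hypothesis gamma0 : 0 < gamma.
Hypothesis gamma1 : gamma <= 1.
Hypothesis rocX : roc X.
Hypothesis dense : rdense X.

Section Kernel.
Variables (theta : R) (psi : R -> R) (CK L Z : R) (b : bool) (j : nat).
Hypothesis theta12 : 2^-1 <= theta < 1.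
Hypothesis mpsi : bmeas psi.
Hypothesis psi1 : forall t, `|psi t| <= 1.
Hypothesis psic : forall t, 0 < t < 1 -> {for t, continuous psi}.
Hypothesis KC : kdec theta CK (kern psi).
Hypothesis L0 : 0 <= L.
Hypothesis Z0 : 0 <= Z.
Hypothesis hL : forall sigma, 0 < sigma -> forall r c, uniq r -> (forall k, k \notin r -> c k = 0) ->
  exists us, [/\ derivs b (Qop sigma (kern psi) c) us, S us &
    p us <= sigma ^+ b.+1 * L * p (st sigma (derr sigma psi c))].
Hypothesis hZ : forall sigma, 0 < sigma -> residual_bound X sigma b psi Z.

Let hpsi : bddm psi 1. Proof. by split=> //; exact: borel_lebesgue. Qed.

Lemma equiv_of_kernel : real_equiv psi gamma b j.
Proof.
have [n hn] := ex_pow2_ge (4 * CA).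
have [K [CE hE]] := error_kernels theta12.
have [CV CV0 hV] := @V_pinv R.
have KV : kdec theta CV (kern (@jac R)).
  apply: kdec_pinv => // t; case: (leP 0 t) => [t0|/ltW t0]; first by rewrite (ger0_norm t0); exact: hV.
  by rewrite (ler0_norm t0) -V_even; apply: hV => //; rewrite oppr_ge0.
have [mE CE0 KE fE] := hE b.
pose M := Csm CA theta CK Z CE.
have M0 : 0 <= M by exact: (Csm_ge0 hCA theta12 KC Z0 CE0).
pose C1 := Clow CA gamma b L j; pose C2 := Cup CA theta CK gamma M n j b.
have [C10 C20] : 0 <= `|C1| /\ 0 <= `|C2| by split.
exists (`|C1| + `|C2|) => [|sigma u s1 Su Sn]; first exact: addr_ge0.
have s0 : 0 < sigma by exact: lt_le_trans s1.
have hl := lower_real hCA theta12 s0 hpsi KC gamma0 gamma1 rocX L0 (hL s0) j Su Sn.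
have hM := smooth_upper hCA theta12 s0 mpsi psi1 psic KC (hZ s0) CV0 KV mE CE0 KE fE.
have hu := upper_real hCA theta12 s0 j hpsi KC gamma0 gamma1 hn dense M0 hM Su Sn.
have [SA _] := iter_cdiff_rset hCA s0 gamma0 j.+1 Su.
have [Sf _] := iter_fdiff_rset hCA s0 gamma0 b.+1 Su.
have [[_ _] [SBn _]] := sub_cdiff_rset hCA s0 gamma0 gamma1 j.+1 Su.
have SAn : S (st sigma (nodes sigma (iter j.+1 (cdiff (gamma / sigma)) u))).
  rewrite (_ : st sigma (nodes sigma (iter j.+1 _ _)) = fun x => st sigma (nodes sigma u) x -
    st sigma (nodes sigma (fun x => u x - iter j.+1 (cdiff (gamma / sigma)) u x)) x); first exact: rsetB.
  by apply/funext => x; rewrite !stE !nodesE; ring.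
have [SQ _] := Q_rset hCA theta12 s0 KC (cont_kern hpsi) Sn.
have [SQn _] := Q_node hCA theta12 s0 KC Sn.
have E0 : 0 <= real_error psi sigma u by rewrite addr_ge0// rnorm_ge0//; [exact: rsetB|exact: (rsetB Sn SQn)].
have T0 : 0 <= real_smooth gamma b j sigma u by rewrite addr_ge0// rnorm_ge0.
split; [apply: le_trans hl _|apply: le_trans hu _].
  by apply: ler_wpM2r => //; apply: le_trans (ler_norm _) _; rewrite lerDl.
by apply: ler_wpM2r => //; apply: le_trans (ler_norm _) _; rewrite lerDr.
Qed.

End Kernel.
End RealEquivalence.

(** * The equivalence for real functions and the symbols rho and phi *)

Section RealTheorems.
Context {R : realType} (X : banach_lattice R).
Variables (CA gamma alpha : R) (j : nat).
Hypothesis hCA : steklov_bound X CA.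
Hypothesis gamma0 : 0 < gamma.
Hypothesis gamma1 : gamma <= 1.
Hypothesis rocX : roc X.
Hypothesis dense : rdense X.
Hypothesis alpha0 : 0 < alpha.
Local Notation theta := (2 `^ (- aexp alpha)).

Lemma theta_range : ((2^-1 : R) <= theta) && (theta < 1).
Proof.
have /andP[a0 a1] := aexp01 alpha0; apply/andP; split.
  rewrite -[2^-1]powR_inv1//; apply: ler_powR; first lra.
  by rewrite lerN2 (le_trans a1)// invf_le1// ler1n.
rewrite powRN invf_lt1 ?powR_gt0//.
by have := @gt0_ltr_powR R _ a0 1 2; rewrite powR1 !nnegrE; apply => //; rewrite ltr1n.
Qed.

Lemma kdec_C0 t C (K : R -> R) : kdec t C K -> 0 <= C.
Proof. by case=> h _; apply: le_trans (h 0). Qed.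

Lemma equiv_rho : real_equiv X (rho alpha) gamma true j.
Proof.
have [CK KC] := kdec_rho alpha0; have [Cg Kg] := kdec_gsym alpha0; have [Cm Km] := kdec_msym alpha0.
have th := theta_range; have cm := Cmaj_ge0 hCA th.
apply: (@equiv_of_kernel R X CA gamma hCA gamma0 gamma1 rocX dense theta (rho alpha) CK (CQ theta Cg * Cmaj CA theta) (Crho CA theta Cm) true j th) => //.
- exact: bmeas_rho.
- by move=> t; exact: rho_norm.
- by move=> t _; exact: cont_rho.
- by apply: mulr_ge0 => //; exact: (CQ_ge0 th Kg).
- have t0 : 0 <= 2 / theta by rewrite divr_ge0// ltW// (theta_gt0 th).
  rewrite /Crho mulr_ge0 ?addr_ge0// mulr_ge0// mulr_ge0//; exact: kdec_C0 Km.
- by move=> sigma s0 r c ur hr; exact: (lower_rho hCA th s0 alpha0 KC Kg ur hr).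
- move=> sigma s0; apply: residual_rho => //; exact: kdec_C0 Km.
Qed.

Lemma equiv_phi CH : 0 <= CH ->
  (forall f, schwartz f -> X (hilbert f) /\ bl_norm X (hilbert f) <= CH * bl_norm X f) ->
  real_equiv X (@phi R) gamma false j.
Proof.
move=> CH0 hilb; have [CK KC] := kdec_phi alpha0; have [Cz Kz] := kdec_zsym alpha0.
have th := theta_range; have cm := Cmaj_ge0 hCA th.
have [CV CV0 hV] := @V_pinv R.
have KV : kdec theta CV (kern (@jac R)).
  apply: kdec_pinv => // t; case: (leP 0 t) => [t0|/ltW t0]; first by rewrite (ger0_norm t0); exact: hV.
  by rewrite (ler0_norm t0) -V_even; apply: hV => //; rewrite oppr_ge0.
have Cz0 := kdec_C0 Kz; have CA0 : 0 <= CA by case: hCA.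
have t0 : 0 <= 2 / theta by rewrite divr_ge0// ltW// (theta_gt0 th).
apply: (@equiv_of_kernel R X CA gamma hCA gamma0 gamma1 rocX dense theta (@phi R) CK (CH * (CQ theta CK * Cmaj CA theta)) (Cphi CA theta CH gamma CV Cz) false j th) => //.
- by apply: cont_bmeas; exact: cont_phi.
- by move=> t; exact: phi_norm.
- by move=> t _; exact: cont_phi.
- by rewrite mulr_ge0// mulr_ge0// (CQ_ge0 th KC).
- have k1 : 0 <= CH * (2 / theta * CV * Cmaj CA theta) by rewrite mulr_ge0// mulr_ge0// mulr_ge0.
  apply: addr_ge0 => //; apply: addr_ge0.
    by rewrite mulr_ge0 ?(Cder_ge0 hCA)// mulr_ge0// mulr_ge0.
  by apply: mulr_ge0 => //; rewrite divr_ge0 ?mulr_ge0// ltW.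
- by move=> sigma s0; exact: lower_phi.
- by move=> sigma s0; exact: residual_phi.
Qed.

End RealTheorems.

(** * Real and imaginary parts in the lattice *)

Section ComplexParts.
Local Open Scope complex_scope.
Context {R : realType} (X : banach_lattice R).
Local Notation S := (rset X).
Local Notation p := (rnorm X).
Implicit Types (f F : R -> R[i]) (u v : R -> R) (x : R).

Definition re f : R -> R := fun x => complex.Re (f x).
Definition im f : R -> R := fun x => complex.Im (f x).

Lemma normc_nneg (z : R[i]) : 0 <= normc z.
Proof. by case: z => a c /=; exact: sqrtr_ge0. Qed.

Lemma normc_ge_re (z : R[i]) : `|complex.Re z| <= normc z.
Proof. by case: z => a c /=; rewrite -sqrtr_sqr ler_wsqrtr// lerDl sqr_ge0. Qed.

Lemma normc_ge_im (z : R[i]) : `|complex.Im z| <= normc z.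
Proof. by case: z => a c /=; rewrite -sqrtr_sqr ler_wsqrtr// lerDr sqr_ge0. Qed.

Lemma normc_le_parts (z : R[i]) : normc z <= `|complex.Re z| + `|complex.Im z|.
Proof.
case: z => a c /=; rewrite -[leRHS]ger0_norm ?addr_ge0// -sqrtr_sqr ler_wsqrtr//.
rewrite sqrrD !real_normK ?num_real// lerD2r lerDl mulrn_wge0// mulr_ge0//.
Qed.

Lemma bl_parts F : S (re F) -> S (im F) -> X F /\ bl_norm X F <= p (re F) + p (im F).
Proof.
move=> Sr Si; have Xi := bl_scale 'i%C Si.
have E : F = of_real (re F) \+ (fun x => 'i%C * of_real (im F) x).
  by apply/funext => x; rewrite /re /im /of_real /=; case: (F x) => a c /=; simpc.
split; first by rewrite E; exact: bl_add.
rewrite [in leLHS]E; apply: le_trans (bl_norm_add Sr Xi) _; rewrite bl_norm_scale//.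
have -> : normc ('i%C : R[i]) = 1 by rewrite /= expr0n expr1n add0r sqrtr1.
by rewrite mul1r.
Qed.

Variable sigma : R.
Hypothesis sigma0 : 0 < sigma.

Lemma node_itv k x : node sigma k <= x < node sigma (k + 1) = (Num.floor (sigma * x) == k).
Proof.
rewrite /node ler_pdivrMr// ltr_pdivlMr// (mulrC x); apply/idP/eqP => [h|<-].
  by apply: floor_def.
exact: floor_itv.
Qed.

Lemma sample_stepE f : sample_step sigma f = st sigma (fun k => normc (f (node sigma k))).
Proof.
apply/funext => x; set c := fun k : int => normc (f (node sigma k)).
pose k0 := Num.floor (sigma * x).
rewrite /sample_step -(@fsbig_widen _ _ _ _ [set k0]) //; last first.
  move=> k [_ /= kk]; rewrite indicE memNset ?mulr0//= in_itv/= node_itv => /eqP e.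
  by apply: kk.
by rewrite fsbig_set1 indicE mem_set ?mulr1//= in_itv/= node_itv.
Qed.

Lemma sample_parts f : S (sample_step sigma f) ->
  [/\ S (st sigma (nodes sigma (re f))), p (st sigma (nodes sigma (re f))) <= p (sample_step sigma f),
      S (st sigma (nodes sigma (im f))) & p (st sigma (nodes sigma (im f))) <= p (sample_step sigma f)].
Proof.
rewrite sample_stepE => Sf.
have n0 k : `|normc (f (node sigma k))| = normc (f (node sigma k)) by rewrite ger0_norm// normc_nneg.
have [S1 p1] := st_le (c := nodes sigma (re f)) sigma0 Sf (fun k => ltac:(rewrite n0; exact: normc_ge_re)).
have [S2 p2] := st_le (c := nodes sigma (im f)) sigma0 Sf (fun k => ltac:(rewrite n0; exact: normc_ge_im)).
by split.
Qed.

Lemma sample_of_parts f : S (st sigma (nodes sigma (re f))) -> S (st sigma (nodes sigma (im f))) ->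
  S (sample_step sigma f) /\
  p (sample_step sigma f) <= p (st sigma (nodes sigma (re f))) + p (st sigma (nodes sigma (im f))).
Proof.
rewrite sample_stepE => Sr Si; have Ar := rset_abs Sr; have Ai := rset_abs Si.
have [S1 p1] : S (st sigma (fun k => normc (f (node sigma k)))) /\
    p (st sigma (fun k => normc (f (node sigma k)))) <=
    p (fun x => `|st sigma (nodes sigma (re f)) x| + `|st sigma (nodes sigma (im f)) x|).
  apply: rset_le; [exact: lmeas_st|exact: rsetD|move=> x].
  rewrite (ger0_norm (normc_nneg _)) [leRHS]ger0_norm ?addr_ge0//; exact: normc_le_parts.
split => //; apply: le_trans p1 _; apply: le_trans (rnormD Ar Ai) _.
by rewrite !rnorm_abs.
Qed.

Lemma xnormE f : X f -> xnorm X f = (bl_norm X f)%:E.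
Proof. by move=> Xf; rewrite /xnorm asboolT. Qed.

Lemma xsnormE f : S (sample_step sigma f) -> xsnorm X sigma f = (p (sample_step sigma f))%:E.
Proof. exact: xnormE. Qed.

Lemma XsigmaP f : Xsigma X sigma f -> X f /\ S (sample_step sigma f).
Proof. by case=> Xf; rewrite /xsnorm /xnorm; case: asboolP. Qed.

End ComplexParts.

(** * Real and imaginary parts of the averages and of the sampling series *)

Section ComplexOperators.
Local Open Scope complex_scope.
Context {R : realType}.
Implicit Types (f : R -> R[i]) (psi u : R -> R) (h x sigma : R).

Lemma parts_sub f (g : R -> R[i]) : re (f \- g) = (fun x => re f x - re g x) /\
  im (f \- g) = (fun x => im f x - im g x).
Proof.
by split; apply/funext => x; rewrite /re /im /=; case: (f x) => ? ?; case: (g x).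
Qed.

Lemma adot_parts h f x : re (steklov_dot h f) x = adot h (re f) x /\ im (steklov_dot h f) x = adot h (im f) x.
Proof.
rewrite /steklov_dot /steklov /cintegral /re /im /adot /itg /=.
by rewrite addrK !mul0r subr0 addr0 -addrA -splitr.
Qed.

Lemma stek_parts h f x : re (steklov h f) x = stek h (re f) x /\ im (steklov h f) x = stek h (im f) x.
Proof.
by rewrite /steklov /cintegral /re /im /stek /itg /= !mul0r subr0 addr0.
Qed.

Lemma iter_diff_parts (T : (R -> R[i]) -> R -> R[i]) (D : (R -> R) -> R -> R) r f :
  (forall g x, re (T g) x = re g x - D (re g) x /\ im (T g) x = im g x - D (im g) x) ->
  re (iter_diff r T f) = iter r D (re f) /\ im (iter_diff r T f) = iter r D (im f).
Proof.
move=> hT; elim: r => [//|r [IH1 IH2]]; rewrite /iter_diff /= -/(iter_diff r T f).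
rewrite -IH1 -IH2; split; apply/funext => x; have [h1 h2] := hT (iter_diff r T f) x.
  rewrite [LHS](_ : _ = re (iter_diff r T f) x - re (T (iter_diff r T f)) x); first by rewrite h1; ring.
  by rewrite /re /=; case: (iter_diff r T f x) => ? ?; case: (T _ x).
rewrite [LHS](_ : _ = im (iter_diff r T f) x - im (T (iter_diff r T f)) x); first by rewrite h2; ring.
by rewrite /im /=; case: (iter_diff r T f x) => ? ?; case: (T _ x).
Qed.

Lemma diff_dot_parts h r f : re (iter_diff r (steklov_dot h) f) = iter r (fdiff h) (re f) /\
  im (iter_diff r (steklov_dot h) f) = iter r (fdiff h) (im f).
Proof.
by apply: iter_diff_parts => g x; have [-> ->] := adot_parts h g x; rewrite /fdiff; split; ring.
Qed.

Lemma diff_parts h r f : re (iter_diff r (steklov h) f) = iter r (cdiff h) (re f) /\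
  im (iter_diff r (steklov h) f) = iter r (cdiff h) (im f).
Proof.
by apply: iter_diff_parts => g x; have [-> ->] := stek_parts h g x; rewrite /cdiff; split; ring.
Qed.

Section Series.
Variables (psi : R -> R) (sigma : R).
Hypothesis cpsi : continuous psi.
Hypothesis epsi : forall t, psi (- t) = psi t.
Hypothesis opsi : forall t, 1 <= `|t| -> psi t = 0.

(** Evenness removes the sine part and folds the integral onto [0, 1]; the resulting factor 2 turns
    [1 / (2 * pi)] into [1 / pi]. *)
Lemma fourier_kern x : fourier (of_real psi) x = (kern psi x)%:C.
Proof.
have cint (c : R -> R) : continuous c -> \int[@cmu R]_(t in setT) (psi t * c t) = rint (fun t => psi t * c t).
  by move=> cc; rewrite Rintegral_completed//; apply: cont_bmeas; exact: cont_mul.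
have cc : continuous (fun t : R => cos (- (t * x))).
  rewrite (_ : (fun t : R => _) = fun t : R => cos (- x * t)); first exact: cos_cont.
  by apply/funext => t; rewrite mulNr mulrC.
have cs : continuous (fun t : R => sin (- (t * x))).
  rewrite (_ : (fun t : R => _) = fun t : R => sin (- x * t)); first exact: sin_cont.
  by apply/funext => t; rewrite mulNr mulrC.
have e1 t : complex.Re (of_real psi t * cis (- (t * x))) = psi t * cos (- (t * x)) by rewrite /of_real /cis /=; ring.
have e2 t : complex.Im (of_real psi t * cis (- (t * x))) = psi t * sin (- (t * x)) by rewrite /of_real /cis /=; ring.
rewrite /fourier /cintegral.
under eq_Rintegral do rewrite e1.
under [X in _ +i* X]eq_Rintegral do rewrite e2.
rewrite !cint//.
have c1 : continuous (fun t : R => psi t * cos (- (t * x))) by exact: cont_mul.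
have c2 : continuous (fun t : R => psi t * sin (- (t * x))) by exact: cont_mul.
have s2 : bdd_supp (fun t : R => psi t * sin (- (t * x))) by exists 1 => t /ltW/opsi ->; rewrite mul0r.
rewrite (rint_reflect c1); [|by move=> t; rewrite epsi mulNr opprK cosN|by move=> t /opsi ->; rewrite mul0r].
rewrite (rint_odd c2); [|exact: L1_csupp|by move=> t; rewrite epsi mulNr opprK sinN mulrN opprK].
rewrite /kern /cosint (eq_itg (g := fun t => psi t * cos (x * t))); last first.
  by move=> t _; rewrite cosN (mulrC t).
apply/eqP; rewrite eq_complex /= !mulr0 !mul0r subr0 addr0 eqxx andbT; apply/eqP.
by rewrite mulrA; congr (_ * _); rewrite invfM mulrAC mulVf ?mul1r.
Qed.

Lemma term_parts f k x : re (sampling_term psi sigma f k) x = nodes sigma (re f) k * kern psi (sigma * x - k%:~R) /\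
  im (sampling_term psi sigma f k) x = nodes sigma (im f) k * kern psi (sigma * x - k%:~R).
Proof.
rewrite /re /im /sampling_term fourier_kern !nodesE; case: (f _) => a c /=.
by split; ring.
Qed.

Lemma partial_parts f m n x :
  complex.Re (sampling_partial psi sigma f m n x) = zpart (fun k => nodes sigma (re f) k * kern psi (sigma * x - k%:~R)) m n /\
  complex.Im (sampling_partial psi sigma f m n x) = zpart (fun k => nodes sigma (im f) k * kern psi (sigma * x - k%:~R)) m n.
Proof.
rewrite /sampling_partial /zpart.
have hs (g : nat -> R[i]) N : complex.Re (\sum_(0 <= k < N) g k) = \sum_(0 <= k < N) complex.Re (g k) /\
    complex.Im (\sum_(0 <= k < N) g k) = \sum_(0 <= k < N) complex.Im (g k).
  elim: N => [|N [h1 h2]]; first by rewrite !big_geq.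
  by rewrite !big_nat_recr//= -h1 -h2; case: (\sum_(0 <= k < N) g k) => ? ?; case: (g N).
have hadd (z w : R[i]) : complex.Re (z + w) = complex.Re z + complex.Re w /\ complex.Im (z + w) = complex.Im z + complex.Im w.
  by case: z => ? ?; case: w.
rewrite !(hadd _ _).1 !(hadd _ _).2 !(hs _ _).1 !(hs _ _).2; split.
  by congr (_ + _); apply: eq_bigr => k _; exact: (term_parts f _ x).1.
by congr (_ + _); apply: eq_bigr => k _; exact: (term_parts f _ x).2.
Qed.

Lemma op_parts f : re (sampling_op psi sigma f) = Qop sigma (kern psi) (nodes sigma (re f)) /\
  im (sampling_op psi sigma f) = Qop sigma (kern psi) (nodes sigma (im f)).
Proof.
split; apply/funext => x; rewrite /sampling_op /re /im /Qop /zlim /=; congr (limn _); apply/funext => n.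
  exact: (partial_parts f n n x).1.
exact: (partial_parts f n n x).2.
Qed.

End Series.
End ComplexOperators.

(** * From real to complex functions *)

Section ComplexEquivalence.
Local Open Scope complex_scope.
Context {R : realType} (X : banach_lattice R).
Local Notation S := (rset X).
Local Notation p := (rnorm X).
Variables (CA theta CK gamma : R) (psi : R -> R) (b : bool) (j : nat).
Hypothesis hCA : steklov_bound X CA.
Hypothesis theta12 : 2^-1 <= theta < 1.
Hypothesis rocX : roc X.
Hypothesis gamma0 : 0 < gamma.
Hypothesis gamma1 : gamma <= 1.
Hypothesis cpsi : continuous psi.
Hypothesis epsi : forall t, psi (- t) = psi t.
Hypothesis opsi : forall t, 1 <= `|t| -> psi t = 0.
Hypothesis psi1 : forall t, `|psi t| <= 1.
Hypothesis KC : kdec theta CK (kern psi).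
Implicit Types (f g G H : R -> R[i]) (u : R -> R) (sigma x : R).

Let hpsi : bddm psi 1. Proof. by split=> //; exact: lmeas_cont. Qed.
Let cK : continuous (kern psi). Proof. exact: cont_kern hpsi. Qed.

Lemma norm_of_parts G H sigma : 0 < sigma -> S (re G) -> S (im G) ->
  S (st sigma (nodes sigma (re H))) -> S (st sigma (nodes sigma (im H))) ->
  exists t, [/\ (xnorm X G + xsnorm X sigma H)%E = t%:E,
    t <= (p (re G) + p (st sigma (nodes sigma (re H)))) + (p (im G) + p (st sigma (nodes sigma (im H)))),
    p (re G) + p (st sigma (nodes sigma (re H))) <= t,
    p (im G) + p (st sigma (nodes sigma (im H))) <= t & 0 <= t].
Proof.
move=> s0 Sr Si Nr Ni; have [XG bG] := bl_parts Sr Si.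
have [SH bH] := sample_of_parts s0 Nr Ni.
have [_ r1] := re_bl XG; have [_ i1] := im_bl XG.
have [_ r2 _ i2] := sample_parts s0 SH.
exists (bl_norm X G + p (sample_step sigma H)); split.
- by rewrite xnormE// xsnormE.
- by rewrite addrACA; exact: lerD.
- exact: lerD.
- exact: lerD.
- by rewrite addr_ge0 ?bl_norm_ge0 ?rnorm_ge0.
Qed.

Lemma term_rset sigma (c : int -> R) k : 0 < sigma -> S (fun x => c k * kern psi (sigma * x - k%:~R)).
Proof.
move=> s0; pose d l := if l == k then c k else 0.
have hd l : l \notin [:: k] -> d l = 0 by rewrite inE /d => /negbTE ->.
have Sd : S (st sigma d) by apply: rset_st_fin hd.
have [SQ _] := Q_rset hCA theta12 s0 KC cK Sd.
rewrite (_ : (fun x => _) = Qop sigma (kern psi) d)//; apply/funext => x.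
by rewrite (Q_fin theta12 s0 _ _ _ hd)// big_seq1 /d eqxx.
Qed.

Lemma cvg_of_nodes sigma f : 0 < sigma -> S (st sigma (nodes sigma (re f))) -> S (st sigma (nodes sigma (im f))) ->
  sampling_cvg X psi sigma f.
Proof.
move=> s0 Nr Ni; have [opr opi] := op_parts sigma cpsi epsi opsi f.
have [Qr _] := Q_rset hCA theta12 s0 KC cK Nr; have [Qi _] := Q_rset hCA theta12 s0 KC cK Ni.
have ReB (z w : R[i]) : complex.Re (z - w) = complex.Re z - complex.Re w by case: z => ? ?; case: w.
have ImB (z w : R[i]) : complex.Im (z - w) = complex.Im z - complex.Im w by case: z => ? ?; case: w.
have dr m n : re (sampling_op psi sigma f \- sampling_partial psi sigma f m n) = fun x =>
    Qop sigma (kern psi) (nodes sigma (re f)) x - zpart (fun k => nodes sigma (re f) k * kern psi (sigma * x - k%:~R)) m n.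
  apply/funext => x; rewrite /re /= ReB (partial_parts sigma cpsi epsi opsi f m n x).1.
  by rewrite -/(re (sampling_op psi sigma f) x) opr.
have di m n : im (sampling_op psi sigma f \- sampling_partial psi sigma f m n) = fun x =>
    Qop sigma (kern psi) (nodes sigma (im f)) x - zpart (fun k => nodes sigma (im f) k * kern psi (sigma * x - k%:~R)) m n.
  apply/funext => x; rewrite /im /= ImB (partial_parts sigma cpsi epsi opsi f m n x).2.
  by rewrite -/(im (sampling_op psi sigma f) x) opi.
have tr k : re (sampling_term psi sigma f k) = fun x => nodes sigma (re f) k * kern psi (sigma * x - k%:~R).
  by apply/funext => x; exact: (term_parts sigma cpsi epsi opsi f k x).1.
have ti k : im (sampling_term psi sigma f k) = fun x => nodes sigma (im f) k * kern psi (sigma * x - k%:~R).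
  by apply/funext => x; exact: (term_parts sigma cpsi epsi opsi f k x).2.
split.
- by move=> k; apply: (bl_parts _ _).1; [rewrite tr|rewrite ti]; exact: term_rset.
- by apply: (bl_parts _ _).1; [rewrite opr|rewrite opi].
- move=> e e0; have e2 : 0 < e / 2 by rewrite divr_gt0.
  have [N1 h1] := Q_cvg hCA theta12 s0 KC cK rocX Nr e2.
  have [N2 h2] := Q_cvg hCA theta12 s0 KC cK rocX Ni e2.
  exists (maxn N1 N2) => m n; rewrite !geq_max => /andP[m1 m2] /andP[n1 n2].
  have zS (c : int -> R) : S (fun x => zpart (fun k => c k * kern psi (sigma * x - k%:~R)) m n).
    rewrite (_ : (fun x => _) = fun x => \sum_(k <- zrange 0 m n) c k * kern psi (sigma * x - k%:~R)).
      by apply: (rset_sum _ _).1 => k; exact: term_rset.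
    by apply/funext => x; rewrite zpartE.
  have Sdr : S (re (sampling_op psi sigma f \- sampling_partial psi sigma f m n)) by rewrite dr; exact: rsetB.
  have Sdi : S (im (sampling_op psi sigma f \- sampling_partial psi sigma f m n)) by rewrite di; exact: rsetB.
  have [_ h] := bl_parts Sdr Sdi.
  by apply: le_trans h _; rewrite dr di [e]splitr; apply: lerD; [exact: h1|exact: h2].
- move=> x e e0; have e2 : 0 < e / 2 by rewrite divr_gt0.
  have [N1 h1] := zlimP (Q_zbdd hCA theta12 s0 KC x Nr) e2.
  have [N2 h2] := zlimP (Q_zbdd hCA theta12 s0 KC x Ni) e2.
  exists (maxn N1 N2) => m n; rewrite !geq_max => /andP[m1 m2] /andP[n1 n2].
  apply: le_trans (normc_le_parts _) _; rewrite [e]splitr; apply: lerD.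
    by have := h1 m n m1 n1; have := congr1 (fun w => w x) (dr m n) => <-.
  by have := h2 m n m2 n2; have := congr1 (fun w => w x) (di m n) => <-.
Qed.

Lemma two_sided_alg (C te ts eu ev su sv : R) : 0 <= C -> 0 <= te -> 0 <= ts -> te <= eu + ev -> eu <= te -> ev <= te ->
  ts <= su + sv -> su <= ts -> sv <= ts -> su <= C * eu -> eu <= C * su -> sv <= C * ev -> ev <= C * sv ->
  ts <= (2 * C + 1) * te /\ te <= (2 * C + 1) * ts.
Proof.
move=> C0 te0 ts0 a1 a2 a3 b1 b2 b3 c1 c2 c3 c4.
have d1 := ler_wpM2l C0 a2; have d2 := ler_wpM2l C0 a3; have d3 := ler_wpM2l C0 b2; have d4 := ler_wpM2l C0 b3.
have e t : (2 * C + 1) * t = C * t + C * t + t by ring.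
by rewrite !e; split; lra.
Qed.

(** Each side, taken for [f], dominates its value for either part and is at most the sum of the two
    values; the real equivalence is applied to both parts. *)
Lemma complex_equiv : real_equiv X psi gamma b j ->
  exists c1 c2 : R, 0 < c1 /\ 0 < c2 /\ forall sigma f, 1 <= sigma -> Xsigma X sigma f ->
    sampling_cvg X psi sigma f /\
    two_sided c1 c2 (sampling_error X psi sigma f) (smoothness X gamma b.+1 j.+1 sigma f).
Proof.
move=> [C C0 hC]; have k0 : 0 < 2 * C + 1 by rewrite ltr_wpDl// mulr_ge0.
(* [2 * C] suffices for the estimates; [C] may be 0, and adding 1 keeps the constants positive. *)
exists (2 * C + 1)^-1, (2 * C + 1); split; first by rewrite invr_gt0.
split => // sigma f s1 /(XsigmaP)[Xf Sf]; have s0 : 0 < sigma by exact: lt_le_trans s1.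
have [Sr _] := re_bl Xf; have [Si _] := im_bl Xf.
have [Nr _ Ni _] := sample_parts s0 Sf.
split; first exact: cvg_of_nodes.
have [Er Tr] := hC sigma _ s1 Sr Nr; have [Ei Ti] := hC sigma _ s1 Si Ni.
have [opr opi] := op_parts sigma cpsi epsi opsi f.
have gr : re (f \- sampling_op psi sigma f) = fun x => re f x - Qop sigma (kern psi) (nodes sigma (re f)) x.
  by rewrite -opr (parts_sub _ _).1.
have gi : im (f \- sampling_op psi sigma f) = fun x => im f x - Qop sigma (kern psi) (nodes sigma (im f)) x.
  by rewrite -opi (parts_sub _ _).2.
have [Qr _] := Q_rset hCA theta12 s0 KC cK Nr; have [Qi _] := Q_rset hCA theta12 s0 KC cK Ni.
have [Qrn _] := Q_node hCA theta12 s0 KC Nr; have [Qin _] := Q_node hCA theta12 s0 KC Ni.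
have [dr di] := diff_dot_parts (gamma / sigma) b.+1 f; have [ar ai] := diff_parts (gamma / sigma) j.+1 f.
have An u : S u -> S (st sigma (nodes sigma u)) -> S (st sigma (nodes sigma (iter j.+1 (cdiff (gamma / sigma)) u))).
  move=> Su Sn; have [_ [SBn _]] := sub_cdiff_rset hCA s0 gamma0 gamma1 j.+1 Su.
  rewrite (_ : st sigma (nodes sigma (iter j.+1 _ _)) = fun x => st sigma (nodes sigma u) x -
    st sigma (nodes sigma (fun x => u x - iter j.+1 (cdiff (gamma / sigma)) u x)) x); first exact: rsetB.
  by apply/funext => x; rewrite !stE !nodesE; ring.
have [te [te_eq e1 e2 e3 e4]] : exists t, [/\ sampling_error X psi sigma f = t%:E,
    t <= real_error X psi sigma (re f) + real_error X psi sigma (im f),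
    real_error X psi sigma (re f) <= t, real_error X psi sigma (im f) <= t & 0 <= t].
  have := @norm_of_parts (f \- sampling_op psi sigma f) (f \- sampling_op psi sigma f) sigma s0.
  rewrite gr gi; apply; [exact: rsetB|exact: rsetB|exact: (rsetB Nr Qrn)|exact: (rsetB Ni Qin)].
have [ts [ts_eq t1 t2 t3 t4]] : exists t, [/\ smoothness X gamma b.+1 j.+1 sigma f = t%:E,
    t <= real_smooth X gamma b j sigma (re f) + real_smooth X gamma b j sigma (im f),
    real_smooth X gamma b j sigma (re f) <= t, real_smooth X gamma b j sigma (im f) <= t & 0 <= t].
  have := @norm_of_parts (iter_diff b.+1 (steklov_dot (gamma / sigma)) f) (iter_diff j.+1 (steklov (gamma / sigma)) f) sigma s0.
  rewrite dr di ar ai; apply; [| |exact: An|exact: An].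
    exact: (iter_fdiff_rset hCA s0 gamma0 b.+1 Sr).1.
  exact: (iter_fdiff_rset hCA s0 gamma0 b.+1 Si).1.
rewrite te_eq ts_eq.
have [h1 h2] := two_sided_alg C0 e4 t4 e1 e2 e3 t1 t2 t3 Er Tr Ei Ti.
split; rewrite -EFinM lee_fin//.
by rewrite ler_pdivrMl.
Qed.

End ComplexEquivalence.

Theorem theorem4p6 (R : realType) (X : banach_lattice R) (alpha gamma : R)
    (halpha : 0 < alpha) (hgamma : 0 < gamma <= 1)
    (hoc : order_continuous X) (hS : schwartz_dense X) (hA : assumptionA X) :
  (forall r : nat, (0 < r)%N ->
    exists c1 c2 : R, 0 < c1 /\ 0 < c2 /\
      forall (sigma : R) (f : R -> R[i]), 1 <= sigma -> Xsigma X sigma f ->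
        sampling_cvg X (rho alpha) sigma f /\
        two_sided c1 c2 (sampling_error X (rho alpha) sigma f)
                        (smoothness X gamma 2 r sigma f)) /\
  (hilbert_bounded X ->
   forall r : nat, (0 < r)%N ->
    exists c1 c2 : R, 0 < c1 /\ 0 < c2 /\
      forall (sigma : R) (f : R -> R[i]), 1 <= sigma -> Xsigma X sigma f ->
        sampling_cvg X (@phi R) sigma f /\
        two_sided c1 c2 (sampling_error X (@phi R) sigma f)
                        (smoothness X gamma 1 r sigma f)).
Proof.
have rocX := order_continuous_real hoc; have dense := real_dense rocX hS.
have [CA hCA] := assumptionA_real hA; have /andP[gamma0 gamma1] := hgamma.
have th := theta_range halpha.
split=> [[//|j] _|[CH hilb] [//|j] _].
  have [CK KC] := kdec_rho halpha.
  apply: (complex_equiv (b := true) hCA th rocX gamma0 gamma1 (cont_rho halpha) (@rho_even R alpha) _ _ KC).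
  - by move=> t; exact: rho_out.
  - by move=> t; exact: rho_norm.
  - exact: equiv_rho hCA gamma0 gamma1 rocX dense halpha.
have [CK KC] := kdec_phi halpha.
apply: (complex_equiv (b := false) hCA th rocX gamma0 gamma1 (@cont_phi R) (@phi_even R) _ _ KC).
- by move=> t; exact: phi_out.
- by move=> t; exact: phi_norm.
(* The constant in [hilbert_bounded] carries no sign, hence the absolute value. *)
- apply: (@equiv_phi R X CA gamma alpha j hCA gamma0 gamma1 rocX dense halpha `|CH|) => // f sf.
  have [h1 h2] := hilb f sf; split => //; apply: le_trans h2 _.
  by apply: ler_wpM2r (ler_norm _); apply: bl_norm_ge0; exact: hS.1.
Qed.
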